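(* Assume $N \geq 2$ and let $(u_0, u_1) \in (\dot H^1(\mathbb{R}^3) \cap L^\infty(\mathbb{R}^3)) \times L^2(\mathbb{R}^3)$ be radial and outgoing initial data. Then the corresponding solution $u$ to the equation $$u(t)=\Phi_0(t)(u_0, u_1)+\int_0^t \Phi_0(t-s)P_+(0, |u(s)|^N u(s)) \, ds$$ exists globally on $\mathbb{R}^3 \times [0, \infty)$, and $$\|u\|_{L^\infty_t \dot H^1_x} \lesssim \|u_0\|_{\dot H^1},\qquad \|u(t)\|_{L^\infty} \lesssim t^{-1/2} \|u_0\|_{\dot H^1},$$ $$\|u\|_{L^\infty_{t, x}} \lesssim \|u_0\|_{L^\infty} + \|u_0\|_{\dot H^1}^{2} \|u_0\|_{L^\infty}^{(N-2)/2} + \|u_0\|_{\dot H^1} \|u_0\|_{L^\infty}^{N/2}.$$ In addition, assuming that $N>4$, $$\|u\|_{L^2_t L^\infty_x} \lesssim \|u_0\|_{L^\infty} + (\ln_+ \|u_0\|_{\dot H^1} + \ln_+ \|u_0\|_{L^\infty} + 1)^{1/2} \|u_0\|_{\dot H^1}.$$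
   Context: For a radial function $u$ on $\mathbb{R}^3$ write $u(r)=u(x)$, $r=|x|$. $A \lesssim B$ means $|A| \leq C|B|$ with a constant $C$ independent of the data (it may depend on $N$). $\ln_+ a=\max(\ln a,0)$. Mixed norms over $\mathbb{R}^3\times[0,\infty)$: $\|f\|_{L^p_tL^q_x}=\big(\int_0^\infty \|f(t)\|_{L^q_x}^p\,dt\big)^{1/p}$, with the usual modification for $p=\infty$; $L^\infty_{t,x}=L^\infty_tL^\infty_x$. $\Phi(t)(u_0,u_1)=(\Phi_0(t)(u_0,u_1),\Phi_1(t)(u_0,u_1)):=(w(t),w_t(t))$, where $w$ solves the linear wave equation $w_{tt}-\Delta w=0$ on $\mathbb{R}^{3+1}$, $w(0)=u_0$, $w_t(0)=u_1$; i.e. $\Phi_0(t)(u_0,u_1)=\cos(t\sqrt{-\Delta})u_0+\frac{\sin(t\sqrt{-\Delta})}{\sqrt{-\Delta}}u_1$. On radial pairs, the projections on outgoing/incoming states are $$P_+(u_0,u_1)=\Big(\tfrac12\Big(u_0-\tfrac1r\int_0^r\rho u_1(\rho)\,d\rho\Big),\ \tfrac12\big(-(u_0)_r-\tfrac{u_0}{r}+u_1\big)\Big),$$ $$P_-(u_0,u_1)=\Big(\tfrac12\Big(u_0+\tfrac1r\int_0^r\rho u_1(\rho)\,d\rho\Big),\ \tfrac12\big((u_0)_r+\tfrac{u_0}{r}+u_1\big)\Big).$$ A radial pair $(u_0,u_1)$ is outgoing if $P_-(u_0,u_1)=0$. A solution on $\mathbb{R}^3\times I$ with data $(u_0,u_1)$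 is a radial function $u$ satisfying the displayed integral equation for all $t\in I$. *)

(* Defs.v *)
From mathcomp Require Import all_boot all_order all_algebra.
From mathcomp Require Import all_classical all_reals all_analysis.

Set Implicit Arguments.
Unset Strict Implicit.
Unset Printing Implicit Defensive.

Import Order.TTheory GRing.Theory Num.Theory numFieldNormedType.Exports.
Local Open Scope classical_set_scope.
Local Open Scope ring_scope.

(* [measurableTypeR R] is [R] with its Borel sets; so [R3 R] is convertible to
   the normed module [R * R * R], which is where derivatives are taken. *)
Definition R3 (R : realType) : measurableType _ :=
  (measurableTypeR R * measurableTypeR R * measurableTypeR R)%type.

Definition mu3 (R : realType) : {measure set (R3 R) -> \bar R} :=
  ((@lebesgue_measure R \x @lebesgue_measure R) \x @lebesgue_measure R)%E.

Definition mu_time (R : realType) : {measure set (measurableTypeR R) -> \bar R} :=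
  mrestr (@lebesgue_measure R) (measurable_itv `[(0 : R), +oo[).

Definition coord (R : realType) (i : 'I_3) (x : R * R * R) : R :=
  [:: x.1.1; x.1.2; x.2]`_i.

Definition basis (R : realType) (i : 'I_3) : R * R * R :=
  ((i == 0 :> nat)%:R, (i == 1 :> nat)%:R, (i == 2 :> nat)%:R).

(* Euclidean norm; the norm [`|x|] of the normed module R * R * R is the
   sup-norm. *)
Definition enorm (R : realType) (x : R * R * R) : R :=
  Num.sqrt (\sum_(i < 3) coord i x ^+ 2).

(* Radial data are represented by functions that are radial everywhere, not
   only up to a null set, so that [profile u r] is the value u(r). *)
Definition radial (R : realType) (u : R3 R -> R) : Prop :=
  exists f : R -> R, forall x, u x = f (enorm x).

Definition profile (R : realType) (u : R3 R -> R) (r : R) : R := u (r, 0, 0).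

Definition loc_integrable (R : realType) (f : R3 R -> R) : Prop :=
  forall M : R,
    (mu3 R).-integrable [set x : R3 R | enorm x <= M] (EFin \o f).

Fixpoint iter_deriv (R : realType) (s : seq (R * R * R))
    (phi : R * R * R -> R) : R * R * R -> R :=
  if s is v :: s' then fun x => 'D_v (iter_deriv s' phi) x else phi.

Definition smooth (R : realType) (phi : R * R * R -> R) : Prop :=
  forall s : seq (R * R * R), continuous (iter_deriv s phi) /\
    forall x v, derivable (iter_deriv s phi) x v.

Definition test_function (R : realType) (phi : R * R * R -> R) : Prop :=
  smooth phi /\ exists M : R, forall x, M < enorm x -> phi x = 0.

Definition laplacian (R : realType) (phi : R * R * R -> R) (x : R * R * R) : R :=
  \sum_(i < 3) iter_deriv [:: basis R i; basis R i] phi x.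

Definition pairing (R : realType) (f : R3 R -> R) (phi : R * R * R -> R) : R :=
  \int[mu3 R]_x (f x * phi x).

Definition is_weak_grad (R : realType) (u : R3 R -> R)
    (g : 'I_3 -> R3 R -> R) : Prop :=
  [/\ loc_integrable u,
      forall i, loc_integrable (g i) &
      forall phi, test_function phi -> forall i : 'I_3,
        pairing u (fun x => 'D_(basis R i) phi x) = - pairing (g i) phi].

(* Weak gradients are unique almost everywhere; [weak_grad u] is a chosen
   version (and 0 when there is none). *)
Definition weak_grad (R : realType) (u : R3 R -> R) : 'I_3 -> R3 R -> R :=
  xget (fun _ _ => 0) [set g | is_weak_grad u g].

Definition radial_deriv (R : realType) (u : R3 R -> R) (x : R3 R) : R :=
  \sum_(i < 3) coord i x / enorm x * weak_grad u i x.

(* In dimension 3 the completion of the test functions for the norm of the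
   gradient in L^2 is the space of functions of L^6 with gradient in L^2. *)
Definition in_dotH1 (R : realType) (u : R3 R -> R) : Prop :=
  [/\ u \in Lfun (mu3 R) 6%:E,
      is_weak_grad u (weak_grad u) &
      forall i, weak_grad u i \in Lfun (mu3 R) 2%:E].

Definition dotH1_norm (R : realType) (u : R3 R -> R) : \bar R :=
  if `[< in_dotH1 u >] then
    'N[mu3 R]_(2%:E)
      [(fun x => (Num.sqrt (\sum_(i < 3) weak_grad u i x ^+ 2))%R%:E)]%E
  else +oo%E.

Definition Linfty_norm (R : realType) (u : R3 R -> R) : \bar R :=
  'N[mu3 R]_(+oo) [EFin \o u]%E.

Definition state (R : realType) := ((R3 R -> R) * (R3 R -> R))%type.

Definition P_plus (R : realType) (U : state R) : state R :=
  (fun x => 2^-1 * (U.1 x - (enorm x)^-1 *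
     \int[@lebesgue_measure R]_(rho in `[0, enorm x]) (rho * profile U.2 rho)),
   fun x => 2^-1 * (- radial_deriv U.1 x - U.1 x / enorm x + U.2 x)).

Definition P_minus (R : realType) (U : state R) : state R :=
  (fun x => 2^-1 * (U.1 x + (enorm x)^-1 *
     \int[@lebesgue_measure R]_(rho in `[0, enorm x]) (rho * profile U.2 rho)),
   fun x => 2^-1 * (radial_deriv U.1 x + U.1 x / enorm x + U.2 x)).

Definition outgoing (R : realType) (U : state R) : Prop :=
  (\forall x \ae mu3 R, (P_minus U).1 x = 0) /\
  (\forall x \ae mu3 R, (P_minus U).2 x = 0).

(* (w, w_t) is a distributional solution, for all times t in R, of the Cauchy
   problem w_tt - Laplacian w = 0, (w, w_t)(0) = U. It is unique up to null
   sets at each time. *)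
Definition linear_wave (R : realType) (U : state R)
    (w w_t : R -> R3 R -> R) : Prop :=
  [/\ forall t, loc_integrable (w t) /\ loc_integrable (w_t t),
      \forall x \ae mu3 R, w 0 x = U.1 x,
      \forall x \ae mu3 R, w_t 0 x = U.2 x &
      forall phi, test_function phi -> forall t : R,
        is_derive t (1 : R) (fun s => pairing (w s) phi) (pairing (w_t t) phi) /\
        is_derive t (1 : R) (fun s => pairing (w_t s) phi)
          (pairing (w t) (laplacian phi))].

(* [is_Phi t U V]: V = Phi(t) U, almost everywhere. *)
Definition is_Phi (R : realType) (t : R) (U V : state R) : Prop :=
  exists w w_t : R -> R3 R -> R,
    [/\ linear_wave U w w_t,
        \forall x \ae mu3 R, V.1 x = w t x &
        \forall x \ae mu3 R, V.2 x = w_t t x].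

Definition is_Phi0 (R : realType) (t : R) (U : state R) (f : R3 R -> R) : Prop :=
  exists g : R3 R -> R, is_Phi t U (f, g).

Definition nonlinearity (R : realType) (N : R) (u : R3 R -> R) (x : R3 R) : R :=
  `|u x| `^ N * u x.

(* In the integral equation G is a version of
   (s, x) |-> Phi_0(t - s) P_+(0, |u(s)|^N u(s)) (x). Its joint measurability
   makes the integral in s independent, for almost every x, of the version. *)
Definition is_solution (R : realType) (N : R) (I : set R) (U : state R)
    (u : R -> R3 R -> R) : Prop :=
  [/\ forall t, I t -> radial (u t),
      measurable_fun (I `*` setT : set (measurableTypeR R * R3 R))
        (fun p : measurableTypeR R * R3 R => u p.1 p.2) &
      forall t : R, I t -> exists (f : R3 R -> R) (G : R -> R3 R -> R),
        [/\ is_Phi0 t U f,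
            measurable_fun (`[0, t] `*` setT : set (measurableTypeR R * R3 R))
              (fun p : measurableTypeR R * R3 R => G p.1 p.2),
            forall s, s \in `[0, t] ->
              is_Phi0 (t - s) (P_plus (fun=> 0, nonlinearity N (u s))) (G s) &
            \forall x \ae mu3 R,
              (@lebesgue_measure R).-integrable `[0, t] (fun s => (G s x)%:E) /\
              u t x = f x + \int[@lebesgue_measure R]_(s in `[0, t]) G s x]].

Definition ln_plus (R : realType) (a : R) : R := Num.max (ln a) 0.

(* Main.v *)
(* For outgoing data put v = r u and V(y, t) = v(y + t, t). Since the source is projected on outgoing
   states, V vanishes for y <= 0 and solves a first order problem: V is the primitive in y of
   W = k0 - (1/2) * (integral over 0 < s < t of f), where f(y, s) = |V|^N V (y + s)^(-N) and
   k0(r) = - r u1(r). With the nonlinearity truncated at |V| = K (y + s), Picard iteration converges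
   in an exponentially weighted sup norm. The work of the flux, the integral of f W over 0 < y < Y, is
   nonnegative because |V|^N (y + s)^(-N) is nondecreasing in V^2 and nonincreasing in y; hence the
   integral of W^2 is at most a^2, the integral of k0^2, and V^2 <= a^2 y. Where t y (2B)^N <= 1 the iterates satisfy
   |V| <= 2 B y. Together these give |V| <= K (y + t) for K = 2 B + a (2B)^(N/4), so the truncation is
   inactive; this is the sup bound, and V^2 <= a^2 y is the decay in t. Hardy's inequality compares the
   integral of W^2 with the homogeneous Sobolev norm in both directions.

   For the L^2 in time bound the half-line is cut at max(B, 1)^(-N/2) and Y = max(a, 1)^(2N/(N-4)). The
   sup bound is used before the first time and the decay between the two, whence the logarithms. For
   t > Y, V(y) - V(Y) is the integral of W over (Y, y), W^2 is bounded by 2 k0^2 plus a multiple of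
   y^(3-N), and the Cauchy-Schwarz inequality with weight y^(1/2) gives a square integrable bound.

   The flow is identified through the explicit radial waves (F(r - s) - F(- r - s)) / r, which are paired
   with test functions by means of spherical integrals, themselves written as integrals over the unit
   ball along rays. *)

Require Import Defs.
From HB Require Import structures.
From mathcomp Require Import all_boot all_order all_algebra.
From mathcomp Require Import all_classical all_reals all_analysis.
From mathcomp Require Import measurable_realfun ess_sup_inf ring lra.
Import Order.TTheory GRing.Theory Num.Theory numFieldNormedType.Exports.
Local Open Scope classical_set_scope.
Local Open Scope ring_scope.
Set Implicit Arguments.
Unset Strict Implicit.
Unset Printing Implicit Defensive.

(** * Integration on products *)

(** The truncation takes the place of a continuation argument. The sign of the work of the flux
    rests on monotonicity alone, which the truncated power keeps, so the energy bound holds for the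
    truncated problem at every level K, and that problem is solved for all times at once. The level
    must then be reached by bounds that do not involve it. The bound a y^(1/2) on |V| is too weak
    when y and t are both small; the bound linear in y covers that corner, and it is proved on the
    iterates, independently of K. Outside the corner, t y (2B)^N > 1 gives y^2 <= (2B)^N (y + t)^4,
    which turns a y^(1/2) into a (2B)^(N/4) (y + t).

    The data enter through k0 alone, since outgoing data satisfy (r u0)_r = - r u1. With A the
    homogeneous Sobolev norm and B the sup norm of u0, a is c A with c^2 = 2 / kappa, where kappa is
    the area of the unit sphere and the 2 is the cost of the reverse Hardy inequality. In the last
    estimate N > 4 makes y^(3-N) integrable at infinity; the two cutting times are the powers for
    which no power of the data other than B^2 and a^2 survives. *)

Section integrals.
Context d1 d2 (T1 : measurableType d1) (T2 : measurableType d2) (R : realType).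
Variable m1 : {sigma_finite_measure set T1 -> \bar R}.
Variable m2 : {sigma_finite_measure set T2 -> \bar R}.

(** [Rintegral] sends an infinite inner integral to 0, so the real inner integral agrees with
    [fubini_F] only where the slice is integrable, which is almost everywhere. *)
Lemma integrable_Rintegral2 (f : T1 * T2 -> R) :
  (m1 \x m2)%E.-integrable setT (EFin \o f) ->
  m1.-integrable setT (EFin \o (fun x => \int[m2]_y f (x, y))).
Proof.
move=> intf; have iF := integrable_fubini_F intf.
apply/integrableP; split.
  apply/measurable_EFinP/measurableT_comp => //.
  exact: measurable_int iF.
rewrite (_ : \int[m1]_x _ = \int[m1]_x `|fubini_F m2 (EFin \o f) x|)%E.
  by case/integrableP : iF.
apply: ae_eq_integral => //.
- apply: measurableT_comp => //; apply/measurable_EFinP/measurableT_comp => //.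
  exact: measurable_int iF.
- by apply: measurableT_comp => //; exact: measurable_int iF.
- have := ae_integrable1 intf; apply: filterS => x /= ix _.
  rewrite /= /fubini_F /= /Rintegral -[in RHS](@fineK _ (integral _ _ _))//.
  exact: integrable_fin_num.
Qed.

Lemma Rintegral12 (f : T1 * T2 -> R) :
  (m1 \x m2)%E.-integrable setT (EFin \o f) ->
  \int[m1]_x (\int[m2]_y f (x, y)) = \int[(m1 \x m2)%E]_z f z.
Proof.
move=> intf; rewrite /Rintegral -integral12_prod_meas1//; congr fine.
apply: ae_eq_integral => //.
- exact: (measurable_int _ (integrable_Rintegral2 intf)).
- exact: (measurable_int _ (integrable_fubini_F intf)).
- have := ae_integrable1 intf; apply: filterS => x /= ix _.
  by rewrite /fubini_F /= /Rintegral fineK//; exact: integrable_fin_num.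
Qed.
End integrals.

Section fubini.
Context d1 d2 (T1 : measurableType d1) (T2 : measurableType d2) (R : realType).
Variable m1 : {sigma_finite_measure set T1 -> \bar R}.
Variable m2 : {sigma_finite_measure set T2 -> \bar R}.

Lemma integrable_swap (f : T1 * T2 -> \bar R) :
  (m1 \x m2)%E.-integrable setT f ->
  (m2 \x m1)%E.-integrable setT (f \o (fun p : T2 * T1 => (p.2, p.1))).
Proof.
move=> intf; have mf := measurable_int _ intf.
apply/integrable12ltyP; first by apply: measurableT_comp => //; exact/measurable_fun_pair.
by move/integrable21ltyP : intf => /(_ mf).
Qed.

Lemma RFubini (f : T1 * T2 -> R) :
  (m1 \x m2)%E.-integrable setT (EFin \o f) ->
  \int[m1]_x (\int[m2]_y f (x, y)) = \int[m2]_y (\int[m1]_x f (x, y)).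
Proof.
move=> intf; rewrite Rintegral12//.
rewrite (@Rintegral12 _ _ _ _ _ m2 m1 (f \o (fun p : T2 * T1 => (p.2, p.1)))) //; last first.
  exact: (@integrable_swap (EFin \o f)).
congr fine; rewrite -(integral21_prod_meas1 intf).
by rewrite -(integral12_prod_meas1 (@integrable_swap (EFin \o f) intf)).
Qed.

Lemma integrable_prod (f : T1 * T2 -> R) (g : T1 -> \bar R) :
  measurable_fun setT f ->
  (forall x, \int[m2]_y (`|f (x, y)|)%:E <= g x)%E ->
  measurable_fun setT g ->
  (\int[m1]_x g x < +oo)%E ->
  (m1 \x m2)%E.-integrable setT (EFin \o f).
Proof.
move=> mf fg mg gfin; apply/integrable12ltyP; first exact/measurable_EFinP.
apply: le_lt_trans gfin; apply: ge0_le_integral => //=.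
- by move=> x _; exact: integral_ge0.
- apply: (measurable_fun_fubini_tonelli_F (m2 := m2) (fun z => `|(f z)%:E|%E)) => //.
  by apply: measurableT_comp => //; exact/measurable_EFinP.
Qed.

(** The real integral is [fine] of a difference of two Tonelli integrals, each measurable in the
    parameter; slices that are not integrable only produce the default values of [fine] and of
    extended subtraction. *)
Lemma measurable_Rintegral_param (f : T1 * T2 -> R) :
  measurable_fun setT f -> measurable_fun setT (fun x => \int[m2]_y f (x, y)).
Proof.
move=> mf; have mEf : measurable_fun setT (EFin \o f) by exact/measurable_EFinP.
rewrite /Rintegral; apply: measurableT_comp => //.
rewrite [X in measurable_fun _ X](_ : _ = (fun x =>
   \int[m2]_y (EFin \o f)^\+ (x, y) - \int[m2]_y (EFin \o f)^\- (x, y))%E); last first.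
  apply/funext => x; rewrite integralE; congr (_ - _)%E; apply: eq_integral => y _;
    by rewrite ?funeposE ?funenegE.
apply: emeasurable_funB.
- apply: (measurable_fun_fubini_tonelli_F (m2 := m2) ((EFin \o f)^\+)%E) => //.
  exact: measurable_funepos.
- apply: (measurable_fun_fubini_tonelli_F (m2 := m2) ((EFin \o f)^\-)%E) => //.
  exact: measurable_funeneg.
Qed.
End fubini.
Arguments measurable_Rintegral_param {d1 d2 T1 T2 R} m2 f.


Lemma mcomp d1 d2 d3 (T1 : measurableType d1) (T2 : measurableType d2) (T3 : measurableType d3)
    (f : T2 -> T3) (g : T1 -> T2) :
  measurable_fun setT f -> measurable_fun setT g -> measurable_fun setT (fun t => f (g t)).
Proof. exact: measurableT_comp. Qed.

Section generic.
Context d (T : measurableType d) (R : realType) (m : {measure set T -> \bar R}).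

Lemma Rintegral_if (D : set T) (f : T -> R) :
  \int[m]_(x in D) f x = \int[m]_x (if x \in D then f x else 0).
Proof. by rewrite Rintegral_mkcond. Qed.

Lemma integral_if (D : set T) (f : T -> \bar R) :
  (\int[m]_(x in D) f x = \int[m]_x (if x \in D then f x else 0))%E.
Proof. by rewrite integral_mkcond. Qed.

Lemma integrable_if (D : set T) (f : T -> R) : measurable D ->
  m.-integrable D (EFin \o f) <->
  m.-integrable setT (EFin \o (fun x => if x \in D then f x else 0)).
Proof.
move=> mD; rewrite integrable_mkcond// restrict_EFin.
by split => h; exact: h.
Qed.

Lemma ae_eq_Rintegral (D : set T) (f g : T -> R) : measurable D ->
  measurable_fun D f -> measurable_fun D g ->
  (\forall x \ae m, D x -> f x = g x) ->
  \int[m]_(x in D) f x = \int[m]_(x in D) g x.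
Proof.
move=> mD mf mg fg; congr fine; apply: ae_eq_integral => //;
  [exact/measurable_EFinP|exact/measurable_EFinP|].
by apply: filterS fg => x /= h Dx; rewrite h.
Qed.


Lemma integrable_addr (D : set T) (f g : T -> R) : measurable D ->
  m.-integrable D (EFin \o f) -> m.-integrable D (EFin \o g) ->
  m.-integrable D (EFin \o (fun x => f x + g x)).
Proof. by move=> mD fi gi; exact: (integrableD mD fi gi). Qed.

Lemma integrable_subr (D : set T) (f g : T -> R) : measurable D ->
  m.-integrable D (EFin \o f) -> m.-integrable D (EFin \o g) ->
  m.-integrable D (EFin \o (fun x => f x - g x)).
Proof. by move=> mD fi gi; exact: (integrableB mD fi gi). Qed.

Lemma integrable_mulr (D : set T) (k : R) (f : T -> R) : measurable D ->
  m.-integrable D (EFin \o f) -> m.-integrable D (EFin \o (fun x => k * f x)).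
Proof. by move=> mD fi; exact: (integrableZl mD k fi). Qed.

Lemma le_integrable_real (D : set T) (f g : T -> R) : measurable D -> measurable_fun D f ->
  (forall x, D x -> `|f x| <= g x) -> m.-integrable D (EFin \o g) ->
  m.-integrable D (EFin \o f).
Proof.
move=> mD mf fg gi; apply: (le_integrable mD _ _ gi); first exact/measurable_EFinP.
by move=> x Dx /=; rewrite lee_fin (le_trans (fg x Dx))// ler_norm.
Qed.

Lemma ae_imp (P Q : T -> Prop) : (forall x, P x -> Q x) ->
  (\forall x \ae m, P x) -> \forall x \ae m, Q x.
Proof. by move=> PQ; apply: filterS. Qed.

Lemma ae_imp2 (P Q S : T -> Prop) : (forall x, P x -> Q x -> S x) ->
  (\forall x \ae m, P x) -> (\forall x \ae m, Q x) -> \forall x \ae m, S x.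
Proof. by move=> PQ; apply: filterS2. Qed.

(* An upper bound of the integral needs no measurability of the smaller function. *)
Lemma ge0_le_integral_nomeas (f g : T -> \bar R) :
  (forall x, 0 <= f x)%E -> (forall x, f x <= g x)%E ->
  (\int[m]_x f x <= \int[m]_x g x)%E.
Proof.
move=> f0 fg; have g0 x : (0 <= g x)%E by exact: le_trans (fg x).
rewrite !ge0_integralTE//; apply: le_ereal_sup => _ [h /= hf <-].
by exists h => // x; exact: le_trans (fg x).
Qed.
End generic.

(** * Affine changes of variables on the line *)

Section affine.
Variable R : realType.
Local Notation mu := (@lebesgue_measure R).

(** Uniqueness of Lebesgue measure: the rescaled pushforward is a measure that gives half-open
    intervals their length. Shifts are treated in the same way. *)
Lemma lebesgue_measure_scale (c : R) (A : set R) : 0 < c -> measurable A ->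
  (c%:E * mu ((fun x => c * x)%R @^-1` A) = mu A)%E.
Proof.
move=> c0 mA.
pose f : measurableTypeR R -> measurableTypeR R := fun x => c * x.
have mf : measurable_fun setT f by exact: mulrl_measurable.
pose m' := mscale (NngNum (ltW c0))
  (measure_function_pushforward__canonical__measure_function_Measure mu mf).
rewrite -[LHS]/(m' A); apply/esym/lebesgue_measure_unique => // X [[a b] /= _ <-].
rewrite /m' /mscale /= /pushforward.
rewrite (_ : f @^-1` _ = `]a / c, b / c]%classic); last first.
  apply/seteqP; split => x /=; rewrite !in_itv/= ltr_pdivrMr// ler_pdivlMr// mulrC//.
rewrite !lebesgue_measure_itv/= !lte_fin ltr_pM2r ?invr_gt0//.
case: ifPn => // _; last by rewrite mule0.
by rewrite -!EFinB -EFinM -mulrBl mulrCA divff ?mulr1// gt_eqF.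
Qed.

Lemma lebesgue_measure_shift (d : R) (A : set R) : measurable A ->
  mu ((fun x => x + d)%R @^-1` A) = mu A.
Proof.
move=> mA.
pose f : measurableTypeR R -> measurableTypeR R := fun x => x + d.
have mf : measurable_fun setT f by apply: measurable_funD => //; exact: measurable_cst.
rewrite -[LHS]/(measure_function_pushforward__canonical__measure_function_Measure mu mf A); apply/esym/lebesgue_measure_unique => // X [[a b] /= _ <-].
rewrite /pushforward.
rewrite (_ : f @^-1` _ = `]a - d, b - d]%classic); last first.
  by apply/seteqP; split => x /=; rewrite !in_itv/= ltrBlDr lerBrDr.
rewrite !lebesgue_measure_itv/= !lte_fin ltrD2r.
by case: ifPn => // _; rewrite -!EFinB; congr EFin; ring.
Qed.

Lemma ge0_integral_scale (c : R) (f : R -> \bar R) : 0 < c ->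
  measurable_fun setT f -> (forall x, 0 <= f x)%E ->
  (\int[mu]_x f x = c%:E * \int[mu]_x f (c * x)%R)%E.
Proof.
move=> c0 mf f0.
pose g : measurableTypeR R -> measurableTypeR R := fun x => c * x.
have mg : measurable_fun setT g by exact: mulrl_measurable.
rewrite (_ : c = (NngNum (ltW c0))%:num)//.
rewrite -[in RHS](@ge0_integral_pushforward _ _ _ _ _ _ mg mu setT f)//.
rewrite -ge0_integral_mscale//.
by apply: eq_measure_integral => A mA _; exact/esym/lebesgue_measure_scale.
Qed.

Lemma ge0_integral_shift (d : R) (f : R -> \bar R) :
  measurable_fun setT f -> (forall x, 0 <= f x)%E ->
  (\int[mu]_x f x = \int[mu]_x f (x + d)%R)%E.
Proof.
move=> mf f0.
pose g : measurableTypeR R -> measurableTypeR R := fun x => x + d.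
have mg : measurable_fun setT g by apply: measurable_funD => //; exact: measurable_cst.
rewrite -[in RHS](@ge0_integral_pushforward _ _ _ _ _ _ mg mu setT f)//.
by apply: eq_measure_integral => A mA _; exact/esym/lebesgue_measure_shift.
Qed.

Lemma ge0_integral_opp (f : R -> \bar R) :
  measurable_fun setT f -> (forall x, 0 <= f x)%E ->
  (\int[mu]_x f x = \int[mu]_x f (- x)%R)%E.
Proof.
move=> mf f0.
pose g : measurableTypeR R -> measurableTypeR R := fun x => - x.
have mg : measurable_fun setT g by exact: oppr_measurable.
rewrite -[in RHS](@ge0_integral_pushforward _ _ _ _ _ _ mg mu setT f)//.
by apply: eq_measure_integral => A mA _; exact/esym/lebesgue_measureN.
Qed.

Lemma Rintegral_shift (d : R) (f : R -> R) : measurable_fun setT f ->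
  \int[mu]_x f x = \int[mu]_x f (x + d).
Proof.
move=> mf; have mEf : measurable_fun setT (EFin \o f) by exact/measurable_EFinP.
rewrite /Rintegral integralE [in RHS]integralE; congr (fine (_ - _)%E).
- rewrite (ge0_integral_shift d (measurable_funepos mEf)) => [|x]; last exact: funepos_ge0.
  by apply: eq_integral => x _; rewrite !funeposE.
- rewrite (ge0_integral_shift d (measurable_funeneg mEf)) => [|x]; last exact: funeneg_ge0.
  by apply: eq_integral => x _; rewrite !funenegE.
Qed.

Lemma Rintegral_opp (f : R -> R) : measurable_fun setT f ->
  \int[mu]_x f x = \int[mu]_x f (- x).
Proof.
move=> mf; have mEf : measurable_fun setT (EFin \o f) by exact/measurable_EFinP.
rewrite /Rintegral integralE [in RHS]integralE; congr (fine (_ - _)%E).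
- rewrite (ge0_integral_opp (measurable_funepos mEf)) => [|x]; last exact: funepos_ge0.
  by apply: eq_integral => x _; rewrite !funeposE.
- rewrite (ge0_integral_opp (measurable_funeneg mEf)) => [|x]; last exact: funeneg_ge0.
  by apply: eq_integral => x _; rewrite !funenegE.
Qed.
End affine.

Section sigma_finite_product.
Context d1 d2 (T1 : measurableType d1) (T2 : measurableType d2) (R : realType).
Variable m1 : {sigma_finite_measure set T1 -> \bar R}.
Variable m2 : {sigma_finite_measure set T2 -> \bar R}.

Definition sfprod : set (T1 * T2) -> \bar R := (m1 \x m2)%E.
HB.instance Definition _ := Measure.on sfprod.

Lemma sfprod_sigma_finite : sigma_finite setT sfprod.
Proof.
have [F TF Foo] := sigma_finiteT m1; have [G TG Goo] := sigma_finiteT m2.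
(* Products of the two exhausting sequences, enumerated by unpickling; an index that codes no pair
   contributes the empty set. *)
exists (fun n => if @unpickle (nat * nat)%type n is Some ij then F ij.1 `*` G ij.2 else set0).
  apply/seteqP; split => // -[x y] _.
  have [i _ Fx] : (\bigcup_i F i) x by rewrite -TF.
  have [j _ Gy] : (\bigcup_j G j) y by rewrite -TG.
  by exists (pickle (i, j)) => //; rewrite pickleK.
move=> n; case: unpickle => [[i j]|]; last by split => //; rewrite measure0.
have [mF Fy] := Foo i; have [mG Gy] := Goo j; split; first exact: measurableX.
by rewrite /sfprod product_measure1E// lte_mul_pinfty// ge0_fin_numE.
Qed.
HB.instance Definition _ := Measure_isSigmaFinite.Build _ _ _ sfprod sfprod_sigma_finite.
End sigma_finite_product.

(* The library's product measure carries no sigma-finite structure that unification finds;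
   these aliases, convertible to it, do. *)
Definition leb2 (R : realType) : {sigma_finite_measure set (measurableTypeR R * measurableTypeR R)%type -> \bar R} :=
  sfprod (@lebesgue_measure R) (@lebesgue_measure R).
Definition leb3 (R : realType) : {sigma_finite_measure set (R3 R) -> \bar R} :=
  sfprod (leb2 R) (@lebesgue_measure R).

(** * Iterated integrals, scaling and reflection in three dimensions *)

Section threed.
Variable R : realType.
Local Notation mu := (@lebesgue_measure R).
Local Notation R3 := (R3 R).
Local Notation mu3 := (mu3 R).

Lemma mu3_tonelli (F : R3 -> \bar R) : measurable_fun setT F ->
  (forall x, 0 <= F x)%E ->
  (\int[mu3]_x F x = \int[mu]_a \int[mu]_b \int[mu]_c F (a, b, c))%E.
Proof.
move=> mF F0.
rewrite (fubini_tonelli1 (m1 := leb2 R) (m2 := mu) F mF F0).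
rewrite (fubini_tonelli1 (m1 := mu) (m2 := mu) (fubini_F mu F))//.
- exact: (measurable_fun_fubini_tonelli_F (m2 := mu) F).
- by move=> x; apply: integral_ge0.
Qed.

Lemma measurable_mu3_line3 (F : R3 -> \bar R) : measurable_fun setT F ->
  (forall x, 0 <= F x)%E -> forall a,
  measurable_fun setT (fun b => \int[mu]_c F (a, b, c))%E.
Proof.
move=> mF F0 a.
apply: (@measurableT_comp _ _ _ _ _ _ (fubini_F mu F) _ (fun b => (a, b))).
  exact: (measurable_fun_fubini_tonelli_F (m2 := mu) F).
exact: pair1_measurable.
Qed.

Lemma measurable_mu3_line2 (F : R3 -> \bar R) : measurable_fun setT F ->
  (forall x, 0 <= F x)%E ->
  measurable_fun setT (fun a => \int[mu]_b \int[mu]_c F (a, b, c))%E.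
Proof.
move=> mF F0.
apply: (measurable_fun_fubini_tonelli_F (m2 := mu) (fubini_F mu F)).
- exact: (measurable_fun_fubini_tonelli_F (m2 := mu) F).
- by move=> x; apply: integral_ge0.
Qed.

Definition sc3 (c : R) (x : R3) : R3 := (c * x.1.1, c * x.1.2, c * x.2).

Lemma measurable_sc3 (c : R) : measurable_fun setT (sc3 c).
Proof.
apply/measurable_fun_pair; first apply/measurable_fun_pair => /=.
- by apply: measurable_funM => //; apply: measurableT_comp.
- by apply: measurable_funM => //; apply: measurableT_comp.
- by apply: measurable_funM.
Qed.

Lemma mu3_scale (c : R) (F : R3 -> \bar R) : 0 < c -> measurable_fun setT F ->
  (forall x, 0 <= F x)%E ->
  (\int[mu3]_x F x = (c ^+ 3)%:E * \int[mu3]_x F (sc3 c x))%E.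
Proof.
move=> c0 mF F0.
pose G := F \o sc3 c.
have mG : measurable_fun setT G by apply: measurableT_comp mF _; exact: measurable_sc3.
have G0 x : (0 <= G x)%E by exact: F0.
rewrite (mu3_tonelli mF F0) (mu3_tonelli mG G0).
rewrite (ge0_integral_scale c0 (measurable_mu3_line2 mF F0)); last first.
  by move=> a; apply: integral_ge0 => b _; exact: integral_ge0.
rewrite exprS EFinM -muleA; congr (_ * _)%E.
rewrite -ge0_integralZl//; last 3 first.
- exact: measurable_mu3_line2.
- by move=> a _; apply: integral_ge0 => b _; exact: integral_ge0.
- by rewrite lee_fin exprn_ge0// ltW.
apply: eq_integral => a _.
rewrite (ge0_integral_scale c0 (measurable_mu3_line3 mF F0 (c * a))); last first.
  by move=> b; exact: integral_ge0.
rewrite expr2 EFinM -muleA; congr (_ * _)%E.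
rewrite -ge0_integralZl//; last 3 first.
- exact: (measurable_mu3_line3 mG G0).
- by move=> b _; exact: integral_ge0.
- by rewrite lee_fin ltW.
apply: eq_integral => b _; rewrite (ge0_integral_scale c0 (f := fun t => F (c * a, c * b, t)))//.
by apply: (measurableT_comp mF); exact: pair1_measurable.
Qed.

Lemma mu3_opp (F : R3 -> \bar R) : measurable_fun setT F ->
  (forall x, 0 <= F x)%E ->
  (\int[mu3]_x F x = \int[mu3]_x F (sc3 (-1) x))%E.
Proof.
move=> mF F0.
pose G := F \o sc3 (-1).
have mG : measurable_fun setT G by apply: measurableT_comp mF _; exact: measurable_sc3.
have G0 x : (0 <= G x)%E by exact: F0.
rewrite (mu3_tonelli mF F0) (mu3_tonelli mG G0).
rewrite (ge0_integral_opp (measurable_mu3_line2 mF F0)); last first.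
  by move=> a; apply: integral_ge0 => b _; exact: integral_ge0.
apply: eq_integral => a _.
rewrite (ge0_integral_opp (measurable_mu3_line3 mF F0 (- a))); last first.
  by move=> b; exact: integral_ge0.
apply: eq_integral => b _.
rewrite (ge0_integral_opp (f := fun t => F (- a, - b, t)))//; last first.
  by apply: (measurableT_comp mF); exact: pair1_measurable.
by apply: eq_integral => c _; rewrite /G /= /sc3 /= !mulN1r.
Qed.

End threed.

Section open3.
Variable R : realType.
Local Notation R3 := (R3 R).

(** The sigma-algebra of [R3] is a product of Borel sigma-algebras, so an open set of the product
    topology is written as a countable union of boxes with rational centres and radii 1 / (n +
    1). *)
Lemma open_measurable3 (U : set (R * R * R)) : open U -> measurable (U : set R3).
Proof.
move=> oU.
pose box (p : rat * rat * rat * nat) : set R3 :=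
  let b (q : rat) := `]ratr q - p.2.+1%:R^-1, ratr q + p.2.+1%:R^-1[%classic : set R in
  (b p.1.1.1 `*` b p.1.1.2) `*` b p.1.2.
pose B p := if `[< box p `<=` U >] then box p else set0.
have -> : U = \bigcup_(p in [set: rat * rat * rat * nat]) B p.
  apply/seteqP; split => [x Ux|x [p _]]; last by rewrite /B; case: asboolP => // h /h.
  have /nbhs_ballP[e /= e0 eU] : nbhs x U by exact: open_nbhs_nbhs.
  (* The centre of the box is within d of x and the box has radius d, so all its points are within 2
     d of x. *)
  have [n [d [dE de d0]]] : exists n (d : R), [/\ d = n.+1%:R^-1, d < e / 2 & 0 < d].
    have e20 : 0 < e / 2 by lra.
    have [n _ /(_ n (leqnn n)) h] := near_infty_natSinv_lt (PosNum e20).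
    by exists n, n.+1%:R^-1; split => //; rewrite invr_gt0.
  have rt (t : R) : exists q : rat, ratr q - d < t < ratr q + d.
    have ht : t - d < t + d by lra.
    have [q] := rat_in_itvoo ht.
    by rewrite in_itv/= => /andP[q1 q2]; exists q; apply/andP; split; lra.
  have [q1 h1] := rt x.1.1; have [q2 h2] := rt x.1.2; have [q3 h3] := rt x.2.
  exists (q1, q2, q3, n) => //; rewrite /B asboolT.
    by rewrite /box /= -dE; split; [split|]; rewrite /= in_itv.
  rewrite /box /= -dE; move=> y [[/= /[!in_itv]/= y1 y2] y3]; apply: eU.
  have bl (a b : R) : a - e < b < a + e -> ball a e b.
    by move=> ab; rewrite -ball_normE /= ltr_norml; apply/andP; split; lra.
  by split; [split|]; apply: bl => /=; apply/andP; split; lra.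
apply: countable_bigcupT_measurable => [|p]; first exact: countableP.
rewrite /B; case: ifP => // _; apply: measurableX => //; exact: measurableX.
Qed.

Lemma continuous_measurable3 (f : R * R * R -> R) : continuous f ->
  measurable_fun setT (f : R3 -> R).
Proof.
move=> cf; apply: (measurability _ (RGenOpens.measurableE R)).
move=> _ [_ [a [b ->] <-]]; rewrite setTI.
apply: open_measurable3; move/continuousP : cf; apply; exact: interval_open.
Qed.
End open3.

Section enorm.
Variable R : realType.
Local Notation R3 := (R3 R).
Local Notation mu := (@lebesgue_measure R).
Local Notation mu3 := (mu3 R).
Implicit Types x : R3.

Lemma coordE (i : 'I_3) (x : R * R * R) : Defs.coord i x = [:: x.1.1; x.1.2; x.2]`_i.
Proof. by []. Qed.

Lemma enormE (x : R * R * R) : enorm x = Num.sqrt (x.1.1 ^+ 2 + x.1.2 ^+ 2 + x.2 ^+ 2).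
Proof. by rewrite /enorm !big_ord_recr big_ord0 /= add0r. Qed.

Lemma enorm_ge0 (x : R * R * R) : 0 <= enorm x. Proof. exact: sqrtr_ge0. Qed.

Lemma sqr_enorm (x : R * R * R) : enorm x ^+ 2 = x.1.1 ^+ 2 + x.1.2 ^+ 2 + x.2 ^+ 2.
Proof. by rewrite enormE sqr_sqrtr// !addr_ge0 ?sqr_ge0. Qed.

Lemma enorm_sc3 (c : R) x : enorm (sc3 c x) = `|c| * enorm x.
Proof.
rewrite !enormE /sc3 /= -(sqrtr_sqr c) -sqrtrM ?sqr_ge0//; congr Num.sqrt; ring.
Qed.

Lemma normr_coord (i : 'I_3) (x : R * R * R) : `|Defs.coord i x| <= enorm x.
Proof.
rewrite -(sqrtr_sqr (Defs.coord i x)) enormE ler_wsqrtr//.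
have := sqr_ge0 x.1.1; have := sqr_ge0 x.1.2; have := sqr_ge0 x.2.
by case: i => -[|[|[|]]]//= ? ? ? ?; rewrite coordE/=; lra.
Qed.

Lemma enorm_eq0 (x : R * R * R) : (enorm x == 0) = (x == 0).
Proof.
apply/eqP/eqP => [x0|->]; last by rewrite enormE /= expr0n /= !addr0 sqrtr0.
have c0 i : Defs.coord i x = 0 by apply/normr0_eq0/le_anti; rewrite normr_ge0 -x0 normr_coord.
case: x x0 c0 => -[a b] c _ c0; have := (c0 ord0, (c0 (inord 1), c0 (inord 2))).
by rewrite !coordE /= !inordK// => -[/= -> [-> ->]].
Qed.

Lemma enorm_gt0 (x : R * R * R) : (0 < enorm x) = (x != 0).
Proof. by rewrite lt_def enorm_ge0 andbT enorm_eq0. Qed.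

Lemma measurable_coord (i : 'I_3) : measurable_fun setT (Defs.coord i : R3 -> R).
Proof.
case: i => -[|[|[|]]]//= ?.
- exact: (measurableT_comp measurable_fst measurable_fst).
- exact: (measurableT_comp measurable_snd measurable_fst).
- exact: measurable_snd.
Qed.

Lemma measurable_enorm : measurable_fun setT (@enorm R : R3 -> R).
Proof.
apply: (@measurableT_comp _ _ _ _ _ _ (@Num.sqrt R)).
  by apply: continuous_measurable_fun; exact: sqrt_continuous.
by apply: measurable_sum => i; apply: measurable_funX; exact: measurable_coord.
Qed.

Lemma mu3_set1 x : mu3 [set x] = 0%E.
Proof.
rewrite (_ : [set x] = ([set x.1.1] `*` [set x.1.2]) `*` [set x.2]); last first.
  by apply/seteqP; split => [y ->//|[[a b] c] /= [[-> ->] ->]]; case: x => -[].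
rewrite /mu3 /= product_measure1E//; last exact: measurableX.
rewrite -[RHS](mule0 ((@lebesgue_measure R \x @lebesgue_measure R)%E ([set x.1.1] `*` [set x.1.2]))).
by congr (_ * _)%E; exact: lebesgue_measure_set1.
Qed.

Lemma mu3_neq0 : \forall x \ae mu3, x != 0.
Proof.
exists [set (0 : R3)]; split => //; last by move=> x /= /negP; rewrite negbK => /eqP.
- rewrite (_ : [set 0] = ([set 0] `*` [set 0]) `*` [set 0]); last first.
    by apply/seteqP; split => [y ->//|[[a b] c] /= [[-> ->] ->]].
  by apply: measurableX => //; exact: measurableX.
- exact: mu3_set1.
Qed.
End enorm.

Ltac mfun := repeat first
  [ exact: measurable_cst | exact: measurable_id | exact: measurable_fst | exact: measurable_snd
  | assumption
  | apply: measurable_funX | apply: measurable_funM | apply: measurable_funD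
  | apply: measurable_funN
  | apply: (measurableT_comp measurable_fst) | apply: (measurableT_comp measurable_snd)
  | apply: measurable_fun_ler | apply: measurable_fun_ltr | apply: measurable_and
  | apply: measurable_fun_ifT | apply/measurable_fun_pair | apply: measurable_funB ].

(** * Polar coordinates without a surface measure *)

Section polar.
Variable R : realType.
Local Notation R3 := (R3 R).
Local Notation mu := (@lebesgue_measure R).
Local Notation mu3 := (mu3 R).
Implicit Types x : R3.

Definition ray (r : R) (x : R3) : R3 := sc3 (r / enorm x) x.

Lemma enorm_ray (r : R) x : x != 0 -> enorm (ray r x) = `|r|.
Proof.
rewrite -enorm_gt0 => x0; rewrite /ray enorm_sc3 normrM normfV (ger0_norm (enorm_ge0 x)).
by rewrite -mulrA mulVf ?mulr1// gt_eqF.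
Qed.

Lemma measurable_invr : measurable_fun setT (@GRing.inv R).
Proof.
have -> : [set: R] = [set r | r != 0] `|` [set 0].
  by apply/seteqP; split => r //= _; case: (eqVneq r 0) => ?; [right|left].
have oD : open [set r : R | r != 0].
  rewrite (_ : [set r | r != 0] = ~` [set 0]).
    apply: closed_openC; apply: accessible_closed_set1.
    by apply: hausdorff_accessible; exact: Rhausdorff.
  by apply/seteqP; split => r /= /eqP.
apply/measurable_funU => //; first exact: open_measurable.
split; last exact: measurable_fun_set1.
apply: open_continuous_measurable_fun => // r /set_mem /= r0; exact: inv_continuous.
Qed.

Lemma measurable_funV d (T : measurableType d) (f : T -> R) :
  measurable_fun setT f -> measurable_fun setT (fun t => (f t)^-1).
Proof. by move=> mf; apply: (@measurableT_comp _ _ _ _ _ _ (@GRing.inv R) _ f) => //; exact: measurable_invr. Qed.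

Lemma measurable_sc3_fun d (T : measurableType d) (f : T -> R) (g : T -> R3) :
  measurable_fun setT f -> measurable_fun setT g ->
  measurable_fun setT (fun t => sc3 (f t) (g t)).
Proof. by move=> mf mg; rewrite /sc3; mfun. Qed.

Lemma measurable_enorm_fun d (T : measurableType d) (g : T -> R3) :
  measurable_fun setT g -> measurable_fun setT (fun t => enorm (g t)).
Proof. by move=> mg; apply: (@measurableT_comp _ _ _ _ _ _ (@enorm R) _ g) => //; exact: measurable_enorm. Qed.

Lemma measurable_ray : measurable_fun setT (fun p : R * R3 => ray p.1 p.2).
Proof.
apply: measurable_sc3_fun; mfun.
by apply: measurable_funV; apply: measurable_enorm_fun; mfun.
Qed.

(** The factor 3 is the ratio of the area of the unit sphere to the volume of the unit ball, so
    averaging over the ball along rays reproduces the surface integral over the sphere of radius r.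
    The origin is excluded because its ray is degenerate. *)
Definition polar_weight (r : R) (x : R3) : R :=
  if (0 < r) && (0 < enorm x) && (enorm x <= 1) then 3 * r ^+ 2 else 0.

Lemma polar_weight_ge0 r x : 0 <= polar_weight r x.
Proof. by rewrite /polar_weight; case: ifP => // _; rewrite mulr_ge0// sqr_ge0. Qed.

Lemma measurable_polar_weight : measurable_fun setT (fun p : R * R3 => polar_weight p.1 p.2).
Proof.
by apply: measurable_fun_ifT; mfun; apply: measurable_enorm_fun; mfun.
Qed.

Lemma integral_inv4 (a : R) : 0 < a ->
  (\int[mu]_r ((if a <= r then r ^- 4 else 0)%:E) = ((3 * a ^+ 3)^-1)%:E)%E.
Proof.
move=> a0.
rewrite (_ : \int[mu]_r _ = \int[mu]_(r in `[a, +oo[) ((r ^- 4)%R)%:E)%E; last first.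
  rewrite [in RHS]integral_if; apply: eq_integral => r _.
  by rewrite mem_setE in_itv/= andbT; case: ifP.
rewrite (@ge0_continuous_FTC2y _ (fun r => r ^- 4) (fun r => - (3 * r ^+ 3)^-1) a 0).
- by rewrite -EFinB sub0r opprK.
- by move=> x ax; rewrite invr_ge0 exprn_ge0// (le_trans _ ax)// ltW.
- apply: continuous_in_subspaceT => x; rewrite mem_setE in_itv/= andbT => ax.
  apply: cvgV; first by rewrite expf_neq0// gt_eqF// (lt_le_trans a0).
  exact: exprn_continuous.
- rewrite -oppr0; apply: cvgN.
  apply/cvgrPdist_lt => e e0; near=> x.
  have x1 : 1 < x by near: x; exact: nbhs_pinfty_gt.
  have xe : e^-1 < x by near: x; apply: nbhs_pinfty_gt; exact: num_real.
  have x0 : 0 < x by rewrite (lt_trans _ x1).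
  rewrite sub0r normrN gtr0_norm ?invr_gt0 ?mulr_gt0 ?exprn_gt0//.
  rewrite (@le_lt_trans _ _ x^-1)//.
    rewrite lef_pV2 ?posrE ?mulr_gt0 ?exprn_gt0//.
    have : x * 1 <= x * x ^+ 2 by rewrite ler_pM2l// exprn_ege1// ltW.
    have : 0 < x ^+ 3 by rewrite exprn_gt0.
    by rewrite mulr1 exprS; lra.
  by rewrite -(invrK e) ltf_pV2 ?posrE ?invr_gt0.
- move=> x ax; have x0 : x != 0 by rewrite gt_eqF// (lt_trans a0).
  by apply: derivableN; apply: derivableV; rewrite ?mulf_neq0 ?expf_neq0.
- apply: cvg_at_right_filter; apply: cvgN; apply: cvgV.
    by rewrite mulf_neq0 ?expf_neq0 ?gt_eqF.
  by apply: cvgM; [exact: cvg_cst|exact: exprn_continuous].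
- move=> x; rewrite in_itv/= andbT => ax; have x0 : x != 0 by rewrite gt_eqF// (lt_trans a0).
  have h : is_derive x (1 : R) (fun r : R => 3 * r ^+ 3) (9 * x ^+ 2).
    by apply: is_derive_eq; rewrite /GRing.scale /=; ring.
  have h3 : 3 * x ^+ 3 != 0 by rewrite mulf_neq0 ?expf_neq0.
  have := is_deriveN (@is_deriveV _ (fun r : R => 3 * r ^+ 3) x _ _ h3 h).
  rewrite derive1E => /@derive_val ->; rewrite /GRing.scale /=.
  by field.
Unshelve. all: by end_near. Qed.

(* Insert 1 = 3 |x|^3 * (integral of r^-4 over r >= |x|) and rescale x by r / |x|: the surface
   measure is replaced by an average along the rays of the unit ball. *)
Lemma polar_tonelli (F : R3 -> \bar R) : measurable_fun setT F -> (forall x, 0 <= F x)%E ->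
  (\int[mu3]_x F x = \int[mu]_r \int[mu3]_x ((polar_weight r x)%:E * F (ray r x)))%E.
Proof.
move=> mF F0.
pose H1 (p : R * R3) := ((polar_weight p.1 p.2)%:E * F (ray p.1 p.2))%E.
have mH1 : measurable_fun setT H1.
  apply: emeasurable_funM; first by apply/measurable_EFinP; exact: measurable_polar_weight.
  by apply: (measurableT_comp mF); exact: measurable_ray.
have H10 p : (0 <= H1 p)%E by rewrite mule_ge0// lee_fin polar_weight_ge0.
(* [H1] after the substitution of |x| r for r at fixed x, which turns the point on the ray into r
   x. *)
pose H2 (p : R * R3) := ((if (0 < p.1) && (0 < enorm p.2) && (enorm p.2 <= 1)
  then 3 * enorm p.2 ^+ 3 * p.1 ^+ 2 else 0)%:E * F (sc3 p.1 p.2))%E.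
have mH2 : measurable_fun setT H2.
  apply: emeasurable_funM; last first.
    by apply: (measurableT_comp mF); apply: measurable_sc3_fun; mfun.
  by apply/measurable_EFinP; apply: measurable_fun_ifT; mfun; apply: measurable_enorm_fun; mfun.
have H20 p : (0 <= H2 p)%E.
  apply: mule_ge0 => //; rewrite lee_fin; case: ifP => // _; apply: mulr_ge0; last exact: sqr_ge0.
  by rewrite mulr_ge0// exprn_ge0// enorm_ge0.
(* [H2] after the substitution of x / r for x at fixed r; the integral in r is now the one of
   [integral_inv4]. *)
pose H3 (p : R * R3) := ((if (0 < p.1) && (0 < enorm p.2) && (enorm p.2 <= p.1)
  then 3 * enorm p.2 ^+ 3 * p.1 ^- 4 else 0)%:E * F p.2)%E.
have mH3 : measurable_fun setT H3.
  apply: emeasurable_funM; last by apply: (measurableT_comp mF); mfun.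
  apply/measurable_EFinP; apply: measurable_fun_ifT; mfun; try (apply: measurable_enorm_fun; mfun).
  by apply: measurable_funV; mfun.
have H30 p : (0 <= H3 p)%E.
  rewrite mule_ge0// lee_fin; case: ifP => // /andP[/andP[p0 _] _].
  by rewrite !mulr_ge0// ?invr_ge0 ?exprn_ge0 ?enorm_ge0// ltW.
transitivity (\int[mu]_r \int[leb3 R]_x H1 (r, x))%E; last by [].
rewrite (fubini_tonelli (m1 := mu) (m2 := leb3 R) H1 mH1 H10).
transitivity (\int[leb3 R]_x \int[mu]_r H2 (r, x))%E; last first.
  apply: eq_integral => x _.
  have [x0|x0] := ltP 0 (enorm x); last first.
    rewrite !integral0_eq// => r _; rewrite /H1 /H2 /= /polar_weight ?(ltNge 0) ?x0/= ?andbF/= ?mul0e//.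
  rewrite (ge0_integral_scale x0 (f := fun r => H1 (r, x)))//; last first.
    by apply: (measurableT_comp mH1); exact: pair2_measurable.
  rewrite -ge0_integralZl//; last 2 first.
  - apply: (@measurableT_comp _ _ _ _ _ _ H1 _ (fun r => (enorm x * r, x))) => //; mfun.
  - by rewrite lee_fin ltW.
  apply: eq_integral => r _; rewrite /H1 /H2 /= /polar_weight x0 /= andbT pmulr_rgt0// andbT.
  rewrite /ray (_ : enorm x * r / enorm x = r); last by rewrite mulrAC divff ?mul1r ?gt_eqF.
  rewrite muleA -EFinM; congr ((_)%:E * _)%E.
  by case: ifP => _; [ring|rewrite mulr0].
transitivity (\int[mu]_r \int[leb3 R]_x H2 (r, x))%E; last first.
  exact: (fubini_tonelli (m1 := mu) (m2 := leb3 R) H2 mH2 H20).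
transitivity (\int[mu]_r \int[leb3 R]_x H3 (r, x))%E; last first.
  apply: eq_integral => r _.
  have [r0|r0] := ltP 0 r; last first.
    rewrite !integral0_eq// => x _; rewrite /H3 /H2 /= ?(ltNge 0 r) ?r0/= ?mul0e//.
  rewrite (@mu3_scale _ r^-1 (fun x => H2 (r, x))) ?invr_gt0//; last first.
    by apply: (measurableT_comp mH2); exact: pair1_measurable.
  rewrite -ge0_integralZl//; last 2 first.
  - exact: (measurableT_comp (measurableT_comp mH2 (pair1_measurable r)) (measurable_sc3 r^-1)).
  - by rewrite lee_fin exprn_ge0// invr_ge0 ltW.
  apply: eq_integral => x _; rewrite /H3 /H2 /= r0 /= enorm_sc3 normfV (gtr0_norm r0).
  rewrite pmulr_rgt0 ?invr_gt0// (_ : (r^-1 * enorm x <= 1) = (enorm x <= r)); last first.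
    by rewrite mulrC ler_pdivrMr// mul1r.
  rewrite muleA -EFinM.
  congr ((_)%:E * F _)%E.
    case: ifP => _; last by rewrite mulr0.
    by field; rewrite gt_eqF.
  by case: x => -[a b] c; rewrite /sc3 /= !mulrA divff ?gt_eqF// !mul1r.
rewrite (fubini_tonelli (m1 := mu) (m2 := leb3 R) H3 mH3 H30).
apply: ge0_ae_eq_integral => //.
- exact: (measurable_fun_fubini_tonelli_G (m1 := mu) H3).
- by move=> x _; exact: integral_ge0.
- apply: ae_imp (mu3_neq0 R) => x; rewrite -enorm_gt0 => x0 _.
  pose a := 3 * enorm x ^+ 3.
  have a0 : 0 < a by rewrite mulr_gt0// exprn_gt0.
  transitivity (\int[mu]_r ((a%:E * F x) * (if enorm x <= r then r ^- 4 else 0)%:E))%E.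
    rewrite ge0_integralZl//; last 3 first.
    - by apply/measurable_EFinP; apply: measurable_fun_ifT; mfun; apply: measurable_funV; mfun.
    - move=> r _; rewrite lee_fin; case: ifP => // xr; rewrite invr_ge0 exprn_ge0//.
      by rewrite (le_trans _ xr)// enorm_ge0.
    - by rewrite mule_ge0// lee_fin ltW.
    by rewrite integral_inv4// muleAC -EFinM divff ?mul1e// gt_eqF.
  apply: eq_integral => r _; rewrite /H3 /= x0 andbT muleAC -EFinM; congr ((_)%:E * _)%E.
  have [xr|] := leP (enorm x) r; last by rewrite andbF mulr0.
  by rewrite (lt_le_trans x0 xr).
Qed.
End polar.

(** * Spherical integrals as integrals over the unit ball *)

Section smean.
Variable R : realType.
Local Notation R3 := (R3 R).
Local Notation mu := (@lebesgue_measure R).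
Local Notation mu3 := (mu3 R).
Implicit Types (x : R3) (h phi : R3 -> R).

Lemma measurable_setb d (T : measurableType d) (b : T -> bool) :
  measurable_fun setT b -> measurable [set t | b t].
Proof.
move=> mb; rewrite (_ : [set t | b t] = setT `&` b @^-1` [set true]).
  exact: mb.
by rewrite setTI.
Qed.

Definition unitb : set R3 := [set x | 0 < enorm x <= 1].

Lemma in_unitb x : (x \in unitb) = (0 < enorm x <= 1).
Proof. by rewrite mem_setE. Qed.

Lemma measurable_unitb : measurable unitb.
Proof. by apply: measurable_setb; mfun; exact: measurable_enorm. Qed.

Lemma mu3_box (a b : R) : mu3 ((`]a, b[ `*` `]a, b[) `*` `]a, b[) = if (a < b)%R then (((b - a) ^+ 3)%R)%:E else 0%E.
Proof.
transitivity (mu `]a, b[%classic * mu `]a, b[%classic * mu `]a, b[%classic)%E.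
  rewrite [LHS]product_measure1E//; last exact: measurableX.
  by congr (_ * _)%E; rewrite [LHS]product_measure1E.
rewrite !lebesgue_measure_itv/= !lte_fin.
by case: ifP => _; rewrite ?mule0// -!EFinB -!EFinM !exprS expr0 mulr1 mulrA.
Qed.

Lemma measurable_box (a b : R) : measurable ((`]a, b[ `*` `]a, b[) `*` `]a, b[ : set R3).
Proof. by apply: measurableX => //; exact: measurableX. Qed.

Lemma mu3_unitb_lty : (mu3 unitb < +oo)%E.
Proof.
apply: (@le_lt_trans _ _ (mu3 ((`](-2), 2[ `*` `](-2), 2[) `*` `](-2), 2[))).
  apply: le_measure; rewrite ?inE; [exact: measurable_unitb|exact: measurable_box|].
  move=> x /andP[_ x1].
  have h (i : 'I_3) : -2 < Defs.coord i x < 2.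
    by rewrite -ltr_norml (le_lt_trans (normr_coord i x))// (le_lt_trans x1)// ltr1n.
  split; [split|]; rewrite /= in_itv /=.
  - exact: (h (Ordinal (isT : 0 < 3)%N)).
  - exact: (h (Ordinal (isT : 1 < 3)%N)).
  - exact: (h (Ordinal (isT : 2 < 3)%N)).
by rewrite mu3_box ifT ?ltry//; lra.
Qed.

Lemma mu3_unitb_gt0 : (0 < mu3 unitb)%E.
Proof.
apply: (@lt_le_trans _ _ (mu3 ((`]0, 2^-1[ `*` `]0, 2^-1[) `*` `]0, 2^-1[))).
  by rewrite mu3_box ifT ?lte_fin ?exprn_gt0//; lra.
apply: le_measure; rewrite ?inE; [exact: measurable_box|exact: measurable_unitb|].
move=> x [[/= x1 x2] x3]; rewrite !in_itv/= in x1 x2 x3.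
have h : 0 < enorm x ^+ 2 <= 1 by rewrite sqr_enorm; apply/andP; split; nra.
have := enorm_ge0 x => e0; rewrite /unitb /=; apply/andP; split; nra.
Qed.

(* The area of the unit sphere. *)
Definition kappa : R := 3 * fine (mu3 unitb).

Lemma kappa_gt0 : 0 < kappa.
Proof. by rewrite mulr_gt0// fine_gt0// mu3_unitb_gt0 mu3_unitb_lty. Qed.

Lemma integral_unitb_cst (c : R) :
  (\int[mu3]_(x in unitb) c%:E = (c * (kappa / 3))%:E)%E.
Proof.
rewrite integral_cst; last exact: measurable_unitb.
rewrite /kappa mulrAC divff// mul1r EFinM fineK// ge0_fin_numE//.
exact: mu3_unitb_lty.
Qed.

(** A radial integrand is constant on spheres, so the inner integral of the polar formula is 3 r^2
    g(r) times the volume of the unit ball. *)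
Lemma radial_tonelli (g : R -> \bar R) : measurable_fun setT g -> (forall r, 0 <= g r)%E ->
  (\int[mu3]_x g (enorm x) = kappa%:E * \int[mu]_(r in `]0%R, +oo[) ((r ^+ 2)%:E * g r))%E.
Proof.
move=> mg g0.
rewrite polar_tonelli//; last first.
  by apply: (mcomp mg); exact: measurable_enorm.
rewrite [in RHS]integral_if -ge0_integralZl//; last 3 first.
- apply: measurable_fun_ifT => //.
  + by under eq_fun do rewrite mem_setE in_itv/= andbT; mfun.
  + by apply: emeasurable_funM => //; apply/measurable_EFinP; mfun.
- by move=> r _; case: ifP => // _; rewrite mule_ge0// lee_fin sqr_ge0.
- by rewrite lee_fin ltW// kappa_gt0.
apply: eq_integral => r _; rewrite mem_setE in_itv/= andbT.
case: ifPn => [r0|]; last first.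
  by move=> /negbTE r0; rewrite mule0 integral0_eq// => x _; rewrite /polar_weight r0 mul0e.
transitivity (\int[mu3]_(x in unitb) ((3 * r ^+ 2)%:E * g r))%E.
  rewrite [in RHS]integral_if; apply: eq_integral => x _.
  rewrite /polar_weight r0 /= in_unitb; case: ifPn => xu; last by rewrite mul0e.
  by rewrite enorm_ray ?gtr0_norm// -enorm_gt0; case/andP: xu.
under eq_integral => x _ do rewrite -[X in (X * _)%E]mule1 -muleA.
rewrite ge0_integralZl//; [|exact: measurable_unitb|by move=> *; rewrite mule_ge0|by rewrite lee_fin mulr_ge0// sqr_ge0].
rewrite ge0_integralZr//; [|exact: measurable_unitb].
rewrite integral_unitb_cst muleA -EFinM muleA -EFinM.
by congr (_%:E * _)%E; field.
Qed.

(* For h homogeneous of degree 0, the integral of h w * phi (r w) over the unit sphere. *)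
Definition smean (h phi : R3 -> R) (r : R) : R :=
  3 * \int[mu3]_(x in unitb) (h x * phi (ray r x)).

Lemma bounded_unitb_integrable (f : R3 -> R) (C : R) : measurable_fun setT f ->
  (forall x, unitb x -> `|f x| <= C) -> mu3.-integrable unitb (EFin \o f).
Proof.
move=> mf fC; apply: measurable_bounded_integrable.
- exact: measurable_unitb.
- exact: mu3_unitb_lty.
- exact: measurable_funS mf.
- by exists C; split; [exact: num_real|move=> M CM x /fC /le_trans; apply; exact: ltW].
Qed.

Lemma measurable_phi_ray phi r : measurable_fun setT phi ->
  measurable_fun setT (fun x => phi (ray r x)).
Proof.
by move=> mphi; apply: (mcomp mphi); apply: measurable_sc3_fun; mfun; apply: measurable_funV; exact: measurable_enorm.
Qed.

Lemma measurable_smean_integrand h phi r : measurable_fun setT h -> measurable_fun setT phi ->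
  measurable_fun setT (fun x => h x * phi (ray r x)).
Proof. by move=> mh mphi; apply: measurable_funM => //; exact: measurable_phi_ray. Qed.

Lemma polar_Rintegral (f : R3 -> R) : mu3.-integrable setT (EFin \o f) ->
  \int[mu3]_x f x = \int[mu]_r (\int[mu3]_x (polar_weight r x * f (ray r x))).
Proof.
move=> intf.
pose P (p : R * R3) : R := polar_weight p.1 p.2 * f (ray p.1 p.2).
have mf : measurable_fun setT f by have /measurable_EFinP := measurable_int _ intf.
have mfE : measurable_fun setT (EFin \o f) by exact/measurable_EFinP.
have mP : measurable_fun setT P.
  apply: measurable_funM; first exact: measurable_polar_weight.
  by apply: (mcomp mf); exact: measurable_ray.
have mPE : measurable_fun setT (EFin \o P) by exact/measurable_EFinP.
have iP : (mu \x leb3 R)%E.-integrable setT (EFin \o P).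
  apply/integrable12ltyP; first exact: mPE.
  have /integrableP[_] := intf.
  have mfA : measurable_fun setT (fun x => `|(f x)%:E|%E) by apply: measurableT_comp.
  rewrite (polar_tonelli mfA) => [|x]; last exact: abse_ge0.
  apply: le_lt_trans; rewrite le_eqVlt; apply/orP; left; apply/eqP.
  apply: eq_integral => r _; apply: eq_integral => x _.
  rewrite -[LHS]/(`|polar_weight r x * f (ray r x)|%:E) normrM EFinM.
  by rewrite (ger0_norm (polar_weight_ge0 r x)).
transitivity (\int[mu]_r (\int[leb3 R]_x P (r, x))); last by [].
rewrite Rintegral12//; congr fine; rewrite [LHS]integralE [RHS]integralE.
congr (_ - _)%E.
- rewrite (polar_tonelli (measurable_funepos mfE)) => [|x]; last exact: funepos_ge0.
  rewrite (fubini_tonelli1 (m1 := mu) (m2 := leb3 R) _ (measurable_funepos mPE)) => [|x]; last exact: funepos_ge0.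
  apply: eq_integral => r _; apply: eq_integral => x _.
  by rewrite !funeposE /P /= -EFin_max -EFinM -EFin_max maxr_pMr ?polar_weight_ge0// mulr0.
- rewrite (polar_tonelli (measurable_funeneg mfE)) => [|x]; last exact: funeneg_ge0.
  rewrite (fubini_tonelli1 (m1 := mu) (m2 := leb3 R) _ (measurable_funeneg mPE)) => [|x]; last exact: funeneg_ge0.
  apply: eq_integral => r _; apply: eq_integral => x _.
  rewrite !funenegE /P /= -EFin_max -EFinM -EFin_max maxr_pMr ?polar_weight_ge0// mulr0.
  by rewrite mulrN.
Qed.

(** One statement for radial functions ([h = cst 1]) and for the components of their gradients
    ([h = dir i]): a depends on the radius only and leaves the spherical integral, while h is
    constant along rays. *)
Lemma polar_radial (a : R -> R) h phi (H C : R) :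
  measurable_fun setT h -> measurable_fun setT phi ->
  (forall x, `|h x| <= H) -> (forall x, `|phi x| <= C) ->
  (forall r x, 0 < r -> x != 0 -> h (ray r x) = h x) ->
  mu3.-integrable setT (EFin \o (fun x => a (enorm x) * (h x * phi x))) ->
  \int[mu3]_x (a (enorm x) * (h x * phi x)) =
  \int[mu]_(r in `]0, +oo[) (a r * (r ^+ 2 * smean h phi r)).
Proof.
move=> mh mphi hH pC hray intf.
rewrite (polar_Rintegral intf) [in RHS]Rintegral_if; apply: eq_Rintegral => r _.
rewrite mem_setE in_itv/= andbT; case: ifPn => [r0|/negbTE r0]; last first.
  rewrite /Rintegral (_ : integral _ _ _ = 0%E)// integral0_eq// => x _.
  by rewrite /polar_weight r0 mul0r.
rewrite /smean 2!mulrA.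
rewrite -RintegralZl; [|exact: measurable_unitb|]; last first.
  apply: (@bounded_unitb_integrable _ (H * C)); first exact: measurable_smean_integrand.
  by move=> x _; rewrite normrM ler_pM.
rewrite [in RHS]Rintegral_if; apply: eq_Rintegral => x _.
rewrite /polar_weight r0 /= in_unitb; case: ifPn => xu; last by rewrite mul0r.
have x0 : x != 0 by rewrite -enorm_gt0; case/andP: xu.
rewrite enorm_ray// gtr0_norm// hray//; ring.
Qed.

Lemma mu3_Rint_opp (f : R3 -> R) : measurable_fun setT f ->
  \int[mu3]_x f x = \int[mu3]_x f (sc3 (-1) x).
Proof.
move=> mf; have mEf : measurable_fun setT (EFin \o f) by exact/measurable_EFinP.
rewrite /Rintegral integralE [in RHS]integralE; congr (fine (_ - _)%E).
- rewrite (mu3_opp (measurable_funepos mEf)) => [|x]; last exact: funepos_ge0.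
  by apply: eq_integral => x _; rewrite !funeposE.
- rewrite (mu3_opp (measurable_funeneg mEf)) => [|x]; last exact: funeneg_ge0.
  by apply: eq_integral => x _; rewrite !funenegE.
Qed.

(** The reflection of the ball exchanges opposite rays. Evenness makes r times the spherical
    integral an odd function on the whole line, the setting of d'Alembert's formula. *)
Lemma smeanN phi r : measurable_fun setT phi ->
  smean (cst 1) phi (- r) = smean (cst 1) phi r.
Proof.
move=> mphi; congr (_ * _); rewrite Rintegral_if [in RHS]Rintegral_if.
rewrite mu3_Rint_opp; last first.
  apply: measurable_fun_ifT => //.
  - by under eq_fun do rewrite in_unitb; mfun; exact: measurable_enorm.
  - by apply: measurable_smean_integrand.
apply: eq_Rintegral => x _; rewrite !in_unitb enorm_sc3 normrN1 mul1r.
case: ifP => // _; congr (_ * phi _).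
by rewrite /ray enorm_sc3 normrN1 mul1r /sc3 /= !mulN1r !mulNr !mulrN !opprK.
Qed.

End smean.

(** * Test functions and spherical integrals *)

Section test_functions.
Variable R : realType.
Local Notation V := (R * R * R)%type.
Implicit Types (f phi : V -> R) (x y v : V).

Lemma is_derive_line f v x s : derivable f (x + s *: v) v ->
  is_derive s (1 : R) (fun s => f (x + s *: v)) ('D_v f (x + s *: v)).
Proof.
move=> df.
have E : (fun h : R => h^-1 *: (((fun s => f (x + s *: v)) \o shift s) (h *: (1 : R)) - f (x + s *: v)))
  = (fun h : R => h^-1 *: ((f \o shift (x + s *: v)) (h *: v) - f (x + s *: v))).
  apply/funext => h /=; congr (_ *: (f _ - _)).
  by rewrite /GRing.scale /= mulr1 -[X in _ + X]/((h + s) *: v) scalerDl addrCA.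
by apply: DeriveDef; rewrite ?/derivable ?/derive E.
Qed.

Lemma smooth_derive phi v : smooth phi -> smooth (fun x => 'D_v phi x).
Proof.
move=> sphi s; have := sphi (s ++ [:: v]).
suff -> : iter_deriv (s ++ [:: v]) phi = iter_deriv s (fun x => 'D_v phi x) by [].
by elim: s => //= w s ->.
Qed.

Lemma smooth_continuous phi : smooth phi -> continuous phi.
Proof. by move=> /(_ [::])[]. Qed.

Lemma smooth_derivable phi x v : smooth phi -> derivable phi x v.
Proof. by move=> /(_ [::])[]. Qed.

Lemma continuous_enorm : continuous (@enorm R).
Proof.
move=> x; rewrite (_ : @enorm R = fun x => Num.sqrt (x.1.1 ^+ 2 + x.1.2 ^+ 2 + x.2 ^+ 2)); last first.
  by apply/funext => y; rewrite enormE.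
apply: continuous_comp; last exact: sqrt_continuous.
have c11 : (y.1.1 @[y --> x]) --> x.1.1 by exact: (cvg_comp _ _ cvg_fst cvg_fst).
have c12 : (y.1.2 @[y --> x]) --> x.1.2 by exact: (cvg_comp _ _ cvg_fst cvg_snd).
have c2 : (y.2 @[y --> x]) --> x.2 by exact: cvg_snd.
by apply: cvgD; [apply: cvgD|]; rewrite expr2; apply: cvgM.
Qed.

Lemma derive_out phi v (M : R) x : (forall x, M < enorm x -> phi x = 0) -> M < enorm x ->
  'D_v phi x = 0.
Proof.
move=> phi0 Mx.
have h : \forall y \near x, phi y = 0.
  have : \forall y \near x, M < enorm y.
    have eM : 0 < enorm x - M by rewrite subr_gt0.
    have /cvgrPdist_lt/(_ _ eM) := @continuous_enorm x.
    by apply: filterS => y; rewrite ltr_norml => /andP[_]; lra.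
  by apply: filterS => y; exact: phi0.
have -> : 'D_v phi x = 'D_v (cst 0 : V -> R) x by apply: near_eq_derive.
exact: derive_cst.
Qed.

Lemma test_function_derive phi v : test_function phi -> test_function (fun x => 'D_v phi x).
Proof.
move=> [sphi [M phi0]]; split; first exact: smooth_derive.
by exists M => x; exact: derive_out.
Qed.

Lemma test_function_bounded phi : test_function phi -> exists2 C, 0 < C & forall x, `|phi x| <= C.
Proof.
move=> [sphi [M phi0]].
pose K : set V := (`[- M, M] `*` `[- M, M]) `*` `[- M, M].
have cK : compact K by apply: compact_setX; [apply: compact_setX|]; exact: segment_compact.
have : compact (phi @` K).
  by apply: continuous_compact => //; apply: continuous_subspaceT; exact: smooth_continuous.
move=> /compact_bounded [N [Nr hN]].
exists (`|N| + 1); first by rewrite ltr_wpDl.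
move=> x; have [Mx|xM] := ltP M (enorm x).
  by rewrite phi0// normr0 addr_ge0.
apply: (hN (`|N| + 1)); first by rewrite (le_lt_trans (ler_norm N))// ltrDl.
exists x => //.
have h (i : 'I_3) : - M <= Defs.coord i x <= M.
  by rewrite -ler_norml (le_trans (normr_coord i x)).
split; [split|]; rewrite /= in_itv /=.
- exact: (h (Ordinal (isT : 0 < 3)%N)).
- exact: (h (Ordinal (isT : 1 < 3)%N)).
- exact: (h (Ordinal (isT : 2 < 3)%N)).
Qed.

Lemma MVT_line phi v x t : smooth phi ->
  exists2 c, `|c| <= `|t| & phi (x + t *: v) - phi x = t * 'D_v phi (x + c *: v).
Proof.
move=> sphi.
pose g s := phi (x + s *: v).
have dg (s : R) : is_derive s 1 g ('D_v phi (x + s *: v)).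
  by apply: is_derive_line; exact: smooth_derivable.
have cg (a b : R) : {within `[a, b], continuous g}.
  by apply: derivable_within_continuous => y _; exact: ex_derive.
have -> : phi x = g 0 by rewrite /g scale0r addr0.
rewrite -/(g t).
have [t0|t0] := leP 0 t.
  have [c] := @MVT_segment _ g (fun s => 'D_v phi (x + s *: v)) 0 t t0 (fun s _ => dg s) (cg _ _).
  rewrite in_itv/= subr0 => /andP[c0 ct] ->; exists c; last by rewrite mulrC.
  by rewrite !ger0_norm.
have [c] := @MVT_segment _ g (fun s => 'D_v phi (x + s *: v)) t 0 (ltW t0) (fun s _ => dg s) (cg _ _).
rewrite in_itv/= sub0r => /andP[tc c0] h; exists c.
  by rewrite !ler0_norm ?lerN2// ltW.
by rewrite -opprB h mulrN opprK mulrC.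
Qed.

Lemma ball3P x y (d : R) : (forall i : 'I_3, `|Defs.coord i x - Defs.coord i y| < d) -> ball x d y.
Proof.
move=> h; have bl (a b : R) : `|a - b| < d -> ball a d b by rewrite -ball_normE.
split; [split|]; apply: bl.
- exact: (h (Ordinal (isT : 0 < 3)%N)).
- exact: (h (Ordinal (isT : 1 < 3)%N)).
- exact: (h (Ordinal (isT : 2 < 3)%N)).
Qed.

Lemma cont3_ball (F : 'I_3 -> V -> R) (p : V) (e : R) :
  (forall i, {for p, continuous (F i)}) -> 0 < e ->
  exists2 d, 0 < d & forall i y, ball p d y -> `|F i p - F i y| < e.
Proof.
move=> cF e0.
have h i : exists2 d, 0 < d & forall y, ball p d y -> `|F i p - F i y| < e.
  have /cvgrPdist_lt/(_ _ e0) := cF i.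
  by move=> /nbhs_ballP[d /= d0 hd]; exists d.
have [d1 d10 h1] := h (Ordinal (isT : 0 < 3)%N).
have [d2 d20 h2] := h (Ordinal (isT : 1 < 3)%N).
have [d3 d30 h3] := h (Ordinal (isT : 2 < 3)%N).
exists (Num.min d1 (Num.min d2 d3)); first by rewrite !lt_min d10 d20 d30.
have le1 : Num.min d1 (Num.min d2 d3) <= d1 by rewrite ge_min lexx.
have le2 : Num.min d1 (Num.min d2 d3) <= d2 by rewrite !ge_min lexx !orbT.
have le3 : Num.min d1 (Num.min d2 d3) <= d3 by rewrite !ge_min lexx !orbT.
move=> [[|[|[|]]]// i3] y py.
- by rewrite (_ : Ordinal i3 = Ordinal (isT : 0 < 3)%N) ?h1//; [exact: le_ball py|exact: val_inj].
- by rewrite (_ : Ordinal i3 = Ordinal (isT : 1 < 3)%N) ?h2//; [exact: le_ball py|exact: val_inj].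
- by rewrite (_ : Ordinal i3 = Ordinal (isT : 2 < 3)%N) ?h3//; [exact: le_ball py|exact: val_inj].
Qed.

Lemma add_basis0 (y : V) (s : R) (i : (0 < 3)%N) :
  y + s *: Defs.basis R (Ordinal i) = (y.1.1 + s, y.1.2, y.2).
Proof.
case: y => -[a b] c.
by rewrite -[LHS]/(a + s * 1, b + s * 0, c + s * 0) mulr1 !mulr0 !addr0.
Qed.

Lemma add_basis1 (y : V) (s : R) (i : (1 < 3)%N) :
  y + s *: Defs.basis R (Ordinal i) = (y.1.1, y.1.2 + s, y.2).
Proof.
case: y => -[a b] c.
by rewrite -[LHS]/(a + s * 0, b + s * 1, c + s * 0) mulr1 !mulr0 !addr0.
Qed.

Lemma add_basis2 (y : V) (s : R) (i : (2 < 3)%N) :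
  y + s *: Defs.basis R (Ordinal i) = (y.1.1, y.1.2, y.2 + s).
Proof.
case: y => -[a b] c.
by rewrite -[LHS]/(a + s * 0, b + s * 0, c + s * 1) mulr1 !mulr0 !addr0.
Qed.

Lemma abs_aux3 (a b c : R) : 0 <= a -> 0 <= b -> 0 <= c ->
  [/\ a <= 1 + a + b + c, b <= 1 + a + b + c, c <= 1 + a + b + c & a + b + c <= 1 + a + b + c].
Proof. by move=> *; split; lra. Qed.

(** [smooth] speaks of directional derivatives only; the content is that the derivative along x is
    the combination of the partial ones. The increment is split along the three axes, the mean value
    theorem is applied on each, and the partial derivatives are continuous. *)
Lemma is_derive_ray phi (x : V) (t : R) : smooth phi ->
  is_derive t (1 : R) (fun t => phi (sc3 t x))
    (\sum_(i < 3) Defs.coord i x * 'D_(Defs.basis R i) phi (sc3 t x)).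
Proof.
move=> sphi.
set L := \sum_(i < 3) _; set p : V := sc3 t x.
set i0 : 'I_3 := Ordinal (isT : 0 < 3)%N; set i1 : 'I_3 := Ordinal (isT : 1 < 3)%N.
set i2 : 'I_3 := Ordinal (isT : 2 < 3)%N.
have LE : L = x.1.1 * 'D_(Defs.basis R i0) phi p + x.1.2 * 'D_(Defs.basis R i1) phi p
    + x.2 * 'D_(Defs.basis R i2) phi p.
  rewrite /L !big_ord_recr big_ord0 /= add0r; congr (_ + _ + _);
  by congr (_ * 'D_(Defs.basis R _) phi p); apply: val_inj.
suff cv : (fun h : R => h^-1 *: (((fun t => phi (sc3 t x)) \o shift t) (h *: (1 : R)) - phi p))
    @ 0^' --> L.
  by apply: DeriveDef; [apply/cvg_ex; exists L|apply: cvg_lim].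
apply/cvgrPdist_lt => e e0.
have [Sa Sb Sc Sd] := abs_aux3 (normr_ge0 x.1.1) (normr_ge0 x.1.2) (normr_ge0 x.2).
(* Bounds the sum of the coefficients of the three partial derivatives. The 1 keeps it positive at x
   = 0, and the 2 in [e / (2 * S)] makes the final inequality strict. *)
pose S := 1 + `|x.1.1| + `|x.1.2| + `|x.2|.
have S1 : 1 <= S by rewrite /S -!addrA lerDl !addr_ge0.
have S0 : 0 < S by exact: lt_le_trans ltr01 S1.
have eS : 0 < e / (2 * S) by rewrite divr_gt0 ?mulr_gt0.
have [d d0 hd] := @cont3_ball (fun i => 'D_(Defs.basis R i) phi) p (e / (2 * S))
  (fun i => smooth_continuous (smooth_derive (Defs.basis R i) sphi) (x:=p)) eS.
near=> h.
have h0 : h != 0 by near: h; exact: nbhs_dnbhs_neq.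
have hS : `|h| * S < d.
  rewrite -ltr_pdivlMr//; near: h; apply: dnbhs0_lt; exact: divr_gt0.
have [c1 c1h E1] := MVT_line (Defs.basis R i0) p (h * x.1.1) sphi.
set p1 := p + _ in E1.
have [c2 c2h E2] := MVT_line (Defs.basis R i1) p1 (h * x.1.2) sphi.
set p2 := p1 + _ in E2.
have [c3 c3h E3] := MVT_line (Defs.basis R i2) p2 (h * x.2) sphi.
set p3 := p2 + _ in E3.
have p3E : sc3 (h *: 1 + t) x = p3.
  rewrite /p3 add_basis2 /p2 add_basis1 /p1 add_basis0 /p /sc3 /= /GRing.scale /= mulr1.
  by congr (_, _, _); ring.
have near_p (a b c : R) : `|a| <= `|h| * `|x.1.1| -> `|b| <= `|h| * `|x.1.2| ->
    `|c| <= `|h| * `|x.2| -> ball p d (p.1.1 + a, p.1.2 + b, p.2 + c).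
  have a0 := normr_ge0 h.
  move=> ha hb hc; apply: ball3P => -[[|[|[|]]]]// ?; rewrite /Defs.coord /= opprD addrA subrr sub0r normrN;
    apply: le_lt_trans hS; rewrite /S.
  - by apply: le_trans ha _; rewrite ler_wpM2l.
  - by apply: le_trans hb _; rewrite ler_wpM2l.
  - by apply: le_trans hc _; rewrite ler_wpM2l.
rewrite normrM in c1h; rewrite normrM in c2h; rewrite normrM in c3h.
have z0 (u : R) : `|0 : R| <= `|h| * `|u| by rewrite normr0 mulr_ge0.
have hz (u : R) : `|h * u| <= `|h| * `|u| by rewrite normrM.
have q1 : ball p d (p + c1 *: Defs.basis R i0).
  have := near_p c1 0 0 c1h (z0 _) (z0 _); rewrite add_basis0; congr (ball p d _).
  by congr (_, _, _); ring.
have q2 : ball p d (p1 + c2 *: Defs.basis R i1).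
  have := near_p (h * x.1.1) c2 0 (hz _) c2h (z0 _).
  by rewrite add_basis1 /p1 add_basis0; congr (ball p d _); congr (_, _, _); rewrite /=; ring.
have q3 : ball p d (p2 + c3 *: Defs.basis R i2).
  have := near_p (h * x.1.1) (h * x.1.2) c3 (hz _) (hz _) c3h.
  by rewrite add_basis2 /p2 add_basis1 /p1 add_basis0; congr (ball p d _); congr (_, _, _); rewrite /=; ring.
move: (hd i0 _ q1) (hd i1 _ q2) (hd i2 _ q3).
rewrite /comp /shift p3E.
have -> : phi p3 - phi p = h * x.1.1 * 'D_(Defs.basis R i0) phi (p + c1 *: Defs.basis R i0)
   + h * x.1.2 * 'D_(Defs.basis R i1) phi (p1 + c2 *: Defs.basis R i1)
   + h * x.2 * 'D_(Defs.basis R i2) phi (p2 + c3 *: Defs.basis R i2).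
  by rewrite -E1 -E2 -E3; ring.
rewrite LE.
move: ('D_(Defs.basis R i0) phi p) ('D_(Defs.basis R i1) phi p) ('D_(Defs.basis R i2) phi p)
  ('D_(Defs.basis R i0) phi (p + _)) ('D_(Defs.basis R i1) phi (p1 + _)) ('D_(Defs.basis R i2) phi (p2 + _)).
move=> A1 A2 A3 B1 B2 B3 b1 b2 b3.
rewrite (_ : _ - _ = x.1.1 * (A1 - B1) + x.1.2 * (A2 - B2) + x.2 * (A3 - B3)); last first.
  by rewrite /GRing.scale /=; field.
apply: (@le_lt_trans _ _ (`|x.1.1| * (e / (2 * S)) + `|x.1.2| * (e / (2 * S)) + `|x.2| * (e / (2 * S)))).
  apply: le_trans (ler_normD _ _) _; apply: lerD; last by rewrite normrM ler_wpM2l// ltW.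
  by apply: le_trans (ler_normD _ _) _; apply: lerD; rewrite normrM ler_wpM2l// ltW.
rewrite -!mulrDl; apply: (@le_lt_trans _ _ (S * (e / (2 * S)))).
  by rewrite ler_wpM2r ?(ltW eS).
rewrite (_ : S * (e / (2 * S)) = e / 2); first by rewrite ltr_pdivrMr// ltr_pMr// ltr1n.
by field; rewrite gt_eqF.
Unshelve. all: by end_near. Qed.
End test_functions.

(** * One-variable calculus and differentiation under the integral *)

Section calculus.
Variable R : realType.
Local Notation mu := (@lebesgue_measure R).

Lemma integral_itv_cst (a b c : R) : a <= b ->
  (\int[mu]_(x in `[a, b]) c%:E = (c * (b - a))%:E)%E.
Proof.
move=> ab; have E : (mu `[a, b]%classic = (b - a)%:E)%E.
  rewrite lebesgue_measure_itv/= lte_fin.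
  by move: ab; rewrite le_eqVlt => /predU1P[->|->]; rewrite ?ltxx ?subrr// -EFinB.
rewrite EFinM -E; apply: integral_cst; exact: measurable_itv.
Qed.

Lemma is_derive_continuous (f : R -> R) (x df : R) : is_derive x 1 f df -> {for x, continuous f}.
Proof. by move=> [d _]; apply: differentiable_continuous; apply/derivable1_diffP. Qed.

Lemma is_derive_under d (Y : measurableType d) (m : {measure set Y -> \bar R}) (B : set Y)
    (f f' : R -> Y -> R) (a : R) (G : Y -> R) : measurable B ->
  (forall x, m.-integrable B (EFin \o f x)) ->
  (forall x y, B y -> is_derive x (1 : R) (f ^~ y) (f' x y)) ->
  (forall y, 0 <= G y) -> m.-integrable B (EFin \o G) ->
  (forall x y, a - 1 < x < a + 1 -> B y -> `|f' x y| <= G y) ->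
  is_derive a (1 : R) (fun x => \int[m]_(y in B) f x y) (\int[m]_(y in B) f' a y).
Proof.
move=> mB fi df G0 Gi fG.
have Ia : [set` `](a - 1), (a + 1)[] a by rewrite /= in_itv/=; apply/andP; split; lra.
have h1 x : [set` `](a - 1), (a + 1)[] x -> m.-integrable B (EFin \o f x) by [].
have h2 x y : [set` `](a - 1), (a + 1)[] x -> B y -> derivable (f ^~ y) x 1.
  by move=> _ By; have [] := df x y By.
have h3 x y : [set` `](a - 1), (a + 1)[] x -> B y -> `|partial1of2 f x y| <= G y.
  rewrite /= in_itv/= => xI By; rewrite partial1of2E.
  by have [_ ->] := df x y By; exact: fG.
have D := derivable_under_integral mB Ia h1 h2 G0 Gi h3.
have E := differentiation_under_integral mB Ia h1 h2 G0 Gi h3.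
apply: DeriveDef => //; rewrite -derive1E E; apply: eq_Rintegral => y /set_mem By.
by rewrite partial1of2E; have [_ ->] := df a y By.
Qed.

Lemma continuous_integrable_itv (f : R -> R) (a b : R) : continuous f ->
  mu.-integrable `[a, b] (EFin \o f).
Proof.
move=> cf; apply: continuous_compact_integrable; first exact: segment_compact.
exact: continuous_subspaceT.
Qed.

Lemma is_derive_FTC1 (f : R -> R) (a x : R) : continuous f -> a < x ->
  is_derive x (1 : R) (fun x => \int[mu]_(t in `[a, x]) f t) (f x).
Proof.
move=> cf ax; have x1 : x < x + 1 by rewrite ltrDl.
have [D E] := continuous_FTC1_closed x1 (@continuous_integrable_itv f a (x + 1) cf) ax (cf x).
by apply: DeriveDef; [exact: D|rewrite -derive1E; exact: E].
Qed.

Lemma FTC2_derive (F f : R -> R) (a b : R) : a <= b -> continuous f ->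
  (forall x, a <= x <= b -> is_derive x (1 : R) F (f x)) ->
  (\int[mu]_(x in `[a, b]) (f x)%:E = (F b - F a)%:E)%E.
Proof.
rewrite le_eqVlt => /predU1P[->|ab] cf dF.
  by rewrite set_itv1 integral_set1 subrr.
have aab : a <= a <= b by rewrite lexx ltW.
have bab : a <= b <= b by rewrite lexx ltW.
rewrite (@continuous_FTC2 _ f F a b ab).
- by [].
- exact: continuous_subspaceT.
- split.
  + by move=> x; rewrite in_itv/= => /andP[ax xb]; apply: ex_derive; apply: dF; rewrite !ltW.
  + by apply: cvg_at_right_filter; exact: is_derive_continuous (dF a aab).
  + by apply: cvg_at_left_filter; exact: is_derive_continuous (dF b bab).
- move=> x; rewrite in_itv/= => /andP[ax xb].
  rewrite derive1E; have xx : a <= x <= b by rewrite !ltW.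
  by have [_ ->] := dF x xx.
Qed.

(* Differentiating the hypothesis in X isolates the ball integral of a. *)
Lemma weighted_ball_derivative (a b : R -> R) : continuous a -> continuous b ->
  (forall X, 0 < X -> \int[mu]_(r in `[0, X]) ((X ^+ 2 - r ^+ 2) * a r) =
    \int[mu]_(r in `[0, X]) (2 * r * b r)) ->
  forall X, 0 < X -> \int[mu]_(r in `[0, X]) a r = b X.
Proof.
move=> ca cb H X X0.
have cr2a : continuous (fun r : R => r ^+ 2 * a r).
  by move=> x; apply: cvgM; [exact: exprn_continuous|exact: ca].
have crb : continuous (fun r : R => 2 * r * b r).
  by move=> x; apply: cvgM; [apply: cvgM; [exact: cvg_cst|exact: cvg_id]|exact: cb].
pose A x := \int[mu]_(t in `[0, x]) a t.
have dA : is_derive X (1 : R) A (a X) by exact: is_derive_FTC1.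
have d2 := is_derive_FTC1 cr2a X0; have d3 := is_derive_FTC1 crb X0.
(* The boundary terms X^2 a(X) of the two summands cancel. *)
have dL : is_derive X (1 : R) (fun x => x ^+ 2 * A x - \int[mu]_(t in `[0, x]) (t ^+ 2 * a t))
   (2 * X * A X).
  by apply: is_derive_eq; rewrite /GRing.scale /=; ring.
have eqn : {near X, (fun x => x ^+ 2 * A x - \int[mu]_(t in `[0, x]) (t ^+ 2 * a t)) =1
   (fun x => \int[mu]_(t in `[0, x]) (2 * t * b t))}.
  near=> Y.
  have Y0 : 0 < Y by near: Y; exact: lt_nbhsr.
  rewrite -H// /A -RintegralZl//; last exact: continuous_integrable_itv.
  have cY : continuous (fun r : R => Y ^+ 2 * a r).
    by move=> x; apply: cvgM; [exact: cvg_cst|exact: ca].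
  rewrite -(@RintegralB _ _ _ mu `[0, Y]%classic (fun x => Y ^+ 2 * a x) (fun t => t ^+ 2 * a t));
    [|exact: measurable_itv|exact: continuous_integrable_itv|exact: continuous_integrable_itv].
  by apply: eq_Rintegral => r _; rewrite mulrBl.
have := @near_eq_derive R R R _ _ X 1 eqn.
rewrite (@derive_val _ _ _ _ _ _ _ dL) (@derive_val _ _ _ _ _ _ _ d3) => E.
have X2 : 2 * X != 0 by rewrite mulf_neq0// gt_eqF.
by apply: (mulfI X2); rewrite -E.
Unshelve. all: by end_near. Qed.
End calculus.

(** * Derivatives of spherical integrals in the radius *)

Section sphere.
Variable R : realType.
Local Notation R3 := (R3 R).
Local Notation mu := (@lebesgue_measure R).
Local Notation mu3 := (mu3 R).
Local Notation unitb := (@unitb R).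
Local Notation D i f := (fun x => 'D_(Defs.basis R i) f x).
Implicit Types (x : R3) (h : R3 -> R) (phi : R * R * R -> R).

Definition dir (i : 'I_3) (x : R3) : R := Defs.coord i x / enorm x.

Lemma measurable_dir i : measurable_fun setT (dir i).
Proof.
apply: measurable_funM; first exact: measurable_coord.
by apply: measurable_funV; exact: measurable_enorm.
Qed.

Lemma norm_dir i x : `|dir i x| <= 1.
Proof.
rewrite normrM normfV (ger0_norm (enorm_ge0 x)).
have [->|x0] := eqVneq (enorm x) 0; first by rewrite invr0 mulr0.
by rewrite ler_pdivrMr ?mul1r ?normr_coord// lt_def x0 enorm_ge0.
Qed.

Lemma coord_sc3 i c x : Defs.coord i (sc3 c x) = c * Defs.coord i x.
Proof. by case: i => -[|[|[|]]]. Qed.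

Lemma dir_ray i r x : 0 < r -> x != 0 -> dir i (ray r x) = dir i x.
Proof.
move=> r0 x0; rewrite /dir enorm_ray// gtr0_norm// coord_sc3.
have ex : enorm x != 0 by rewrite enorm_eq0.
by field; rewrite ex gt_eqF.
Qed.

Lemma rayE r x : ray r x = sc3 r (sc3 (enorm x)^-1 x).
Proof. by rewrite /ray /sc3 /= !mulrA. Qed.

Lemma test_measurable phi : test_function phi -> measurable_fun setT (phi : R3 -> R).
Proof. by move=> [sphi _]; apply: continuous_measurable3; exact: smooth_continuous. Qed.

(** Differentiation under the ball integral: along a ray, phi varies by its radial derivative, whose
    components bring in the factors [dir i]. *)
Lemma is_derive_smean h phi (H r : R) : measurable_fun setT h -> (forall x, `|h x| <= H) ->
  test_function phi ->
  is_derive r (1 : R) (smean h phi)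
    (\sum_(i < 3) smean (fun x => h x * dir i x) (D i phi) r).
Proof.
move=> mh hH tphi.
have H0 : 0 <= H by exact: le_trans (normr_ge0 _) (hH 0).
have [C C0 hC] := test_function_bounded tphi.
have [C1 C10 hC1] : exists2 C1, 0 < C1 & forall i x, `|D i phi x| <= C1.
  have [a a0 ha] := test_function_bounded (test_function_derive (Defs.basis R (Ordinal (isT : 0 < 3)%N)) tphi).
  have [b b0 hb] := test_function_bounded (test_function_derive (Defs.basis R (Ordinal (isT : 1 < 3)%N)) tphi).
  have [c c0 hc] := test_function_bounded (test_function_derive (Defs.basis R (Ordinal (isT : 2 < 3)%N)) tphi).
  exists (a + b + c); first by rewrite !addr_gt0.
  move=> [[|[|[|]]]// ii] x.
  - by rewrite (_ : Ordinal ii = Ordinal (isT : 0 < 3)%N) ?(le_trans (ha x))//; [lra|exact: val_inj].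
  - by rewrite (_ : Ordinal ii = Ordinal (isT : 1 < 3)%N) ?(le_trans (hb x))//; [lra|exact: val_inj].
  - by rewrite (_ : Ordinal ii = Ordinal (isT : 2 < 3)%N) ?(le_trans (hc x))//; [lra|exact: val_inj].
have mphi := test_measurable tphi.
have mD i : measurable_fun setT (D i phi : R3 -> R) by apply: test_measurable; exact: test_function_derive.
have mhd i : measurable_fun setT (fun x => h x * dir i x) by apply: measurable_funM => //; exact: measurable_dir.
have iu i s : mu3.-integrable unitb (EFin \o (fun x => h x * dir i x * D i phi (ray s x))).
  apply: (@bounded_unitb_integrable _ _ (H * C1)).
    exact: (measurable_smean_integrand (h := fun x => h x * dir i x) (phi := D i phi) s (mhd i) (mD i)).
  move=> x _; rewrite normrM ler_pM// normrM -[X in _ <= X]mulr1 ler_pM//; exact: norm_dir.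
pose f' s x := \sum_(i < 3) h x * dir i x * D i phi (ray s x).
have DU : is_derive r (1 : R) (fun s => \int[mu3]_(x in unitb) (h x * phi (ray s x)))
    (\int[mu3]_(x in unitb) f' r x).
  apply: (@is_derive_under _ _ _ mu3 unitb (fun s x => h x * phi (ray s x)) f' r (cst (3 * (H * C1)))).
  - exact: measurable_unitb.
  - move=> s; apply: (@bounded_unitb_integrable _ _ (H * C)).
      by apply: measurable_smean_integrand.
    by move=> x _; rewrite normrM ler_pM.
  - move=> s x _.
    rewrite (_ : (fun s => _) = (fun s => h x * phi (sc3 s (sc3 (enorm x)^-1 x)))); last first.
      by apply/funext => t; rewrite rayE.
    have /(is_derive_ray (sc3 (enorm x)^-1 x) s) dd := tphi.1.
    have := @is_deriveZ _ _ _ _ (h x) s 1 _ dd.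
    move=> [d1 d2]; apply: DeriveDef => //.
    rewrite [LHS]d2 /f' /GRing.scale /= mulr_sumr; apply: eq_bigr => i _.
    by rewrite coord_sc3 /dir -rayE; ring.
  - by move=> y; rewrite /cst mulr_ge0// mulr_ge0// ltW.
  - apply: (@bounded_unitb_integrable _ _ (3 * (H * C1))); first exact: measurable_cst.
    by move=> x _; rewrite ger0_norm// mulr_ge0// mulr_ge0// ltW.
  - move=> s x _ _; rewrite /f' /cst !big_ord_recr big_ord0 /= add0r.
    have b i : `|h x * dir i x * D i phi (ray s x)| <= H * C1.
      rewrite normrM ler_pM// normrM -[X in _ <= X]mulr1 ler_pM//; exact: norm_dir.
    apply: le_trans (ler_normD _ _) _; rewrite (_ : 3 * _ = H * C1 + H * C1 + H * C1); last by ring.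
    by apply: lerD; rewrite ?b// (le_trans (ler_normD _ _))// lerD// b.
have := @is_deriveZ _ _ _ _ (3 : R) r 1 _ DU.
move=> [d1 d2]; apply: DeriveDef; first exact: d1.
rewrite [LHS]d2 /GRing.scale /= /f' /smean !big_ord_recr big_ord0 /= add0r.
under eq_Rintegral do rewrite !big_ord_recr big_ord0 /= add0r.
have mU := @measurable_unitb R.
rewrite RintegralD//; last first.
  by apply: (integrable_addr mU); exact: iu.
rewrite RintegralD//.
by rewrite !mulrDr.
Qed.

Lemma continuous_smean h phi (H : R) : measurable_fun setT h -> (forall x, `|h x| <= H) ->
  test_function phi -> continuous (smean h phi).
Proof. by move=> mh hH tphi x; exact: is_derive_continuous (is_derive_smean x mh hH tphi). Qed.

Lemma smean_out h phi (M r : R) : (forall x, M < enorm x -> phi x = 0) -> M < `|r| -> smean h phi r = 0.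
Proof.
move=> p0 Mr; rewrite /smean (_ : Rintegral _ _ _ = 0) ?mulr0//.
rewrite /Rintegral integral0_eq// => x /andP[x0 _].
by rewrite p0 ?mulr0// enorm_ray// -enorm_gt0.
Qed.
End sphere.

(** * The divergence theorem on balls *)

Section divergence.
Variable R : realType.
Local Notation R3 := (R3 R).
Local Notation mu := (@lebesgue_measure R).
Local Notation mu3 := (mu3 R).
Local Notation unitb := (@unitb R).
Local Notation D i f := (fun x => 'D_(Defs.basis R i) f x).
Implicit Types (x : R3) (h : R3 -> R) (phi : R * R * R -> R).

Definition line (i : 'I_3) (y : R * R * R) (t : R) : R * R * R := y + t *: Defs.basis R i.

(** Tonelli with the i-th coordinate innermost. Two nonnegative functions are compared because the
    intended pair is the positive and negative parts of a function whose integral along every such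
    line is 0. *)
Lemma mu3_lines (i : 'I_3) (F G : R3 -> \bar R) :
  measurable_fun setT F -> measurable_fun setT G ->
  (forall x, 0 <= F x)%E -> (forall x, 0 <= G x)%E ->
  (forall y : R * R * R, Defs.coord i y = 0 ->
    (\int[mu]_t F (line i y t) = \int[mu]_t G (line i y t))%E) ->
  (\int[mu3]_x F x = \int[mu3]_x G x)%E.
Proof.
move=> mF mG F0 G0.
have swap12 (K : R3 -> \bar R) : measurable_fun setT K -> (forall x, 0 <= K x)%E ->
    (\int[mu]_a \int[mu]_b \int[mu]_c K (a, b, c) = \int[mu]_a \int[mu]_c \int[mu]_b K (a, b, c))%E.
  move=> mK K0; apply: eq_integral => a _.
  apply: (fubini_tonelli (m1 := mu) (m2 := mu) (fun p : R * R => K (a, p.1, p.2))) => //.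
  by apply: (mcomp mK); mfun.
have swap01 (K : R3 -> \bar R) : measurable_fun setT K -> (forall x, 0 <= K x)%E ->
    (\int[mu]_a \int[mu]_b \int[mu]_c K (a, b, c) = \int[mu]_b \int[mu]_c \int[mu]_a K (a, b, c))%E.
  move=> mK K0.
  have f0 p : (0 <= fubini_F mu K p)%E by exact: integral_ge0.
  rewrite (fubini_tonelli (m1 := mu) (m2 := mu) (fubini_F mu K)
    (measurable_fun_fubini_tonelli_F (m2 := mu) K mK K0) f0).
  apply: eq_integral => b _.
  apply: (fubini_tonelli (m1 := mu) (m2 := mu) (fun p : R * R => K (p.1, b, p.2))) => //.
  by apply: (mcomp mK); mfun.
rewrite (mu3_tonelli mF F0) (mu3_tonelli mG G0).
destruct i as [[|[|[|m]]] i] => FG; last by case: (notF i).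
- rewrite (swap01 _ mF F0) (swap01 _ mG G0).
  apply: eq_integral => b _; apply: eq_integral => c _.
  have := FG (0, b, c) erefl.
  have E t : line (Ordinal i) (0, b, c) t = (t, b, c) by rewrite /line add_basis0 /= add0r.
  under eq_integral do rewrite E.
  by under [in X in _ = X -> _]eq_integral do rewrite E.
- rewrite (swap12 _ mF F0) (swap12 _ mG G0).
  apply: eq_integral => a _; apply: eq_integral => c _.
  have := FG (a, 0, c) erefl.
  have E t : line (Ordinal i) (a, 0, c) t = (a, t, c) by rewrite /line add_basis1 /= add0r.
  under eq_integral do rewrite E.
  by under [in X in _ = X -> _]eq_integral do rewrite E.
- apply: eq_integral => a _; apply: eq_integral => b _.
  have := FG (a, b, 0) erefl.
  have E t : line (Ordinal i) (a, b, 0) t = (a, b, t) by rewrite /line add_basis2 /= add0r.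
  under eq_integral do rewrite E.
  by under [in X in _ = X -> _]eq_integral do rewrite E.
Qed.

Lemma coord_line (i : 'I_3) (y : R * R * R) t : Defs.coord i y = 0 ->
  Defs.coord i (line i y t) = t.
Proof.
rewrite /line.
case: i => -[|[|[|]]]// i; [rewrite add_basis0|rewrite add_basis1|rewrite add_basis2];
  by rewrite /Defs.coord /= => ->; rewrite add0r.
Qed.

Lemma enorm_line (i : 'I_3) (y : R * R * R) t : Defs.coord i y = 0 ->
  enorm (line i y t) ^+ 2 = enorm y ^+ 2 + t ^+ 2.
Proof.
rewrite /line.
case: i => -[|[|[|]]]// i; [rewrite add_basis0|rewrite add_basis1|rewrite add_basis2];
  rewrite !sqr_enorm /Defs.coord /= => ->; ring.
Qed.

Lemma continuous_line (f : R * R * R -> R) i y : continuous f -> continuous (fun t : R => f (line i y t)).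
Proof.
move=> cf t; apply: (@continuous_comp _ _ _ (line i y) f); last exact: cf.
by apply: cvgD; [exact: cvg_cst|exact: scalel_continuous].
Qed.

(** On a line meeting the ball the integrand is the derivative of (q^2 - t^2) phi, where q is half
    the length of the chord, and this function vanishes at both ends of the chord. On the other
    lines the integrand is 0. *)
Lemma ball_divergence_line (i : 'I_3) phi (X : R) (y : R * R * R) : test_function phi -> 0 < X ->
  Defs.coord i y = 0 ->
  let g x := (if enorm x <= X then (X ^+ 2 - enorm x ^+ 2) * D i phi x - 2 * Defs.coord i x * phi x else 0) in
  (\int[mu]_t (EFin \o g)^\+ (line i y t) = \int[mu]_t (EFin \o g)^\- (line i y t))%E.
Proof.
move=> tphi X0 yi g.
pose L := line i y; rewrite -/L.
have [Xy|yX] := ltP (X ^+ 2) (enorm y ^+ 2).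
  have g0 t : g (L t) = 0.
    rewrite /g ifN// -ltNge -(ltr_pXn2r (n := 2)) ?nnegrE ?(ltW X0) ?enorm_ge0//.
    by rewrite enorm_line// (lt_le_trans Xy)// lerDl sqr_ge0.
  by apply: eq_integral => t _; rewrite funeposE funenegE /= g0 oppr0.
pose q := Num.sqrt (X ^+ 2 - enorm y ^+ 2).
have q0 : 0 <= q by exact: sqrtr_ge0.
have q2 : q ^+ 2 = X ^+ 2 - enorm y ^+ 2 by rewrite sqr_sqrtr// subr_ge0.
pose f t := (q ^+ 2 - t ^+ 2) * D i phi (L t) - 2 * t * phi (L t).
pose F t := (q ^+ 2 - t ^+ 2) * phi (L t).
have cphi : continuous (fun t => phi (L t)) by apply: continuous_line; exact: smooth_continuous tphi.1.
have cDphi : continuous (fun t => D i phi (L t)).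
  by apply: (@continuous_line (D i phi)); exact: (smooth_continuous (test_function_derive _ tphi).1).
have cf : continuous f.
  move=> t; apply: cvgB; (apply: cvgM; last first); [exact: cDphi| |exact: cphi|].
  - by apply: cvgB; [exact: cvg_cst|exact: exprn_continuous].
  - by apply: cvgM; [exact: cvg_cst|exact: cvg_id].
have dF t : is_derive t (1 : R) F (f t).
  have dphi : is_derive t (1 : R) (fun t => phi (L t)) (D i phi (L t)).
    by apply: is_derive_line; exact: smooth_derivable tphi.1.
  by apply: is_derive_eq; rewrite /f /GRing.scale /=; ring.
have gE t : g (L t) = if t \in `[- q, q] then f t else 0.
  rewrite in_itv/= -ler_norml -(ler_pXn2r (n := 2)) ?nnegrE// q2 real_normK ?num_real//.
  rewrite /g -(ler_pXn2r (n := 2) _ _ (_ : X \in Num.nneg)) ?nnegrE ?(ltW X0) ?enorm_ge0//.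
  rewrite enorm_line// lerBrDl; case: ifP => // _.
  by rewrite /f q2 coord_line//; congr (_ * _ - _); ring.
have intg : mu.-integrable setT (EFin \o (fun t => g (L t))).
  have -> : EFin \o (fun t => g (L t)) = EFin \o (fun t => if t \in `[- q, q]%classic then f t else 0).
    by apply/funext => t /=; rewrite gE mem_setE.
  apply: ((@integrable_if _ _ _ mu `[(- q), q]%classic f (measurable_itv _)).1).
  exact: continuous_integrable_itv.
have : (\int[mu]_t (g (L t))%:E = 0)%E.
  have -> : (\int[mu]_t (g (L t))%:E = \int[mu]_(t in `[(- q)%R, q]) (f t)%:E)%E.
    rewrite [RHS]integral_if; apply: eq_integral => t _; rewrite gE mem_setE.
    by case: ifP.
  rewrite (FTC2_derive _ cf (fun t _ => dF t)) ?ge0_cp// /F sqrrN !subrr !mul0r subrr//.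
rewrite integralE.
have := integrable_pos_fin_num measurableT intg; have := integrable_neg_fin_num measurableT intg.
have e1 : (\int[mu]_t (EFin \o g)^\+ (L t) = \int[mu]_t ((EFin \o (fun t => g (L t))) ^\+ t))%E.
  by apply: eq_integral => t _; rewrite !funeposE.
have e2 : (\int[mu]_t (EFin \o g)^\- (L t) = \int[mu]_t ((EFin \o (fun t => g (L t))) ^\- t))%E.
  by apply: eq_integral => t _; rewrite !funenegE.
rewrite e1 e2.
by move=> f1 f2 /eqP; rewrite sube_eq ?fin_num_adde_defl// add0e => /eqP.
Qed.

Lemma norm_cst1 x : `|(cst 1 : R3 -> R) x| <= 1.
Proof. by rewrite /cst normr1. Qed.

Lemma continuous_smean1 phi : test_function phi -> continuous (smean (cst 1) phi).
Proof. by move=> tphi; apply: (continuous_smean _ norm_cst1 tphi); exact: measurable_cst. Qed.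

(* The factor X^2 - |x|^2 vanishes on the sphere, so integrating by parts on lines leaves no
   boundary term. *)
Lemma ball_divergence (i : 'I_3) phi (X : R) : test_function phi -> 0 < X ->
  \int[mu]_(r in `[0, X]) ((X ^+ 2 - r ^+ 2) * (r ^+ 2 * smean (cst 1) (D i phi) r)) =
  \int[mu]_(r in `[0, X]) (2 * r * (r ^+ 2 * smean (dir i) phi r)).
Proof.
move=> tphi X0.
have tD := test_function_derive (Defs.basis R i) tphi.
have [C C0 hC] := test_function_bounded tphi.
have [C1 C10 hC1] := test_function_bounded tD.
have mphi := test_measurable tphi; have mD := test_measurable tD.
pose a1 r : R := if r <= X then X ^+ 2 - r ^+ 2 else 0.
pose a2 r : R := if r <= X then 2 * r else 0.
have ma1 : measurable_fun setT a1 by apply: measurable_fun_ifT; mfun.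
have ma2 : measurable_fun setT a2 by apply: measurable_fun_ifT; mfun.
have bint (a : R -> R) (K : R) (h p : R3 -> R) (c : R) : measurable_fun setT a ->
   (forall r, 0 <= r -> `|a r| <= K) -> (forall r, X < r -> a r = 0) ->
   measurable_fun setT h -> measurable_fun setT p -> (forall x, `|h x| <= 1) ->
   (forall x, `|p x| <= c) ->
   mu3.-integrable setT (EFin \o (fun x => a (enorm x) * (h x * p x))).
  move=> ma aK a0 mh mp h1 pc.
  have mae : measurable_fun setT (fun x : R3 => a (enorm x)).
    by apply: (mcomp ma); exact: measurable_enorm.
  have K0 : 0 <= K := le_trans (normr_ge0 _) (aK 0 (lexx _)).
  have c0 : 0 <= c := le_trans (normr_ge0 _) (pc 0).
  apply/integrableP; split.
    by apply/measurable_EFinP; mfun.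
  have : (\int[mu3]_x ((if enorm x <= X then K * c else 0)%:E) < +oo)%E.
    rewrite (radial_tonelli (g := fun r => (if r <= X then K * c else 0)%:E)); last 2 first.
    - by apply/measurable_EFinP; apply: measurable_fun_ifT; mfun.
    - by move=> r; rewrite lee_fin; case: ifP => // _; rewrite mulr_ge0.
    apply: lte_mul_pinfty; rewrite ?lee_fin ?(ltW (kappa_gt0 R))//.
    apply: (@le_lt_trans _ _ (\int[mu]_(r in `[0%R, X]) (X ^+ 2 * (K * c))%:E)%E).
      rewrite integral_if [leRHS]integral_if; apply: ge0_le_integral_nomeas => r.
        by case: ifP => // _; rewrite mule_ge0// lee_fin ?sqr_ge0//; case: ifP => // _; rewrite mulr_ge0.
      rewrite !mem_setE !in_itv /= andbT.
      case: ifPn => [r0|_]; last first.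
        by case: ifP => // _; rewrite lee_fin (mulr_ge0 (sqr_ge0 _) (mulr_ge0 K0 c0)).
      rewrite (ltW r0) /=; case: ifP => rX; last by rewrite mule0.
      rewrite -EFinM lee_fin ler_wpM2r ?mulr_ge0//.
      by apply: lerXn2r; rewrite ?nnegrE ?(ltW r0) ?(ltW X0).
    by rewrite integral_itv_cst ?(ltW X0)// ltry.
  apply: le_lt_trans; apply: ge0_le_integral_nomeas => x; first by rewrite abse_ge0.
  rewrite /= lee_fin; case: ifPn => xX; last first.
    by rewrite a0 ?mul0r ?normr0// ltNge.
  by rewrite normrM ler_pM ?aK ?enorm_ge0// normrM -[X in _ <= X]mul1r ler_pM.
have i1 : mu3.-integrable setT (EFin \o (fun x => a1 (enorm x) * (cst 1 x * D i phi x))).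
  apply: (bint a1 (X ^+ 2) _ _ C1) => //.
  - move=> r r0; rewrite /a1; case: ifP => rX; last by rewrite normr0 sqr_ge0.
    have rX2 : r ^+ 2 <= X ^+ 2 by rewrite ler_pXn2r// nnegrE ltW.
    by rewrite ger0_norm ?subr_ge0// gerBl sqr_ge0.
  - by move=> r; rewrite /a1 ltNge => /negbTE ->.
  - by move=> x; rewrite /cst normr1.
have i2 : mu3.-integrable setT (EFin \o (fun x => a2 (enorm x) * (dir i x * phi x))).
  apply: (bint a2 (2 * X) _ _ C) => //.
  - move=> r r0; rewrite /a2; case: ifP => rX; last by rewrite normr0 mulr_ge0// ltW.
    by rewrite ger0_norm ?mulr_ge0// ler_pM2l.
  - by move=> r; rewrite /a2 ltNge => /negbTE ->.
  - exact: measurable_dir.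
  - exact: norm_dir.
have P1 := polar_radial (@measurable_cst _ _ R3 R setT 1) mD norm_cst1 hC1 (fun _ _ _ _ => erefl) i1.
have P2 := polar_radial (measurable_dir i) mphi (norm_dir i) hC (dir_ray i) i2.
(* The difference of the two sides is the integral of [g], whose positive and negative parts have
   equal integrals on each line. *)
have E : \int[mu3]_x (a1 (enorm x) * (cst 1 x * D i phi x)) = \int[mu3]_x (a2 (enorm x) * (dir i x * phi x)).
  apply/eqP; rewrite -subr_eq0 -RintegralB//; apply/eqP.
  pose g x := (if enorm x <= X then (X ^+ 2 - enorm x ^+ 2) * D i phi x - 2 * Defs.coord i x * phi x else 0).
  have gE x : a1 (enorm x) * (cst 1 x * D i phi x) - a2 (enorm x) * (dir i x * phi x) = g x.
    rewrite /a1 /a2 /g /dir /cst; case: ifP => _; last by rewrite !mul0r subrr.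
    have [/eqP x0|x0] := eqVneq (enorm x) 0; last by field.
    rewrite enorm_eq0 in x0; rewrite (eqP x0) (_ : Defs.coord i 0 = 0); last first.
      by case: (i) => -[|[|[|]]].
    by rewrite !(mul0r,mulr0) mul1r.
  under eq_Rintegral do rewrite gE.
  have mg : measurable_fun setT (EFin \o g).
    apply/measurable_EFinP; rewrite -(funext gE).
    by have /measurable_EFinP := measurable_int _ (integrable_subr measurableT i1 i2).
  rewrite /Rintegral integralE (_ : \int[mu3]_x (EFin \o g)^\+ x = \int[mu3]_x (EFin \o g)^\- x)%E.
    rewrite subee//; apply: integrable_neg_fin_num; first exact: measurableT.
    have := integrable_subr measurableT i1 i2.
    by rewrite (funext gE).
  apply: (@mu3_lines i).
  - exact: measurable_funepos.
  - exact: measurable_funeneg.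
  - by move=> x; exact: funepos_ge0.
  - by move=> x; exact: funeneg_ge0.
  - by move=> y yi; exact: ball_divergence_line.
have restr (F : R -> R) (a : R -> R) (aE : R -> R) : continuous aE -> (forall r, 0 < r <= X -> a r * F r = aE r) -> (forall r, X < r -> a r = 0) ->
   \int[mu]_(r in `]0, +oo[) (a r * F r) = \int[mu]_(r in `[0, X]) (aE r).
  move=> caE h1 h2; rewrite Rintegral_if.
  rewrite -(@Rintegral_itv_obnd_cbnd _ 0 (BRight X) aE); last first.
    apply: (@integrableS _ _ _ mu `[0, X]%classic); [exact: measurable_itv|exact: measurable_itv| |].
      by apply: subset_itvr; rewrite bnd_simp.
    exact: continuous_integrable_itv.
  rewrite [in RHS]Rintegral_if; apply: eq_Rintegral => r _.
  rewrite !mem_setE !in_itv/= andbT; case: ifPn => //= r0.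
  by have [rX|/h2 ->] := leP r X; [rewrite h1// r0|rewrite mul0r].
have cS1 := continuous_smean1 tD.
have cS2 := continuous_smean (measurable_dir i) (norm_dir i) tphi.
move: E; rewrite P1.
rewrite P2 (restr _ _ (fun r => (X ^+ 2 - r ^+ 2) * (r ^+ 2 * smean (cst 1) (D i phi) r))).
- rewrite (restr _ _ (fun r => 2 * r * (r ^+ 2 * smean (dir i) phi r)))//.
  + move=> r; apply: cvgM; first by apply: cvgM; [exact: cvg_cst|exact: cvg_id].
    by apply: cvgM; [exact: exprn_continuous|exact: cS2].
  + by move=> r /andP[_ rX]; rewrite /a2 rX.
  + by move=> r; rewrite /a2 ltNge => /negbTE ->.
- move=> r; apply: cvgM; first by apply: cvgB; [exact: cvg_cst|exact: exprn_continuous].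
  by apply: cvgM; [exact: exprn_continuous|exact: cS1].
- by move=> r /andP[_ rX]; rewrite /a1 rX.
- by move=> r; rewrite /a1 ltNge => /negbTE ->.
Qed.

(** The flux through the sphere of radius X equals the integral of the i-th derivative over the
    ball, by [ball_divergence] and [weighted_ball_derivative]; the fundamental theorem of calculus
    then differentiates it in X. *)
Lemma is_derive_flux (i : 'I_3) phi (X : R) : test_function phi -> 0 < X ->
  is_derive X (1 : R) (fun r => r ^+ 2 * smean (dir i) phi r) (X ^+ 2 * smean (cst 1) (D i phi) X).
Proof.
move=> tphi X0.
have tD := test_function_derive (Defs.basis R i) tphi.
have cS1 := continuous_smean1 tD.
have cS2 := continuous_smean (measurable_dir i) (norm_dir i) tphi.
pose a r : R := r ^+ 2 * smean (cst 1) (D i phi) r.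
pose b r : R := r ^+ 2 * smean (dir i) phi r.
have ca : continuous a by move=> r; apply: cvgM; [exact: exprn_continuous|exact: cS1].
have cb : continuous b by move=> r; apply: cvgM; [exact: exprn_continuous|exact: cS2].
have H := weighted_ball_derivative ca cb (fun X X0 => ball_divergence i tphi X0).
have d := is_derive_FTC1 ca X0.
apply: near_eq_is_derive d; near=> r.
by rewrite H//; near: r; exact: lt_nbhsr.
Unshelve. all: by end_near. Qed.

End divergence.

(** * Locally integrable functions on the line *)

Section locint.
Variable R : realType.
Local Notation mu := (@lebesgue_measure R).

Lemma integrable_measurable (f : R -> R) : mu.-integrable setT (EFin \o f) ->
  measurable_fun setT f.
Proof. by move=> /measurable_int h; exact/measurable_EFinP. Qed.

Lemma norm_Rintegral_le (f : R -> R) (a b C : R) : a <= b ->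
  mu.-integrable `[a, b] (EFin \o f) -> (forall x, a <= x <= b -> `|f x| <= C) ->
  `|\int[mu]_(x in `[a, b]) f x| <= C * (b - a).
Proof.
move=> ab fi fC.
have -> : C * (b - a) = \int[mu]_(x in `[a, b]) C by rewrite /Rintegral integral_itv_cst.
have := @le_normr_Rintegral _ _ _ mu `[a, b]%classic f (measurable_itv _) fi.
move=> /le_trans; apply; apply: le_Rintegral.
- exact: measurable_itv.
- exact: integrable_norm.
- by apply: (continuous_integrable_itv (f := cst C)); exact: cst_continuous.
- by move=> x; rewrite /= in_itv/=; exact: fC.
Qed.

Definition locint (k : R -> R) : Prop :=
  measurable_fun setT k /\ forall M, mu.-integrable `[- M, M] (EFin \o k).

Lemma locint_itv (k : R -> R) (a b : R) : locint k -> mu.-integrable `[a, b] (EFin \o k).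
Proof.
move=> [mk ik]; pose M := Num.max `|a| `|b|.
apply: (@integrableS _ _ _ mu `[- M, M]%classic); [exact: measurable_itv|exact: measurable_itv| |exact: ik].
move=> x /=; rewrite !in_itv/= => /andP[ax xb]; apply/andP; split.
- apply: le_trans ax; rewrite lerNl (le_trans (ler_norm _))// normrN /M le_max lexx//.
- by apply: le_trans xb _; rewrite (le_trans (ler_norm _))// /M le_max lexx orbT.
Qed.

Lemma locint_lty (k : R -> R) (a b : R) : locint k ->
  (\int[mu]_(x in `[a, b]) `|k x|%:E < +oo)%E.
Proof. by move=> /(locint_itv a b)/integrableP[]. Qed.

Lemma integrable_locint_mul (k E : R -> R) (C M : R) : locint k -> measurable_fun setT E ->
  (forall y, `|E y| <= C) -> (forall y, M < `|y| -> E y = 0) ->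
  mu.-integrable setT (EFin \o (fun y => k y * E y)).
Proof.
move=> lk mE EC E0; have mk := lk.1.
have C0 : 0 <= C := le_trans (normr_ge0 _) (EC 0).
have h : mu.-integrable setT (EFin \o (fun y => if y \in `[- M, M]%classic then C * `|k y| else 0)).
  apply: ((@integrable_if _ _ _ mu `[- M, M]%classic (fun y => C * `|k y|) (measurable_itv _)).1).
  apply: integrable_mulr; first exact: measurable_itv.
  by apply: integrable_norm; exact: lk.2.
apply: (le_integrable_real _ _ _ h) => //; first exact: measurable_funM.
move=> y _; rewrite mem_setE in_itv/= -ler_norml.
case: (leP `|y| M) => yM; last by rewrite E0// mulr0 normr0.
by rewrite normrM mulrC ler_wpM2r.
Qed.

Lemma locint_shift (k : R -> R) (s : R) : locint k -> locint (fun y : R => k (y + s)).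
Proof.
move=> lk; have [mk ik] := lk.
have mks : measurable_fun setT (fun y : R => k (y + s)) by apply: (mcomp mk); mfun.
split => // M; apply/integrableP; split; first by apply/measurable_EFinP; exact: measurable_funS mks.
apply: le_lt_trans (locint_lty (- M + s) (M + s) lk).
rewrite integral_if [leRHS]integral_if.
rewrite [leRHS](@ge0_integral_shift _ s)//; last 2 first.
- apply: measurable_fun_ifT => //; last by apply/measurable_EFinP; exact: measurableT_comp.
  by under eq_fun do rewrite mem_setE in_itv/=; mfun.
- by move=> x; case: ifP => // _; rewrite lee_fin.
rewrite le_eqVlt; apply/orP; left; apply/eqP; apply: eq_integral => x _.
by rewrite !mem_setE !in_itv/= !lerD2r.
Qed.

Lemma locint_opp (k : R -> R) : locint k -> locint (fun y : R => k (- y)).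
Proof.
move=> lk; have [mk ik] := lk.
have mks : measurable_fun setT (fun y : R => k (- y)) by apply: (mcomp mk); mfun.
split => // M; apply/integrableP; split; first by apply/measurable_EFinP; exact: measurable_funS mks.
apply: le_lt_trans (locint_lty (- M) M lk).
rewrite integral_if [leRHS]integral_if.
rewrite [leRHS]ge0_integral_opp//; last 2 first.
- apply: measurable_fun_ifT => //; last by apply/measurable_EFinP; exact: measurableT_comp.
  by under eq_fun do rewrite mem_setE in_itv/=; mfun.
- by move=> x; case: ifP => // _; rewrite lee_fin.
rewrite le_eqVlt; apply/orP; left; apply/eqP; apply: eq_integral => x _.
by rewrite !mem_setE !in_itv/= [in RHS]lerN2 [in RHS]lerNl [in RHS]andbC.
Qed.

Lemma locint_add (k l : R -> R) : locint k -> locint l -> locint (fun y => k y + l y).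
Proof.
move=> [mk ik] [ml il]; split; first exact: measurable_funD.
by move=> M; apply: integrable_addr => //.
Qed.

(** Shift by s, then fold the negative half-line onto the positive one. This links a whole-line
    integral, where time is a shift, with the radial variable, where the outgoing part k(r - s) and
    the incoming part k(- r - s) appear together. *)
Lemma fold_integral (k E : R -> R) (s C M : R) : locint k -> measurable_fun setT E ->
  (forall y, `|E y| <= C) -> (forall y, M < `|y| -> E y = 0) ->
  \int[mu]_y (k y * E (y + s)) =
  \int[mu]_(r in `]0, +oo[) (k (r - s) * E r + k (- r - s) * E (- r)).
Proof.
move=> lk mE EC E0; have mk := lk.1.
rewrite (@Rintegral_shift _ (- s)); last first.
  by apply: measurable_funM => //; apply: (mcomp mE); mfun.
under eq_Rintegral do rewrite subrK.
have lks := locint_shift (- s) lk.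
have i1 := integrable_locint_mul lks mE EC E0.
have i2 : mu.-integrable setT (EFin \o (fun r : R => k (- r - s) * E (- r))).
  apply: (@integrable_locint_mul (fun r : R => k (- r - s)) (fun r : R => E (- r)) C M).
  - exact: (locint_opp lks).
  - by apply: (mcomp mE); mfun.
  - by [].
  - by move=> y My; rewrite E0// normrN.
have ip (f : R -> R) : mu.-integrable setT (EFin \o f) -> mu.-integrable setT (EFin \o (fun r => if 0 < r then f r else 0)).
  move=> fi; apply: (le_integrable_real _ _ _ (integrable_norm fi)) => //.
    apply: measurable_fun_ifT; mfun; exact: integrable_measurable fi.
  by move=> r _; case: ifP => _ /=; rewrite ?normr0.
transitivity (\int[mu]_r (if 0 < r then k (r - s) * E r else 0) +
   \int[mu]_r (if 0 < r then k (- r - s) * E (- r) else 0)).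
  rewrite [X in _ + X]Rintegral_opp; last first.
    apply: measurable_fun_ifT; [mfun|exact: (integrable_measurable i2)|mfun].
  rewrite -RintegralD//; last 2 first.
  - exact: ip i1.
  - have : mu.-integrable setT (EFin \o (fun r : R => if r < 0 then k (r - s) * E r else 0)).
      apply: (le_integrable_real _ _ _ (integrable_norm i1)) => //.
        apply: measurable_fun_ifT; [mfun|exact: integrable_measurable i1|mfun].
      by move=> r _; case: ifP => _ /=; rewrite ?normr0.
    by apply: eq_integrable => // r _ /=; rewrite oppr_gt0 opprK.
  apply: ae_eq_Rintegral => //.
  - exact: integrable_measurable i1.
  - apply: measurable_funD; apply: measurable_fun_ifT; mfun.
    + by apply: (mcomp mk); mfun.
    + by apply: (mcomp mk); mfun.
    + by apply: (mcomp mE); mfun.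
  - exists [set 0]; split => //; first exact: lebesgue_measure_set1.
    move=> r /= /not_implyP[_]; apply: contra_notP => r0.
    rewrite oppr_gt0 opprK; have [|r1|/esym//] := ltgtP 0 r; first by rewrite addr0.
    by rewrite add0r.
rewrite -RintegralD//; [|exact: ip i1|exact: (ip _ i2)].
rewrite [RHS]Rintegral_if; apply: eq_Rintegral => r _.
by rewrite mem_setE in_itv/= andbT; case: ifP; rewrite ?addr0.
Qed.

(** The profile k is only locally integrable, so the derivative falls on the compactly supported
    kernel. *)
Lemma is_derive_conv (k T T' : R -> R) (C C' M s : R) : locint k ->
  (forall y, is_derive y (1 : R) T (T' y)) -> measurable_fun setT T' ->
  (forall y, `|T y| <= C) -> (forall y, `|T' y| <= C') ->
  (forall y, M < `|y| -> T y = 0) -> (forall y, M < `|y| -> T' y = 0) ->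
  is_derive s (1 : R) (fun s => \int[mu]_y (k y * T (y + s))) (\int[mu]_y (k y * T' (y + s))).
Proof.
move=> lk dT mT' TC T'C T0 T'0; have mk := lk.1.
have C'0 : 0 <= C' := le_trans (normr_ge0 _) (T'C 0).
have cT : continuous T by move=> x; exact: is_derive_continuous (dT x).
have mT : measurable_fun setT T by exact: continuous_measurable_fun.
(* For every t within distance 1 of s, [T' (y + t)] vanishes when y is outside [- N, N]. *)
pose N := M + `|s| + 1.
apply: (@is_derive_under _ _ _ mu setT (fun s y => k y * T (y + s)) (fun s y => k y * T' (y + s)) s
  (fun y => if y \in `[- N, N]%classic then C' * `|k y| else 0)) => //.
- move=> t; apply: (@integrable_locint_mul k (fun y => T (y + t)) C (M + `|t|)) => //.
    by apply: (mcomp mT); mfun.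
  move=> y yM; apply: T0; have := ler_normB (y + t) t; rewrite addrK; lra.
- move=> t y _.
  have dsh : is_derive t (1 : R) (fun t : R => T (y + t)) (T' (y + t)).
    have d1 : is_derive t (1 : R) (fun t : R => y + t) 1.
      by have := is_deriveD (is_derive_cst y t 1) (is_derive_id t (1 : R)); rewrite add0r.
    have := @is_derive1_comp _ T (fun t : R => y + t) t _ _ (dT (y + t)) d1.
    by rewrite mulr1.
  have := @is_deriveZ _ _ _ _ (k y) t 1 _ dsh.
  by move=> [d1 d2]; apply: DeriveDef; [exact: d1|rewrite [LHS]d2].
- by move=> y; case: ifP => // _; rewrite mulr_ge0.
- apply: ((@integrable_if _ _ _ mu `[- N, N]%classic (fun y => C' * `|k y|) (measurable_itv _)).1).
  apply: integrable_mulr; first exact: measurable_itv.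
  by apply: integrable_norm; exact: lk.2.
- move=> t y st _; rewrite mem_setE in_itv/= -ler_norml; case: (leP `|y| N) => yN.
    by rewrite normrM mulrC ler_wpM2r.
  rewrite T'0 ?mulr0 ?normr0//.
  have := ler_normB (y + t) t; rewrite addrK.
  have : `|t| <= `|s| + 1.
    have := ler_normD s (t - s); rewrite addrC subrK => /le_trans; apply.
    by rewrite lerD2l ler_norml; apply/andP; split; lra.
  rewrite /N in yN; lra.
Qed.

(** Fubini on the triangle 0 < x <= y <= M for k(x) G1(y) integrates by parts against the primitive
    of a function that is only locally integrable. G is differentiated only at positive radii,
    because the derivatives obtained from the flux are known only there. *)
Lemma radial_by_parts (k G G1 : R -> R) (M C : R) : locint k -> continuous G1 -> 0 < M ->
  (forall r : R, 0 < r -> is_derive r (1 : R) G (G1 r)) ->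
  (forall r : R, `|G1 r| <= C) ->
  (forall r : R, M <= r -> G r = 0) -> (forall r : R, M <= r -> G1 r = 0) ->
  \int[mu]_(r in `]0, +oo[) (G1 r * \int[mu]_(t in `[0, r]) k t) =
  - \int[mu]_(r in `]0, +oo[) (k r * G r).
Proof.
move=> lk cG1 M0 dG GC G0 G10; have mk := lk.1.
have mG1 : measurable_fun setT G1 by exact: continuous_measurable_fun.
have C0 : 0 <= C := le_trans (normr_ge0 _) (GC 0).
pose f (p : R * R) : R := if (0 < p.1) && (p.1 <= p.2) && (p.2 <= M) then k p.1 * G1 p.2 else 0.
have mf : measurable_fun setT f.
  apply: measurable_fun_ifT; mfun.
  + by apply: (mcomp mk); mfun.
  + by apply: (mcomp mG1); mfun.
have fi : (mu \x mu)%E.-integrable setT (EFin \o f).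
  apply: (@integrable_prod _ _ _ _ _ mu mu f
    (fun x => (if x \in `[0%R, M]%classic then `|k x| * (C * M) else 0)%:E)) => //.
  - move=> x; apply: (@le_trans _ _ (\int[mu]_(y in `[0%R, M]) (if (0 < x) && (x <= M) then `|k x| * C else 0)%:E)%E).
      rewrite [leRHS]integral_if; apply: ge0_le_integral_nomeas => y; first by rewrite lee_fin.
      rewrite mem_setE in_itv/= /f /=; case: ifPn => [/andP[/andP[x0 xy] yM]|_].
        rewrite (le_trans (ltW x0) xy) yM/= x0 (le_trans xy yM)/= lee_fin normrM ler_wpM2l//.
      by rewrite normr0; case: ifP => // _; rewrite lee_fin; case: ifP => // _; rewrite mulr_ge0.
    rewrite integral_itv_cst; last exact: ltW.
    rewrite lee_fin subr0 mem_setE in_itv/=.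
    case: ifPn => [/andP[x0 xM]|_]; first by rewrite (ltW x0) xM mulrA.
    by rewrite mul0r; case: ifP => // _; rewrite !mulr_ge0// ltW.
  - apply/measurable_EFinP; apply: measurable_fun_ifT => //; last by apply: measurable_funM => //; exact: measurableT_comp.
    by under eq_fun do rewrite mem_setE in_itv/=; mfun.
  - have /integrableP[_] := locint_itv 0 M lk.
    rewrite -[X in _ -> X]/(_) => kfin.
    have : (\int[mu]_(x in `[0%R, M]) ((C * M)%:E * `|k x|%:E) < +oo)%E.
      rewrite ge0_integralZl//.
      + by apply: lte_mul_pinfty => //; rewrite lee_fin mulr_ge0// ltW.
      + by apply/measurable_EFinP; apply: measurableT_comp => //; exact: measurable_funS mk.
      + by rewrite lee_fin mulr_ge0// ltW.
    rewrite integral_if; apply: le_lt_trans; rewrite le_eqVlt; apply/orP; left; apply/eqP.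
    by apply: eq_integral => x _; case: ifP => // _; rewrite -EFinM mulrC.
have := RFubini fi.
have -> : \int[mu]_x \int[mu]_y f (x, y) = - \int[mu]_(r in `]0, +oo[) (k r * G r).
  have GE r : 0 < r -> r <= M -> - G r = \int[mu]_(y in `[r, M]) G1 y.
    move=> r0 rM; rewrite -[- G r]add0r -(G0 M (lexx _)).
    have dG' y : r <= y <= M -> is_derive y (1 : R) G (G1 y).
      by move=> /andP[ry _]; apply: dG; exact: lt_le_trans ry.
    by rewrite /Rintegral (FTC2_derive rM cG1 dG').
  pose E r : R := if 0 < r then G r else 0.
  have mE : measurable_fun setT E.
    rewrite /E; apply: measurable_fun_if; [exact: measurableT|mfun| |mfun].
    have h : measurable_fun (`]0, +oo[%classic : set R) G.
      apply: open_continuous_measurable_fun; first exact: interval_open.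
      move=> r /set_mem; rewrite /= in_itv/= andbT => r0; exact: is_derive_continuous (dG r r0).
    apply: measurable_funS h; first exact: measurable_itv.
    by move=> r /= [_]; rewrite in_itv/= andbT.
  have EC r : `|E r| <= C * M.
    rewrite /E; case: ifPn => [r0|_]; last by rewrite normr0 mulr_ge0// ltW.
    have [rM|Mr] := leP r M; last by rewrite (G0 _ (ltW Mr)) normr0 mulr_ge0// ltW.
    rewrite -normrN GE//; have iG1 := continuous_integrable_itv r M cG1.
    apply: le_trans (norm_Rintegral_le rM iG1 (fun x _ => GC x)) _.
    by rewrite ler_wpM2l//; lra.
  have E0 r : M < `|r| -> E r = 0.
    rewrite /E; case: ifPn => // r0; rewrite gtr0_norm// => Mr; exact: G0 (ltW Mr).
  have := integrable_locint_mul lk mE EC E0 => ikE.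
  have -> : \int[mu]_(r in `]0, +oo[) (k r * G r) = \int[mu]_(r in `]0, +oo[) (k r * E r).
    by apply: eq_Rintegral => r; rewrite /E mem_setE in_itv/= andbT => ->.
  rewrite [in RHS]Rintegral_if -mulN1r -RintegralZl//; last first.
    apply: eq_integrable ikE => // r _ /=; rewrite /E mem_setE in_itv/= andbT.
    by case: ifP => //; rewrite mulr0.
  apply: eq_Rintegral => x _; rewrite mem_setE in_itv/= andbT.
  have [x0|x0] := ltP 0 x; last first.
    rewrite mulr0 /Rintegral integral0_eq// => y _; rewrite /f /= ltNge x0//.
  have [xM|Mx] := leP x M; last first.
    rewrite /E x0 G0 ?(ltW Mx)// !mulr0 /Rintegral integral0_eq// => y _; rewrite /f /= x0/=.
    by case: ifP => // /andP[xy yM]; have := lt_le_trans Mx (le_trans xy yM); rewrite ltxx.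
  rewrite /E x0 mulN1r -mulrN GE//.
  rewrite -RintegralZl//; last exact: continuous_integrable_itv.
  rewrite [in RHS]Rintegral_if; apply: eq_Rintegral => y _.
  by rewrite mem_setE in_itv/= /f /= x0 /=; case: ifP.
move=> ->; rewrite Rintegral_if; apply: eq_Rintegral => y _.
rewrite mem_setE in_itv/= andbT.
have [y0|y0] := ltP 0 y; last first.
  rewrite /Rintegral integral0_eq// => x _; rewrite /f /=; case: ifP => // /andP[/andP[x0 xy] _].
  by have := lt_le_trans x0 (le_trans xy y0); rewrite ltxx.
have [yM|My] := leP y M; last first.
  rewrite G10 ?(ltW My)// mul0r /Rintegral integral0_eq// => x _; rewrite /f /=.
  by rewrite (leNgt y) My andbF.
rewrite -RintegralZl//; last exact: locint_itv.
rewrite -(@Rintegral_itv_obnd_cbnd _ 0 (BRight y)); last first.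
  apply: (@integrableS _ _ _ mu `[0, y]%classic); [exact: measurable_itv|exact: measurable_itv| |].
    by apply: subset_itvr; rewrite bnd_simp.
  by apply: integrable_mulr; [exact: measurable_itv|exact: locint_itv].
rewrite Rintegral_if; apply: eq_Rintegral => x _.
by rewrite mem_setE in_itv/= /f /= yM andbT mulrC.
Qed.
End locint.

(** * Pairing radial functions with test functions *)

Section radial_pairing.
Variable R : realType.
Local Notation R3 := (R3 R).
Local Notation mu := (@lebesgue_measure R).
Local Notation mu3 := (mu3 R).
Implicit Types (x : R3) (h : R3 -> R) (phi : R * R * R -> R).

(** Local integrability of a(|x|) in three dimensions, read through the Jacobian of polar
    coordinates; a may be singular at 0. *)
Definition radial_weight (a : R -> R) : Prop :=
  measurable_fun setT a /\
  forall M, mu.-integrable `]0, M] (EFin \o (fun r => r ^+ 2 * a r)).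

Lemma measurable_ball3 (M : R) : measurable [set x : R3 | enorm x <= M].
Proof. by apply: measurable_setb; mfun; exact: measurable_enorm. Qed.

Lemma in_ball3 (M : R) x : (x \in [set x : R3 | enorm x <= M]) = (enorm x <= M).
Proof. by rewrite mem_setE. Qed.

Lemma loc_integrable_radial (a : R -> R) h (H : R) : radial_weight a ->
  measurable_fun setT h -> (forall x, `|h x| <= H) ->
  loc_integrable (fun x : R3 => a (enorm x) * h x).
Proof.
move=> [ma ia] mh hH M.
have H0 : 0 <= H := le_trans (normr_ge0 _) (hH 0).
have mae : measurable_fun setT (fun x : R3 => a (enorm x)).
  by apply: (mcomp ma); exact: measurable_enorm.
apply: (@le_integrable_real _ _ _ _ _ _ (fun x => H * `|a (enorm x)|)).
- exact: measurable_ball3.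
- by apply: measurable_funS (measurable_funM mae mh).
- by move=> x _; rewrite normrM mulrC ler_wpM2r.
apply: integrable_mulr; first exact: measurable_ball3.
apply/integrableP; split.
  apply: (@measurable_funS _ _ _ _ setT) => //.
  by apply/measurable_EFinP; apply: measurableT_comp.
rewrite integral_if.
have mg : measurable_fun setT (fun r : R => (if r <= M then `|a r| else 0)%:E).
  by apply/measurable_EFinP; apply: measurable_fun_ifT; mfun; exact: measurableT_comp.
have := @radial_tonelli R (fun r : R => (if r <= M then `|a r| else 0)%:E) mg.
have g0 (r : R) : (0 <= (if (r <= M)%R then `|a r| else 0)%:E)%E by rewrite lee_fin; case: ifP.
move=> /(_ g0) E.
apply: (@le_lt_trans _ _ (\int[mu3]_x (if (enorm x <= M)%R then `|a (enorm x)| else 0)%:E)%E).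
  apply: ge0_le_integral_nomeas => x; first by case: ifP.
  by rewrite in_ball3; case: ifP => //= _; rewrite normr_id.
rewrite E; apply: lte_mul_pinfty; [by rewrite lee_fin ltW// kappa_gt0|by []|].
have /integrableP[_] := ia M; rewrite integral_if [X in _ -> (X < _)%E]integral_if.
apply: le_lt_trans; apply: ge0_le_integral_nomeas => r.
  by case: ifP => // _; rewrite mule_ge0// lee_fin sqr_ge0.
rewrite !mem_setE !in_itv/= andbT; case: (0 < r) => //=.
by case: ifP => _; rewrite ?mule0// lee_fin normrM ger0_norm ?sqr_ge0.
Qed.

Lemma loc_integrable_mul (f : R3 -> R) phi : loc_integrable f -> test_function phi ->
  mu3.-integrable setT (EFin \o (fun x => f x * phi x)).
Proof.
move=> lf tphi; have [C C0 hC] := test_function_bounded tphi.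
have [_ [M phi0]] := tphi; have mphi := test_measurable tphi.
have mB := measurable_ball3 M.
have -> : (fun x => f x * phi x) = (fun x : R3 => if x \in [set x : R3 | enorm x <= M] then f x * phi x else 0).
  apply/funext => x; rewrite in_ball3; case: (leP (enorm x) M) => // Mx; by rewrite phi0 ?mulr0.
apply: ((@integrable_if _ _ _ mu3 _ (fun x => f x * phi x) mB).1).
have /measurable_int/measurable_EFinP mf := lf M.
apply: (@le_integrable_real _ _ _ _ _ _ (fun x => C * `|f x|)) => //.
- by apply: measurable_funM => //; exact: measurable_funS mphi.
- by move=> x _; rewrite normrM mulrC ler_wpM2r.
- by apply: integrable_mulr => //; exact: integrable_norm.
Qed.

Lemma pairing_radial (a : R -> R) h phi (H : R) : radial_weight a ->
  measurable_fun setT h -> (forall x, `|h x| <= H) ->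
  (forall r x, 0 < r -> x != 0 -> h (ray r x) = h x) -> test_function phi ->
  pairing (fun x : R3 => a (enorm x) * h x) phi =
  \int[mu]_(r in `]0, +oo[) (a r * (r ^+ 2 * smean h phi r)).
Proof.
move=> ra mh hH hr tphi; have [C C0 hC] := test_function_bounded tphi.
have li := loc_integrable_mul (loc_integrable_radial ra mh hH) tphi.
rewrite -(polar_radial mh (test_measurable tphi) hH hC hr).
  by apply: eq_Rintegral => x _; rewrite mulrA.
by apply: eq_integrable li => // x _ /=; rewrite mulrA.
Qed.

Lemma pairing_radial1 (a : R -> R) phi : radial_weight a -> test_function phi ->
  pairing (fun x : R3 => a (enorm x)) phi =
  \int[mu]_(r in `]0, +oo[) (a r * (r ^+ 2 * smean (cst 1) phi r)).
Proof.
move=> ra tphi; rewrite -(pairing_radial ra (measurable_cst _) (@norm_cst1 R))//.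
by apply: eq_Rintegral => x _; rewrite /cst mulr1.
Qed.

Lemma loc_integrable_radial1 (a : R -> R) : radial_weight a ->
  loc_integrable (fun x : R3 => a (enorm x)).
Proof.
move=> ra; have := loc_integrable_radial ra (measurable_cst _) (@norm_cst1 R).
by rewrite /cst; under eq_fun do rewrite mulr1.
Qed.

(** The interval is empty for r < 0, so the primitive is 0 there. The vanishing of V for y < 0 is
    encoded in this way. *)
Definition prim (l : R -> R) (r : R) : R := \int[mu]_(t in `[0, r]) l t.

Lemma measurable_prim l : measurable_fun setT l -> measurable_fun setT (prim l).
Proof.
move=> ml; rewrite /prim; under eq_fun do rewrite Rintegral_if.
apply: (measurable_Rintegral_param mu (fun p : R * R => if p.2 \in `[0, p.1]%classic then l p.2 else 0)).
apply: measurable_fun_ifT; [|by apply: (mcomp ml); mfun|mfun].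
by under eq_fun do rewrite mem_setE in_itv/=; mfun.
Qed.

Lemma norm_prim_le l (r M : R) : locint l -> r <= M ->
  `|prim l r| <= prim (fun t => `|l t|) M.
Proof.
move=> ll rM; have mi (r' : R) : measurable (`[0, r']%classic : set R) := measurable_itv _.
apply: (le_trans (@le_normr_Rintegral _ _ _ mu `[0, r]%classic l (mi _) (locint_itv 0 r ll))).
rewrite /prim; apply: fine_le.
- by apply: integrable_fin_num => //; apply: integrable_norm; exact: locint_itv.
- by apply: integrable_fin_num => //; apply: integrable_norm; exact: locint_itv.
rewrite integral_if [leRHS]integral_if; apply: ge0_le_integral_nomeas => t; first by case: ifP.
rewrite !mem_setE !in_itv/=; case: (0 <= t) => //=.
by case: (leP t r) => [tr|_]; [rewrite (le_trans tr rM)|case: ifP].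
Qed.

Lemma bounded_radial_weight (a : R -> R) : measurable_fun setT a ->
  (forall M, exists C, forall r, 0 < r <= M -> `|r ^+ 2 * a r| <= C) -> radial_weight a.
Proof.
move=> ma H; split => // M; have [C hC] := H M.
apply: (@le_integrable_real _ _ _ _ _ _ (cst `|C|)) => //.
- by apply: measurable_funM; [|apply: measurable_funS ma]; mfun.
- by move=> r; rewrite /= in_itv/= => /hC /le_trans; apply; exact: ler_norm.
apply: (@integrableS _ _ _ mu `[0, M]%classic) => //.
  by apply: subset_itvr; rewrite bnd_simp.
by apply: continuous_integrable_itv; exact: cst_continuous.
Qed.

Lemma radial_weight_prim l : locint l -> radial_weight (fun r => r^-1 * prim l r).
Proof.
move=> ll; apply: bounded_radial_weight.
  by apply: measurable_funM; [exact: measurable_invr|exact: measurable_prim ll.1].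
move=> M; exists (M * prim (fun t => `|l t|) M) => r /andP[r0 rM].
rewrite expr2 mulrA mulfK ?gt_eqF// normrM gtr0_norm// ler_pM//; [exact: ltW|exact: norm_prim_le].
Qed.

Lemma radial_weight_locint l : locint l -> radial_weight (fun r => r^-1 * l r).
Proof.
move=> ll; have ml := ll.1; split => [|M].
  by apply: measurable_funM; [exact: measurable_invr|].
apply: (@le_integrable_real _ _ _ mu `]0, M]%classic _ (fun r : R => M * `|l r|)) => //.
- have mm : measurable_fun setT (fun r : R => r ^+ 2 * (r^-1 * l r)).
    apply: measurable_funM; first mfun.
    by apply: measurable_funM => //; exact: measurable_invr.
  exact: measurable_funS mm.
- move=> r; rewrite /= in_itv/= => /andP[r0 rM].
  by rewrite expr2 mulrA mulfK ?gt_eqF// normrM gtr0_norm// ler_wpM2r.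
apply: integrable_mulr => //; apply: integrable_norm.
by apply: (integrableS _ _ _ (locint_itv 0 M ll)) => //; apply: subset_itvr; rewrite bnd_simp.
Qed.
End radial_pairing.

(** * Radial waves *)

Section wave.
Variable R : realType.
Local Notation R3 := (R3 R).
Local Notation mu := (@lebesgue_measure R).
Local Notation mu3 := (mu3 R).
Local Notation D i f := (fun x => 'D_(Defs.basis R i) f x).
Implicit Types (x : R3) (phi : R * R * R -> R) (k : R -> R).

Lemma iter_derivD (f g : R * R * R -> R) s : smooth f -> smooth g ->
  iter_deriv s (fun x => f x + g x) = (fun x => iter_deriv s f x + iter_deriv s g x).
Proof.
move=> sf sg; elim: s => //= v s ->; apply/funext => x.
by rewrite -deriveD//; [have [_] := sf s|have [_] := sg s].
Qed.

Lemma smoothD (f g : R * R * R -> R) : smooth f -> smooth g -> smooth (fun x => f x + g x).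
Proof.
move=> sf sg s; rewrite iter_derivD//; have [cf df] := sf s; have [cg dg] := sg s.
by split=> [x|x v]; [apply: cvgD; [exact: cf|exact: cg]|exact: derivableD].
Qed.

Lemma test_functionD (f g : R * R * R -> R) : test_function f -> test_function g ->
  test_function (fun x => f x + g x).
Proof.
move=> [sf [M f0]] [sg [M' g0]]; split; first exact: smoothD.
by exists (Num.max M M') => x; rewrite gt_max => /andP[a b]; rewrite f0// g0// addr0.
Qed.

Lemma sum_fun_ind (T : Type) n (P : (T -> R) -> Prop) (F : 'I_n -> T -> R) : P (fun=> 0) ->
  (forall f g, P f -> P g -> P (fun x : T => f x + g x)) -> (forall i, P (F i)) ->
  P (fun x : T => \sum_(i < n) F i x).
Proof.
move=> P0 PD PF; suff h (r : seq 'I_n) : P (fun x : T => \sum_(i <- r) F i x) by exact: h.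
elim: r => [|i r IH]; first by under eq_fun do rewrite big_nil.
by under eq_fun do rewrite big_cons; exact: PD.
Qed.

Lemma test_function0 : test_function (fun=> 0 : R).
Proof.
split; last by exists 0.
have E s : iter_deriv s (fun=> 0) = (fun=> 0 : R) :> (R * R * R -> R).
  by elim: s => //= v s ->; apply/funext => x; exact: derive_cst.
by move=> s; rewrite E; split => [x|x v]; [exact: cvg_cst|exact: derivable_cst].
Qed.

Lemma test_function_laplacian phi : test_function phi -> test_function (laplacian phi).
Proof.
move=> tphi; apply: sum_fun_ind => [|f g|i]; [exact: test_function0|exact: test_functionD|].
by do 2 apply: test_function_derive.
Qed.

Definition bounded_mfun (f : R3 -> R) : Prop :=
  measurable_fun setT f /\ exists C, forall x, `|f x| <= C.

Lemma smeanD (f g : R3 -> R) r : bounded_mfun f -> bounded_mfun g ->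
  smean (cst 1) (fun x => f x + g x) r = smean (cst 1) f r + smean (cst 1) g r.
Proof.
move=> [mf [C fC]] [mg [C' gC]]; rewrite /smean -mulrDr -RintegralD.
- by congr (_ * _); apply: eq_Rintegral => x _; rewrite mulrDr.
- exact: measurable_unitb.
- apply: (@bounded_unitb_integrable _ _ C); first exact: (measurable_smean_integrand _ (measurable_cst _)).
  by move=> x _; rewrite mul1r.
- apply: (@bounded_unitb_integrable _ _ C'); first exact: (measurable_smean_integrand _ (measurable_cst _)).
  by move=> x _; rewrite mul1r.
Qed.

Lemma bounded_mfun_test phi : test_function phi -> bounded_mfun (phi : R3 -> R).
Proof.
move=> tphi; split; first exact: test_measurable.
by have [C _ hC] := test_function_bounded tphi; exists C.
Qed.

Lemma smean_laplacian phi r : test_function phi ->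
  smean (cst 1) (laplacian phi) r = \sum_(i < 3) smean (cst 1) (D i (D i phi)) r.
Proof.
move=> tphi; have t i : test_function (D i (D i phi)) by do 2 apply: test_function_derive.
suff h (s : seq 'I_3) : test_function (fun x => \sum_(i <- s) D i (D i phi) x) /\
   smean (cst 1) (fun x => \sum_(i <- s) D i (D i phi) x) r = \sum_(i <- s) smean (cst 1) (D i (D i phi)) r.
  by have [_ <-] := h (index_enum _).
elim: s => [|i s [IH1 IH2]].
  under eq_fun do rewrite big_nil; split; first exact: test_function0.
  rewrite big_nil /smean /Rintegral integral0_eq ?mulr0// => x _; by rewrite mulr0.
under eq_fun do rewrite big_cons; split; first exact: test_functionD.
by rewrite smeanD ?big_cons ?IH2//; exact: bounded_mfun_test.
Qed.

(** Darboux's reduction: multiplied by r, the spherical integral turns the Laplacian into the second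
    derivative in r. *)
Definition rmean phi (r : R) : R := r * smean (cst 1) phi r.

Definition rmean1 phi (r : R) : R :=
  smean (cst 1) phi r + r * \sum_(i < 3) smean (dir i) (D i phi) r.

Lemma is_derive_rmean phi (r : R) : test_function phi ->
  is_derive r (1 : R) (rmean phi) (rmean1 phi r).
Proof.
move=> tphi; have d1 := is_derive_smean r (measurable_cst _) (@norm_cst1 R) tphi.
have := is_deriveM (is_derive_id r (1 : R)) d1.
move=> [e1 e2]; apply: DeriveDef; first exact: e1.
rewrite [LHS]e2 /rmean1 /GRing.scale/= mulr1 addrC; congr (_ + _ * _).
apply: eq_bigr => i _; congr (smean _ _ _); apply/funext => x; by rewrite /cst mul1r.
Qed.

Lemma continuous_rmean phi : test_function phi -> continuous (rmean phi).
Proof. by move=> tphi x; exact: is_derive_continuous (is_derive_rmean x tphi). Qed.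

Lemma continuous_rmean1 phi : test_function phi -> continuous (rmean1 phi).
Proof.
move=> tphi x; apply: cvgD; first exact: continuous_smean1.
apply: cvgM; first exact: cvg_id.
apply: (@sum_fun_ind _ _ (fun f : R -> R => continuous f) (fun i => smean (dir i) (D i phi))).
- by move=> y; exact: cvg_cst.
- by move=> f g cf cg y; apply: cvgD; [exact: cf|exact: cg].
move=> i; apply: (continuous_smean (measurable_dir i) (norm_dir i)); exact: test_function_derive.
Qed.

(** r times the derivative of the spherical integral is r^-1 times a sum of fluxes, which
    [is_derive_flux] differentiates; the terms of first order cancel, leaving r times the spherical
    integral of the Laplacian. *)
Lemma is_derive_rmean1 phi (r : R) : test_function phi -> 0 < r ->
  is_derive r (1 : R) (rmean1 phi) (rmean (laplacian phi) r).
Proof.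
move=> tphi r0.
have tD i := test_function_derive (Defs.basis R i) tphi.
have d1 := is_derive_smean r (measurable_cst _) (@norm_cst1 R) tphi.
pose Fl (i : 'I_3) (r : R) := r ^+ 2 * smean (dir i) (D i phi) r.
have dF i : is_derive r (1 : R) (Fl i) (r ^+ 2 * smean (cst 1) (D i (D i phi)) r).
  exact: is_derive_flux (tD i) r0.
have dS : is_derive r (1 : R) (\sum_(i < 3) Fl i) _ := is_derive_sum dF.
have r00 : r != 0 by rewrite gt_eqF.
have dV : is_derive r (1 : R) (fun r : R => r^-1) _ := is_deriveV r00 (is_derive_id r (1 : R)).
have dP := is_deriveD d1 (is_deriveM dV dS).
have eqn : \near r, (smean (cst 1) phi + (fun r : R => r^-1) * (\sum_(i < 3) Fl i)) r = rmean1 phi r.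
  near=> Y.
  have Y0 : Y != 0 by rewrite gt_eqF//; near: Y; exact: lt_nbhsr.
  rewrite /rmean1 -[LHS]/(smean (cst 1) phi Y + Y^-1 * (\sum_(i < 3) Fl i) Y); congr (_ + _).
  rewrite fct_sumE !mulr_sumr; apply: eq_bigr => i _.
  by rewrite /Fl expr2 -mulrA mulKf.
have [e1 e2] := near_eq_is_derive eqn dP; apply: DeriveDef; first exact: e1.
rewrite [LHS]e2 /rmean smean_laplacian// fct_sumE /Fl /GRing.scale/= mulr1.
rewrite !mulr_suml !mulr_sumr -!big_split/=; apply: eq_bigr => i _.
rewrite (_ : smean (fun x => cst 1 x * dir i x) = smean (dir i)); last first.
  by congr smean; apply/funext => x; rewrite /cst mul1r.
have aux (a b : R) : a + (r^-1 * (r ^+ 2 * b) + r ^+ 2 * a * - r ^- 2) = r * b.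
  by field.
exact: aux.
Unshelve. all: by end_near. Qed.

Lemma rmeanN phi r : test_function phi -> rmean phi (- r) = - rmean phi r.
Proof. by move=> tphi; rewrite /rmean smeanN ?mulNr//; exact: test_measurable. Qed.

Lemma is_derive_comp_opp (f : R -> R) (r df : R) : is_derive (- r) (1 : R) f df ->
  is_derive r (1 : R) (fun r => f (- r)) (- df).
Proof.
move=> d; have dN : is_derive r (1 : R) (fun r : R => - r) (- 1).
  exact: is_deriveN (is_derive_id r (1 : R)).
by have := is_derive1_comp d dN; rewrite mulrN1.
Qed.

Lemma rmean1N phi r : test_function phi -> rmean1 phi (- r) = rmean1 phi r.
Proof.
move=> tphi; have d1 := is_derive_comp_opp (is_derive_rmean (- r) tphi).
have d2 := is_deriveN (is_derive_rmean r tphi).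
have E : (fun r => rmean phi (- r)) = - rmean phi.
  by apply/funext => y; rewrite rmeanN.
rewrite E in d1; have := @derive_val _ _ _ _ _ _ _ d1.
rewrite (@derive_val _ _ _ _ _ _ _ d2) => /oppr_inj ->.
done.
Qed.

Lemma continuous_support_bounded (f : R -> R) (M : R) : continuous f ->
  (forall r, M < `|r| -> f r = 0) -> exists2 C, 0 <= C & forall r, `|f r| <= C.
Proof.
move=> cf f0.
have ab : - `|M| <= `|M| by rewrite (@le_trans _ _ 0)// oppr_le0.
have cnf : continuous (fun r => `|f r|) by move=> r; apply: continuous_comp; [exact: cf|exact: norm_continuous].
have [c _ hc] := @EVT_max R (fun r => `|f r|) _ _ ab (continuous_subspaceT cnf).
exists `|f c| => // r; have [rM|Mr] := leP `|r| `|M|.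
  by apply: hc; rewrite in_itv/= -ler_norml.
by rewrite f0 ?normr0// (le_lt_trans (ler_norm _)).
Qed.

(** The primitive taken from the left of the support is even because P is odd, and evenness carries
    its vanishing on the left over to the right. It is needed for P = [rmean phi]. *)
Lemma odd_antiderivative (P : R -> R) (M : R) : 0 <= M -> continuous P ->
  (forall r, P (- r) = - P r) -> (forall r, M < `|r| -> P r = 0) ->
  exists T, [/\ forall r, is_derive r (1 : R) T (- P r), forall r, T (- r) = T r &
    forall r, M < `|r| -> T r = 0].
Proof.
(* A base point strictly to the left of the support: beyond it the fundamental theorem applies, and
   up to it the primitive is locally 0. *)
move=> M0 cP oP P0; pose L := - (M + 1).
pose I r := \int[mu]_(t in `[L, r]) P t.
have I0 r : r < - M -> I r = 0.
  move=> rM; rewrite /I /Rintegral integral0_eq// => t; rewrite /= in_itv/= => /andP[_ tr].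
  by rewrite P0// ltr0_norm; lra.
have dI r : is_derive r (1 : R) I (P r).
  have [Lr|rL] := ltP L r; first exact: is_derive_FTC1.
  have rM : r < - M by rewrite (le_lt_trans rL)// /L; lra.
  rewrite P0; last by rewrite ltr0_norm; lra.
  have := @near_eq_is_derive R R R (cst 0) I r 1 0 _ (is_derive_cst _ r 1); apply.
  by near=> y; rewrite I0//; near: y; exact: lt_nbhsl.
exists (fun r => - I r).
have dT r : is_derive r (1 : R) (fun r => - I r) (- P r) by exact: is_deriveN.
have T0 r : r < - M -> - I r = 0 by move=> /I0 ->; rewrite oppr0.
have eT r : - I (- r) = - I r.
  have d0 y : is_derive y (1 : R) (fun y => - I (- y) - - I y) 0.
    have := is_deriveB (is_derive_comp_opp (dT (- y))) (dT y).
    rewrite (_ : - - P (- y) - - P y = 0); first exact.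
    by rewrite oP; ring.
  have := is_derive_0_is_cst r 0 d0; rewrite oppr0 subrr => /eqP.
  by rewrite subr_eq0 => /eqP.
split => // r; have [r0|r0] := leP 0 r => Mr.
  by rewrite -eT T0// ltrN2; rewrite ger0_norm in Mr.
by rewrite T0//; rewrite ltr0_norm// in Mr; rewrite ltrNr.
Unshelve. all: by end_near. Qed.

(** Changing the sign exchanges positive and negative parts; when one of their integrals is
    infinite, [fine] returns 0 on both sides. *)
Lemma RintegralN (D : set R) (f : R -> R) : \int[mu]_(x in D) (- f x) = - \int[mu]_(x in D) f x.
Proof.
rewrite /Rintegral integralE [in RHS]integralE.
have -> : (fun x : R => (- f x)%:E)^\+%E = (fun x : R => (f x)%:E)^\-%E.
  by apply/funext => x; rewrite funeposE funenegE.
have -> : (fun x : R => (- f x)%:E)^\-%E = (fun x : R => (f x)%:E)^\+%E.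
  by apply/funext => x; rewrite funeposE funenegE -EFinN opprK.
move: (integral _ _ _) (integral _ _ _) => [a| |] [b| |] //=; rewrite ?oppr0//.
by rewrite opprB.
Qed.

(* d'Alembert: r w(r, s) = F(r - s) - F(- r - s) where F' = k. *)
Definition wave k (s : R) (x : R3) : R :=
  (enorm x)^-1 * prim (fun r => k (r - s) + k (- r - s)) (enorm x).

(** The formal derivative of [wave] in s. *)
Definition wave_t k (s : R) (x : R3) : R :=
  (enorm x)^-1 * (k (- enorm x - s) - k (enorm x - s)).

Lemma locint_N k : locint k -> locint (fun r : R => - k r).
Proof.
move=> [mk ik]; split; first exact: measurableT_comp.
move=> M; have := @integrable_mulr _ _ _ mu _ (-1) _ (measurable_itv `[- M, M]) (ik M).
by apply: eq_integrable => // x _ /=; rewrite mulN1r.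
Qed.

Lemma locint_even k (s : R) : locint k -> locint (fun r : R => k (r - s) + k (- r - s)).
Proof.
by move=> lk; have lks := locint_shift (- s) lk; apply: locint_add => //; exact: (locint_opp lks).
Qed.

Lemma locint_odd k (s : R) : locint k -> locint (fun r : R => k (- r - s) - k (r - s)).
Proof.
move=> lk; have lks := locint_shift (- s) lk; apply: locint_add; first exact: (locint_opp lks).
exact: (locint_N lks).
Qed.

Lemma rmean_support phi : test_function phi ->
  exists2 M, 0 < M & (forall r, M <= `|r| -> rmean phi r = 0) /\
    (forall r, M <= `|r| -> rmean1 phi r = 0).
Proof.
move=> tphi; have [_ [M0 phi0]] := tphi.
have t i := test_function_derive (Defs.basis R i) tphi.
have s0 M r : M < `|r| -> (forall x, M < enorm x -> phi x = 0) -> rmean phi r = 0.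
  by move=> Mr p0; rewrite /rmean (smean_out _ p0 Mr) mulr0.
exists (`|M0| + 1); first by rewrite ltr_pwDr.
have lt r : `|M0| + 1 <= `|r| -> M0 < `|r|.
  by move=> h; apply: le_lt_trans (ler_norm _) _; apply: lt_le_trans h; rewrite ltrDl.
have c0 r : M0 < `|r| -> rmean phi r = 0 by move=> h; exact: s0 phi0.
split => r /lt Mr; first exact: c0.
have := @near_eq_is_derive R R R (cst 0) (rmean phi) r 1 0 _ (is_derive_cst _ r 1).
move=> h; have {}h : is_derive r (1 : R) (rmean phi) 0.
  apply: h; near=> y; rewrite c0//.
  near: y; apply: (@cvgr_gt _ _ _ _ (fun y : R => `|y|) `|r|) => //.
  exact: norm_continuous.
rewrite -(@derive_val _ _ _ _ _ _ _ (is_derive_rmean r tphi)).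
exact: (@derive_val _ _ _ _ _ _ _ h).
Unshelve. all: by end_near. Qed.

(** In this form s only shifts a compactly supported kernel, so derivatives in s never fall on k. *)
Lemma pairing_wave_t k s phi : locint k -> test_function phi ->
  pairing (wave_t k s) phi = - \int[mu]_y (k y * rmean phi (y + s)).
Proof.
move=> lk tphi; have [M M0 [s0 s1]] := rmean_support tphi.
have cr := continuous_rmean tphi.
have s0' r : M < `|r| -> rmean phi r = 0 by move=> h; apply: s0; exact: ltW.
have [C C0 hC] := continuous_support_bounded cr s0'.
rewrite (fold_integral _ lk (continuous_measurable_fun cr) hC s0').
rewrite (pairing_radial1 (radial_weight_locint (locint_odd s lk)) tphi).
rewrite -RintegralN; apply: eq_Rintegral => r; rewrite mem_setE in_itv/= andbT => r0.
rewrite rmeanN// /rmean expr2.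
have r00 : r != 0 by rewrite gt_eqF.
by set a := k _; set b := k _; set c := smean _ _ _; field.
Qed.

(** Integrating by parts moves the primitive inside [wave] onto the kernel [rmean phi], replacing
    that kernel by T; the evenness of T matches the folded form. *)
Lemma pairing_wave k s phi : locint k -> test_function phi ->
  forall T, (forall r, is_derive r (1 : R) T (- rmean phi r)) ->
  forall M, 0 < M -> (forall r, M <= `|r| -> rmean phi r = 0) ->
  (forall r, M <= `|r| -> T r = 0) -> (forall r, T (- r) = T r) ->
  pairing (wave k s) phi = \int[mu]_y (k y * T (y + s)).
Proof.
move=> lk tphi T dT M M0 s0 T0 eT.
have cr := continuous_rmean tphi.
have s0' r : M < `|r| -> rmean phi r = 0 by move=> h; apply: s0; exact: ltW.
have [C C0 hC] := continuous_support_bounded cr s0'.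
have cT : continuous T by move=> r; exact: is_derive_continuous (dT r).
have T0' r : M < `|r| -> T r = 0 by move=> h; apply: T0; exact: ltW.
have [C' C'0 hC'] := continuous_support_bounded cT T0'.
have le := locint_even s lk.
rewrite (fold_integral _ lk (continuous_measurable_fun cT) hC' T0').
rewrite (pairing_radial1 (radial_weight_prim le) tphi).
have dNT (r : R) : 0 < r -> is_derive r (1 : R) (fun r : R => - T r) (rmean phi r).
  by move=> _; have := is_deriveN (dT r); rewrite opprK.
have nT0 (r : R) : M <= r -> - T r = 0.
  by move=> Mr; rewrite T0 ?oppr0// (le_trans Mr)// ler_norm.
have nr0 (r : R) : M <= r -> rmean phi r = 0 by move=> Mr; rewrite s0// (le_trans Mr)// ler_norm.
transitivity (\int[mu]_(r in `]0, +oo[) (rmean phi r * prim (fun r : R => k (r - s) + k (- r - s)) r)).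
  apply: eq_Rintegral => r; rewrite mem_setE in_itv/= andbT => r0.
  have r00 : r != 0 by rewrite gt_eqF.
  by rewrite /rmean; set a := prim _ _; set c := smean _ _ _; field.
rewrite [LHS](radial_by_parts le cr M0 dNT hC nT0 nr0).
rewrite -RintegralN; apply: eq_Rintegral => r _; rewrite eT; ring.
Qed.

(** [rmean (laplacian phi)] is the derivative of [rmean1 phi], and one integration by parts against
    the primitive of the profile leaves [rmean1 phi]. *)
Lemma pairing_wave_laplacian k s phi : locint k -> test_function phi ->
  pairing (wave k s) (laplacian phi) = - \int[mu]_y (k y * rmean1 phi (y + s)).
Proof.
move=> lk tphi; have tL := test_function_laplacian tphi.
have [M M0 [_ s1]] := rmean_support tphi.
have [M' M'0 [s0 _]] := rmean_support tL.
have cr := continuous_rmean tL; have cr1 := continuous_rmean1 tphi.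
have s0' r : M' < `|r| -> rmean (laplacian phi) r = 0 by move=> h; apply: s0; exact: ltW.
have s1' r : M < `|r| -> rmean1 phi r = 0 by move=> h; apply: s1; exact: ltW.
have [C C0 hC] := continuous_support_bounded cr s0'.
have [C' C'0 hC'] := continuous_support_bounded cr1 s1'.
have le := locint_even s lk.
rewrite (fold_integral _ lk (continuous_measurable_fun cr1) hC' s1').
rewrite (pairing_radial1 (radial_weight_prim le) tL).
have M20 : 0 < M + M' by rewrite addr_gt0.
have dr (r : R) : 0 < r -> is_derive r (1 : R) (rmean1 phi) (rmean (laplacian phi) r).
  exact: is_derive_rmean1.
have n1 (r : R) : M + M' <= r -> rmean1 phi r = 0.
  by move=> h; apply: s1; apply: le_trans (ler_norm r); apply: le_trans h; rewrite lerDl ltW.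
have n0 (r : R) : M + M' <= r -> rmean (laplacian phi) r = 0.
  by move=> h; apply: s0; apply: le_trans (ler_norm r); apply: le_trans h; rewrite lerDr ltW.
transitivity (\int[mu]_(r in `]0, +oo[) (rmean (laplacian phi) r * prim (fun r : R => k (r - s) + k (- r - s)) r)).
  apply: eq_Rintegral => r; rewrite mem_setE in_itv/= andbT => r0.
  have r00 : r != 0 by rewrite gt_eqF.
  by rewrite /rmean; set a := prim _ _; set c := smean _ _ _; field.
rewrite [LHS](radial_by_parts le cr M20 dr hC n1 n0); congr (- _).
apply: eq_Rintegral => r _; rewrite rmean1N//; ring.
Qed.

(** By the pairing formulas both required derivatives are derivatives of convolutions with k: the
    kernel [T] has derivative [- rmean phi], and [rmean phi] has derivative [rmean1 phi]. *)
Lemma linear_wave_wave k (U : state R) : locint k ->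
  (\forall x \ae mu3, wave k 0 x = U.1 x) -> (\forall x \ae mu3, wave_t k 0 x = U.2 x) ->
  linear_wave U (wave k) (wave_t k).
Proof.
move=> lk U1 U2; split => //.
  move=> t; split.
  - exact: loc_integrable_radial1 (radial_weight_prim (locint_even t lk)).
  - exact: loc_integrable_radial1 (radial_weight_locint (locint_odd t lk)).
move=> phi tphi t; have [M M0 [s0 s1]] := rmean_support tphi.
have s0' r : M < `|r| -> rmean phi r = 0 by move=> h; apply: s0; exact: ltW.
have s1' r : M < `|r| -> rmean1 phi r = 0 by move=> h; apply: s1; exact: ltW.
have cr := continuous_rmean tphi; have cr1 := continuous_rmean1 tphi.
have [C C0 hC] := continuous_support_bounded cr s0'.
have [C1 C10 hC1] := continuous_support_bounded cr1 s1'.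
have [T [dT eT T0]] := odd_antiderivative (ltW M0) cr (fun r => rmeanN r tphi) s0'.
have cT : continuous T by move=> r; exact: is_derive_continuous (dT r).
have [C2 C20 hC2] := continuous_support_bounded cT T0.
have M10 : 0 < M + 1 by rewrite addr_gt0.
have M1 (r : R) : M + 1 <= `|r| -> M < `|r| by apply: lt_le_trans; rewrite ltrDl.
split.
- have -> : (fun s => pairing (wave k s) phi) = (fun s => \int[mu]_y (k y * T (y + s))).
    apply/funext => s; apply: (@pairing_wave k s phi lk tphi T dT (M + 1)) => // r /M1; [exact: s0'|exact: T0].
  rewrite pairing_wave_t// -RintegralN; under eq_Rintegral do rewrite -mulrN.
  apply: (@is_derive_conv _ k T (fun r => - rmean phi r) C2 C M) => //.
  + by apply: measurableT_comp => //; exact: continuous_measurable_fun.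
  + by move=> y; rewrite normrN.
  + by move=> y /s0' ->; rewrite oppr0.
- have -> : (fun s => pairing (wave_t k s) phi) = (fun s => - \int[mu]_y (k y * rmean phi (y + s))).
    by apply/funext => s; rewrite pairing_wave_t.
  rewrite pairing_wave_laplacian//; apply: is_deriveN.
  apply: (@is_derive_conv _ k (rmean phi) (rmean1 phi) C C1 M) => //.
  + by move=> y; exact: is_derive_rmean.
  + exact: continuous_measurable_fun.
Qed.

Definition radial_grad k (i : 'I_3) (x : R3) : R :=
  ((enorm x)^-1 * (k (enorm x) - (enorm x)^-1 * prim k (enorm x))) * dir i x.

Lemma locint_grad k : locint k -> radial_weight (fun r : R => r^-1 * (k r - r^-1 * prim k r)).
Proof.
move=> lk; have [m1 h1] := radial_weight_locint lk; have mp := measurable_prim lk.1.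
split.
  apply: measurable_funM; first exact: measurable_invr.
  apply: measurable_funB; first exact: lk.1.
  by apply: measurable_funM => //; exact: measurable_invr.
move=> M; have h2 : mu.-integrable `]0, M] (EFin \o prim k).
  apply: (@le_integrable_real _ _ _ mu `]0, M]%classic _ (cst (prim (fun t => `|k t|) M))) => //.
  - exact: measurable_funS mp.
  - by move=> r; rewrite /= in_itv/= => /andP[r0 rM]; exact: norm_prim_le.
  - apply: (@integrableS _ _ _ mu `[0, M]%classic) => //.
      by apply: subset_itvr; rewrite bnd_simp.
    by apply: continuous_integrable_itv; exact: cst_continuous.
have := @integrable_subr _ _ _ mu _ _ _ (measurable_itv `]0, M]) (h1 M) h2.
apply: eq_integrable => // r; rewrite mem_setE in_itv/= => /andP[r0 _]; congr (_%:E).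
have r00 : r != 0 by rewrite gt_eqF.
by set a := prim _ _; set c := k r; field.
Qed.

(** Polar coordinates reduce the identity to an integration by parts on the half-line against r
    times the spherical integral of [dir i] and phi, whose derivative follows from
    [is_derive_flux]. *)
Lemma weak_grad_radial k : locint k ->
  is_weak_grad (fun x : R3 => (enorm x)^-1 * prim k (enorm x)) (radial_grad k).
Proof.
move=> lk; split.
- exact: loc_integrable_radial1 (radial_weight_prim lk).
- by move=> i; exact: (loc_integrable_radial (locint_grad lk) (measurable_dir i) (norm_dir i)).
move=> phi tphi i; have tD := test_function_derive (Defs.basis R i) tphi.
rewrite (pairing_radial1 (radial_weight_prim lk) tD).
rewrite (pairing_radial (locint_grad lk) (measurable_dir i) (norm_dir i) _ tphi); last first.
  by move=> *; exact: dir_ray.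
pose F := smean (dir i) phi.
pose G (r : R) := r * F r; pose G1 (r : R) := r * smean (cst 1) (D i phi) r - F r.
have cF : continuous F := continuous_smean (measurable_dir i) (norm_dir i) tphi.
have cG : continuous G by move=> r; apply: cvgM; [exact: cvg_id|exact: cF].
have cG1 : continuous G1.
  by move=> r; apply: cvgB; [apply: cvgM; [exact: cvg_id|exact: continuous_smean1]|exact: cF].
have [_ [M0 phi0]] := tphi; pose M := `|M0| + 1.
have M_gt0 : 0 < M by rewrite ltr_pwDr.
have M0M : M0 < M by rewrite /M (le_lt_trans (ler_norm _))// ltrDl.
have p0 x : M < enorm x -> phi x = 0 by move=> h; apply: phi0; exact: lt_trans h.
have Dp0 x : M < enorm x -> D i phi x = 0 by exact: derive_out.
have F0 r : M < `|r| -> F r = 0 := smean_out (dir i) p0.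
have G0 r : M < `|r| -> G r = 0 by move=> /F0 h; rewrite /G h mulr0.
have G10 r : M < `|r| -> G1 r = 0.
  by move=> h; rewrite /G1 F0// (smean_out _ Dp0 h) mulr0 subr0.
have [C C0 hC] := continuous_support_bounded cG1 G10.
have [CF _ hCF] := continuous_support_bounded cF F0.
have [CG _ hCG] := continuous_support_bounded cG G0.
have M10 : 0 < M + 1 by rewrite addr_gt0.
have dG (r : R) : 0 < r -> is_derive r (1 : R) G (G1 r).
  move=> r0; have r00 : r != 0 by rewrite gt_eqF.
  have d1 := is_derive_flux i tphi r0.
  have dV : is_derive r (1 : R) (fun r : R => r^-1) _ := is_deriveV r00 (is_derive_id r (1 : R)).
  have dP := is_deriveM dV d1.
  have eqn : \near r, ((fun r : R => r^-1) * (fun r => r ^+ 2 * smean (dir i) phi r)) r = G r.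
    near=> Y; have Y0 : Y != 0 by rewrite gt_eqF//; near: Y; exact: lt_nbhsr.
    by rewrite -[LHS]/(Y^-1 * (Y ^+ 2 * F Y)) /G expr2 -mulrA mulKf.
  have [e1 e2] := near_eq_is_derive eqn dP; apply: DeriveDef; first exact: e1.
  rewrite [LHS]e2 /G1 /F /GRing.scale/= mulr1.
  have aux (a b : R) : r^-1 * (r ^+ 2 * b) + r ^+ 2 * a * - r ^- 2 = r * b - a by field.
  exact: aux.
have M1 (r : R) : M + 1 <= r -> M < `|r|.
  by move=> h; apply: lt_le_trans (ler_norm _); apply: lt_le_trans h; rewrite ltrDl.
have lp : locint (prim k).
  split; first exact: measurable_prim lk.1.
  move=> X; apply: (@le_integrable_real _ _ _ mu `[- X, X]%classic _ (cst (prim (fun t => `|k t|) X))) => //.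
  - exact: measurable_funS (measurable_prim lk.1).
  - by move=> r; rewrite /= in_itv/= => /andP[r0 rM]; exact: norm_prim_le.
  - by apply: continuous_integrable_itv; exact: cst_continuous.
have sub : `]0%R, +oo[%classic `<=` [set: R] by [].
have half f : mu.-integrable setT (EFin \o f) -> mu.-integrable `]0, +oo[ (EFin \o f).
  by apply: integrableS.
have i1 := half _ (integrable_locint_mul lp (continuous_measurable_fun cG1) hC G10).
have i2 := half _ (integrable_locint_mul lp (continuous_measurable_fun cF) hCF F0).
have i3 := half _ (integrable_locint_mul lk (continuous_measurable_fun cG) hCG G0).
transitivity (\int[mu]_(r in `]0, +oo[) (prim k r * G1 r + prim k r * F r)).
  apply: eq_Rintegral => r; rewrite mem_setE in_itv/= andbT => r0.
  have r00 : r != 0 by rewrite gt_eqF.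
  by rewrite /G1; set a := prim _ _; set c := smean _ _ _; field.
rewrite RintegralD//; have -> : \int[mu]_(r in `]0, +oo[) (prim k r * G1 r) = - \int[mu]_(r in `]0, +oo[) (k r * G r).
  rewrite -(radial_by_parts lk cG1 M10 dG hC (fun r h => G0 _ (M1 _ h)) (fun r h => G10 _ (M1 _ h))).
  by apply: eq_Rintegral => r _; rewrite mulrC.
rewrite addrC -[LHS]opprB -RintegralB//; congr (- _); apply: eq_Rintegral => r.
rewrite mem_setE in_itv/= andbT => r0.
have r00 : r != 0 by rewrite gt_eqF.
by rewrite /G /F; set a := prim _ _; set c := smean _ _ _; field.
Unshelve. all: by end_near. Qed.

End wave.

(** * Uniqueness of weak gradients *)

Section bumps.
Variable R : realType.
Local Notation V := (R * R * R)%type.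

(** The derivatives of exp(-1/l), extended by 0, are combinations of these functions, so the family
    is indexed by n in order to be closed under differentiation. *)
Definition flat n (l : R) : R := if 0 < l then l ^- n * expR (- l^-1) else 0.

Lemma flat_ge0 n l : 0 <= flat n l.
Proof.
by rewrite /flat; case: ifP => // l0; rewrite mulr_ge0 ?expR_ge0// invr_ge0 exprn_ge0// ltW.
Qed.

(** The term of order n + 2 of the exponential series bounds l^(-n-2) by (n + 2)! exp(1/l).
    Vanishing to second order gives the derivative 0 at the origin, by [is_derive0_sq]. *)
Lemma flat_le n l : `|flat n l| <= n.+2`!%:R * l ^+ 2.
Proof.
rewrite ger0_norm ?flat_ge0// /flat; case: ifPn => [l0|_]; last by rewrite mulr_ge0 ?sqr_ge0.
have l1 : 0 <= l^-1 by rewrite invr_ge0 ltW.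
have F0 : (0 : R) < n.+2`!%:R by rewrite ltr0n fact_gt0.
have h := expR_ge1Dxn n.+1 l1.
have {}h : l^-1 ^+ n.+2 <= n.+2`!%:R * expR l^-1.
  rewrite mulrC -ler_pdivrMr//; apply: le_trans h; by rewrite lerDr.
rewrite expRN ler_pdivrMr ?expR_gt0//.
have l2 : 0 < l ^+ 2 by rewrite exprn_gt0.
rewrite mulrAC -ler_pdivrMr//; apply: le_trans h.
by rewrite -!exprVn -exprD addn2.
Qed.

Lemma is_derive0_sq (f : R -> R) (C : R) : (forall h, `|f h| <= C * h ^+ 2) ->
  is_derive (0 : R) (1 : R) f 0.
Proof.
move=> fC; have f0 : f 0 = 0.
  by apply/normr0_eq0/le_anti; rewrite normr_ge0 andbT; apply: le_trans (fC 0) _; rewrite expr0n mulr0.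
have cv : (fun h : R => h^-1 *: ((f \o shift 0) (h *: (1 : R)) - f 0)) @ 0^' --> (0 : R).
  have C10 : 0 < `|C| + 1 by rewrite ltr_pwDr.
  apply/cvgrPdist_le => e e0; near=> h.
  have h0 : h != 0 by near: h; exact: nbhs_dnbhs_neq.
  rewrite sub0r normrN /= f0 subr0 addr0 /GRing.scale/= mulr1 normrM normfV.
  rewrite ler_pdivrMl ?normr_gt0//; apply: le_trans (fC h) _.
  apply: (@le_trans _ _ ((`|C| + 1) * h ^+ 2)).
    by rewrite ler_wpM2r ?sqr_ge0//; have := ler_norm C; lra.
  rewrite -(real_normK (num_real h)) expr2 mulrA [leRHS]mulrC ler_wpM2r// mulrC -ler_pdivlMr//.
  near: h; apply: dnbhs0_le; exact: divr_gt0.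
by apply: DeriveDef; [apply/cvg_ex; exists 0|exact/cvg_lim].
Unshelve. all: by end_near. Qed.

Lemma is_derive_flat n (l : R) :
  is_derive l (1 : R) (flat n) (- n%:R * flat n.+1 l + flat n.+2 l).
Proof.
have [l0|l0|->] := ltgtP l 0.
- rewrite /flat !ltNge (ltW l0)/= mulr0 addr0.
  have := @near_eq_is_derive R R R (cst 0) (flat n) l 1 0 _ (is_derive_cst _ l 1); apply.
  near=> y; rewrite /flat ifF//; apply/negbTE; rewrite -leNgt ltW//.
  by near: y; exact: lt_nbhsl.
- have l00 : l != 0 by rewrite gt_eqF.
  have ln0 : l ^+ n != 0 by rewrite expf_neq0.
  have dV : is_derive l (1 : R) (fun r : R => r^-1) _ := is_deriveV l00 (is_derive_id l (1 : R)).
  have dN : is_derive l (1 : R) (fun r : R => - r^-1) _ := is_deriveN dV.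
  have dE := @is_derive1_comp _ expR (fun r : R => - r^-1) l _ _ (is_derive_expR (- l^-1)) dN.
  have dP := is_deriveM (is_deriveX n dV) dE.
  have eqn : \near l, ((fun r : R => r^-1) ^+ n * (expR \o (fun r : R => - r^-1))) l = flat n l.
    near=> y; rewrite /flat ifT; last by near: y; exact: lt_nbhsr.
    by rewrite -exprVn -[LHS]/(((fun r : R => r^-1) ^+ n) y * _) exprfctE.
  have [e1 e2] := near_eq_is_derive eqn dP; apply: DeriveDef; first exact: e1.
  rewrite [LHS]e2 /flat l0 /GRing.scale/= !mulr1 opprK exprfctE -!exprVn.
  move: (l^-1) (expR _) => i E; case: n {ln0 dP eqn e1 e2} => [|n]; rewrite ?mul0r /=.
    by rewrite expr0 mul1r mulr0 oppr0 mul0r add0r addr0 mulrC.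
  by rewrite !exprS; ring.
- rewrite /flat !ltxx mulr0 addr0; apply: is_derive0_sq; exact: flat_le.
Unshelve. all: by end_near. Qed.

Lemma continuous_flat n : continuous (flat n).
Proof. by move=> x; exact: is_derive_continuous (is_derive_flat n x). Qed.

(* Closed under directional derivatives, hence contained in the smooth functions. *)
Inductive flat_alg : (V -> R) -> Prop :=
| flat_alg_gen c n (i : 'I_3) s b : flat_alg (fun x => c * flat n (s * Defs.coord i x + b))
| flat_algD f g : flat_alg f -> flat_alg g -> flat_alg (fun x => f x + g x)
| flat_algM f g : flat_alg f -> flat_alg g -> flat_alg (fun x => f x * g x).

Lemma continuous_coord (i : 'I_3) : continuous (Defs.coord i : V -> R).
Proof.
move=> x; case: i => -[|[|[|]]]//= ii.
- exact: (cvg_comp _ _ cvg_fst cvg_fst).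
- exact: (cvg_comp _ _ cvg_fst cvg_snd).
- exact: cvg_snd.
Qed.

Lemma flat_alg_continuous f : flat_alg f -> continuous f.
Proof.
elim=> [c n i s b|{}f g _ cf _ cg|{}f g _ cf _ cg] x.
- apply: cvgM; first exact: cvg_cst.
  apply: (@continuous_comp _ _ _ (fun x => s * Defs.coord i x + b) (flat n)); last exact: continuous_flat.
  by apply: cvgD; [apply: cvgM; [exact: cvg_cst|exact: continuous_coord]|exact: cvg_cst].
- by apply: cvgD; [exact: cf|exact: cg].
- by apply: cvgM; [exact: cf|exact: cg].
Qed.

Lemma coord_lin (i : 'I_3) (h : R) (v x : V) :
  Defs.coord i (h *: v + x) = h * Defs.coord i v + Defs.coord i x.
Proof. by case: i => -[|[|[|]]]. Qed.

Lemma is_derive_coord_comp (F : R -> R) (dF s b : R) (i : 'I_3) (x v : V) :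
  is_derive (s * Defs.coord i x + b) (1 : R) F dF ->
  is_derive x v (fun x => F (s * Defs.coord i x + b)) (s * Defs.coord i v * dF).
Proof.
move=> d; pose c := s * Defs.coord i v; pose p := s * Defs.coord i x + b.
have dL : is_derive (0 : R) (1 : R) (fun t : R => t * c + p) c.
  have := is_deriveD (is_deriveM (is_derive_id (0 : R) (1 : R)) (is_derive_cst c (0 : R) 1)) (is_derive_cst p (0 : R) (1 : R)).
  by rewrite /GRing.scale/= mulr0 add0r mulr1 addr0.
have d' : is_derive ((fun t : R => t * c + p) 0) (1 : R) F dF by rewrite mul0r add0r.
have [e1 e2] := @is_derive1_comp _ F (fun t : R => t * c + p) 0 _ _ d' dL.
have E : (fun h : R => h^-1 *: ((F \o (fun t : R => t * c + p) \o shift 0) (h *: (1 : R)) - (F \o (fun t : R => t * c + p)) 0))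
  = (fun h : R => h^-1 *: (((fun x => F (s * Defs.coord i x + b)) \o shift x) (h *: v) - F (s * Defs.coord i x + b))).
  apply/funext => h /=; congr (_ *: (F _ - F _)); last by rewrite mul0r add0r.
  by rewrite coord_lin /c /p /GRing.scale/= mulr1 addr0; ring.
rewrite /derivable E in e1; rewrite /derive E in e2.
by apply: DeriveDef; [exact: e1|rewrite [LHS]e2 mulrC].
Qed.

Lemma flat_alg_derive f (v : V) : flat_alg f ->
  (forall x, derivable f x v) /\ flat_alg (fun x => 'D_v f x).
Proof.
elim=> [c n i s b|{}f g ff [df Df] fg [dg Dg]|{}f g ff [df Df] fg [dg Dg]].
- have d x := is_deriveZ c (is_derive_coord_comp v (is_derive_flat n (s * Defs.coord i x + b))).
  split => [x|]; first by have [] := d x.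
  rewrite (_ : (fun x => _) = (fun x => c * (s * Defs.coord i v) * - n%:R * flat n.+1 (s * Defs.coord i x + b) +
     c * (s * Defs.coord i v) * flat n.+2 (s * Defs.coord i x + b))).
    by apply: flat_algD; exact: flat_alg_gen.
  apply/funext => x; have [_ ->] := d x; rewrite /GRing.scale/=; ring.
- split => [x|]; first exact: derivableD.
  rewrite (_ : (fun x => _) = (fun x => 'D_v f x + 'D_v g x)); first exact: flat_algD.
  by apply/funext => x; rewrite deriveD.
- split => [x|]; first exact: derivableM.
  rewrite (_ : (fun x => _) = (fun x => f x * 'D_v g x + g x * 'D_v f x)).
    by apply: flat_algD; apply: flat_algM.
  by apply/funext => x; rewrite deriveM.
Qed.

Lemma flat_alg_smooth f : flat_alg f -> smooth f.
Proof.
move=> ff s; have {}ff : flat_alg (iter_deriv s f).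
  by elim: s => //= v s /(flat_alg_derive v)[].
split; first exact: flat_alg_continuous.
by move=> x v; have [] := flat_alg_derive v ff.
Qed.

(** With values in [0, 1] and converging pointwise to the indicator of ]a, b[ as m grows: the
    dilation by m + 1 sharpens the cutoff at both ends without moving the support. *)
Definition bump1 (m : nat) (a b t : R) : R :=
  flat 0 (m.+1%:R * (t - a)) * flat 0 (m.+1%:R * (b - t)).

Lemma flat01 l : 0 <= flat 0 l <= 1.
Proof.
apply/andP; split; first exact: flat_ge0.
rewrite /flat; case: ifPn => [l0|_]; last exact: ler01.
rewrite (_ : l ^- 0 = 1); last by rewrite expr0 invr1.
rewrite mul1r expRN invf_le1 ?expR_gt0//.
by rewrite ltW// expR_gt1 invr_gt0.
Qed.

Lemma bump1_01 m a b t : 0 <= bump1 m a b t <= 1.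
Proof.
have /andP[h1 h2] := flat01 (m.+1%:R * (t - a)).
have /andP[h3 h4] := flat01 (m.+1%:R * (b - t)).
by rewrite mulr_ge0//= mulr_ile1.
Qed.

Lemma bump1_out m a b t : ~~ (a < t < b) -> bump1 m a b t = 0.
Proof.
rewrite negb_and -!leNgt => /orP[ta|bt]; rewrite /bump1 /flat.
- by rewrite [X in X * _]ifF ?mul0r//; apply/negbTE; rewrite -leNgt mulr_ge0_le0// subr_le0.
- by rewrite [X in _ * X]ifF ?mulr0//; apply/negbTE; rewrite -leNgt mulr_ge0_le0// subr_le0.
Qed.

Lemma flat_cvg (u : R) : 0 < u -> (fun m : nat => flat 0 (m.+1%:R * u)) @ \oo --> (1 : R).
Proof.
move=> u0; have -> : (fun m : nat => flat 0 (m.+1%:R * u)) = (fun m : nat => expR (- u^-1 * m.+1%:R^-1)).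
  apply/funext => m; rewrite /flat mulr_gt0// expr0 invr1 mul1r invfM; congr expR; ring.
have h : (fun m : nat => - u^-1 * m.+1%:R^-1) @ \oo --> - u^-1 * 0.
  by apply: cvgM; [exact: cvg_cst|exact: cvg_harmonic].
by have := cvg_comp _ _ h (@continuous_expR R _); rewrite mulr0 expR0.
Qed.

Lemma bump1_cvg (a b t : R) :
  (fun m => bump1 m a b t) @ \oo --> (if a < t < b then 1 else 0 : R).
Proof.
case: ifPn => [/andP[at_ tb]|n]; last first.
  by rewrite (_ : (fun m => _) = cst 0); [exact: cvg_cst|apply/funext => m; exact: bump1_out].
by rewrite -[X in _ --> X]mulr1; apply: cvgM; apply: flat_cvg; rewrite subr_gt0.
Qed.

Definition bump (m : nat) (A B C : R * R) (x : V) : R :=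
  bump1 m A.1 A.2 x.1.1 * bump1 m B.1 B.2 x.1.2 * bump1 m C.1 C.2 x.2.

Lemma bump_test m A B C : test_function (bump m A B C).
Proof.
have g (i : 'I_3) (a b : R) : flat_alg (fun x => bump1 m a b (Defs.coord i x)).
  have -> : (fun x : V => bump1 m a b (Defs.coord i x)) = (fun x =>
     (1 * flat 0 (m.+1%:R * Defs.coord i x + m.+1%:R * - a)) *
     (1 * flat 0 (- m.+1%:R * Defs.coord i x + m.+1%:R * b))).
    apply/funext => x; rewrite /bump1 !mul1r; congr (flat 0 _ * flat 0 _); ring.
  by apply: flat_algM; exact: flat_alg_gen.
split.
  apply: flat_alg_smooth; apply: flat_algM; first apply: flat_algM.
  - exact: (g (Ordinal (isT : 0 < 3)%N)).
  - exact: (g (Ordinal (isT : 1 < 3)%N)).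
  - exact: (g (Ordinal (isT : 2 < 3)%N)).
exists (`|A.1| + `|A.2| + `|B.1| + `|B.2| + `|C.1| + `|C.2|) => x; apply: contraTeq.
rewrite /bump mulf_eq0 negb_or => /andP[]; rewrite mulf_eq0 negb_or => /andP[h1 h2] h3.
rewrite -leNgt.
have k a b t : bump1 m a b t != 0 -> `|t| <= `|a| + `|b|.
  apply: contraNT; rewrite -ltNge => h; apply/eqP; apply: bump1_out; apply: contraTN h.
  move=> /andP[ta tb]; rewrite -leNgt ler_norml.
  by have := ler_norm b; have := ler_norm (- a); rewrite normrN; have := normr_ge0 a; have := normr_ge0 b; lra.
have {}h1 := k _ _ _ h1; have {}h2 := k _ _ _ h2; have {}h3 := k _ _ _ h3.
have e2 : enorm x ^+ 2 <= (`|x.1.1| + `|x.1.2| + `|x.2|) ^+ 2.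
  rewrite sqr_enorm -(real_normK (num_real x.1.1)) -(real_normK (num_real x.1.2)) -(real_normK (num_real x.2)).
  have := normr_ge0 x.1.1; have := normr_ge0 x.1.2; have := normr_ge0 x.2; nra.
apply: (@le_trans _ _ (`|x.1.1| + `|x.1.2| + `|x.2|)); last by lra.
by rewrite -(ler_pXn2r (n := 2))// nnegrE ?enorm_ge0// !addr_ge0.
Qed.
End bumps.

(** * The fundamental lemma of the calculus of variations *)

Section fundamental_lemma.
Variable R : realType.
Local Notation R3 := (R3 R).
Local Notation mu := (@lebesgue_measure R).
Local Notation mu3 := (mu3 R).
Implicit Types (x : R3).

(** The sets over which g integrates to 0 form a Dynkin system. E is a window on which g is
    integrable and plays the part of the whole space, which is why the integral over E is required
    to vanish. *)
Lemma dynkin_integral0 d d' (T : measurableType d) (T' : measurableType d')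
    (m : {measure set T -> \bar R}) (g : T -> R) (pr : T -> T') (E : set T) (G : set (set T')) :
  measurable_fun setT pr -> measurable E -> m.-integrable E (EFin \o g) ->
  @measurable _ T' = <<s G >> -> setI_closed G ->
  (\int[m]_(x in E) (g x)%:E = 0)%E ->
  (forall A, G A -> \int[m]_(x in E `&` pr @^-1` A) (g x)%:E = 0)%E ->
  forall A, measurable A -> (\int[m]_(x in E `&` pr @^-1` A) (g x)%:E = 0)%E.
Proof.
move=> mpr mE gi GE GI E0 GP A mA.
have mp B : measurable B -> measurable (E `&` pr @^-1` B).
  by move=> mB; apply: measurableI => //; rewrite -[X in measurable X]setTI; exact: mpr.
have mg := measurable_int _ gi.
apply: (dynkin_induction (P := fun A => (\int[m]_(x in E `&` pr @^-1` A) (g x)%:E = 0)%E) GE GI); last by rewrite -GE.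
- by rewrite preimage_setT setIT.
- exact: GP.
- move=> S mS S0.
  have EU : E = (E `&` pr @^-1` S) `|` (E `&` pr @^-1` (~` S)).
    by rewrite preimage_setC -setIUr setUv setIT.
  move: E0; rewrite [X in (\int[m]_(x in X) _)%E]EU integral_setU; last first.
  - by rewrite disj_set2E preimage_setC setIACA setICr setI0.
  - by rewrite -EU.
  - by apply: mp; exact: measurableC.
  - exact: mp.
  by rewrite S0 add0e.
- move=> F mF tF F0; rewrite preimage_bigcup setI_bigcupr integral_bigcup.
  + by rewrite eseries0.
  + apply/trivIsetP => i j _ _ ij; have /trivIsetP/(_ i j Logic.I Logic.I ij) := tF.
    by rewrite setIACA -(preimage_setI pr) => ->; rewrite preimage_set0 setI0.
  + by move=> k; exact: mp.
  + apply: integrableS gi => //; last by move=> x [k _ []].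
    by apply: bigcupT_measurable => k; exact: mp.
Qed.

Definition box (A B C : set R) : set R3 := (A `*` B) `*` C.

Lemma measurable_box3 (A B C : set R) : measurable A -> measurable B -> measurable C ->
  measurable (box A B C).
Proof. by move=> mA mB mC; apply: measurableX => //; exact: measurableX. Qed.

Lemma setI_closed_itvoo : setI_closed (@RGenOpens.G R).
Proof.
move=> _ _ [a [b ->]] [c [e ->]]; exists (Num.max a c), (Num.min b e).
apply/seteqP; split => x /=; rewrite !in_itv/= gt_max lt_min.
- by move=> [/andP[-> ->] /andP[-> ->]].
- by move=> /andP[/andP[-> ->] /andP[-> ->]].
Qed.

Lemma setI_closed_prod d1 d2 (T1 : measurableType d1) (T2 : measurableType d2) :
  setI_closed [set A `*` B | A in @measurable _ T1 & B in @measurable _ T2].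
Proof.
move=> _ _ [A mA [B mB <-]] [A' mA' [B' mB' <-]].
exists (A `&` A'); first exact: measurableI.
by exists (B `&` B'); [exact: measurableI|rewrite setXI].
Qed.

Lemma box_integral0 (g : R3 -> R) (M : R) (I := `]- M, M[%classic : set R) :
  mu3.-integrable (box I I I) (EFin \o g) ->
  (forall A B C, RGenOpens.G A -> RGenOpens.G B -> RGenOpens.G C ->
    \int[mu3]_(x in box (I `&` A) (I `&` B) (I `&` C)) (g x)%:E = 0)%E ->
  \forall x \ae mu3, box I I I x -> g x = 0.
Proof.
move=> gi Z0.
have mI : measurable I by exact: measurable_itv.
have GI : RGenOpens.G I by exists (- M), M.
have fst1 : measurable_fun setT (fun x : R3 => x.1.1) := measurableT_comp measurable_fst measurable_fst.
have snd1 : measurable_fun setT (fun x : R3 => x.1.2) := measurableT_comp measurable_snd measurable_fst.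
have snd2 : measurable_fun setT (fun x : R3 => x.2) := measurable_snd.
have genR : @measurable _ (measurableTypeR R) = <<s (@RGenOpens.G R) >> := RGenOpens.measurableE R.
have Gm A : RGenOpens.G A -> @measurable _ (measurableTypeR R) A.
  by move=> GA; rewrite genR; exact: sub_sigma_algebra.
have sub A B C : A `<=` I -> B `<=` I -> C `<=` I -> measurable A -> measurable B -> measurable C ->
    mu3.-integrable (box A B C) (EFin \o g).
  move=> AI BI CI mA mB mC; apply: integrableS gi.
  - by apply: measurable_box3.
  - by apply: measurable_box3.
  - by move=> x [[/AI ? /BI ?] /CI ?]; split; [split|].
have II : I `&` I = I by rewrite setIid.
have IA A : I `&` A `<=` I by exact: subIsetl.
have mIA A : measurable A -> measurable (I `&` A) by exact: measurableI.
have Z1 A B C : measurable A -> RGenOpens.G B -> RGenOpens.G C ->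
  (\int[mu3]_(x in box (I `&` A) (I `&` B) (I `&` C)) (g x)%:E = 0)%E.
  move=> mA GB GC.
  have eq A' : box I (I `&` B) (I `&` C) `&` (fun x : R3 => x.1.1) @^-1` A' = box (I `&` A') (I `&` B) (I `&` C).
    by apply/seteqP; split=> [x [[[? ?] ?] ?]|x [[[? ?] ?] ?]]; (split; [split|]).
  rewrite -eq; apply: (dynkin_integral0 fst1 _ _ genR setI_closed_itvoo _ _ mA).
  - by apply: measurable_box3 => //; apply: mIA; exact: Gm.
  - by apply: sub => //; apply: mIA; exact: Gm.
  - by rewrite -[X in box X _ _]II; exact: Z0.
  - by move=> A' GA'; rewrite eq; exact: Z0.
have Z2 A B C : measurable A -> measurable B -> RGenOpens.G C ->
  (\int[mu3]_(x in box (I `&` A) (I `&` B) (I `&` C)) (g x)%:E = 0)%E.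
  move=> mA mB GC.
  have eq A' : box (I `&` A) I (I `&` C) `&` (fun x : R3 => x.1.2) @^-1` A' = box (I `&` A) (I `&` A') (I `&` C).
    by apply/seteqP; split=> [x [[[? ?] ?] ?]|x [[? [? ?]] ?]]; (split; [split|]).
  rewrite -eq; apply: (dynkin_integral0 snd1 _ _ genR setI_closed_itvoo _ _ mB).
  - by apply: measurable_box3 => //; apply: mIA => //; exact: Gm.
  - by apply: sub => //; apply: mIA => //; exact: Gm.
  - by rewrite -[X in box _ X _]II; exact: Z1.
  - by move=> A' GA'; rewrite eq; exact: Z1.
have Z3 A B C : measurable A -> measurable B -> measurable C ->
  (\int[mu3]_(x in box (I `&` A) (I `&` B) (I `&` C)) (g x)%:E = 0)%E.
  move=> mA mB mC.
  have eq A' : box (I `&` A) (I `&` B) I `&` (fun x : R3 => x.2) @^-1` A' = box (I `&` A) (I `&` B) (I `&` A').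
    by apply/seteqP; split=> [x [[[? ?] ?] ?]|x [[? ?] [? ?]]]; (split; [split|]).
  rewrite -eq; apply: (dynkin_integral0 snd2 _ _ genR setI_closed_itvoo _ _ mC).
  - by apply: measurable_box3 => //; apply: mIA.
  - by apply: sub => //; apply: mIA.
  - by rewrite -[X in box _ _ X]II; exact: Z2.
  - by move=> A' GA'; rewrite eq; exact: Z2.
have mprod := measurable_prod_measurableType.
have Z4 (D : set (R * R)) C : measurable D -> measurable C ->
  (\int[mu3]_(x in box I I (I `&` C) `&` (fun x : R3 => x.1) @^-1` D) (g x)%:E = 0)%E.
  move=> mD mC.
  have eq A B : box I I (I `&` C) `&` (fun x : R3 => x.1) @^-1` (A `*` B) = box (I `&` A) (I `&` B) (I `&` C).
    by apply/seteqP; split=> [x [[[? ?] ?] [? ?]]|x [[[? ?] [? ?]] ?]]; (split; [split|]).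
  apply: (dynkin_integral0 (measurable_fst : measurable_fun setT (fun x : R3 => x.1)) _ _ (mprod _ _ _ _) (@setI_closed_prod _ _ _ _) _ _ mD).
  - by apply: measurable_box3 => //; apply: mIA.
  - by apply: sub => //; apply: mIA.
  - by rewrite -[X in box X _ _]II -[X in box _ X _]II; exact: Z3.
  - by move=> _ [A mA [B mB <-]]; rewrite eq; exact: Z3.
have Z5 (S : set R3) : measurable S -> (\int[mu3]_(x in box I I I `&` (fun x : R3 => x) @^-1` S) (g x)%:E = 0)%E.
  move=> mS.
  have eq D C : box I I I `&` (fun x : R3 => x) @^-1` (D `*` C) = box I I (I `&` C) `&` (fun x : R3 => x.1) @^-1` D.
    by apply/seteqP; split=> [x [[[? ?] ?] [? ?]]|x [[[? ?] [? ?]] ?]]; (split; [split|]).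
  apply: (dynkin_integral0 (@measurable_id _ _ setT) _ gi (mprod _ _ _ _) (@setI_closed_prod _ _ _ _) _ _ mS).
  - exact: measurable_box3.
  - by rewrite -[X in box X _ _]II -[X in box _ X _]II -[X in box _ _ X]II; exact: Z3.
  - by move=> _ [D mD [C mC <-]]; rewrite eq; exact: Z4.
have mB := measurable_box3 mI mI mI.
have h : ae_eq mu3 (box I I I) (EFin \o g) (cst 0%E).
  apply: (integral_ae_eq mB gi); first exact: measurable_cst.
  move=> S SB mS; have := Z5 S mS; rewrite (_ : box I I I `&` _ = S) => [->|].
    by rewrite integral0.
  by apply/seteqP; split => [x []//|x Sx]; split => //; exact: SB.
by apply: ae_imp h => x h Bx; have [] := h Bx.
Qed.

Lemma loc_integrable_measurable (g : R3 -> R) : loc_integrable g -> measurable_fun setT g.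
Proof.
move=> lg.
have -> : setT = \bigcup_n [set x : R3 | enorm x <= n%:R].
  apply/seteqP; split => // x _; exists (Num.truncn (enorm x)).+1 => //=.
  by rewrite ltW// -truncn_lt_nat// enorm_ge0.
apply/measurable_fun_bigcup; first by move=> n; exact: measurable_ball3.
by move=> n; have /measurable_int/measurable_EFinP := lg n%:R.
Qed.

(** Bump functions converge boundedly to the indicator of a box, so g integrates to 0 over every
    bounded open box by dominated convergence, and these boxes generate the Borel sets. *)
Lemma loc_integrable0 (g : R3 -> R) : loc_integrable g ->
  (forall phi, test_function phi -> pairing g phi = 0) ->
  \forall x \ae mu3, g x = 0.
Proof.
move=> lg g0; have mg := loc_integrable_measurable lg.
have gB M : mu3.-integrable (box `]- M, M[ `]- M, M[ `]- M, M[) (EFin \o g).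
  apply: integrableS (lg (3 * M)).
  - exact: measurable_ball3.
  - by apply: measurable_box3; exact: measurable_itv.
  - move=> x [[]]; rewrite /= !in_itv/= => h1 h2 h3.
    rewrite -(ler_pXn2r (n := 2))// ?nnegrE ?enorm_ge0//; last by lra.
    by rewrite sqr_enorm; nra.
have box0 A B C : RGenOpens.G A -> RGenOpens.G B -> RGenOpens.G C ->
    (exists M, box A B C `<=` box `]- M, M[ `]- M, M[ `]- M, M[) ->
    (\int[mu3]_(x in box A B C) (g x)%:E = 0)%E.
  move=> [a [b ->]] [c [d ->]] [e [f ->]] [M sM].
  pose ph m := bump m (a, b) (c, d) (e, f).
  pose ind (x : R3) : R := (if a < x.1.1 < b then 1 else 0) * (if c < x.1.2 < d then 1 else 0) * (if e < x.2 < f then 1 else 0).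
  pose BM := box `]- M, M[ `]- M, M[ `]- M, M[.
  have mBM : measurable BM by apply: measurable_box3; exact: measurable_itv.
  pose G (x : R3) : R := if x \in BM then `|g x| else 0.
  have iG : mu3.-integrable setT (EFin \o G).
    by apply: ((@integrable_if _ _ _ mu3 _ (fun x => `|g x|) mBM).1); exact: integrable_norm (gB M).
  have tph m : test_function (ph m) by exact: bump_test.
  have mind : measurable_fun setT ind.
    have mi1 (p q : R) : measurable_fun setT (fun t : R => if p < t < q then 1 else 0 : R).
      by apply: measurable_fun_ifT; mfun.
    by apply: measurable_funM; [apply: measurable_funM|]; apply: (mcomp (mi1 _ _)); mfun.
  have mf m : measurable_fun setT (fun x => (g x * ph m x)%:E).
    apply/measurable_EFinP; apply: measurable_funM => //; exact: test_measurable.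
  have mf' : measurable_fun setT (fun x => (g x * ind x)%:E).
    by apply/measurable_EFinP; exact: measurable_funM.
  have cv : \forall x \ae mu3, setT x -> (fun m => (g x * ph m x)%:E) @ \oo --> (g x * ind x)%:E.
    apply: aeW => x _; apply: cvg_EFin; first by near=> n.
    apply: cvgM; first exact: cvg_cst.
    by apply: cvgM; [apply: cvgM|]; exact: bump1_cvg.
  have dom : \forall x \ae mu3, forall m, setT x -> (`|(g x * ph m x)%:E| <= (EFin \o G) x)%E.
    apply: aeW => x m _; rewrite /= lee_fin normrM /G.
    have /andP[p1 p2] := bump1_01 m a b x.1.1; have /andP[p3 p4] := bump1_01 m c d x.1.2.
    have /andP[p5 p6] := bump1_01 m e f x.2.
    case: ifPn => xB.
      have ph0 : 0 <= ph m x by apply: mulr_ge0 => //; exact: mulr_ge0.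
      rewrite -[leRHS]mulr1; apply: ler_wpM2l => //; rewrite (ger0_norm ph0).
      by apply: mulr_ile1; [exact: mulr_ge0| |apply: mulr_ile1|].
    rewrite (_ : ph m x = 0) ?normr0 ?mulr0//; apply/eqP; apply: contraNT xB => p0.
    rewrite inE; apply: sM; move: p0; rewrite /ph /bump /= mulf_eq0 negb_or mulf_eq0 negb_or.
    move=> /andP[/andP[q1 q2] q3]; split; [split|]; rewrite /= in_itv/=.
    - by apply: contraNT q1 => /(bump1_out m) ->.
    - by apply: contraNT q2 => /(bump1_out m) ->.
    - by apply: contraNT q3 => /(bump1_out m) ->.
  have [_ _] := dominated_convergence measurableT mf mf' cv iG dom.
  have -> : (fun n => \int[mu3]_x (g x * ph n x)%:E)%E = cst 0%E.
    apply/funext => m; have := g0 _ (tph m); rewrite /pairing /Rintegral => h.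
    rewrite -[LHS]fineK ?h//; apply: (integrable_fin_num measurableT).
    exact: (loc_integrable_mul lg (tph m)).
  move=> h; have := cvg_lim (@ereal_hausdorff R) h; rewrite lim_cst// => h0.
  rewrite integral_if [RHS]h0; apply: eq_integral => x _; rewrite /ind.
  have -> : (x \in box `]a, b[ `]c, d[ `]e, f[) = [&& a < x.1.1 < b, c < x.1.2 < d & e < x.2 < f].
    apply/idP/idP => [/set_mem[[]]|/and3P[q1 q2 q3]]; last first.
      by rewrite inE; split; [split|]; rewrite /= in_itv.
    by rewrite /= !in_itv/= => -> -> ->.
  by do 3 case: (_ < _ < _); rewrite /= ?(mulr0,mul0r,mulr1).
have aeM (n : nat) : \forall x \ae mu3, box `]- n%:R, n%:R[ `]- n%:R, n%:R[ `]- n%:R, n%:R[ x -> g x = 0.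
  apply: box_integral0 => // A B C GA GB GC; apply: box0.
  - by apply: setI_closed_itvoo => //; exists (- n%:R), n%:R.
  - by apply: setI_closed_itvoo => //; exists (- n%:R), n%:R.
  - by apply: setI_closed_itvoo => //; exists (- n%:R), n%:R.
  - by exists n%:R => x [[[? _] [? _]] [? _]]; split; [split|].
have /ae_imp := ae_foralln aeM; apply => x h.
pose n := (Num.truncn (`|x.1.1| + `|x.1.2| + `|x.2|)).+1.
have n1 : `|x.1.1| + `|x.1.2| + `|x.2| < n%:R by rewrite -truncn_lt_nat// !addr_ge0.
by apply: (h n); split; [split|]; rewrite /= in_itv/= -ltr_norml; apply: le_lt_trans n1;
  have := normr_ge0 x.1.1; have := normr_ge0 x.1.2; have := normr_ge0 x.2; lra.
Unshelve. all: by end_near. Qed.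

Lemma weak_grad_unique (u : R3 -> R) (g g' : 'I_3 -> R3 -> R) i :
  is_weak_grad u g -> is_weak_grad u g' -> \forall x \ae mu3, g i x = g' i x.
Proof.
move=> [_ lg hg] [_ lg' hg'].
have : \forall x \ae mu3, g i x - g' i x = 0.
  apply: loc_integrable0.
    move=> M; apply: integrable_subr; [exact: measurable_ball3|exact: lg|exact: lg'].
  move=> phi tphi; rewrite /pairing.
  have i1 := loc_integrable_mul (lg i) tphi; have i2 := loc_integrable_mul (lg' i) tphi.
  under eq_Rintegral do rewrite mulrBl.
  rewrite (@RintegralB _ _ _ mu3 setT _ _ measurableT i1 i2).
  have := hg phi tphi i; rewrite hg'// => /oppr_inj; rewrite /pairing => ->.
  by rewrite subrr.
by apply: ae_imp => x /eqP; rewrite subr_eq0 => /eqP.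
Qed.
End fundamental_lemma.

(** * The truncated nonlinearity *)

Section tools.
Variable R : realType.
Local Notation mu := (@lebesgue_measure R).
Implicit Types (k l W : R -> R).

Lemma bounded_locint k : measurable_fun setT k ->
  (forall M, exists C, forall z, `|z| <= M -> `|k z| <= C) -> locint k.
Proof.
move=> mk h; split => // M; have [C hC] := h M.
apply: (@le_integrable_real _ _ _ mu `[- M, M]%classic _ (cst C)) => //.
- exact: measurable_funS mk.
- by move=> z; rewrite /= in_itv/= -ler_norml => /hC.
- by apply: continuous_integrable_itv; exact: cst_continuous.
Qed.

Lemma locint_prim l : locint l -> locint (prim l).
Proof.
move=> ll; apply: bounded_locint; first exact: measurable_prim ll.1.
by move=> M; exists (prim (fun t => `|l t|) M) => z /ler_normlP[_ zM]; exact: norm_prim_le.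
Qed.

Lemma locint_norm l : locint l -> locint (fun t : R => `|l t|).
Proof.
by move=> [ml il]; split; [exact: measurableT_comp|move=> M; apply: integrable_norm; exact: il].
Qed.

Lemma locint_bounded_mul k l : locint k -> measurable_fun setT l ->
  (forall M, exists C, forall z, `|z| <= M -> `|l z| <= C) -> locint (fun z : R => k z * l z).
Proof.
move=> lk ml h; split; first by apply: measurable_funM => //; exact: lk.1.
move=> M; have [C hC] := h M.
apply: (@le_integrable_real _ _ _ mu `[- M, M]%classic _ (fun z : R => C * `|k z|)) => //.
- by apply: measurable_funS (measurable_funM lk.1 ml).
- by move=> z; rewrite /= in_itv/= -ler_norml => /hC h'; rewrite normrM mulrC ler_wpM2r.
- by apply: integrable_mulr => //; apply: integrable_norm; exact: lk.2.
Qed.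

Lemma locint_mulr (c : R) k : locint k -> locint (fun z : R => c * k z).
Proof.
move=> [mk ik]; split; first by apply: measurable_funM; mfun.
by move=> M; apply: integrable_mulr.
Qed.

Lemma locint_sub k l : locint k -> locint l -> locint (fun z : R => k z - l z).
Proof. by move=> lk ll; apply: locint_add => //; exact: locint_N. Qed.

Lemma prim_lt0 l (y : R) : y < 0 -> prim l y = 0.
Proof. by move=> y0; rewrite /prim set_itv_ge ?Rintegral_set0// bnd_simp -ltNge. Qed.

Lemma primD k l y : locint k -> locint l -> prim (fun z => k z + l z) y = prim k y + prim l y.
Proof.
move=> lk ll; rewrite /prim RintegralD//; exact: locint_itv.
Qed.

Lemma primB k l y : locint k -> locint l -> prim (fun z => k z - l z) y = prim k y - prim l y.
Proof.
move=> lk ll; rewrite /prim RintegralB//; exact: locint_itv.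
Qed.

Lemma primZ (c : R) k y : locint k -> prim (fun z => c * k z) y = c * prim k y.
Proof.
move=> lk; rewrite /prim RintegralZl//; exact: locint_itv.
Qed.

Lemma eq_prim k l y : (forall z, 0 <= z <= y -> k z = l z) -> prim k y = prim l y.
Proof. by move=> h; apply: eq_Rintegral => z; rewrite mem_setE in_itv/=; exact: h. Qed.

Lemma le_prim k l y : locint k -> locint l -> (forall z, 0 <= z <= y -> k z <= l z) ->
  prim k y <= prim l y.
Proof.
move=> lk ll h; apply: le_Rintegral; [exact: measurable_itv|exact: locint_itv|exact: locint_itv|].
by move=> z; rewrite /= in_itv/=; exact: h.
Qed.

Lemma norm_prim k y : locint k -> `|prim k y| <= prim (fun z => `|k z|) y.
Proof. by move=> lk; exact: norm_prim_le. Qed.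

Lemma prim_cst (c y : R) : 0 <= y -> prim (cst c) y = c * y.
Proof. by move=> y0; rewrite /prim /Rintegral integral_itv_cst//= subr0. Qed.

Lemma locint_continuous (f : R -> R) : continuous f -> locint f.
Proof.
move=> cf; split; first exact: continuous_measurable_fun.
by move=> M; exact: continuous_integrable_itv.
Qed.

Lemma norm_prim_cst k (C y : R) : 0 <= y -> locint k -> (forall z, 0 <= z <= y -> `|k z| <= C) ->
  `|prim k y| <= C * y.
Proof.
move=> y0 lk kC; apply: le_trans (norm_prim _ lk) _; rewrite -prim_cst//.
by apply: le_prim => //; [exact: locint_norm|apply: locint_continuous; exact: cst_continuous].
Qed.

Lemma prim_sub l (a b : R) : locint l -> 0 <= a -> a <= b ->
  prim l b - prim l a = \int[mu]_(z in `[a, b]) l z.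
Proof.
move=> ll a0 ab.
have fi : mu.-integrable `[0, b] (EFin \o l) by exact: locint_itv.
rewrite /prim (@Rintegral_itvB _ l (BLeft 0) (BRight b) a fi) ?bnd_simp//.
apply: Rintegral_itv_obnd_cbnd; apply: integrableS fi => //.
by apply: subset_itvr; rewrite bnd_simp.
Qed.

(** The chain rule for the square of a primitive that may not be differentiable everywhere. Fubini
    on a triangle gives the same integral for k(z) prim k z and for k(z) (prim k y - prim k z). *)
Lemma sqr_prim k (y : R) : locint k -> 0 <= y ->
  prim k y ^+ 2 = 2 * prim (fun z => k z * prim k z) y.
Proof.
move=> lk y0; have mk := lk.1.
pose f (p : R * R) : R := if (0 <= p.2) && (p.2 <= p.1) && (p.1 <= y) then k p.1 * k p.2 else 0.
have mf : measurable_fun setT f.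
  by apply: measurable_fun_ifT; [mfun|apply: measurable_funM; apply: (mcomp mk); mfun|mfun].
have lkn := locint_norm lk.
have fi : (mu \x mu)%E.-integrable setT (EFin \o f).
  apply: (@integrable_prod _ _ _ _ _ mu mu f
    (fun x => (if x \in `[0%R, y]%classic then `|k x| * prim (fun z => `|k z|) y else 0)%:E)) => //.
  - move=> x; apply: (@le_trans _ _ (\int[mu]_(z in `[0%R, y]) (if (0 <= x) && (x <= y) then `|k x| * `|k z| else 0)%:E)%E).
      rewrite [leRHS]integral_if; apply: ge0_le_integral_nomeas => z; first by rewrite lee_fin.
      rewrite mem_setE in_itv/= /f /=; case: ifPn => [/andP[/andP[z0 zx] xy]|_].
        by rewrite z0 (le_trans zx xy) (le_trans z0 zx) xy/= normrM.
      by rewrite normr0; case: ifP => // _; rewrite lee_fin; case: ifP => // _; rewrite mulr_ge0.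
    rewrite mem_setE in_itv/=; case: ifPn => _; last by rewrite integral0.
    rewrite (_ : (\int[mu]_(z in _) _)%E = (prim (fun z => `|k x| * `|k z|) y)%:E); last first.
      rewrite /prim /Rintegral fineK//; apply: integrable_fin_num; first exact: measurable_itv.
      by apply: integrable_mulr; [exact: measurable_itv|exact: locint_itv].
    by rewrite primZ.
  - apply/measurable_EFinP; apply: measurable_fun_ifT => //; last first.
      by apply: measurable_funM => //; exact: measurableT_comp.
    by under eq_fun do rewrite mem_setE in_itv/=; mfun.
  - have h : mu.-integrable `[0, y] (EFin \o (fun x => prim (fun z => `|k z|) y * `|k x|)).
      by apply: integrable_mulr; [exact: measurable_itv|exact: locint_itv].
    have /integrableP[_] := h; rewrite integral_if; apply: le_lt_trans.
    apply: ge0_le_integral_nomeas => x.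
      by rewrite lee_fin; case: ifP => // _; rewrite mulr_ge0//; apply: Rintegral_ge0.
    by case: ifP => // _; rewrite /= lee_fin mulrC ler_norm.
have := RFubini fi.
have -> : \int[mu]_x \int[mu]_z f (x, z) = prim (fun z => k z * prim k z) y.
  rewrite /prim [RHS]Rintegral_if; apply: eq_Rintegral => x _; rewrite mem_setE in_itv/=.
  case: ifPn => [/andP[x0 xy]|nx]; last first.
    rewrite /Rintegral integral0_eq// => z _; rewrite /f /= ifF//; apply: contraNF nx.
    by move=> /andP[/andP[z0 zx] ->]; rewrite (le_trans z0 zx).
  rewrite -RintegralZl; [|exact: measurable_itv|exact: locint_itv].
  rewrite [RHS]Rintegral_if; apply: eq_Rintegral => z _; rewrite mem_setE in_itv/= /f /=.
  by rewrite xy andbT.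
have -> : \int[mu]_z \int[mu]_x f (x, z) = prim (fun z => k z * (prim k y - prim k z)) y.
  rewrite /prim [RHS]Rintegral_if; apply: eq_Rintegral => z _; rewrite mem_setE in_itv/=.
  case: ifPn => [/andP[z0 zy]|nz]; last first.
    rewrite /Rintegral integral0_eq// => x _; rewrite /f /= ifF//; apply: contraNF nz.
    by move=> /andP[/andP[-> zx] xy]; rewrite (le_trans zx xy).
  rewrite -/(prim k y) -/(prim k z) prim_sub// -RintegralZl; [|exact: measurable_itv|exact: locint_itv].
  rewrite [RHS]Rintegral_if; apply: eq_Rintegral => x _; rewrite mem_setE in_itv/= /f /=.
  by rewrite z0 /= mulrC.
under [X in _ = X -> _]eq_prim => z _ do rewrite mulrBr.
have lp := locint_prim lk.
have lkp : locint (fun z : R => k z * prim k z).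
  apply: locint_bounded_mul => //; first exact: lp.1.
  by move=> M; exists (prim (fun t => `|k t|) M) => z /ler_normlP[_ zM]; exact: norm_prim_le.
have lkc : locint (fun z : R => k z * prim k y).
  by have := locint_mulr (prim k y) lk; under eq_fun do rewrite mulrC.
rewrite primB// (_ : prim (fun z => k z * prim k y) y = prim k y * prim k y).
  by rewrite expr2; lra.
by rewrite -primZ//; apply: eq_prim => z _; rewrite mulrC.
Qed.

(** Cauchy-Schwarz, from the nonnegativity of the integral of (W - c)^2 with c the mean of W. *)
Lemma sqr_Rintegral_le W (a b : R) : a < b -> mu.-integrable `[a, b] (EFin \o W) ->
  mu.-integrable `[a, b] (EFin \o (fun x => W x ^+ 2)) ->
  (\int[mu]_(x in `[a, b]) W x) ^+ 2 <= (b - a) * \int[mu]_(x in `[a, b]) W x ^+ 2.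
Proof.
move=> ab iW iW2; set S := \int[mu]_(x in _) W x; set S2 := \int[mu]_(x in _) _.
have ba : 0 < b - a by rewrite subr_gt0.
pose c := S / (b - a).
have mI := measurable_itv `[a, b].
have ic : mu.-integrable `[a, b] (EFin \o (fun _ : R => c ^+ 2)).
  by apply: (continuous_integrable_itv (f := cst (c ^+ 2))); exact: cst_continuous.
have i2 : mu.-integrable `[a, b] (EFin \o (fun x => 2 * c * W x)) by exact: integrable_mulr.
have : 0 <= \int[mu]_(x in `[a, b]) (W x ^+ 2 - 2 * c * W x + c ^+ 2).
  by apply: Rintegral_ge0 => x _; rewrite (_ : _ + _ = (W x - c) ^+ 2) ?sqr_ge0//; ring.
rewrite RintegralD//; last exact: integrable_subr.
rewrite RintegralB// RintegralZl// [X in _ + X]/Rintegral (integral_itv_cst _ (ltW ab))/=.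
rewrite -/S -/S2 => h; have Sc : S = c * (b - a) by rewrite /c mulfVK// gt_eqF.
have : (b - a) * (S2 - 2 * c * S + c ^+ 2 * (b - a)) >= 0 by rewrite mulr_ge0// ltW.
by rewrite {1}Sc; rewrite Sc; nra.
Qed.

(** In the exponential weight each integration gains a factor 1 / lam; the Picard map integrates
    twice, once in s and once in y. *)
Lemma weight_prim (g : R -> R) (D lam : R) : 0 < lam -> 0 <= D -> measurable_fun setT g ->
  (forall z, `|g z| <= D * expR (lam * `|z|)) ->
  locint g /\ forall y, `|prim g y| <= D / lam * expR (lam * `|y|).
Proof.
move=> l0 D0 mg gD.
have lg : locint g.
  apply: bounded_locint => // M; exists (D * expR (lam * M)) => z zM.
  by apply: le_trans (gD z) _; rewrite ler_wpM2l// ler_expR ler_wpM2l// ltW.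
split => // y; have [y0|y0] := leP 0 y; last first.
  by rewrite prim_lt0// normr0 mulr_ge0 ?expR_ge0// divr_ge0// ltW.
have dE (x : R) : is_derive x (1 : R) (fun z => D / lam * expR (lam * z)) (D * expR (lam * x)).
  have d1 : is_derive x (1 : R) (fun z : R => lam * z) lam.
    by have := is_deriveZ lam (is_derive_id x (1 : R)); rewrite /GRing.scale/= mulr1.
  have := is_deriveZ (D / lam) (@is_derive1_comp _ expR (fun z : R => lam * z) x _ _ (is_derive_expR _) d1).
  move=> [e1 e2]; apply: DeriveDef; first exact: e1.
  rewrite [LHS]e2 /GRing.scale/=; have l00 : lam != 0 by rewrite gt_eqF.
  by move: (expR _) => E; field.
have cE : continuous (fun z => D * expR (lam * z)).
  move=> x; apply: cvgM; first exact: cvg_cst.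
  apply: (@continuous_comp _ _ _ (fun z : R => lam * z) expR); last exact: continuous_expR.
  by apply: cvgM; [exact: cvg_cst|exact: cvg_id].
apply: le_trans (norm_prim _ lg) _.
apply: (@le_trans _ _ (prim (fun z => D * expR (lam * z)) y)).
  apply: le_prim; [exact: locint_norm|exact: locint_continuous|].
  by move=> z /andP[z0 _]; have := gD z; rewrite (ger0_norm z0).
rewrite /prim /Rintegral (FTC2_derive y0 cE (fun x _ => dE x))/= (ger0_norm y0) gerBl.
by rewrite mulr_ge0 ?expR_ge0// divr_ge0// ltW.
Qed.

(** The intervals [[a n, b n]] are nested, so the supremum of their left ends lies in all of them;
    this gives the limit together with its rate. *)
Lemma geometric_limit (u : nat -> R) (M : R) : (forall n, `|u n.+1 - u n| <= M / 2 ^+ n) ->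
  exists l : R, forall n, `|u n - l| <= 2 * M / 2 ^+ n.
Proof.
move=> h; have M0 : 0 <= M by have := le_trans (normr_ge0 _) (h 0%N); rewrite expr0 divr1.
pose a n := u n - 2 * M / 2 ^+ n; pose b n := u n + 2 * M / 2 ^+ n.
have e n : 2 * M / 2 ^+ n.+1 = M / 2 ^+ n.
  by rewrite exprS invfM mulrACA divff ?mul1r.
have p n : 0 <= M / 2 ^+ n by rewrite divr_ge0// exprn_ge0.
have e2 n : 2 * M / 2 ^+ n = 2 * (M / 2 ^+ n) by rewrite mulrA.
have aS n : a n <= a n.+1 by have := h n; rewrite /a e e2 ler_norml; lra.
have bS n : b n.+1 <= b n by have := h n; rewrite /b e e2 ler_norml; lra.
have am m n : (m <= n)%N -> a m <= a n.
  by move=> /subnK <-; elim: (n - m)%N => // d IH; rewrite addSn (le_trans IH).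
have bm m n : (m <= n)%N -> b n <= b m.
  by move=> /subnK <-; elim: (n - m)%N => // d IH; rewrite addSn (le_trans _ IH).
have ab m n : a m <= b n.
  have [mn|nm] := leqP m n.
    by apply: le_trans (am _ _ mn) _; rewrite /a /b e2; have := p n; lra.
  by apply: le_trans (bm _ _ (ltnW nm)); rewrite /a /b e2; have := p m; lra.
have hs : has_sup (range a) by split; [exists (a 0%N), 0%N|exists (b 0%N) => _ [m _ <-]].
exists (sup (range a)) => n.
have l1 : a n <= sup (range a) by apply: (ub_le_sup hs.2); exists n.
have l2 : sup (range a) <= b n by apply: ge_sup; [exact: hs.1|move=> _ [m _ <-]; exact: ab].
by move: l1 l2; rewrite /a /b ler_norml; lra.
Qed.

Lemma measurable_prim_param d (T : measurableType d) (h : T * R -> R) (g : T -> R) :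
  measurable_fun setT h -> measurable_fun setT g ->
  measurable_fun setT (fun q : T => prim (fun s => h (q, s)) (g q)).
Proof.
move=> mh mg; rewrite /prim; under eq_fun do rewrite Rintegral_if.
apply: (measurable_Rintegral_param mu (fun p : T * R => if p.2 \in `[0, g p.1]%classic then h (p.1, p.2) else 0)).
apply: measurable_fun_ifT; [|by apply: (mcomp mh); apply: measurable_fun_pair; mfun|mfun].
under eq_fun do rewrite mem_setE in_itv/=.
apply: measurable_and; mfun.
by apply: (mcomp mg); mfun.
Qed.

Lemma powR_lipschitz (p Q a b : R) : 1 <= p -> 0 <= a -> a <= b -> b <= Q ->
  b `^ p - a `^ p <= p * Q `^ (p - 1) * (b - a).
Proof.
move=> p1 a0 ab bQ.
have p0 : 0 < p by lra.
(* The continuity required by the mean value theorem is taken from the derivative, which is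
   available only at positive points. *)
have [a00|an0] := eqVneq a 0.
  rewrite a00 powR0 ?gt_eqF// !subr0; have b0 : 0 <= b by rewrite -a00.
  rewrite -(mulr_powRB1 b0 p0) mulrC ler_wpM2r//.
  have h : b `^ (p - 1) <= Q `^ (p - 1) by apply: ge0_ler_powR => //; rewrite ?nnegrE ?subr_ge0// (le_trans b0).
  by apply: le_trans h _; rewrite ler_peMl// powR_ge0.
have a_gt0 : 0 < a by rewrite lt_def an0.
have d (x : R) : 0 < x -> is_derive x (1 : R) (fun x => x `^ p) (p * x `^ (p - 1)).
  by move=> x0; exact: is_derive1_powR.
have [||c cab ->] := @MVT_segment R (fun x => x `^ p) (fun x => p * x `^ (p - 1)) a b ab.
- by move=> x; rewrite in_itv/= => /andP[ax _]; apply: d; exact: lt_trans ax.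
- apply: continuous_in_subspaceT => x; rewrite inE/= in_itv/= => /andP[ax _].
  by apply: is_derive_continuous; apply: d; exact: lt_le_trans ax.
move: cab; rewrite in_itv/= => /andP[ac cb].
apply: ler_wpM2r; first by rewrite subr_ge0.
apply: ler_wpM2l; first exact: ltW.
apply: ge0_ler_powR; rewrite ?nnegrE ?subr_ge0//.
- exact: le_trans ac.
- by apply: le_trans a0 _; exact: le_trans bQ.
- exact: le_trans bQ.
Qed.


(* The truncated power q^(N/2), applied to q = u^2. *)
Definition tpow (N K q : R) : R := (Num.min q (K ^+ 2)) `^ (N / 2).

Lemma tpow_ge0 N K q : 0 <= tpow N K q.
Proof. exact: powR_ge0. Qed.

Lemma measurable_tpow N K : measurable_fun setT (tpow N K).
Proof.
apply: (measurableT_comp (measurable_powR _)); apply: measurable_minr; mfun.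
Qed.

Lemma le_tpow N K q q' : 2 <= N -> 0 <= q -> q <= q' -> tpow N K q <= tpow N K q'.
Proof.
move=> N2 q0 qq'; have q'0 := le_trans q0 qq'; have K2 := sqr_ge0 K.
apply: ge0_ler_powR; rewrite ?nnegrE ?le_min ?q0 ?q'0//; first by apply: divr_ge0 => //; lra.
by rewrite !ge_min qq' lexx /= orbT.
Qed.

Lemma tpow_le N K q : 2 <= N -> 0 <= q -> tpow N K q <= (K ^+ 2) `^ (N / 2).
Proof.
move=> N2 q0; have K2 := sqr_ge0 K.
apply: ge0_ler_powR; rewrite ?nnegrE ?le_min ?q0//; first by apply: divr_ge0 => //; lra.
by rewrite ge_min lexx orbT.
Qed.

Lemma tpowE N K q : q <= K ^+ 2 -> tpow N K q = q `^ (N / 2).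
Proof. by move=> qK; rewrite /tpow min_l. Qed.

(** The derivative of q^(N/2) at the level q = K^2; since N >= 2 it bounds the slope below that
    level. *)
Definition tpow_lip (N K : R) : R := N / 2 * (K ^+ 2) `^ (N / 2 - 1).

Lemma tpow_lip_ge0 N K : 2 <= N -> 0 <= tpow_lip N K.
Proof. by move=> N2; rewrite /tpow_lip mulr_ge0 ?powR_ge0// divr_ge0//; lra. Qed.

Lemma tpow_lipschitz_min N K q q' : 2 <= N -> 0 <= q -> q <= q' ->
  tpow N K q' - tpow N K q <= tpow_lip N K * (Num.min q' (K ^+ 2) - Num.min q (K ^+ 2)).
Proof.
move=> N2 q0 qq'; apply: powR_lipschitz.
- by rewrite ler_pdivlMr//; lra.
- by rewrite le_min q0 sqr_ge0.
- by rewrite le_min !ge_min qq' lexx !orbT.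
- by rewrite ge_min lexx orbT.
Qed.

Lemma tpow_lipschitz N K q q' : 2 <= N -> 0 <= q -> 0 <= q' ->
  `|tpow N K q - tpow N K q'| <= tpow_lip N K * `|q - q'|.
Proof.
move=> N2; have L0 := tpow_lip_ge0 K N2.
wlog qq' : q q' / q <= q'.
  move=> H q0 q'0; have [qq'|/ltW q'q] := leP q q'; first exact: H.
  by rewrite distrC [X in _ <= _ * X]distrC; exact: H.
move=> q0 q'0; rewrite distrC ger0_norm ?subr_ge0 ?le_tpow//.
apply: le_trans (tpow_lipschitz_min _ N2 q0 qq') _; rewrite ler_wpM2l//.
rewrite distrC ger0_norm ?subr_ge0//.
by rewrite /Num.min; case: ltP => h1; case: ltP => h2; lra.
Qed.

(** With v = r u the argument is u^2, so this is |u|^N v as long as |u| <= K and K^N v beyond.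
    Truncating the even factor only keeps it monotone in v^2, as the work of the flux requires. *)
Definition cut_flux (N K v r : R) : R := v * tpow N K (v ^+ 2 / r ^+ 2).

Lemma ratio_ge0 (v r : R) : 0 <= v ^+ 2 / r ^+ 2.
Proof. by rewrite divr_ge0// sqr_ge0. Qed.

Lemma norm_cut_flux N K v r : 2 <= N -> `|cut_flux N K v r| <= (K ^+ 2) `^ (N / 2) * `|v|.
Proof.
by move=> N2; rewrite normrM mulrC ler_wpM2r// ger0_norm ?tpow_ge0// tpow_le// ratio_ge0.
Qed.

Definition flux_lip (N K : R) : R := (K ^+ 2) `^ (N / 2) + tpow_lip N K * (2 * K ^+ 2).

Lemma flux_lip_ge0 N K : 2 <= N -> 0 <= flux_lip N K.
Proof.
by move=> N2; rewrite addr_ge0 ?powR_ge0// mulr_ge0 ?tpow_lip_ge0// mulr_ge0// sqr_ge0.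
Qed.

(** The constant is independent of r: for |v| <= |v'| the variation of the power is multiplied by
    the smaller value |v|, and it vanishes unless |v| <= K r, which absorbs the inverse powers of
    r. *)
Lemma cut_flux_lipschitz N K v v' r : 2 <= N -> 0 <= K -> 0 < r ->
  `|cut_flux N K v r - cut_flux N K v' r| <= flux_lip N K * `|v - v'|.
Proof.
move=> N2 K0 r0; have r2 : 0 < r ^+ 2 by rewrite exprn_gt0.
wlog vv' : v v' / `|v| <= `|v'|.
  move=> H; have [?|/ltW ?] := leP `|v| `|v'|; first exact: H.
  by rewrite distrC [X in _ <= _ * X]distrC; exact: H.
pose q := v ^+ 2 / r ^+ 2; pose q' := v' ^+ 2 / r ^+ 2.
have q0 : 0 <= q := ratio_ge0 v r; have q'0 : 0 <= q' := ratio_ge0 v' r.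
have qq' : q <= q'.
  rewrite ler_pM2r ?invr_gt0// -(real_normK (num_real v)) -(real_normK (num_real v')).
  by rewrite ler_pXn2r// nnegrE.
have -> : cut_flux N K v r - cut_flux N K v' r = (v - v') * tpow N K q' + v * (tpow N K q - tpow N K q').
  by rewrite /cut_flux -/q -/q'; ring.
apply: le_trans (ler_normD _ _) _; rewrite /flux_lip [leRHS]mulrDl; apply: lerD.
  by rewrite normrM mulrC ler_wpM2r// ger0_norm ?tpow_ge0// tpow_le.
rewrite normrM distrC (ger0_norm (_ : 0 <= tpow N K q' - tpow N K q)) ?subr_ge0 ?le_tpow//.
have L0 := tpow_lip_ge0 K N2.
apply: (@le_trans _ _ (`|v| * (tpow_lip N K * (Num.min q' (K ^+ 2) - Num.min q (K ^+ 2))))).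
  by rewrite ler_wpM2l// tpow_lipschitz_min.
move: (tpow_lip N K) L0 => L L0; rewrite mulrCA -[leRHS]mulrA; apply: ler_wpM2l => //.
have [qK|Kq] : K ^+ 2 <= q \/ q < K ^+ 2 by case: ltP; [right|left].
  rewrite (min_r (le_trans qK qq')) (min_r qK) subrr mulr0.
  by apply: mulr_ge0 => //; apply: mulr_ge0 => //; apply: mulr_ge0 => //; exact: sqr_ge0.
pose x := `|v| / r; have qx : q = x ^+ 2 by rewrite /q /x expr_div_n real_normK// num_real.
pose x' := `|v'| / r; have qx' : q' = x' ^+ 2 by rewrite /q' /x' expr_div_n real_normK// num_real.
have x0 : 0 <= x by rewrite divr_ge0// ltW.
have xx' : x <= x' by rewrite ler_pM2r ?invr_gt0.
have xK : x <= K.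
  by rewrite -(ler_pXn2r (n := 2))// -qx ltW.
have vd : `|v'| - `|v| <= `|v - v'| by rewrite distrC lerB_dist.
have vr : `|v| = x * r by rewrite /x mulfVK// gt_eqF.
have vr' : `|v'| = x' * r by rewrite /x' mulfVK// gt_eqF.
have step : (Num.min q' (K ^+ 2) - Num.min q (K ^+ 2)) <= 2 * K * (x' - x).
  rewrite (min_l (ltW Kq)) qx qx'.
  have [h|h] := leP x' K.
    by apply: (@le_trans _ _ (x' ^+ 2 - x ^+ 2)); [rewrite lerB// ge_min lexx|nra].
  by apply: (@le_trans _ _ (K ^+ 2 - x ^+ 2)); [rewrite lerB// ge_min lexx orbT|nra].
have step0 : 0 <= Num.min q' (K ^+ 2) - Num.min q (K ^+ 2).
  by rewrite subr_ge0 le_min !ge_min qq' lexx !orbT.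
apply: (@le_trans _ _ (x * r * (2 * K * (x' - x)))); first by rewrite vr ler_wpM2l// mulr_ge0// ltW.
apply: (@le_trans _ _ (2 * K ^+ 2 * (`|v'| - `|v|))); last by rewrite ler_wpM2l// mulr_ge0// sqr_ge0.
have aux (X X' : R) : X <= X' -> X <= K ->
    X * r * (2 * K * (X' - X)) <= 2 * K ^+ 2 * (X' * r - X * r).
  move=> h1 h2; rewrite -subr_ge0 (_ : _ - _ = 2 * K * r * (K - X) * (X' - X)); last by ring.
  by rewrite !mulr_ge0// ?subr_ge0// ltW.
by rewrite vr vr'; exact: aux.
Qed.

Lemma cut_fluxE N K v r : 0 <= K -> 0 < r -> `|v| <= K * r ->
  cut_flux N K v r = `|v| `^ N * v * r `^ (- N).
Proof.
move=> K0 r0 vK; rewrite /cut_flux tpowE; last first.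
  rewrite ler_pdivrMr ?exprn_gt0// -exprMn -(real_normK (num_real v)).
  by rewrite ler_pXn2r// nnegrE mulr_ge0// ltW.
have -> : v ^+ 2 / r ^+ 2 = (`|v| / r) `^ 2%:R.
  rewrite powR_mulrn; last by rewrite divr_ge0// ltW.
  by rewrite expr_div_n real_normK// num_real.
rewrite -powRrM (_ : 2 * (N / 2) = N); last by field.
rewrite powRM// ?invr_ge0 ?ltW// mulrA [v * _]mulrC; congr (_ * _).
by rewrite -powR_inv1 ?ltW// -powRrM mulN1r.
Qed.

Lemma measurable_cut_flux d (T : measurableType d) N K (v r : T -> R) :
  measurable_fun setT v -> measurable_fun setT r ->
  measurable_fun setT (fun t => cut_flux N K (v t) (r t)).
Proof.
move=> mv mr; apply: measurable_funM => //.
apply: (mcomp (measurable_tpow N K)); apply: measurable_funM; mfun.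
by apply: measurable_funV; mfun.
Qed.

End tools.

(** * The sign of the work of a monotone flux *)

Section monotone_flux.
Variable R : realType.
Local Notation mu := (@lebesgue_measure R).
Implicit Types (g x W : R -> R).

Lemma prim_sub_ge g (c a b : R) : locint g -> 0 <= a -> a <= b ->
  (forall z, a <= z <= b -> c <= g z) -> c * (b - a) <= prim g b - prim g a.
Proof.
move=> lg a0 ab h; rewrite prim_sub//.
have -> : c * (b - a) = \int[mu]_(z in `[a, b]) c by rewrite /Rintegral integral_itv_cst.
apply: le_Rintegral; [exact: measurable_itv| |exact: locint_itv|].
  by apply: (continuous_integrable_itv (f := cst c)); exact: cst_continuous.
by move=> z; rewrite /= in_itv/=; exact: h.
Qed.

Lemma le_prim_sub g g' (a b : R) : locint g -> locint g' -> 0 <= a -> a <= b ->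
  (forall z, a <= z <= b -> g z <= g' z) -> prim g b - prim g a <= prim g' b - prim g' a.
Proof.
move=> lg lg' a0 ab h; rewrite !prim_sub//.
apply: le_Rintegral; [exact: measurable_itv|exact: locint_itv|exact: locint_itv|].
by move=> z; rewrite /= in_itv/=; exact: h.
Qed.

Lemma primN g y : locint g -> prim (fun z => - g z) y = - prim g y.
Proof. by move=> lg; rewrite /prim RintegralN. Qed.

Lemma prim_sub_le g (c a b : R) : locint g -> 0 <= a -> a <= b ->
  (forall z, a <= z <= b -> g z <= c) -> prim g b - prim g a <= c * (b - a).
Proof.
move=> lg a0 ab h; have := @prim_sub_ge (fun z => - g z) (- c) a b (locint_N lg) a0 ab.
by rewrite !primN// mulNr -opprD lerN2; apply => z /h; rewrite lerN2.
Qed.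

Lemma prim_ge0 g y : (forall z, 0 <= z <= y -> 0 <= g z) -> 0 <= prim g y.
Proof. by move=> h; apply: Rintegral_ge0 => z; rewrite /= in_itv/=; exact: h. Qed.

Lemma prim0 g : prim g 0 = 0.
Proof. by rewrite /prim set_itv1 /Rintegral integral_set1. Qed.

(* Riemann sums: Gam y is the primitive of M y, and its increment from (y, X) to (y', X') is
   at most M y X' * (X' - X). *)
Lemma monotone_flux (M : R -> R -> R) x (Mb Y : R) : 0 <= Y -> locint x ->
  (forall y, 0 <= y <= Y -> 0 <= prim x y) ->
  (forall y, measurable_fun setT (M y)) -> (forall y xi, 0 <= M y xi <= Mb) ->
  (forall y xi xi', 0 <= xi -> xi <= xi' -> M y xi <= M y xi') ->
  (forall y y' xi, 0 <= y -> y <= y' -> 0 <= xi -> M y' xi <= M y xi) ->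
  measurable_fun setT (fun z => M z (prim x z)) ->
  (forall e, 0 < e -> exists2 d, 0 < d & forall y z w, 0 <= y <= Y -> 0 <= z <= Y -> 0 <= w <= Y ->
     `|y - z| <= d -> `|w - z| <= d -> `|M z (prim x z) - M y (prim x w)| <= e) ->
  0 <= prim (fun z => M z (prim x z) * x z) Y.
Proof.
move=> Y0 lx X0 mM M0b Mxi My mMX unif.
have Mb0 : 0 <= Mb by have /andP[a b] := M0b 0 0; exact: le_trans b.
have lM y : locint (M y).
  apply: bounded_locint => // X; exists Mb => z _; have /andP[a b] := M0b y z.
  by rewrite ger0_norm.
have lMx : locint (fun z => M z (prim x z) * x z).
  have := @locint_bounded_mul _ x (fun z => M z (prim x z)) lx mMX.
  under eq_fun do rewrite mulrC; apply => X; exists Mb => z _; have /andP[a b] := M0b z (prim x z).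
  by rewrite ger0_norm.
(* After the decrease in y is used, the value at the new point b bounds the increment from above
   whether b lies to the right or to the left of a. *)
have step y y' a b : 0 <= y -> y <= y' -> 0 <= a -> 0 <= b ->
    prim (M y') b - prim (M y) a <= M y b * (b - a).
  move=> y0 yy' a0 b0; apply: (@le_trans _ _ (prim (M y) b - prim (M y) a)).
    by rewrite lerD2r; apply: le_prim => // z /andP[z0 _]; exact: My.
  have [ab|ba] := leP a b.
    by apply: prim_sub_le => // z /andP[az zb]; apply: Mxi => //; exact: le_trans az.
  rewrite -lerN2 opprB -mulrN opprB; apply: prim_sub_ge => //; first exact: ltW.
  by move=> z /andP[bz za]; exact: Mxi.
have lxn := locint_norm lx.
have main e : 0 < e -> 0 <= prim (fun z => M z (prim x z) * x z) Y + e * prim (fun z => `|x z|) Y.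
  move=> e0; have [d d0 hd] := unif e e0.
  pose n := (Num.truncn (Y / d)).+1.
  have n0 : (0 : R) < n%:R by rewrite ltr0n.
  have nd : Y / n%:R <= d.
    rewrite ler_pdivrMr// mulrC -ler_pdivrMr//; apply: ltW.
    by rewrite -truncn_lt_nat// divr_ge0// ltW.
  pose h := Y / n%:R; have h0 : 0 <= h by rewrite divr_ge0// ltW.
  have lG : locint (fun z => M z (prim x z) * x z + e * `|x z|).
    by apply: locint_add => //; exact: locint_mulr.
  pose G z := M z (prim x z) * x z + e * `|x z|.
  rewrite -primZ// -primD//; last exact: locint_mulr.
  (* Telescoping over the grid: [G] is the integrand plus e |x|, which pays for freezing the
     arguments of M on each cell. *)
  have ind i : (i <= n)%N -> prim (M (i%:R * h)) (prim x (i%:R * h)) <= prim G (i%:R * h).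
    elim: i => [_|i IH iN]; first by rewrite mul0r !prim0.
    have yi : 0 <= i%:R * h by rewrite mulr_ge0.
    have yS : i%:R * h <= i.+1%:R * h by rewrite ler_wpM2r// ler_nat.
    have yY : i.+1%:R * h <= Y.
      have -> : Y = n%:R * h by rewrite /h mulrC mulfVK// gt_eqF.
      by rewrite ler_wpM2r// ler_nat.
    have hd' : i.+1%:R * h - i%:R * h = h by rewrite -mulrBl -natrB// subSnn mul1r.
    have xi : 0 <= prim x (i%:R * h) by apply: X0; rewrite yi (le_trans yS).
    have xS : 0 <= prim x (i.+1%:R * h) by apply: X0; rewrite (le_trans yi yS).
    have s1 := step _ _ _ _ yi yS xi xS.
    have s2 : M (i%:R * h) (prim x (i.+1%:R * h)) * (prim x (i.+1%:R * h) - prim x (i%:R * h)) <=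
        prim G (i.+1%:R * h) - prim G (i%:R * h).
      rewrite mulrBr -!primZ//; apply: le_prim_sub => //; first exact: locint_mulr.
      move=> z /andP[z1 z2]; rewrite /G.
      have : `|M z (prim x z) - M (i%:R * h) (prim x (i.+1%:R * h))| <= e.
        apply: hd.
        - by rewrite yi (le_trans yS).
        - by rewrite (le_trans yi z1) (le_trans z2).
        - by rewrite (le_trans yi yS).
        - move: (i%:R * h) (i.+1%:R * h) z1 z2 hd' => a b z1 z2 hd'.
          by rewrite ler_norml; move: nd; rewrite -/h -hd'; lra.
        - move: (i%:R * h) (i.+1%:R * h) z1 z2 hd' => a b z1 z2 hd'.
          by rewrite ler_norml; move: nd; rewrite -/h -hd'; lra.
      move=> he; rewrite -subr_ge0.
      rewrite (_ : _ - _ = (M z (prim x z) - M (i%:R * h) (prim x (i.+1%:R * h))) * x z + e * `|x z|); last by ring.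
      have : `|(M z (prim x z) - M (i%:R * h) (prim x (i.+1%:R * h))) * x z| <= e * `|x z|.
        by rewrite normrM ler_wpM2r.
      by rewrite ler_norml => /andP[]; lra.
    by have := IH (ltnW iN); lra.
  have := ind n (leqnn n); rewrite (_ : n%:R * h = Y); last by rewrite /h mulrC mulfVK// gt_eqF.
  apply: le_trans.
  by apply: prim_ge0 => z _; have /andP[] := M0b Y z.
have P0 : 0 <= prim (fun z => `|x z|) Y by exact: prim_ge0.
rewrite leNgt; apply/negP => I0.
pose I := prim (fun z => M z (prim x z) * x z) Y.
(* For this e the error is at most half of |I|, so a negative I contradicts [main]; the 1 in the
   denominator covers the case of a zero integral. *)
have e0 : 0 < - I / (2 * (prim (fun z => `|x z|) Y + 1)).
  by rewrite divr_gt0 ?oppr_gt0// mulr_gt0// ltr_pwDr.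
have := main _ e0; rewrite -/I.
have : - I / (2 * (prim (fun z => `|x z|) Y + 1)) * prim (fun z => `|x z|) Y <= - I / 2.
  rewrite invfM mulrA -mulrA ler_piMr//; first by rewrite divr_ge0// oppr_ge0 ltW.
  by rewrite mulrC ler_pdivrMr ?mul1r ?lerDl// ltr_pwDr.
by move: I0; rewrite -/I; lra.
Qed.

(** Holder continuity of exponent 1/2, by Cauchy-Schwarz between w and z. *)
Lemma prim_holder W (Y z w : R) : locint W -> locint (fun z => W z ^+ 2) ->
  0 <= z <= Y -> 0 <= w <= Y ->
  (prim W z - prim W w) ^+ 2 <= `|z - w| * prim (fun z => W z ^+ 2) Y.
Proof.
move=> lW lW2; wlog zw : z w / w <= z.
  move=> H hz hw; have [wz|/ltW zw] := leP w z; first exact: H.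
  by rewrite distrC -sqrrN opprB; exact: H.
move=> /andP[z0 zY] /andP[w0 wY].
have [->|nzw] := eqVneq w z; first by rewrite !subrr normr0 mul0r expr0n.
have {}zw : w < z by rewrite lt_neqAle nzw.
rewrite prim_sub ?(ltW zw)//.
have := sqr_Rintegral_le zw (locint_itv w z lW) (locint_itv w z lW2).
rewrite -prim_sub ?(ltW zw)// => /le_trans; apply.
rewrite gtr0_norm ?subr_gt0//; apply: ler_wpM2l; first by rewrite subr_ge0 ltW.
rewrite -prim_sub ?(ltW zw)//.
apply: (@le_trans _ _ (prim (fun z => W z ^+ 2) z)).
  by rewrite gerBl; apply: prim_ge0 => y _; exact: sqr_ge0.
rewrite -subr_ge0; have := @prim_sub_ge (fun z => W z ^+ 2) 0 z Y lW2 z0 zY.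
by rewrite mul0r; apply => y _; exact: sqr_ge0.
Qed.

Lemma prim_swap (h : R -> R -> R) g (Y t : R) : 0 <= Y -> 0 <= t ->
  measurable_fun setT (fun p : R * R => h p.1 p.2) -> locint g ->
  (forall y s, 0 <= y <= Y -> 0 <= s <= t -> `|h y s| <= g y) ->
  prim (fun y => prim (h y) t) Y = prim (fun s => prim (h ^~ s) Y) t.
Proof.
move=> Y0 t0 mh lg hg.
pose f (p : R * R) : R := if (0 <= p.1 <= Y) && (0 <= p.2 <= t) then h p.1 p.2 else 0.
have mf : measurable_fun setT f by apply: measurable_fun_ifT; mfun.
have fi : (mu \x mu)%E.-integrable setT (EFin \o f).
  apply: (@integrable_prod _ _ _ _ _ mu mu f
    (fun y => (if y \in `[0%R, Y]%classic then t * `|g y| else 0)%:E)) => //.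
  - move=> y; apply: (@le_trans _ _ (\int[mu]_(z in `[0%R, t]) (if 0 <= y <= Y then `|g y| else 0)%:E)%E).
      rewrite [leRHS]integral_if; apply: ge0_le_integral_nomeas => s; first by rewrite lee_fin.
      rewrite mem_setE in_itv/= /f /=; case: ifPn => [/andP[hy hs]|_].
        by rewrite hy hs lee_fin; apply: le_trans (hg _ _ hy hs) _; exact: ler_norm.
      by rewrite normr0; case: ifP => // _; rewrite lee_fin; case: ifP.
    rewrite integral_itv_cst// mem_setE in_itv/= lee_fin subr0 mulrC.
    by case: ifP => _; rewrite ?mulr0.
  - apply/measurable_EFinP; apply: measurable_fun_ifT => //; last first.
      by apply: measurable_funM => //; apply: measurableT_comp => //; exact: lg.1.
    by under eq_fun do rewrite mem_setE in_itv/=; mfun.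
  - have hi : mu.-integrable `[0, Y] (EFin \o (fun y => t * `|g y|)).
      by apply: integrable_mulr; [exact: measurable_itv|apply: locint_itv; exact: locint_norm].
    have /integrableP[_] := hi; rewrite integral_if; apply: le_lt_trans.
    apply: ge0_le_integral_nomeas => y.
      by rewrite lee_fin; case: ifP => // _; rewrite mulr_ge0.
    by case: ifP => // _; rewrite /= lee_fin ler_norm.
have := RFubini fi.
have -> : \int[mu]_y \int[mu]_s f (y, s) = prim (fun y => prim (h y) t) Y.
  rewrite /prim [RHS]Rintegral_if; apply: eq_Rintegral => y _; rewrite mem_setE in_itv/=.
  case: ifPn => hy; last by rewrite /Rintegral integral0_eq// => s _; rewrite /f /= (negbTE hy).
  by rewrite [RHS]Rintegral_if; apply: eq_Rintegral => s _; rewrite mem_setE in_itv/= /f /= hy.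
move=> ->; rewrite /prim [RHS]Rintegral_if; apply: eq_Rintegral => s _; rewrite mem_setE in_itv/=.
case: ifPn => hs; last by rewrite /Rintegral integral0_eq// => y _; rewrite /f /= (negbTE hs) andbF.
by rewrite [RHS]Rintegral_if; apply: eq_Rintegral => y _; rewrite mem_setE in_itv/= /f /= hs andbT.
Qed.
End monotone_flux.

(** * The radial equation in characteristic coordinates *)

Section goursat.
Variable R : realType.
Local Notation mu := (@lebesgue_measure R).
Variables (N K B : R) (k0 : R -> R).
Hypotheses (N2 : 2 <= N) (K0 : 0 <= K) (B0 : 0 <= B).
Hypotheses (lk0 : locint k0) (k0B : forall y, 0 <= y -> `|prim k0 y| <= B * y).

(* In the norm weighted by growth the Picard map contracts by 1/2, because the Lipschitz constant
   of the flux is at most growth_rate^2. *)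
Definition growth_rate : R := flux_lip N K + 1.
Definition growth (y t : R) : R := expR (growth_rate * `|y|) * expR (growth_rate * `|t|).
Local Notation Kp := ((K ^+ 2) `^ (N / 2)).
Local Notation lam := growth_rate.
Local Notation wt := growth.

Let Kp0 : 0 <= Kp. Proof. exact: powR_ge0. Qed.
Let L0 : 0 <= flux_lip N K. Proof. exact: flux_lip_ge0. Qed.
Let lam1 : 1 <= lam. Proof. by rewrite lerDr. Qed.
Let lam0 : 0 < lam. Proof. exact: lt_le_trans lam1. Qed.
Let Llam : flux_lip N K <= lam ^+ 2.
Proof. by rewrite /growth_rate; have := L0; move: (flux_lip N K) => L L_ge0; nra. Qed.
Let Kplam : Kp <= lam ^+ 2.
Proof.
apply: le_trans Llam; rewrite lerDl; apply: mulr_ge0; first exact: tpow_lip_ge0.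
by rewrite mulr_ge0// sqr_ge0.
Qed.
Let wt0 y t : 0 <= wt y t. Proof. by rewrite mulr_ge0 ?expR_ge0. Qed.

(** The fixed point is posed on the whole plane, where y + s takes every sign; the flux is even in
    r. *)
Lemma cut_flux_lipschitz_all v v' r :
  `|cut_flux N K v r - cut_flux N K v' r| <= flux_lip N K * `|v - v'|.
Proof.
have sq (r1 r2 : R) v1 : r1 ^+ 2 = r2 ^+ 2 -> cut_flux N K v1 r1 = cut_flux N K v1 r2.
  by move=> h; rewrite /cut_flux h.
have [r0|r0|r0] := ltgtP r 0.
- by rewrite !(sq r (- r)) ?sqrrN//; apply: cut_flux_lipschitz => //; rewrite oppr_gt0.
- exact: cut_flux_lipschitz.
(* At r = 0 the quotient v^2 / r^2 is 0 by the convention on division, and 0 to a positive power is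
   0. *)
- have c0 : tpow N K 0 = 0.
    have N20 : 0 < N / 2 by apply: divr_gt0 => //; exact: lt_le_trans N2.
    by rewrite tpowE ?sqr_ge0// powR0// gt_eqF.
  by rewrite r0 /cut_flux expr0n invr0 !mulr0 c0 !mulr0 subrr normr0 mulr_ge0.
Qed.

Definition goursat_flux (v : R -> R -> R) (y s : R) := cut_flux N K (v y s) (y + s).

Definition goursat_W (v : R -> R -> R) (y t : R) : R :=
  k0 y - 2^-1 * prim (goursat_flux v y) t.

Definition goursat_V v y t := prim (goursat_W v ^~ t) y.

Definition controlled (E : R) (v : R -> R -> R) : Prop :=
  measurable_fun setT (fun p : R * R => v p.1 p.2) /\ forall y t, `|v y t| <= E * wt y t.

Lemma measurable_goursat_flux v : measurable_fun setT (fun p : R * R => v p.1 p.2) ->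
  measurable_fun setT (fun p : R * R => goursat_flux v p.1 p.2).
Proof. by move=> mv; apply: measurable_cut_flux; mfun. Qed.

Lemma measurable_goursat_W v : measurable_fun setT (fun p : R * R => v p.1 p.2) ->
  measurable_fun setT (fun p : R * R => goursat_W v p.1 p.2).
Proof.
move=> mv; apply: measurable_funB; first by apply: (mcomp lk0.1); mfun.
apply: measurable_funM; first mfun.
apply: (@measurable_prim_param R _ (R * R)%type (fun q : (R * R) * R => goursat_flux v q.1.1 q.2) (fun p : R * R => p.2)); last mfun.
apply: (mcomp (measurable_goursat_flux mv) (g := fun q : (R * R) * R => (q.1.1, q.2))).
by apply: measurable_fun_pair; mfun.
Qed.

Lemma measurable_goursat_V v : measurable_fun setT (fun p : R * R => v p.1 p.2) ->
  measurable_fun setT (fun p : R * R => goursat_V v p.1 p.2).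
Proof.
move=> mv.
apply: (@measurable_prim_param R _ (R * R)%type (fun q : (R * R) * R => goursat_W v q.2 q.1.2) (fun p : R * R => p.1)); last mfun.
apply: (mcomp (measurable_goursat_W mv) (g := fun q : (R * R) * R => (q.2, q.1.2))).
by apply: measurable_fun_pair; mfun.
Qed.

Lemma goursat_flux_bound v E z : controlled E v ->
  locint (goursat_flux v z) /\
  forall t, `|prim (goursat_flux v z) t| <= Kp * E / lam * expR (lam * `|t|) * expR (lam * `|z|).
Proof.
move=> [mv vE].
have E0 : 0 <= E by have := le_trans (normr_ge0 _) (vE 0 0); rewrite pmulr_lge0// mulr_gt0 ?expR_gt0.
have mf := measurable_goursat_flux mv.
have mfz : measurable_fun setT (goursat_flux v z).
  by apply: (mcomp mf (g := fun s : R => (z, s))); apply: measurable_fun_pair; mfun.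
have D0 : 0 <= Kp * E * expR (lam * `|z|) by rewrite !mulr_ge0 ?expR_ge0.
have fz s : `|goursat_flux v z s| <= Kp * E * expR (lam * `|z|) * expR (lam * `|s|).
  apply: le_trans (norm_cut_flux _ _ _ N2) _.
  by rewrite -!mulrA ler_wpM2l//; have := vE z s; rewrite /growth.
have [lf h] := weight_prim lam0 D0 mfz fz; split => // t; apply: le_trans (h t) _.
by rewrite le_eqVlt; apply/orP; left; apply/eqP; ring.
Qed.

Lemma locint_goursat_W v E t : controlled E v -> locint (goursat_W v ^~ t).
Proof.
move=> cv; have [mv vE] := cv.
have E0 : 0 <= E by have := le_trans (normr_ge0 _) (vE 0 0); rewrite pmulr_lge0// mulr_gt0 ?expR_gt0.
apply: locint_sub => //; apply: locint_mulr.
have mF : measurable_fun setT (fun y => prim (goursat_flux v y) t).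
  apply: (@measurable_prim_param R _ R (fun q : R * R => goursat_flux v q.1 q.2) (fun=> t)); last mfun.
  exact: measurable_goursat_flux.
have D0 : 0 <= Kp * E / lam * expR (lam * `|t|) by rewrite !mulr_ge0 ?expR_ge0// invr_ge0 ltW.
have [|] // := weight_prim lam0 D0 mF; move=> z; by have [_] := goursat_flux_bound z cv.
Qed.

(** The two integrations gain [growth_rate] to the power -2, the Lipschitz constant of the flux is
    at most [growth_rate] squared, and the coefficient 1/2 of the flux is what remains as the
    contraction factor. *)
Lemma goursat_difference v v' E E' D : controlled E v -> controlled E' v' -> 0 <= D ->
  (forall y t, `|v y t - v' y t| <= D * wt y t) ->
  forall y t, `|goursat_V v y t - goursat_V v' y t| <= D / 2 * wt y t.
Proof.
move=> [mv vE] [mv' v'E] D0 vv' y t.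
have mf := measurable_goursat_flux mv; have mf' := measurable_goursat_flux mv'.
have sec (h : R -> R -> R) y1 : measurable_fun setT (fun p : R * R => h p.1 p.2) -> measurable_fun setT (h y1).
  by move=> mh; apply: (mcomp mh (g := fun s : R => (y1, s))); apply: measurable_fun_pair; mfun.
have sec2 (h : R -> R -> R) t1 : measurable_fun setT (fun p : R * R => h p.1 p.2) -> measurable_fun setT (h ^~ t1).
  by move=> mh; apply: (mcomp mh (g := fun y : R => (y, t1))); apply: measurable_fun_pair; mfun.
have dW z : `|goursat_W v z t - goursat_W v' z t| <= D / 2 * lam * expR (lam * `|t|) * expR (lam * `|z|).
  have aux (a b c : R) : a - 2^-1 * b - (a - 2^-1 * c) = - (2^-1 * (b - c)) by ring.
  rewrite /goursat_W aux.
  rewrite -primB; [|exact: (goursat_flux_bound z (conj mv vE)).1|exact: (goursat_flux_bound z (conj mv' v'E)).1].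
  rewrite normrN normrM gtr0_norm ?invr_gt0//.
  have mfd : measurable_fun setT (fun s => goursat_flux v z s - goursat_flux v' z s).
    by apply: measurable_funB; exact: sec.
  have D1 : 0 <= flux_lip N K * D * expR (lam * `|z|) by rewrite !mulr_ge0 ?expR_ge0.
  have fd s : `|goursat_flux v z s - goursat_flux v' z s| <= flux_lip N K * D * expR (lam * `|z|) * expR (lam * `|s|).
    apply: le_trans (cut_flux_lipschitz_all _ _ _) _.
    by rewrite -!mulrA ler_wpM2l//; have := vv' z s; rewrite /growth.
  have [_ /(_ t)] := weight_prim lam0 D1 mfd fd => h.
  apply: (@le_trans _ _ (2^-1 * (flux_lip N K * D * expR (lam * `|z|) / lam * expR (lam * `|t|)))).
    by rewrite ler_pM2l ?invr_gt0.
  rewrite (_ : 2^-1 * _ = (flux_lip N K / lam) * (D / 2 * expR (lam * `|t|) * expR (lam * `|z|))); last by ring.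
  rewrite (_ : D / 2 * lam * _ * _ = lam * (D / 2 * expR (lam * `|t|) * expR (lam * `|z|))); last by ring.
  by rewrite ler_wpM2r ?mulr_ge0 ?expR_ge0 ?divr_ge0// ler_pdivrMr// -expr2.
rewrite /goursat_V -primB; [|exact: (locint_goursat_W t (conj mv vE))|exact: (locint_goursat_W t (conj mv' v'E))].
have mWd : measurable_fun setT (fun z => goursat_W v z t - goursat_W v' z t).
  by apply: measurable_funB; apply: sec2; exact: measurable_goursat_W.
have D1 : 0 <= D / 2 * lam * expR (lam * `|t|) by rewrite !mulr_ge0 ?expR_ge0// ltW.
have [_ /(_ y)] := weight_prim lam0 D1 mWd dW => h.
 apply: le_trans h _; rewrite le_eqVlt; apply/orP; left; apply/eqP; rewrite /growth.
have l0 : lam != 0 by rewrite gt_eqF.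
by move: (expR _) (expR _) => a b; field.
Qed.

Lemma goursat_V0 y t : goursat_V (fun _ _ => 0) y t = prim k0 y.
Proof.
apply: eq_prim => z _; rewrite /goursat_W (_ : prim _ t = 0) ?mulr0 ?subr0//.
rewrite (@eq_prim _ _ (fun=> 0)) => [|s _]; last by rewrite /goursat_flux /cut_flux mul0r.
by rewrite /prim /Rintegral integral0.
Qed.

Lemma prim_k0_wt y t : `|prim k0 y| <= B * wt y t.
Proof.
have [y0|y0] := ltP y 0; first by rewrite prim_lt0// normr0 mulr_ge0.
apply: le_trans (k0B y0) _; rewrite ler_wpM2l// /growth (ger0_norm y0).
apply: (@le_trans _ _ (expR (lam * y))).
  apply: le_trans (expR_ge1Dx _); have := ler_wpM2r y0 lam1; rewrite mul1r; lra.
by rewrite ler_peMr ?expR_ge0// -expR0 ler_expR mulr_ge0// ltW.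
Qed.

(** The free solution, which is the image of 0, has weighted norm at most B, and the contraction
    puts the image of v within B of it. *)
Lemma controlled_goursat_V v : controlled (2 * B) v -> controlled (2 * B) (goursat_V v).
Proof.
move=> [mv vB]; split; first exact: measurable_goursat_V.
move=> y t; have c0 : controlled 0 (fun _ _ => 0 : R).
  by split; [exact: measurable_cst|move=> ? ?; rewrite normr0 mul0r].
have B20 : 0 <= 2 * B by rewrite mulr_ge0.
have h0 := @goursat_difference v (fun _ _ => 0) _ _ (2 * B) (conj mv vB) c0 B20.
have {h0} h h1 := h0 h1 y t; rewrite goursat_V0 in h.
have {}h : `|goursat_V v y t - prim k0 y| <= B * wt y t.
  apply: le_trans (h _) _; first by move=> ? ?; rewrite subr0.
  by rewrite (_ : 2 * B / 2 = B)//; field.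
have := ler_normD (goursat_V v y t - prim k0 y) (prim k0 y); rewrite subrK.
have := prim_k0_wt y t; lra.
Qed.

Definition goursat_iter n := iter n goursat_V (fun _ _ => 0).

Lemma controlled_iter n : controlled (2 * B) (goursat_iter n).
Proof.
elim: n => [|n IH]; last exact: controlled_goursat_V.
by split; [exact: measurable_cst|move=> ? ?; rewrite normr0 mulr_ge0// mulr_ge0].
Qed.

Lemma goursat_iter_step n y t : `|goursat_iter n.+1 y t - goursat_iter n y t| <= B * wt y t / 2 ^+ n.
Proof.
elim: n y t => [|n IH] y t.
  by rewrite /goursat_iter /= goursat_V0 subr0 expr0 divr1 prim_k0_wt.
rewrite mulrAC.
have := @goursat_difference (goursat_iter n.+1) (goursat_iter n) _ _ (B / 2 ^+ n) (controlled_iter _) (controlled_iter _).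
move=> h0; have {h0} h h1 h2 := h0 h1 h2 y t; apply: le_trans (h _ _) _.
- by rewrite divr_ge0// exprn_ge0.
- by move=> y1 t1; have := IH y1 t1; rewrite mulrAC.
by rewrite (_ : B / 2 ^+ n.+1 = B / 2 ^+ n / 2)//; rewrite exprSr invfM mulrA.
Qed.

Lemma geometric_cvg (u : nat -> R) (M l : R) : (forall n, `|u n - l| <= M / 2 ^+ n) -> u @ \oo --> l.
Proof.
move=> h; have h2 : (fun n => M / 2 ^+ n) @ \oo --> M * 0.
  apply: cvgM; first exact: cvg_cst.
  rewrite (_ : (fun n => (2 ^+ n)^-1) = (fun n : nat => (2^-1 : R) ^+ n)).
    by apply: cvg_expr; rewrite gtr0_norm ?invr_gt0// invf_lt1// ltr1n.
  by apply/funext => n; rewrite exprVn.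
rewrite mulr0 in h2; apply/cvgrPdist_le => e e0.
have /cvgrPdist_le/(_ e e0) := h2; apply: filterS => n.
by rewrite sub0r normrN distrC => h3; apply: le_trans (h n) _; exact: le_trans (ler_norm _) h3.
Qed.

(** The convergence of the iterates is recorded because the bound linear in y is proved by induction
    on them and inherited by the limit. *)
Lemma goursat_exists : exists V : R -> R -> R,
  [/\ controlled (2 * B) V, V = goursat_V V &
     forall y t, goursat_iter ^~ y ^~ t @ \oo --> V y t].
Proof.
have ex (p : R * R) : exists l : R, forall n, `|goursat_iter n p.1 p.2 - l| <= 2 * (B * wt p.1 p.2) / 2 ^+ n.
  by apply: geometric_limit => n; exact: goursat_iter_step.
have [V0 hV0] := choice ex; pose V y t := V0 (y, t).
have hV n y t : `|goursat_iter n y t - V y t| <= 2 * (B * wt y t) / 2 ^+ n := hV0 (y, t) n.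
have cV y t : goursat_iter ^~ y ^~ t @ \oo --> V y t by exact: (geometric_cvg (fun n => hV n y t)).
have mV : measurable_fun setT (fun p : R * R => V p.1 p.2).
  apply: (@measurable_fun_cvg _ _ _ _ (fun n (p : R * R) => goursat_iter n p.1 p.2)).
  - by move=> n; have [] := controlled_iter n.
  - by move=> p _; exact: cV.
have VB y t : `|V y t| <= 2 * B * wt y t.
  by have := hV 0%N y t; rewrite /= sub0r normrN expr0 divr1 mulrA.
exists V; split => //; apply/funext => y; apply/funext => t.
have : (fun n => goursat_iter n.+1 y t) @ \oo --> goursat_V V y t.
  apply: (@geometric_cvg _ (B * wt y t)) => n.
  have := @goursat_difference (goursat_iter n) V _ _ (2 * B / 2 ^+ n) (controlled_iter n) (conj mV VB).
  move=> h0; have {h0} h h1 h2 := h0 h1 h2 y t; apply: le_trans (h _ _) _.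
  - by rewrite divr_ge0 ?mulr_ge0// exprn_ge0.
  - by move=> y1 t1; apply: le_trans (hV n y1 t1) _; rewrite le_eqVlt; apply/orP; left; apply/eqP; ring.
  by rewrite le_eqVlt; apply/orP; left; apply/eqP; field; rewrite expf_neq0.
move=> h2; have h1 := cV y t; rewrite -cvg_shiftS in h1.
exact: (cvg_unique _ h1 h2).
Qed.

(* In the region t * y * (2B)^N <= 1 the flux moves v by at most B y. *)
Lemma goursat_iter_small n y t : 0 <= y -> 0 <= t -> t * y * (2 * B) `^ N <= 1 ->
  `|goursat_iter n y t| <= 2 * B * y.
Proof.
have B20 : 0 <= 2 * B by rewrite mulr_ge0.
elim: n y t => [|n IH] y t y0 t0 h; first by rewrite normr0 mulr_ge0.
have cn := controlled_iter n; set v := goursat_iter n in IH cn.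
have p0 : 0 <= (2 * B) `^ N := powR_ge0 _ _.
have fb z s : 0 <= z <= y -> 0 <= s <= t -> `|goursat_flux v z s| <= 2 * B * y * (2 * B) `^ N.
  move=> /andP[z0 zy] /andP[s0 st].
  have vz : `|v z s| <= 2 * B * z.
    apply: IH => //; apply: le_trans h; apply: ler_wpM2r => //; exact: ler_pM.
  rewrite normrM (ger0_norm (tpow_ge0 _ _ _)); apply: ler_pM; rewrite ?tpow_ge0//.
    by apply: le_trans vz _; rewrite ler_wpM2l.
  have N20 : 0 <= N / 2 by apply: divr_ge0 => //; exact: le_trans N2.
  have rz : (v z s) ^+ 2 / (z + s) ^+ 2 <= (2 * B) ^+ 2.
    have [zs0|zs0] := eqVneq (z + s) 0; first by rewrite zs0 expr0n invr0 mulr0 sqr_ge0.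
    have zs : 0 < z + s by rewrite lt_def zs0 addr_ge0.
    rewrite ler_pdivrMr ?exprn_gt0// -exprMn -(real_normK (num_real (v z s))).
    rewrite ler_pXn2r ?nnegrE ?mulr_ge0 ?addr_ge0//; apply: le_trans vz _.
    by rewrite ler_wpM2l// lerDl.
  have -> : (2 * B) `^ N = ((2 * B) ^+ 2) `^ (N / 2).
    by rewrite -powR_mulrn// -powRrM; congr (_ `^ _); field.
  apply: ge0_ler_powR => //; rewrite ?nnegrE ?le_min ?ratio_ge0 ?sqr_ge0//.
  by apply: le_trans rz; rewrite ge_min lexx.
have [lW Wb] : locint (goursat_W v ^~ t) /\ forall z, 0 <= z <= y ->
    `|goursat_W v z t - k0 z| <= 2^-1 * (2 * B * y * (2 * B) `^ N * t).
  split; first exact: locint_goursat_W cn.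
  move=> z zy; have aux (a b : R) : a - b - a = - b by ring.
  rewrite /goursat_W aux normrN normrM gtr0_norm ?invr_gt0// ler_pM2l ?invr_gt0//.
  apply: norm_prim_cst => //; first exact: (goursat_flux_bound z cn).1.
  by move=> s; exact: fb.
have -> : goursat_iter n.+1 y t = prim (fun z => goursat_W v z t - k0 z) y + prim k0 y.
  by rewrite primB// subrK.
apply: le_trans (ler_normD _ _) _.
have h1 : `|prim (fun z => goursat_W v z t - k0 z) y| <= B * y.
  apply: le_trans (norm_prim_cst y0 _ Wb) _; first exact: locint_sub.
  have -> : 2^-1 * (2 * B * y * (2 * B) `^ N * t) * y = B * y * (t * y * (2 * B) `^ N).
    by move: ((2 * B) `^ N) => q; field.
  by rewrite ler_piMr// mulr_ge0.
by have := k0B y0; lra.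
Qed.

(** * The energy of the fixed point *)

Section fixed_point.
Variable V : R -> R -> R.
Hypotheses (cV : controlled (2 * B) V) (VE : V = goursat_V V).
Hypothesis lk02 : locint (fun y => k0 y ^+ 2).
Local Notation W := (goursat_W V).
Local Notation f := (goursat_flux V).

Lemma locint_W t : locint (W ^~ t).
Proof. exact: locint_goursat_W cV. Qed.

Lemma V_prim t y : V y t = prim (W ^~ t) y.
Proof. by rewrite {1}VE. Qed.

Lemma locint_flux y : locint (f y).
Proof. by have [] := goursat_flux_bound y cV. Qed.

Let mf : measurable_fun setT (fun p : R * R => f p.1 p.2).
Proof. by apply: measurable_goursat_flux; have [] := cV. Qed.

Let Cf (M t : R) := Kp * (2 * B) * (expR (lam * M) * expR (lam * t)).

Lemma flux_bound M t y s : `|y| <= M -> `|s| <= t -> `|f y s| <= Cf M t.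
Proof.
move=> yM st; apply: le_trans (norm_cut_flux _ _ _ N2) _; rewrite /Cf -mulrA ler_wpM2l//.
have [_ /(_ y s) h] := cV; apply: le_trans h _; rewrite /growth ler_wpM2l ?mulr_ge0//.
by apply: ler_pM; rewrite ?expR_ge0// ler_expR ler_wpM2l// ltW.
Qed.

Lemma prim_flux_bound M t y : 0 <= t -> `|y| <= M -> `|prim (f y) t| <= Cf M t * t.
Proof.
move=> t0 yM; apply: norm_prim_cst => //; first exact: locint_flux.
by move=> s /andP[s0 st]; apply: flux_bound => //; rewrite ger0_norm.
Qed.

(** The integrated form of (W^2)_t = - f W, which follows from W_t = - f / 2; [sqr_prim] makes it
    available without differentiating in t. *)
Lemma W_sqr y t : 0 <= t -> W y t ^+ 2 = k0 y ^+ 2 - prim (fun s => f y s * W y s) t.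
Proof.
move=> t0; have lf := locint_flux y.
have lp := locint_prim lf.
have lfp : locint (fun s => f y s * prim (f y) s).
  apply: locint_bounded_mul => //; first exact: lp.1.
  by move=> M; exists (prim (fun t => `|f y t|) M) => z /ler_normlP[_ zM]; exact: norm_prim_le.
have -> : prim (fun s => f y s * W y s) t = prim (fun s => k0 y * f y s - 2^-1 * (f y s * prim (f y) s)) t.
  by apply: eq_prim => s _; rewrite /goursat_W; ring.
rewrite primB; [|exact: locint_mulr|exact: locint_mulr].
rewrite !primZ// /goursat_W; have := sqr_prim lf t0.
move: (prim (f y) t) (prim (fun z => f y z * prim (f y) z) t) => a b h.
have -> : (k0 y - 2^-1 * a) ^+ 2 = k0 y ^+ 2 - k0 y * a + 4^-1 * a ^+ 2 by field.
by rewrite h; field.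
Qed.

Lemma locint_W2 t : 0 <= t -> locint (fun y => W y t ^+ 2).
Proof.
move=> t0; have [mWt _] := locint_W t.
have lb : locint (fun y => 2 * k0 y ^+ 2 + 2 * (2^-1 * prim (f y) t) ^+ 2).
  apply: locint_add; apply: locint_mulr => //.
  have mF : measurable_fun setT (fun y => prim (f y) t).
    by apply: (@measurable_prim_param R _ R (fun q : R * R => f q.1 q.2) (fun=> t)); last mfun.
  apply: bounded_locint; first by apply: measurable_funX; apply: measurable_funM; mfun.
  move=> M; exists ((2^-1 * (Cf M t * t)) ^+ 2) => z zM.
  rewrite normrX ler_pXn2r ?nnegrE//; last by rewrite mulr_ge0// (le_trans _ (prim_flux_bound t0 zM)).
  by rewrite normrM gtr0_norm ?invr_gt0// ler_pM2l ?invr_gt0// prim_flux_bound.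
split; first exact: measurable_funX.
move=> M; apply: (@le_integrable_real _ _ _ mu `[- M, M]%classic _ _ _ _ _ (lb.2 M)) => //.
  by apply: measurable_funS (measurable_funX _ mWt).
move=> y _; rewrite ger0_norm ?sqr_ge0// /goursat_W.
have aux (a b : R) : (a - b) ^+ 2 <= 2 * a ^+ 2 + 2 * b ^+ 2 by have := sqr_ge0 (a + b); nra.
exact: aux.
Qed.

(** The work of the flux is known to be nonnegative for s > 0 only, where y + s stays away from 0;
    the endpoint carries no mass. *)
Lemma prim_ge0_oc (g : R -> R) (t : R) : measurable_fun setT g -> (forall s : R, 0 < s -> s <= t -> 0 <= g s) ->
  0 <= prim g t.
Proof.
move=> mg h; rewrite /prim /Rintegral -integral_itv_obnd_cbnd; last first.
  by apply: measurable_funS (measurableT) _ _ => //; exact/measurable_EFinP.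
apply: fine_ge0; apply: integral_ge0 => s; rewrite /= in_itv/= => /andP[s0 st].
by rewrite lee_fin h.
Qed.

(** A negative base has power 1 by convention, hence the extra 1; [monotone_flux] asks for a bound
    at every real argument. *)
Lemma tpow_bounded q : 0 <= tpow N K q <= Kp + 1.
Proof.
rewrite tpow_ge0/=; have [q0|q0] := leP 0 q.
  by apply: le_trans (tpow_le K N2 q0) _; rewrite lerDl.
rewrite /tpow lt0_powR1 ?lerDr//; by rewrite gt_min q0.
Qed.

(* f W = M(y, V^2) (V^2)_y / 2 with M(y, .) nondecreasing and M(., X) nonincreasing. *)
Lemma flux_work_ge0 s Y : 0 < s -> 0 <= Y -> 0 <= prim (fun y => f y s * W y s) Y.
Proof.
move=> s0 Y0; have s0' := ltW s0.
have lW := locint_W s; have lW2 := locint_W2 s0'; have lp := locint_prim lW.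
have lWp : locint (fun z => W z s * prim (W ^~ s) z).
  apply: locint_bounded_mul => //; first exact: lp.1.
  by move=> M; exists (prim (fun t => `|W t s|) M) => z /ler_normlP[_ zM]; exact: norm_prim_le.
pose x z := 2 * (W z s * prim (W ^~ s) z).
have lx : locint x by exact: locint_mulr.
have xE y : 0 <= y -> prim x y = V y s ^+ 2.
  by move=> y0; rewrite /x primZ// V_prim sqr_prim.
pose M y xi := tpow N K (xi / (y + s) ^+ 2).
have -> : prim (fun y => f y s * W y s) Y = 2^-1 * prim (fun z => M z (prim x z) * x z) Y.
  have lM : locint (fun z => M z (prim x z) * x z).
    have := @locint_bounded_mul _ x (fun z => M z (prim x z)) lx.
    under [X in _ -> _ -> locint X]eq_fun do rewrite mulrC; apply.
      apply: (mcomp (measurable_tpow N K)); apply: measurable_funM; first exact: measurable_prim lx.1.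
      by apply: measurable_funV; mfun.
    move=> X; exists (Kp + 1) => z _; have /andP[a b] := tpow_bounded (prim x z / (z + s) ^+ 2).
    by rewrite ger0_norm.
  rewrite -primZ//; apply: eq_prim => z /andP[z0 _].
  rewrite /M xE// /x /goursat_flux /cut_flux -V_prim.
  by move: (tpow _ _ _) => q; field.
apply: mulr_ge0; first by rewrite invr_ge0.
apply: (@monotone_flux _ M x (Kp + 1)) => //.
- by move=> y /andP[y0 _]; rewrite xE// sqr_ge0.
- move=> y; apply: (mcomp (measurable_tpow N K)); mfun.
- by move=> y xi; exact: tpow_bounded.
- move=> y xi xi' xi0 h; apply: le_tpow => //; first by rewrite divr_ge0// sqr_ge0.
  by rewrite ler_wpM2r// invr_ge0 sqr_ge0.
- move=> y y' xi y0 yy' xi0.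
  have p1 : 0 < (y + s) ^+ 2 by rewrite exprn_gt0// ltr_wpDl.
  have p2 : 0 < (y' + s) ^+ 2 by rewrite exprn_gt0// ltr_wpDl// (le_trans y0).
  apply: le_tpow => //; first by rewrite divr_ge0// ltW.
  rewrite ler_wpM2l// lef_pV2 ?posrE// ler_pXn2r ?nnegrE ?addr_ge0//; last exact: le_trans yy'.
  by rewrite lerD2r.
- apply: (mcomp (measurable_tpow N K)); apply: measurable_funM; first exact: measurable_prim lx.1.
  by apply: measurable_funV; mfun.
move=> e e0.
pose Vm := prim (fun z => `|W z s|) Y; pose S := prim (fun z => W z s ^+ 2) Y.
have Vm0 : 0 <= Vm by exact: prim_ge0.
have S0 : 0 <= S by apply: prim_ge0 => z _; exact: sqr_ge0.
have Lc0 := tpow_lip_ge0 K N2.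
(* The two terms bound the change of V^2 / (y + s)^2 due to V, through the Holder estimate, and due
   to y; both use s > 0. *)
pose C0 := tpow_lip N K * (2 * Vm * (S + 1) / s ^+ 2 + 2 * Vm ^+ 2 / s ^+ 3).
have C00 : 0 <= C0.
  by rewrite mulr_ge0// addr_ge0// divr_ge0 ?mulr_ge0// ?exprn_ge0// ?addr_ge0.
pose d := Num.min 1 (e / (C0 + 1)).
have d0 : 0 < d by rewrite lt_min ltr01 divr_gt0// ltr_wpDl.
have d1 : d <= 1 by rewrite ge_min lexx.
have dC : C0 * d <= e.
  apply: (@le_trans _ _ (C0 * (e / (C0 + 1)))); first by rewrite ler_wpM2l// ge_min lexx orbT.
  by rewrite mulrA ler_pdivrMr ?ltr_wpDl//; nra.
(* A square, because V is only Holder continuous of exponent 1/2 in y. *)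
exists (d ^+ 2); first by rewrite exprn_gt0.
move=> y z w /andP[y0 yY] /andP[z0 zY] /andP[w0 wY] yz wz.
have Vz : `|V z s| <= Vm by rewrite V_prim; exact: norm_prim_le.
have Vw : `|V w s| <= Vm by rewrite V_prim; exact: norm_prim_le.
have dV : `|V z s - V w s| <= d * (S + 1).
  have := prim_holder lW lW2 (introT andP (conj z0 zY)) (introT andP (conj w0 wY)).
  rewrite -!V_prim -/S => h.
  rewrite -(ler_pXn2r (n := 2))// ?nnegrE ?mulr_ge0 ?addr_ge0 ?(ltW d0)//.
  rewrite real_normK ?num_real//; apply: le_trans h _.
  apply: (@le_trans _ _ (d ^+ 2 * S)); first by rewrite ler_wpM2r// distrC.
  by rewrite exprMn ler_wpM2l ?sqr_ge0//; nra.
rewrite !xE//; apply: le_trans (tpow_lipschitz _ N2 _ _) _; rewrite ?ratio_ge0//.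
apply: le_trans dC; rewrite /C0 -mulrA ler_wpM2l//.
have zs : 0 < z + s by rewrite ltr_wpDl.
have ys : 0 < y + s by rewrite ltr_wpDl.
have -> : V z s ^+ 2 / (z + s) ^+ 2 - V w s ^+ 2 / (y + s) ^+ 2 =
   (V z s - V w s) * (V z s + V w s) / (z + s) ^+ 2 +
   V w s ^+ 2 * ((y - z) * ((z + s)^-1 * (y + s) ^- 2 + (z + s) ^- 2 * (y + s)^-1)).
  have zs' : z + s != 0 by rewrite gt_eqF.
  have ys' : y + s != 0 by rewrite gt_eqF.
  by move: (V z s) (V w s) => a b; field; rewrite zs' ys'.
have isl (u : R) : 0 <= u -> (u + s)^-1 <= s^-1 by move=> u0; rewrite lef_pV2 ?posrE ?lerDr ?ltr_wpDl.
have i0 (u : R) : 0 <= u -> 0 <= (u + s)^-1 by move=> u0; rewrite invr_ge0 addr_ge0.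
have h2 (u : R) : 0 <= u -> (u + s) ^- 2 <= s ^- 2.
  move=> u0; have us : 0 < u + s by rewrite ltr_wpDl.
  rewrite lef_pV2 ?posrE ?exprn_gt0//.
  by rewrite ler_pXn2r ?nnegrE ?(ltW us)// lerDr.
apply: le_trans (ler_normD _ _) _; rewrite [leRHS]mulrDl; apply: lerD.
- rewrite !normrM (ger0_norm (_ : 0 <= (z + s) ^- 2)) ?invr_ge0 ?sqr_ge0//.
  apply: (@le_trans _ _ (d * (S + 1) * (2 * Vm) * s ^- 2)); last first.
    by rewrite le_eqVlt; apply/orP; left; apply/eqP; ring.
  apply: ler_pM; rewrite ?mulr_ge0// ?invr_ge0 ?sqr_ge0//.
    apply: ler_pM => //; apply: le_trans (ler_normD _ _) _; lra.
  exact: h2.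
- rewrite normrM normrX normrM.
  apply: (@le_trans _ _ (Vm ^+ 2 * (d * (s^-1 * s ^- 2 + s ^- 2 * s^-1)))); last first.
    rewrite le_eqVlt; apply/orP; left; apply/eqP; field; exact: lt0r_neq0.
  apply: ler_pM; rewrite ?exprn_ge0 ?mulr_ge0//; first by rewrite ler_pXn2r ?nnegrE.
  apply: ler_pM => //.
    by apply: le_trans yz _; rewrite expr2 ler_piMr// ltW.
  rewrite ger0_norm; last by rewrite addr_ge0// mulr_ge0// ?i0// ?invr_ge0 ?sqr_ge0.
  by apply: lerD; apply: ler_pM; rewrite ?i0// ?invr_ge0 ?sqr_ge0// ?isl// ?h2.
Qed.

(** Integrating [W_sqr] in y and exchanging the integrations, the loss of energy is the integral
    over 0 < s < t of the work of the flux. *)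
Lemma energy t Y : 0 <= t -> 0 <= Y ->
  prim (fun y => W y t ^+ 2) Y <= prim (fun y => k0 y ^+ 2) Y.
Proof.
move=> t0 Y0; have lW2 := locint_W2 t0.
have gE : (fun y => prim (fun s => f y s * W y s) t) = (fun y => k0 y ^+ 2 - W y t ^+ 2).
  by apply/funext => y; rewrite (W_sqr y t0); ring.
have lg : locint (fun y => prim (fun s => f y s * W y s) t) by rewrite gE; exact: locint_sub.
have -> : prim (fun y => W y t ^+ 2) Y =
    prim (fun y => k0 y ^+ 2) Y - prim (fun y => prim (fun s => f y s * W y s) t) Y.
  by rewrite -primB//; apply: eq_prim => y _; rewrite W_sqr.
have mW : measurable_fun setT (fun p : R * R => W p.1 p.2) by apply: measurable_goursat_W; have [] := cV.
have mfW : measurable_fun setT (fun p : R * R => f p.1 p.2 * W p.1 p.2) by exact: measurable_funM.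
have Cf0 : 0 <= Cf Y t by rewrite !mulr_ge0 ?expR_ge0.
rewrite gerBl (@prim_swap _ (fun y s => f y s * W y s) (fun y => Cf Y t * (`|k0 y| + 2^-1 * (Cf Y t * t))))//.
- apply: prim_ge0_oc => [|s s0 st]; last exact: flux_work_ge0.
  apply: (@measurable_prim_param R _ R (fun q : R * R => f q.2 q.1 * W q.2 q.1) (fun=> Y)); last mfun.
  by apply: (mcomp mfW (g := fun q : R * R => (q.2, q.1))); apply: measurable_fun_pair; mfun.
- apply: locint_mulr; apply: locint_add; first exact: locint_norm.
  by apply: locint_continuous; exact: cst_continuous.
- move=> y s /andP[y0 yY] /andP[s0 st]; rewrite normrM; apply: ler_pM => //.
    by apply: flux_bound; rewrite ger0_norm.
  apply: le_trans (ler_normB _ _) _; rewrite lerD2l normrM gtr0_norm ?invr_gt0// ler_pM2l ?invr_gt0//.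
  apply: (@le_trans _ _ (Cf Y t * s)); last by rewrite ler_wpM2l.
  apply: norm_prim_cst => //; first exact: locint_flux.
  by move=> z /andP[z0 zs]; apply: flux_bound; rewrite ger0_norm// (le_trans zs).
Qed.

Lemma V_sqrt t y a2 : 0 <= t -> 0 <= y -> prim (fun y => k0 y ^+ 2) y <= a2 ->
  V y t ^+ 2 <= y * a2.
Proof.
move=> t0 y0 h.
have y00 : 0 <= (0 : R) <= y by rewrite lexx.
have yy : 0 <= y <= y by rewrite y0 lexx.
have := prim_holder (locint_W t) (locint_W2 t0) yy y00.
rewrite prim0 !subr0 (ger0_norm y0) -V_prim => /le_trans; apply; rewrite ler_wpM2l//.
by apply: le_trans (energy t0 y0) h.
Qed.

End fixed_point.
End goursat.

(** * Hardy inequalities *)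

Section hardy.
Variable R : realType.
Local Notation mu := (@lebesgue_measure R).
Implicit Types (k g : R -> R).

Lemma Rintegral_prim g (a b : R) : 0 <= a -> a <= b -> measurable_fun setT g ->
  \int[mu]_(x in `[a, b]) g x = prim (fun x => if a <= x then g x else 0) b.
Proof.
move=> a0 ab mg; rewrite Rintegral_if /prim [RHS]Rintegral_if; apply: eq_Rintegral => x _.
rewrite !mem_setE !in_itv/=; have [ax|xa] := leP a x; last by case: ifP.
by rewrite (le_trans a0 ax).
Qed.

(** The maximum equals r on the interval and makes the integrand continuous on the whole line, as
    [FTC2_derive] demands. The same device serves for the other powers below. *)
Lemma integral_invsq (a b : R) : 0 < a -> a <= b ->
  \int[mu]_(r in `[a, b]) (Num.max r a) ^- 2 = a^-1 - b^-1.
Proof.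
move=> a0 ab.
have cG : continuous (fun r : R => (Num.max r a) ^- 2).
  move=> r; have m0 : Num.max r a != 0 by rewrite gt_eqF// lt_max a0 orbT.
  apply: cvgV; first by rewrite expf_neq0.
  apply: (@cvg_comp _ _ _ (fun r : R => Num.max r a) (fun r => r ^+ 2)); last exact: exprn_continuous.
  by apply: (@continuous_max _ _ (fun r : R => r) (cst a)); [exact: cvg_id|exact: cvg_cst].
have dG (r : R) : a <= r <= b -> is_derive r (1 : R) (fun r => - r^-1) ((Num.max r a) ^- 2).
  move=> /andP[ar _]; have r0 : r != 0 by rewrite gt_eqF// (lt_le_trans a0).
  have := is_deriveN (is_deriveV r0 (is_derive_id r (1 : R))).
  by rewrite /GRing.scale/= mulr1 opprK max_l.
by rewrite /Rintegral (FTC2_derive ab cG dG)/=; ring.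
Qed.

(** Fubini for k(z) r^(-2) on the triangle a <= z <= r <= b, integrating r^(-2) first on one side
    and k first on the other. *)
Lemma inv_by_parts k (a b : R) : 0 < a -> a <= b -> locint k ->
  \int[mu]_(r in `[a, b]) (r ^- 2 * prim k r) =
  prim k a / a - prim k b / b + \int[mu]_(r in `[a, b]) (r^-1 * k r).
Proof.
move=> a0 ab lk; have a0' := ltW a0; have b0 := le_trans a0' ab; have mk := lk.1.
have lp := locint_prim lk.
pose w (r : R) := (Num.max r a) ^- 2.
have mw : measurable_fun setT w.
  by apply: measurable_funV; apply: measurable_funX; apply: measurable_maxr; mfun.
have w0 r : 0 <= w r by rewrite invr_ge0 sqr_ge0.
have wa r : w r <= a ^- 2.
  have m0 : a <= Num.max r a by rewrite le_max lexx orbT.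
  rewrite lef_pV2 ?posrE ?exprn_gt0 ?(lt_le_trans a0 m0)//.
  by rewrite ler_pXn2r ?nnegrE ?(le_trans a0' m0).
have lw : locint w by apply: bounded_locint => // M; exists (a ^- 2) => r _; rewrite ger0_norm.
have wE r : a <= r -> w r = r ^- 2 by move=> ar; rewrite /w max_l.
pose h (z r : R) := if (a <= z) && (z <= r) then k z * w r else 0.
have mh : measurable_fun setT (fun p : R * R => h p.1 p.2).
  apply: measurable_fun_ifT; [mfun| |mfun].
  by apply: measurable_funM; [apply: (mcomp mk)|apply: (mcomp mw)]; mfun.
have lg : locint (fun z => a ^- 2 * `|k z|) by apply: locint_mulr; exact: locint_norm.
have hg z r : 0 <= z <= b -> 0 <= r <= b -> `|h z r| <= a ^- 2 * `|k z|.
  move=> _ _; rewrite /h; case: ifP => _.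
    by rewrite normrM mulrC ler_wpM2r// ger0_norm.
  by rewrite normr0 mulr_ge0// invr_ge0 sqr_ge0.
have := prim_swap b0 b0 mh lg hg.
have -> : prim (fun z => prim (h z) b) b = \int[mu]_(z in `[a, b]) (k z * (z^-1 - b^-1)).
  rewrite Rintegral_prim//; last by apply: measurable_funM => //; apply: measurable_funB; mfun; exact: measurable_invr.
  apply: eq_prim => z /andP[z0 zb]; case: ifPn => az; last first.
    rewrite (@eq_prim _ _ (cst 0)) ?prim_cst ?mul0r// => r _; by rewrite /h (negbTE az).
  have z_gt0 := lt_le_trans a0 az.
  rewrite -(integral_invsq z_gt0 zb) -RintegralZl; [|exact: measurable_itv|]; last first.
    apply: (continuous_integrable_itv (f := fun r : R => (Num.max r z) ^- 2)) => r.
    have m0 : Num.max r z != 0 by rewrite gt_eqF// lt_max z_gt0 orbT.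
    apply: cvgV; first by rewrite expf_neq0.
    apply: (@cvg_comp _ _ _ (fun r : R => Num.max r z) (fun r => r ^+ 2)); last exact: exprn_continuous.
    by apply: (@continuous_max _ _ (fun r : R => r) (cst z)); [exact: cvg_id|exact: cvg_cst].
  rewrite (Rintegral_prim z0 zb); last first.
    apply: measurable_funM; mfun; apply: measurable_funV; apply: measurable_funX.
    by apply: measurable_maxr; mfun.
  apply: eq_prim => r _; rewrite /h az/=; case: ifPn => // zr.
  by rewrite /w !max_l// (le_trans az).
have -> : prim (fun s => prim (h^~ s) b) b = \int[mu]_(r in `[a, b]) (r ^- 2 * (prim k r - prim k a)).
  rewrite Rintegral_prim//; last first.
    apply: measurable_funM; last by apply: measurable_funB; mfun; exact: lp.1.
    by apply: measurable_funV; mfun.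
  apply: eq_prim => r /andP[r0 rb]; case: ifPn => ar; last first.
    rewrite (@eq_prim _ _ (cst 0)) ?prim_cst ?mul0r// => z _; rewrite /h ifF//.
    by apply/negbTE; apply: contra ar => /andP[az zr]; exact: le_trans zr.
  rewrite prim_sub// -RintegralZl; [|exact: measurable_itv|exact: locint_itv].
  rewrite (Rintegral_prim a0' ar); last by apply: measurable_funM; mfun.
  rewrite /prim Rintegral_if [RHS]Rintegral_if; apply: eq_Rintegral => z _; rewrite !mem_setE !in_itv/=.
  rewrite /h wE//; have [z0|] := leP 0 z => //=; have [az|za] := leP a z => /=; last by rewrite !if_same.
  have [zr|rz] := leP z r; first by rewrite (le_trans zr rb) mulrC.
  by case: ifP.
have mV := @measurable_invr R.
have lkb : locint (fun z => b^-1 * k z) by exact: locint_mulr.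
have lr2 : mu.-integrable `[a, b] (EFin \o (fun r => r ^- 2 * prim k r)).
  apply: (@le_integrable_real _ _ _ mu `[a, b]%classic _ (fun r : R => a ^- 2 * `|prim k r|)) => //.
  - by apply: measurable_funS (measurable_funM _ lp.1) => //; apply: measurable_funV; mfun.
  - move=> r; rewrite /= in_itv/= => /andP[ar _]; rewrite normrM ler_wpM2r// -(wE r ar) ger0_norm//.
  - by apply: integrable_mulr; [exact: measurable_itv|apply: locint_itv; exact: locint_norm].
have lri : mu.-integrable `[a, b] (EFin \o (fun r => r^-1 * k r)).
  apply: (@le_integrable_real _ _ _ mu `[a, b]%classic _ (fun r : R => a^-1 * `|k r|)) => //.
  - by apply: measurable_funS (measurable_funM mV mk).
  - move=> r; rewrite /= in_itv/= => /andP[ar _]; have r0 := lt_le_trans a0 ar.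
    by rewrite normrM ler_wpM2r// ger0_norm ?invr_ge0 ?(ltW r0)// lef_pV2.
  - by apply: integrable_mulr; [exact: measurable_itv|apply: locint_itv; exact: locint_norm].
have lri2 : mu.-integrable `[a, b] (EFin \o (fun r => prim k a * w r)).
  by apply: integrable_mulr; [exact: measurable_itv|exact: locint_itv].
have mI : measurable (`[a, b]%classic : set R) := measurable_itv _.
have E1 : \int[mu]_(z in `[a, b]) (k z * (z^-1 - b^-1)) =
    \int[mu]_(r in `[a, b]) (r^-1 * k r) - b^-1 * (prim k b - prim k a).
  rewrite prim_sub// -RintegralZl//; last exact: locint_itv.
  rewrite -RintegralB//; last exact: locint_itv.
  by apply: eq_Rintegral => z _; ring.
have E2 : \int[mu]_(r in `[a, b]) (r ^- 2 * (prim k r - prim k a)) =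
    \int[mu]_(r in `[a, b]) (r ^- 2 * prim k r) - prim k a * (a^-1 - b^-1).
  rewrite -(integral_invsq a0 ab) -RintegralZl//; last exact: locint_itv.
  rewrite -RintegralB//; apply: eq_Rintegral => r; rewrite mem_setE in_itv/= => /andP[ar _].
  by rewrite -/(w r) wE//; ring.
rewrite E1 E2 !mulrBr => e; rewrite [_ / b]mulrC; have := e; rewrite [prim k a / b]mulrC; lra.
Qed.

(** The mean of k over [0, r] for r > 0. When k is the profile of u it is u itself, and k - quot k
    is r times the radial derivative of u. *)
Definition quot k (r : R) : R := r^-1 * prim k r.

Section quotient.
Variables (k : R -> R) (B : R).
Hypotheses (lk : locint k) (lk2 : locint (fun r => k r ^+ 2)).
Hypothesis kB : forall r, 0 <= r -> `|prim k r| <= B * r.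
Let mp := measurable_prim lk.1.

Lemma measurable_quot : measurable_fun setT (quot k).
Proof. by apply: measurable_funM => //; exact: measurable_invr. Qed.

Lemma norm_quot r : `|quot k r| <= B.
Proof.
have B0 : 0 <= B by have := le_trans (normr_ge0 _) (kB ler01); rewrite mulr1.
have [r0|r0|->] := ltgtP r 0.
- by rewrite /quot prim_lt0// mulr0 normr0.
- by rewrite /quot normrM normfV (gtr0_norm r0) mulrC ler_pdivrMr// kB// ltW.
- by rewrite /quot invr0 mul0r normr0.
Qed.

Lemma locint_quot : locint (quot k).
Proof. by apply: bounded_locint measurable_quot _ => M; exists B => r _; exact: norm_quot. Qed.

Lemma locint_kquot : locint (fun r => k r * quot k r).
Proof.
by apply: locint_bounded_mul => //; [exact: measurable_quot|move=> M; exists B => r _; exact: norm_quot].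
Qed.

Lemma locint_quot2 : locint (fun r => quot k r ^+ 2).
Proof.
under eq_fun do rewrite expr2; apply: locint_bounded_mul locint_quot measurable_quot _.
by move=> M; exists B => r _; exact: norm_quot.
Qed.

Lemma quot_sqr_eq (a b : R) : 0 < a -> a <= b ->
  \int[mu]_(r in `[a, b]) (quot k r ^+ 2) =
  prim k a ^+ 2 / a - prim k b ^+ 2 / b + 2 * \int[mu]_(r in `[a, b]) (k r * quot k r).
Proof.
move=> a0 ab; have b0 := lt_le_trans a0 ab; have lp := locint_prim lk.
have lkp : locint (fun z => k z * prim k z).
  apply: locint_bounded_mul => //; move=> M; exists (prim (fun t => `|k t|) M) => z /ler_normlP[_ zM].
  exact: norm_prim_le.
have l2 : locint (fun z => 2 * (k z * prim k z)) by exact: locint_mulr.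
have pE r : 0 <= r -> prim (fun z => 2 * (k z * prim k z)) r = prim k r ^+ 2.
  by move=> r0; rewrite primZ// sqr_prim.
have := inv_by_parts a0 ab l2; rewrite !pE ?(ltW a0) ?(ltW b0)// => h.
rewrite -RintegralZl; [|exact: measurable_itv|by apply: locint_itv; exact: locint_kquot].
have -> : \int[mu]_(r in `[a, b]) (2 * (k r * quot k r)) = \int[mu]_(r in `[a, b]) (r^-1 * (2 * (k r * prim k r))).
  by apply: eq_Rintegral => r _; rewrite /quot; ring.
rewrite -h; apply: eq_Rintegral => r; rewrite mem_setE in_itv/= => /andP[ar _].
by rewrite pE ?(le_trans (ltW a0))// /quot exprMn exprVn.
Qed.

Lemma itv_split (a b : R) : 0 < a -> a <= b ->
  [/\ mu.-integrable `[a, b] (EFin \o (fun r => k r ^+ 2)),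
      mu.-integrable `[a, b] (EFin \o (fun r => quot k r ^+ 2)) &
      mu.-integrable `[a, b] (EFin \o (fun r => k r * quot k r))].
Proof.
by move=> a0 ab; split; apply: locint_itv => //; [exact: locint_quot2|exact: locint_kquot].
Qed.

(** In differential form, (k - quot k)^2 is k^2 minus the derivative of (prim k)^2 / r. Both
    directions of the comparison with the homogeneous Sobolev norm start from this identity. *)
Lemma diff_quot_sqr_eq (a b : R) : 0 < a -> a <= b ->
  \int[mu]_(r in `[a, b]) ((k r - quot k r) ^+ 2) =
  prim (fun r => k r ^+ 2) b - prim (fun r => k r ^+ 2) a + prim k a ^+ 2 / a - prim k b ^+ 2 / b.
Proof.
move=> a0 ab; have [i1 i2 i3] := itv_split a0 ab; have mI := measurable_itv `[a, b].
have i4 : mu.-integrable `[a, b] (EFin \o (fun r => 2 * (k r * quot k r))) by exact: integrable_mulr.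
transitivity (\int[mu]_(r in `[a, b]) (k r ^+ 2 + quot k r ^+ 2 - 2 * (k r * quot k r))).
  by apply: eq_Rintegral => r _; ring.
rewrite RintegralB//; last exact: integrable_addr.
rewrite RintegralD// RintegralZl// quot_sqr_eq// prim_sub//; last exact: ltW.
by ring.
Qed.

Variable a2 : R.
Hypothesis k2a : forall r, 0 <= r -> prim (fun r => k r ^+ 2) r <= a2.

Lemma sqr_prim_le r : 0 <= r -> prim k r ^+ 2 <= r * a2.
Proof.
move=> r0; have h0 : 0 <= (0 : R) <= r by rewrite lexx.
have hr : 0 <= r <= r by rewrite r0 lexx.
have := prim_holder lk lk2 hr h0; rewrite prim0 !subr0 (ger0_norm r0) => /le_trans; apply.
by rewrite ler_wpM2l// k2a.
Qed.

Lemma sqr_prim_div r : 0 < r -> prim k r ^+ 2 / r <= a2.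
Proof. by move=> r0; rewrite ler_pdivrMr// mulrC sqr_prim_le// ltW. Qed.

Lemma diff_quot_sqr_le (a b : R) : 0 < a -> a <= b ->
  \int[mu]_(r in `[a, b]) ((k r - quot k r) ^+ 2) <= 2 * a2.
Proof.
move=> a0 ab; have b0 := lt_le_trans a0 ab; rewrite diff_quot_sqr_eq//.
have h1 := k2a (ltW b0); have h2 := sqr_prim_div a0.
have h3 : 0 <= prim (fun r => k r ^+ 2) a by apply: prim_ge0 => r _; exact: sqr_ge0.
have h4 : 0 <= prim k b ^+ 2 / b by rewrite divr_ge0 ?sqr_ge0// ltW.
lra.
Qed.

(** Hardy's inequality: in [quot_sqr_eq] the cross term is absorbed by k q <= k^2 + q^2 / 4, which
    leaves half of the left side and yields the constant 6. *)
Lemma quot_sqr_le (a b : R) : 0 < a -> a <= b ->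
  \int[mu]_(r in `[a, b]) (quot k r ^+ 2) <= 6 * a2.
Proof.
move=> a0 ab; have b0 := lt_le_trans a0 ab; have [i1 i2 i3] := itv_split a0 ab.
have mI := measurable_itv `[a, b].
have i4 : mu.-integrable `[a, b] (EFin \o (fun r => 4^-1 * quot k r ^+ 2)) by exact: integrable_mulr.
have : 0 <= \int[mu]_(r in `[a, b]) (k r ^+ 2 + 4^-1 * quot k r ^+ 2 - k r * quot k r).
  by apply: Rintegral_ge0 => r _; rewrite (_ : _ - _ = (k r - 2^-1 * quot k r) ^+ 2) ?sqr_ge0//; field.
rewrite RintegralB//; last exact: integrable_addr.
rewrite RintegralD// RintegralZl//.
have := quot_sqr_eq a0 ab; have := prim_sub lk2 (ltW a0) ab.
have h1 := k2a (ltW b0); have h2 := sqr_prim_div a0.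
have h3 : 0 <= prim (fun r => k r ^+ 2) a by apply: prim_ge0 => r _; exact: sqr_ge0.
have h4 : 0 <= prim k b ^+ 2 / b by rewrite divr_ge0 ?sqr_ge0// ltW.
lra.
Qed.

End quotient.

(* The boundary term (prim k X)^2 / X of diff_quot_sqr_eq is at most half of the integral of k^2
   when X is large. *)
Lemma reverse_hardy k (B C J : R) : locint k -> locint (fun r => k r ^+ 2) ->
  (forall r, 0 <= r -> `|prim k r| <= B * r) ->
  (forall r, 0 <= r -> prim (fun r => k r ^+ 2) r <= C) ->
  (forall a b, 0 < a -> a <= b -> \int[mu]_(r in `[a, b]) ((k r - quot k r) ^+ 2) <= J) ->
  forall r, 0 <= r -> prim (fun r => k r ^+ 2) r <= 2 * J.
Proof.
move=> lk lk2 kB kC hJ r r0.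
pose P r := prim (fun r => k r ^+ 2) r.
have Pmono x y : 0 <= x -> x <= y -> P x <= P y.
  move=> x0 xy; rewrite -subr_ge0; have := @prim_sub_ge _ (fun z => k z ^+ 2) 0 x y lk2 x0 xy.
  by rewrite mul0r; apply => z _; exact: sqr_ge0.
have key a Y : 0 < a -> a <= Y -> P Y - P a <= 2 * J.
  move=> a0 aY; rewrite leNgt; apply/negP => IJ.
  pose E := [set x | exists2 y, a <= y & x = P y - P a].
  have Pa0 : 0 <= P a by apply: prim_ge0 => z _; exact: sqr_ge0.
  have hs : has_sup E.
    split; first by exists (P a - P a), a.
    exists C => _ [y ay ->]; have := kC y (le_trans (ltW a0) ay); rewrite -/(P y); lra.
  pose I := sup E.
  have I1 y : a <= y -> P y - P a <= I by move=> ay; apply: (ub_le_sup hs.2); exists y.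
  have IJ' : 2 * J < I by exact: lt_le_trans (I1 Y aY).
  have J0 : 0 <= J by have := hJ a a a0 (lexx a); rewrite set_itv1 /Rintegral integral_set1.
  have I0 : 0 < I by lra.
  (* Beyond [R0] less than I / 8 of the integral of k^2 remains. *)
  have [_ [R0 aR0 ->] hR0] : exists2 x, E x & I - I / 8 < x.
    by apply: sup_adherent => //; lra.
  (* Makes 16 (prim k R0)^2 <= X I. The boundary term at X is then at most 3 I / 8, while the
     integral of k^2 from a to X exceeds 7 I / 8, so at least I / 2 > J remains. *)
  pose X := R0 + 16 * (prim k R0) ^+ 2 / I.
  have R00 : 0 < R0 := lt_le_trans a0 aR0.
  have XR : R0 <= X.
    by rewrite lerDl; apply: divr_ge0; [apply: mulr_ge0 => //; exact: sqr_ge0|exact: ltW].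
  have X0 : 0 < X := lt_le_trans R00 XR.
  have tail : P X - P R0 <= I / 8 by have := I1 X (le_trans aR0 XR); lra.
  have dK : (prim k X - prim k R0) ^+ 2 <= X * (I / 8).
    have [->|nX] := eqVneq R0 X; first by rewrite subrr expr0n mulr_ge0 ?divr_ge0// ltW.
    have RX : R0 < X by rewrite lt_neqAle nX.
    rewrite prim_sub ?(ltW R00)//.
    have := sqr_Rintegral_le RX (locint_itv R0 X lk) (locint_itv R0 X lk2).
    rewrite -[X in _ * X]prim_sub ?(ltW R00)// => /le_trans; apply.
    apply: ler_pM => //; first by rewrite subr_ge0.
    - by rewrite subr_ge0; exact: Pmono (ltW R00) XR.
    - by rewrite gerBl ltW.
  have sq : prim k X ^+ 2 <= 2 * (prim k R0) ^+ 2 + 2 * (X * (I / 8)).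
    apply: (@le_trans _ _ (2 * prim k R0 ^+ 2 + 2 * (prim k X - prim k R0) ^+ 2)); last by lra.
    by have := sqr_ge0 (prim k X - 2 * prim k R0); nra.
  have sqX : prim k X ^+ 2 / X <= 3 / 8 * I.
    rewrite ler_pdivrMr//; apply: le_trans sq _.
    have : 16 * (prim k R0) ^+ 2 <= X * I.
      rewrite -ler_pdivrMr// /X lerDr ltW//.
    by lra.
  have := hJ a X a0 (le_trans aR0 XR); rewrite (diff_quot_sqr_eq lk lk2 kB a0 (le_trans aR0 XR)).
  have : 0 <= prim k a ^+ 2 / a by rewrite divr_ge0 ?sqr_ge0// ltW.
  have := Pmono R0 X (ltW R00) XR; rewrite -/(P X) -/(P a); lra.
have [->|rn0] := eqVneq r 0.
  rewrite prim0 mulr_ge0//; have := hJ 1 1 ltr01 (lexx _); by rewrite set_itv1 /Rintegral integral_set1.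
have {rn0} r0' : 0 < r by rewrite lt_def rn0.
apply/ler_addgt0Pr => e e0.
(* The estimate between a and r extends down to 0, because the integral of k^2 over [0, a] tends to
   0 with a. *)
have := parameterized_integral_cvg_left ltr01 (locint_itv 0 1 lk2).
move=> /cvgrPdist_lt/(_ e e0) /nbhs_ballP[d /= d0 hd].
pose a := Num.min r (d / 2).
have a0 : 0 < a by rewrite lt_min r0' divr_gt0.
have ad : a < d by rewrite (@le_lt_trans _ _ (d / 2)) ?ge_min ?lexx ?orbT//; lra.
have : `|P a| < e.
  have := hd a; rewrite sub0r normrN; apply; rewrite /ball/= sub0r normrN gtr0_norm//.
have ar : a <= r by rewrite ge_min lexx.
have := key a r a0 ar; rewrite -/(P r); have := ler_norm (P a); lra.
Qed.

(** Monotone convergence along the intervals from 1 / (n + 1) to n + 1. *)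
Lemma half_line_le g (C : R) : measurable_fun setT g -> (forall r, 0 <= g r) -> locint g ->
  (forall a b, 0 < a -> a <= b -> \int[mu]_(r in `[a, b]) g r <= C) ->
  (\int[mu]_(r in `]0%R, +oo[) (g r)%:E <= C%:E)%E.
Proof.
move=> mg g0 lg h.
pose F (n : nat) : set R := `[n.+1%:R^-1, n.+1%:R]%classic.
have ndF : nondecreasing_seq F.
  move=> m n mn; apply/subsetPset => x; rewrite /F /= !in_itv/= => /andP[h1 h2]; apply/andP; split.
    by apply: le_trans h1; rewrite lef_pV2 ?posrE ?ltr0n// ler_nat ltnS.
  by apply: le_trans h2 _; rewrite ler_nat ltnS.
have UF : `]0, +oo[%classic = \bigcup_i F i.
  apply/seteqP; split => x; rewrite /= ?in_itv/= ?andbT => hx; last first.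
    case: hx => n _; rewrite /F/= in_itv/= => /andP[h1 _].
    by apply: lt_le_trans h1; rewrite invr_gt0 ltr0n.
  exists (Num.truncn (x + x^-1)) => //; rewrite /F /= in_itv/=.
  have p : 0 <= x + x^-1 by rewrite addr_ge0// ?invr_ge0 ltW.
  have q : x + x^-1 < (Num.truncn (x + x^-1)).+1%:R by rewrite -truncn_lt_nat.
  have xi : 0 < x^-1 by rewrite invr_gt0.
  apply/andP; split; last by lra.
  by rewrite -[leRHS]invrK lef_pV2 ?posrE ?ltr0n//; lra.
have mF i : measurable (F i) by exact: measurable_itv.
have mgF i : measurable_fun (F i) (EFin \o g) by apply/measurable_EFinP; exact: measurable_funS mg.
have := @ge0_nondecreasing_set_cvg_integral _ (measurableTypeR R) R F (EFin \o g) mu ndF mF mgF (fun i x _ => g0 x).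
rewrite -UF => cv.
rewrite -(cvg_lim (@ereal_hausdorff _) cv); apply: lime_le; first by apply/cvg_ex; eexists; exact: cv.
apply: nearW => n; have n1 : (n.+1%:R^-1 : R) <= n.+1%:R.
  by apply: (@le_trans _ _ 1); rewrite ?invf_le1 ?ler1n ?ltr0n.
have := h _ _ _ n1; rewrite -(@fineK _ (integral _ _ _)); last exact: integrable_fin_num (locint_itv _ _ lg).
by rewrite lee_fin; apply; rewrite invr_gt0 ltr0n.
Qed.
End hardy.

(** * The solution in characteristic coordinates and its bounds *)

Section goursat_solution.
Variable R : realType.

(* With v = r u and y = r - t, the radial equation reads V_(yt) = - f / 2, f = |V|^N V (y + t)^(-N), and W = V_y. *)
Record goursat_solution (N a K : R) (k0 : R -> R) (V W f : R -> R -> R) : Prop := GoursatSolution {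
  gs_mV : measurable_fun setT (fun p : R * R => V p.1 p.2);
  gs_mf : measurable_fun setT (fun p : R * R => f p.1 p.2);
  gs_lW : forall t, locint (W ^~ t);
  gs_lf : forall y, locint (f y);
  gs_f_bound : forall M t : R, exists C, forall y s : R, `|y| <= M -> `|s| <= t -> `|f y s| <= C;
  gs_VE : forall y t, V y t = prim (W ^~ t) y;
  gs_WE : forall y t, W y t = k0 y - 2^-1 * prim (f y) t;
  gs_fE : forall y s : R, 0 <= y -> 0 <= s -> f y s = `|V y s| `^ N * V y s * (y + s) `^ (- N);
  gs_lW2 : forall t, 0 <= t -> locint (fun y => W y t ^+ 2);
  gs_energy : forall t Y, 0 <= t -> 0 <= Y -> prim (fun y => W y t ^+ 2) Y <= a ^+ 2;
  gs_sqrt : forall t y, 0 <= t -> 0 <= y -> V y t ^+ 2 <= y * a ^+ 2;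
  gs_sup : forall t y, 0 <= t -> 0 <= y -> `|V y t| <= K * (y + t) }.

(** The level of the truncation is fixed before the solution is built, from B and a alone; the two
    bounds then confine the truncated solution below that level for all times. *)
Lemma goursat_solution_exists (N a B : R) (k0 : R -> R) : 2 <= N -> 0 <= a -> 0 <= B ->
  locint k0 -> locint (fun y => k0 y ^+ 2) ->
  (forall y, 0 <= y -> `|prim k0 y| <= B * y) ->
  (forall y, 0 <= y -> prim (fun y => k0 y ^+ 2) y <= a ^+ 2) ->
  exists V W f, goursat_solution N a (2 * B + a * (2 * B) `^ (N / 4)) k0 V W f.
Proof.
move=> N2 a0 B0 lk0 lk02 k0B k02; set K := _ + _.
have B20 : 0 <= 2 * B by rewrite mulr_ge0.
have s0 : 0 <= (2 * B) `^ (N / 4) := powR_ge0 _ _.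
have K0 : 0 <= K by rewrite addr_ge0// mulr_ge0.
have [V [cV VE Vlim]] := goursat_exists N2 K0 B0 lk0 k0B.
have Vsq t y : 0 <= t -> 0 <= y -> V y t ^+ 2 <= y * a ^+ 2.
  by move=> t0 y0; apply: (V_sqrt N2 B0 lk0 cV VE lk02) => //; exact: k02.
have sup t y : 0 <= t -> 0 <= y -> `|V y t| <= K * (y + t).
  move=> t0 y0; have [small|large] := leP (t * y * (2 * B) `^ N) 1.
    apply: (@le_trans _ _ (2 * B * y)).
      have cvn : `|goursat_iter N K k0 n y t| @[n --> \oo] --> `|V y t| by apply: cvg_norm; exact: Vlim.
      rewrite -(cvg_lim (@Rhausdorff R) cvn); apply: limr_le; first by apply/cvg_ex; eexists; exact: cvn.
      by apply: nearW => n; exact: goursat_iter_small.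
    by apply: ler_pM => //; rewrite ?lerDl// mulr_ge0.
  pose s := (2 * B) `^ (N / 4).
  have s4 : s ^+ 4 = (2 * B) `^ N.
    by rewrite /s -powR_mulrn// -powRrM; congr (_ `^ _); field.
  (* With s^4 = (2B)^N, the condition t y s^4 > 1 gives y^2 <= s^4 y^3 t, and y^3 t <= (y + t)^4. *)
  have h1 : y <= (s * (y + t)) ^+ 2.
    rewrite -(@ler_pXn2r _ 2)// ?nnegrE ?sqr_ge0// -exprM exprMn s4.
    have t4 : y ^+ 3 * t <= (y + t) ^+ 4.
      have : 0 <= y * t by rewrite mulr_ge0.
      have := sqr_ge0 y; have := sqr_ge0 t; move: (y ^+ 2) => u; nra.
    apply: (@le_trans _ _ (y ^+ 2 * (t * y * (2 * B) `^ N))).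
      by rewrite ler_peMr ?sqr_ge0// ltW.
    by rewrite (_ : y ^+ 2 * _ = (2 * B) `^ N * (y ^+ 3 * t)) ?ler_wpM2l ?powR_ge0//; ring.
  have h2 : `|V y t| <= a * (s * (y + t)).
    rewrite -(@ler_pXn2r _ 2)// ?nnegrE ?mulr_ge0 ?addr_ge0// real_normK ?num_real//.
    by apply: le_trans (Vsq _ _ t0 y0) _; rewrite exprMn mulrC ler_wpM2l// sqr_ge0.
  apply: le_trans h2 _; rewrite mulrA ler_wpM2r ?addr_ge0// /K -/s lerDr//.
exists V, (goursat_W N K k0 V), (goursat_flux N K V).
have [mV _] := cV.
split => //.
- exact: measurable_goursat_flux.
- by move=> t; apply: (locint_W N2 lk0 cV).
- by move=> y; apply: (locint_flux N2 cV).
- move=> M t; eexists => y s; exact: (flux_bound N2 B0 cV).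
- by move=> y t; rewrite {1}VE.
- move=> y s y0 s0'; rewrite /goursat_flux.
  have [ys|ys] := ltP 0 (y + s); first by rewrite cut_fluxE// sup.
  have -> : V y s = 0.
    have -> : y = 0 by apply/eqP; rewrite eq_le y0 andbT; lra.
    by rewrite VE /goursat_V prim0.
  by rewrite /cut_flux mulr0 !mul0r.
- by move=> t; apply: (locint_W2 N2 B0 lk0 cV lk02).
- move=> t Y t0 Y0; apply: le_trans (k02 _ Y0); apply: (energy N2 B0 lk0 cV VE lk02) => //.
Qed.
End goursat_solution.

Section Lnorm_bounds.
Context d (T : measurableType d) (R : realType) (m : {measure set T -> \bar R}).

Lemma Lnorm_le (n : nat) (f : T -> \bar R) (C : R) : (0 < n)%N -> (0 <= C)%R ->
  (\int[m]_x (`|f x| `^ n%:R)%E <= (C ^+ n)%:E)%E -> ('N[m]_(n%:R%:E)[f] <= C%:E)%E.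
Proof.
move=> n0 C0 h; rewrite Lnorm.unlock.
have n0' : (n%:R : R) != 0 by rewrite pnatr_eq0 -lt0n.
have -> : C%:E = ((C ^+ n)%:E `^ n%:R^-1)%E.
  by rewrite poweR_EFin -powR_mulrn// -powRrM divff// powRr1.
apply: gt0_ler_poweR; [by rewrite invr_ge0 ler0n|..|exact: h].
- by rewrite in_itv/= leey andbT integral_ge0// => x _; exact: poweR_ge0.
- by rewrite in_itv/= leey andbT lee_fin exprn_ge0.
Qed.

Lemma Lnorm_EFin_le (n : nat) (f : T -> R) (C : R) : (0 < n)%N -> (0 <= C)%R ->
  (\int[m]_x (`|f x| ^+ n)%:E <= (C ^+ n)%:E)%E -> ('N[m]_(n%:R%:E)[EFin \o f] <= C%:E)%E.
Proof.
move=> n0 C0 h; apply: Lnorm_le => //; apply: le_trans h.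
by rewrite le_eqVlt; apply/orP; left; apply/eqP/eq_integral => x _ /=; rewrite powR_mulrn.
Qed.

Lemma Lfun_nat (n : nat) (f : T -> R) : (0 < n)%N -> measurable_fun setT f ->
  (\int[m]_x (`|f x| ^+ n)%:E < +oo)%E -> f \in Lfun m n%:R%:E.
Proof.
move=> n0 mf h; rewrite inE; apply/andP; split; first by rewrite inE.
rewrite inE /= /finite_norm Lnorm.unlock; apply: poweR_lty; apply: le_lt_trans h.
by rewrite le_eqVlt; apply/orP; left; apply/eqP/eq_integral => x _ /=; rewrite powR_mulrn.
Qed.

End Lnorm_bounds.

(** * The homogeneous Sobolev norm of radial functions *)

Section radial_dotH1.
Variable R : realType.
Local Notation R3 := (R3 R).
Local Notation mu := (@lebesgue_measure R).
Local Notation mu3 := (mu3 R).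

Lemma is_weak_grad_ae (u : R3 -> R) (g : 'I_3 -> R3 -> R) : is_weak_grad u g ->
  is_weak_grad u (weak_grad u) /\ forall i, \forall x \ae mu3, weak_grad u i x = g i x.
Proof.
move=> h; have hw : is_weak_grad u (weak_grad u) by apply: (@xgetPex _ _ [set g | is_weak_grad u g]); exists g.
by split => // i; exact: weak_grad_unique hw h.
Qed.

Lemma sum_sqr_dir (x : R3) : x != 0 -> \sum_(i < 3) dir i x ^+ 2 = 1.
Proof.
move=> x0; have e0 : 0 < enorm x by rewrite enorm_gt0.
rewrite !big_ord_recr big_ord0/= add0r /dir !coordE/= !expr_div_n -!mulrDl -sqr_enorm.
by rewrite divff// gt_eqF// exprn_gt0.
Qed.

Variables (k : R -> R).
Hypothesis (lk : locint k).
Let mk := lk.1.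
Let u (x : R3) : R := (enorm x)^-1 * prim k (enorm x).

Lemma weak_grad_radialE :
  is_weak_grad u (weak_grad u) /\ forall i, \forall x \ae mu3, weak_grad u i x = radial_grad k i x.
Proof. exact: is_weak_grad_ae (weak_grad_radial lk). Qed.

Lemma measurable_weak_grad i : measurable_fun setT (weak_grad u i).
Proof. by have [[_ /(_ i) h _] _] := weak_grad_radialE; exact: loc_integrable_measurable. Qed.

Definition radial_slope (x : R3) : R := (enorm x)^-1 * (k (enorm x) - quot k (enorm x)).

Lemma weak_grad_radial_all : \forall x \ae mu3, forall i, weak_grad u i x = radial_grad k i x.
Proof.
have [_ h] := weak_grad_radialE.
have := ae_imp2 (fun x (p : _ = _) (q : _ = _) => conj p q) (h (lift ord0 (lift ord0 ord0))) (h (lift ord0 ord0)).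
move=> /(ae_imp2 (fun x (p : _ = _) (q : _ /\ _) => conj p q) (h ord0)).
apply: ae_imp => x [e0 [e2 e1]] i.
case: i => -[|[|[|//]]] hi; [move: e0|move: e1|move: e2]; congr (weak_grad _ _ _ = radial_grad _ _ _); exact/val_inj.
Qed.

Lemma radial_derivE : \forall x \ae mu3, radial_deriv u x = radial_slope x.
Proof.
apply: ae_imp2 (mu3_neq0 R) weak_grad_radial_all => x x0 hx; rewrite /radial_deriv -[RHS]mulr1 -(sum_sqr_dir x0) mulr_sumr.
by apply: eq_bigr => i _; rewrite hx /radial_grad -/(quot k (enorm x)) -/(radial_slope x) expr2 mulrCA.
Qed.

Lemma weak_grad_sqr : \forall x \ae mu3, \sum_(i < 3) weak_grad u i x ^+ 2 = radial_slope x ^+ 2.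
Proof.
apply: ae_imp2 (mu3_neq0 R) weak_grad_radial_all => x x0 hx.
rewrite -[RHS]mulr1 -(sum_sqr_dir x0) mulr_sumr.
by apply: eq_bigr => i _; rewrite hx /radial_grad -/(quot k (enorm x)) -/(radial_slope x) exprMn.
Qed.

Lemma measurable_radial_slope : measurable_fun setT radial_slope.
Proof.
have me := @measurable_enorm R; apply: measurable_funM; first exact: measurable_funV.
by apply: measurable_funB; [exact: (mcomp mk)|apply: mcomp me; exact: measurable_quot].
Qed.

Lemma integral_slope_sqr :
  (\int[mu3]_x (radial_slope x ^+ 2)%:E =
   (kappa R)%:E * \int[mu]_(r in `]0%R, +oo[) ((k r - quot k r) ^+ 2)%:E)%E.
Proof.
pose g (r : R) : \bar R := ((r^-1 * (k r - quot k r)) ^+ 2)%:E.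
have mg : measurable_fun setT g.
  apply/measurable_EFinP; apply: measurable_funX; apply: measurable_funM.
    exact: measurable_invr.
  by apply: measurable_funB => //; exact: measurable_quot.
rewrite (radial_tonelli mg) => [|r]; last by rewrite lee_fin sqr_ge0.
congr (_ * _)%E; apply: eq_integral => r; rewrite inE/= in_itv/= andbT => r0.
by rewrite /g -EFinM; congr EFin; field; rewrite gt_eqF.
Qed.

Lemma integral_grad_sqr :
  (\int[mu3]_x (\sum_(i < 3) weak_grad u i x ^+ 2)%:E =
   (kappa R)%:E * \int[mu]_(r in `]0%R, +oo[) ((k r - quot k r) ^+ 2)%:E)%E.
Proof.
rewrite -integral_slope_sqr; apply: ae_eq_integral => //.
- apply/measurable_EFinP; apply: measurable_sum => i.
  by apply: measurable_funX; exact: measurable_weak_grad.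
- by apply/measurable_EFinP; apply: measurable_funX; exact: measurable_radial_slope.
- by apply: ae_imp weak_grad_sqr => x -> _.
Qed.

Variables (B a : R).
Hypotheses (a0 : 0 <= a) (lk2 : locint (fun r => k r ^+ 2)).
Hypothesis kB : forall r, 0 <= r -> `|prim k r| <= B * r.
Hypothesis k2a : forall r, 0 <= r -> prim (fun r => k r ^+ 2) r <= a ^+ 2.

Lemma integral_grad_sqr_le :
  (\int[mu3]_x (\sum_(i < 3) weak_grad u i x ^+ 2)%:E <= (kappa R * (2 * a ^+ 2))%:E)%E.
Proof.
rewrite integral_grad_sqr [leRHS]EFinM; apply: lee_wpmul2l; first by rewrite lee_fin ltW// kappa_gt0.
apply: half_line_le.
- by apply: measurable_funX; apply: measurable_funB => //; exact: measurable_quot.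
- by move=> r; exact: sqr_ge0.
- rewrite (_ : (fun r => _) = (fun r => (k r ^+ 2 + quot k r ^+ 2) - 2 * (k r * quot k r))).
    apply: locint_sub; first by apply: locint_add => //; exact: locint_quot2 kB.
    by apply: locint_mulr; exact: locint_kquot kB.
  by apply/funext => r; ring.
- by move=> x y x0 xy; exact: (diff_quot_sqr_le lk lk2 kB).
Qed.

(** For membership in L^6, r u^2 <= a^2 gives r^2 u^6 <= a^4 u^2, and Hardy's inequality bounds the
    integral of u^2 over the half-line. *)
Lemma dotH1_radial : in_dotH1 u.
Proof.
have [hw _] := weak_grad_radialE; have me := @measurable_enorm R.
have mq : measurable_fun setT (quot k) by exact: measurable_quot.
split => //; last first.
  move=> i; apply: (@Lfun_nat _ _ _ _ 2) => //; first exact: measurable_weak_grad.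
  apply: le_lt_trans (ltry (kappa R * (2 * a ^+ 2))); apply: le_trans integral_grad_sqr_le.
  apply: ge0_le_integral => //.
  - by apply/measurable_EFinP; apply: measurable_funX; apply: measurableT_comp => //; exact: measurable_weak_grad.
  - apply/measurable_EFinP; apply: measurable_sum => j.
    by apply: measurable_funX; exact: measurable_weak_grad.
  - move=> x _; rewrite lee_fin real_normK ?num_real// (bigD1 i)//= lerDl sumr_ge0// => j _.
    exact: sqr_ge0.
apply: (@Lfun_nat _ _ _ _ 6) => //; first exact: (mcomp mq).
have -> : (\int[mu3]_x (`|u x| ^+ 6)%:E = (kappa R)%:E * \int[mu]_(r in `]0%R, +oo[) ((r ^+ 2)%:E * (`|quot k r| ^+ 6)%:E))%E.
  rewrite -(radial_tonelli (g := fun r => (`|quot k r| ^+ 6)%:E))//.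
    by apply/measurable_EFinP; apply: measurable_funX; exact: measurableT_comp.
apply: (@le_lt_trans _ _ ((kappa R)%:E * (a ^+ 4 * (6 * a ^+ 2))%:E)%E); last by rewrite -EFinM ltry.
rewrite lee_pmul2l ?fin_numE ?lte_fin ?kappa_gt0//.
have lq := locint_mulr (a ^+ 4) (locint_quot2 lk kB).
apply: (@le_trans _ _ (\int[mu]_(r in `]0%R, +oo[) (a ^+ 4 * quot k r ^+ 2)%:E)%E).
  apply: ge0_le_integral; first exact: measurable_itv.
  - by move=> r _; rewrite -EFinM lee_fin mulr_ge0// ?sqr_ge0// exprn_ge0.
  - apply: measurable_funS (measurableT) _ _ => //; apply: emeasurable_funM; apply/measurable_EFinP; mfun.
    exact: measurableT_comp.
  - by apply: measurable_funS (measurableT) _ _ => //; apply/measurable_EFinP; exact: lq.1.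
  - move=> r; rewrite /= in_itv/= andbT => r0; rewrite -EFinM lee_fin.
    have h := sqr_prim_div lk lk2 k2a r0.
    have e : r * quot k r ^+ 2 = prim k r ^+ 2 / r.
      by rewrite /quot exprMn; field; rewrite gt_eqF.
    have h2 : (r * quot k r ^+ 2) ^+ 2 <= a ^+ 4.
      rewrite (_ : a ^+ 4 = (a ^+ 2) ^+ 2); last by rewrite -exprM.
      by rewrite ler_pXn2r ?nnegrE ?sqr_ge0 ?e// divr_ge0 ?sqr_ge0// ltW.
    have -> : `|quot k r| ^+ 6 = quot k r ^+ 6.
      by rewrite -normrX (_ : quot k r ^+ 6 = (quot k r ^+ 3) ^+ 2) -?exprM// ger0_norm// ?sqr_ge0// exprM sqr_ge0.
    rewrite (_ : r ^+ 2 * quot k r ^+ 6 = (r * quot k r ^+ 2) ^+ 2 * quot k r ^+ 2); last by ring.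
    by rewrite ler_wpM2r// sqr_ge0.
apply: half_line_le => //.
- exact: lq.1.
- by move=> r; rewrite mulr_ge0 ?sqr_ge0// (_ : a ^+ 4 = (a ^+ 2) ^+ 2) ?sqr_ge0// -exprM.
- move=> x y x0 xy; rewrite RintegralZl//.
    by rewrite ler_wpM2l ?exprn_ge0//; exact: (quot_sqr_le lk lk2 kB).
  by apply: locint_itv; exact: locint_quot2 kB.
Qed.

Lemma dotH1_norm_radial_le : (dotH1_norm u <= (Num.sqrt (2 * kappa R) * a)%:E)%E.
Proof.
rewrite /dotH1_norm asboolT; last exact: dotH1_radial.
have s0 : 0 <= 2 * kappa R by rewrite mulr_ge0// ltW// kappa_gt0.
apply: (@Lnorm_EFin_le _ _ _ _ 2 (fun x => Num.sqrt (\sum_(i < 3) weak_grad u i x ^+ 2))) => //.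
  by rewrite mulr_ge0// sqrtr_ge0.
rewrite exprMn sqr_sqrtr// mulrAC mulrC mulrA [_ * 2]mulrC -mulrA.
rewrite (_ : _ * _ = kappa R * (2 * a ^+ 2)); last by ring.
apply: le_trans integral_grad_sqr_le; rewrite le_eqVlt; apply/orP; left; apply/eqP/eq_integral => x _.
by rewrite real_normK ?num_real// sqr_sqrtr// sumr_ge0// => i _; exact: sqr_ge0.
Qed.

End radial_dotH1.

(** * Outgoing initial data *)


Section initial_data.
Variable R : realType.
Local Notation R3 := (R3 R).
Local Notation mu := (@lebesgue_measure R).
Local Notation mu3 := (mu3 R).

Lemma Lfun_measurable d (T : measurableType d) (m : {measure set T -> \bar R}) p (f : T -> R) :
  f \in Lfun m p -> measurable_fun setT f.
Proof. by rewrite inE => /andP[]; rewrite inE. Qed.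

Lemma radialE (u : R3 -> R) x : radial u -> u x = profile u (enorm x).
Proof.
move=> [f uf]; rewrite /profile !uf; congr f.
by rewrite [RHS]enormE/= expr0n/= !addr0 sqrtr_sqr ger0_norm// enorm_ge0.
Qed.

Lemma measurable_profile (u : R3 -> R) : measurable_fun setT u -> measurable_fun setT (profile u).
Proof.
move=> mu'; apply: (mcomp mu' (g := fun r : R => (r, 0, 0) : R3)).
by apply: measurable_fun_pair; [apply: measurable_fun_pair|]; mfun.
Qed.

Lemma is_weak_grad_congr (u v : R3 -> R) g : loc_integrable v ->
  (\forall x \ae mu3, u x = v x) -> is_weak_grad u g -> is_weak_grad v g.
Proof.
move=> lv uv [lu lg h]; split => // phi tphi i; rewrite -h//; apply: ae_eq_Rintegral => //.
- apply: measurable_funM; first exact: loc_integrable_measurable.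
  by apply: test_measurable; exact: test_function_derive.
- apply: measurable_funM; first exact: loc_integrable_measurable.
  by apply: test_measurable; exact: test_function_derive.
- by apply: ae_imp uv => x ->.
Qed.

Lemma dotH1_norm_sqr (u : R3 -> R) : in_dotH1 u ->
  0 <= fine (dotH1_norm u) /\
  ((fine (dotH1_norm u) ^+ 2)%:E = \int[mu3]_x (\sum_(i < 3) weak_grad u i x ^+ 2)%:E)%E.
Proof.
move=> hu; have [_ hw hg] := hu; rewrite /dotH1_norm asboolT//.
set F := (fun x => _); have N0 := Lnorm_ge0 mu3 2%:E F.
have e : ('N[mu3]_(2%:E)[F] `^ 2 = \int[mu3]_x (\sum_(i < 3) weak_grad u i x ^+ 2)%:E)%E.
  rewrite poweR_Lnorm ?pnatr_eq0//; apply: eq_integral => x _.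
  rewrite /F gee0_abs ?lee_fin ?sqrtr_ge0// poweR_EFin powR_mulrn ?sqrtr_ge0// sqr_sqrtr//.
  by apply: sumr_ge0 => i _; exact: sqr_ge0.
have fin : (\int[mu3]_x (\sum_(i < 3) weak_grad u i x ^+ 2)%:E < +oo)%E.
  have h i := Lfun2_integrable_sqr (hg i).
  have : mu3.-integrable setT (EFin \o (fun x => \sum_(i < 3) weak_grad u i x ^+ 2)).
    under eq_fun do rewrite !big_ord_recr big_ord0/= add0r.
    by apply: integrable_addr => //; apply: integrable_addr.
  move=> /integrableP[_]; set I1 := integral _ _ _; suff -> : (\int[mu3]_x (\sum_(i < 3) weak_grad u i x ^+ 2)%:E = I1)%E by [].
  by apply: eq_integral => x _; rewrite /= ger0_norm//; apply: sumr_ge0 => i _; exact: sqr_ge0.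
move: N0 e; case: ('N[mu3]_2[F])%E => [r| |] // r0 e; last first.
  by move: fin; rewrite -e /= pnatr_eq0.
by rewrite -e /= powR_mulrn -?lee_fin.
Qed.

Variables (u0 u1 : R3 -> R).
Hypotheses (ru0 : radial u0) (ru1 : radial u1) (H1u0 : in_dotH1 u0).
Hypotheses (bu0 : u0 \in Lfun mu3 +oo%E) (Lu1 : u1 \in Lfun mu3 2%:E).
Hypothesis out : \forall x \ae mu3, (P_minus (u0, u1)).1 x = 0.
Local Notation A := (fine (dotH1_norm u0)).
Local Notation B := (fine (Linfty_norm u0)).

(** Since outgoing data satisfy (r u0)_r = - r u1, the profile is read off u1 and is defined
    pointwise. It is 0 for r <= 0, so that the incoming half of d'Alembert's formula is absent for t
    >= 0. *)
Definition outgoing_profile (r : R) : R := if 0 < r then - (r * profile u1 r) else 0.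
Local Notation k0 := outgoing_profile.

Lemma measurable_outgoing_profile : measurable_fun setT k0.
Proof.
have mp := measurable_profile (Lfun_measurable Lu1).
by apply: measurable_fun_ifT; mfun.
Qed.

Lemma integrable_outgoing_profile : mu.-integrable setT (EFin \o (fun r => k0 r ^+ 2)).
Proof.
have mk := measurable_outgoing_profile.
have mp := measurable_profile (Lfun_measurable Lu1).
apply/integrableP; split; first by apply/measurable_EFinP; mfun.
have /integrableP[_] := Lfun2_integrable_sqr Lu1.
under eq_integral => x _ do rewrite /= (radialE x ru1).
rewrite (radial_tonelli (g := fun r => (`|profile u1 r ^+ 2|)%:E))//; last first.
  by apply/measurable_EFinP; apply: measurableT_comp => //; mfun.
rewrite [X in (_ * X)%E]integral_if.
set I1 := integral _ _ _; have -> : I1 = (\int[mu]_r `|(k0 r ^+ 2)%:E|)%E; last first.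
  move=> h; rewrite ltNge leye_eq; apply/negP => /eqP e; move: h.
  by rewrite e gt0_muley ?ltxx// lte_fin kappa_gt0.
apply: eq_integral => r _; rewrite mem_setE in_itv/= andbT /k0; case: ifP => r0.
  by rewrite -EFinM !ger0_norm ?sqr_ge0// sqrrN exprMn.
by rewrite expr0n/= normr0.
Qed.

Lemma locint_sqr_outgoing_profile : locint (fun r => k0 r ^+ 2).
Proof.
split; first by have := measurable_outgoing_profile; mfun.
by move=> M; apply: integrableS integrable_outgoing_profile.
Qed.

Lemma locint_outgoing_profile : locint k0.
Proof.
split; first exact: measurable_outgoing_profile.
move=> M; have mI := measurable_itv `[- M, M].
apply: (@le_integrable_real _ _ _ mu `[- M, M]%classic _ (fun r => 1 + k0 r ^+ 2)) => //.
- by apply: measurable_funS measurable_outgoing_profile.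
- by move=> r _; have := sqr_ge0 (`|k0 r| - 1); rewrite -(real_normK (num_real (k0 r))); nra.
- apply: integrable_addr => //; last by have [] := locint_sqr_outgoing_profile.
  by apply: (continuous_integrable_itv (f := cst 1)); exact: cst_continuous.
Qed.

Lemma wave_outgoing_profile0 (x : R3) : wave k0 0 x = (enorm x)^-1 * prim k0 (enorm x).
Proof.
rewrite /wave; congr (_ * _); apply: eq_prim => r /andP[r0 _].
rewrite !subr0 [X in _ + X](_ : _ = 0) ?addr0// /k0 ifF//; apply/negbTE.
by rewrite -leNgt oppr_le0.
Qed.

Lemma outgoing_u0 : \forall x \ae mu3, (enorm x)^-1 * prim k0 (enorm x) = u0 x.
Proof.
apply: ae_imp out => x; rewrite /P_minus/= => /eqP; rewrite mulf_eq0 invr_eq0 pnatr_eq0/= addr_eq0 => /eqP ->.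
rewrite -mulrN -RintegralN; congr (_ * _); apply: eq_Rintegral => r; rewrite mem_setE in_itv/= => /andP[r0 _].
rewrite /k0; case: ltP => // r0'; have -> : r = 0 by apply/eqP; rewrite eq_le r0 r0'.
by rewrite mul0r oppr0.
Qed.

Lemma outgoing_u1 : \forall x \ae mu3, wave_t k0 0 x = u1 x.
Proof.
apply: ae_imp (mu3_neq0 R) => x x0; have e0 : 0 < enorm x by rewrite enorm_gt0.
rewrite /wave_t !subr0 /k0 e0 ifF ?sub0r ?opprK; last first.
  by apply/negbTE; rewrite -leNgt oppr_le0 ltW.
by rewrite mulKf ?gt_eqF// -radialE.
Qed.

Lemma outgoing_sup_ae : 0 <= B /\ \forall x \ae mu3, `|prim k0 (enorm x)| <= B * enorm x.
Proof.
have mu3_gt0 : (0 < mu3 setT)%E.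
  apply: lt_le_trans (mu3_unitb_gt0 R) _; apply: le_measure; rewrite ?inE//; exact: measurable_unitb.
have fin : Linfty_norm u0 \is a fin_num.
  rewrite ge0_fin_numE; last exact: Lnorm_ge0.
  by move: bu0; rewrite inE => /andP[_]; rewrite inE.
have B0 : 0 <= B by rewrite fine_ge0// Lnorm_ge0.
split => //.
have := ess_sup_ge mu3 (abse \o (EFin \o u0)).
have -> : ess_sup mu3 (abse \o (EFin \o u0)) = Linfty_norm u0.
  by rewrite /Linfty_norm Lnorm.unlock mu3_gt0.
rewrite -(fineK fin) => h; have h' := ae_imp2 (fun x (p : (_ <= _)%E) (q : _ = _) => conj p q) h outgoing_u0.
apply: ae_imp2 (mu3_neq0 R) h' => x x0 [h1 h2].
move: h1; rewrite /= lee_fin -h2; have e0 : 0 < enorm x by rewrite enorm_gt0.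
by rewrite normrM normfV (gtr0_norm e0) mulrC ler_pdivrMr.
Qed.

(** u0 agrees almost everywhere with an explicit function of its profile, so by uniqueness its
    chosen weak gradient is the explicit radial one. *)
Lemma weak_grad_outgoing : \forall x \ae mu3,
  \sum_(i < 3) weak_grad u0 i x ^+ 2 = radial_slope k0 x ^+ 2.
Proof.
have lk := locint_outgoing_profile; have [_ hw _] := H1u0; have [lu0 _ _] := hw.
have h := is_weak_grad_congr lu0 outgoing_u0 (weak_grad_radial lk).
have h' := is_weak_grad_congr lu0 outgoing_u0 (weak_grad_radialE lk).1.
have e i := weak_grad_unique i hw h'.
have e3 : \forall x \ae mu3, forall i, weak_grad u0 i x = weak_grad (fun x : R3 => (enorm x)^-1 * prim k0 (enorm x)) i x.
  have := ae_imp2 (fun x (p : _ = _) (q : _ = _) => conj p q) (e (lift ord0 (lift ord0 ord0))) (e (lift ord0 ord0)).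
  move=> /(ae_imp2 (fun x (p : _ = _) (q : _ /\ _) => conj p q) (e ord0)).
  apply: ae_imp => x [e0 [e2 e1]] i.
  case: i => -[|[|[|//]]] hi; [move: e0|move: e1|move: e2]; congr (weak_grad _ _ _ = weak_grad _ _ _); exact/val_inj.
apply: ae_imp2 e3 (weak_grad_sqr lk) => x e4 <-.
by apply: eq_bigr => i _; rewrite e4.
Qed.

Lemma outgoing_slope : (\int[mu]_(r in `]0%R, +oo[) ((k0 r - quot k0 r) ^+ 2)%:E = (A ^+ 2 / kappa R)%:E)%E.
Proof.
have lk := locint_outgoing_profile.
have [_ h] := dotH1_norm_sqr H1u0; move: h.
have [_ [_ /(_ _) mw _] _] := H1u0.
rewrite (@ae_eq_integral _ _ _ mu3 setT (fun x => (radial_slope k0 x ^+ 2)%:E))//; first last.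
- by apply: ae_imp weak_grad_outgoing => x -> _.
- by apply/measurable_EFinP; apply: measurable_funX; exact: measurable_radial_slope.
- apply/measurable_EFinP; apply: measurable_sum => i.
  by apply: measurable_funX; exact: loc_integrable_measurable.
rewrite integral_slope_sqr// => h.
have k0' : kappa R != 0 by rewrite gt_eqF// kappa_gt0.
have : ((kappa R)^-1%:E * (A ^+ 2)%:E = \int[mu]_(r in `]0%R, +oo[) ((k0 r - quot k0 r) ^+ 2)%:E)%E.
  by rewrite h muleA -EFinM mulVf// mul1e.
by move=> <-; rewrite -EFinM mulrC.
Qed.

(** A qualitative bound from u1 in L^2. It makes the supremum inside [reverse_hardy] finite; the
    bound by the Sobolev norm of u0 comes out of that lemma. *)
Lemma outgoing_sqr_bound : exists2 C, 0 <= C & forall r, 0 <= r -> prim (fun r => k0 r ^+ 2) r <= C.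
Proof.
exists (\int[mu]_r (k0 r ^+ 2)); first by apply: Rintegral_ge0 => r _; exact: sqr_ge0.
move=> r r0; rewrite /prim Rintegral_if; apply: le_Rintegral => //.
- apply: (proj1 (@integrable_if _ _ _ mu `[0, r]%classic (fun x => k0 x ^+ 2) (measurable_itv _))).
  by apply: locint_itv; exact: locint_sqr_outgoing_profile.
- exact: integrable_outgoing_profile.
- by move=> x _; case: ifP => // _; exact: sqr_ge0.
Qed.

(* Continuity of prim turns the almost everywhere bound into a bound everywhere. *)
Lemma outgoing_sup r : 0 <= r -> `|prim k0 r| <= B * r.
Proof.
have lk := locint_outgoing_profile; have lk2 := locint_sqr_outgoing_profile.
have [B0 hB] := outgoing_sup_ae; have [C C0 hC] := outgoing_sqr_bound.
move=> r0; rewrite leNgt; apply/negP => lt_r.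
have rp : 0 < r.
  rewrite lt_def r0 andbT; apply/negP => /eqP r00; move: lt_r.
  by rewrite r00 prim0 normr0 mulr0 ltxx.
pose d := `|prim k0 r| - B * r.
have d0 : 0 < d by rewrite subr_gt0.
(* On [r - e, r] the primitive varies by less than d, as the square of its variation is at most e C
   < d^2; the bound by r / 2 keeps the interval away from 0. *)
pose e := Num.min (r / 2) (d ^+ 2 / (2 * (C + 1))).
have e0 : 0 < e by rewrite lt_min !divr_gt0 ?exprn_gt0// mulr_gt0//; lra.
have er : e <= r / 2 by rewrite ge_min lexx.
have ed : e * C < d ^+ 2.
  have : e * (2 * (C + 1)) <= d ^+ 2.
    by rewrite -ler_pdivlMr ?ge_min ?lexx ?orbT// mulr_gt0//; lra.
  have := mulr_ge0 (ltW e0) C0; nra.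
have near z : r - e <= z <= r -> B * z < `|prim k0 z|.
  move=> /andP[z1 z2]; have z0 : 0 <= z by lra.
  have zz : 0 <= z <= r by rewrite z0.
  have rr : 0 <= r <= r by rewrite r0 lexx.
  have h := prim_holder lk lk2 rr zz.
  have h2 : `|prim k0 r - prim k0 z| < d.
    rewrite -(@ltr_pXn2r _ 2)// ?nnegrE ?(ltW d0)// real_normK ?num_real//.
    apply: le_lt_trans h _; apply: le_lt_trans ed.
    rewrite ger0_norm ?subr_ge0//; apply: ler_pM => //; last exact: hC.
    - by rewrite subr_ge0.
    - by apply: prim_ge0 => x _; exact: sqr_ge0.
    - by lra.
  have h3 := ler_normD (prim k0 r - prim k0 z) (prim k0 z); rewrite subrK in h3.
  have := ler_wpM2l B0 z2; rewrite /d in h2; lra.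
(* The indicator of the radii where the bound fails: polar coordinates make its weighted integral 0,
   yet it equals 1 on an interval of length e. *)
pose g (z : R) : \bar R := (if B * z < `|prim k0 z| then 1 else 0)%:E.
have mg : measurable_fun setT g.
  apply/measurable_EFinP; apply: measurable_fun_ifT; mfun.
  by apply: measurableT_comp => //; apply: measurable_prim; exact: lk.1.
have g0 z : (0 <= g z)%E by rewrite /g lee_fin; case: ifP.
have := radial_tonelli mg g0.
rewrite (_ : (\int[mu3]_x g (enorm x))%E = 0%E); last first.
  rewrite (@ae_eq_integral _ _ _ mu3 setT (cst 0%E)) ?integral0//.
    by apply: (mcomp mg); exact: measurable_enorm.
  by apply: ae_imp hB => x + _; rewrite /g leNgt => /negbTE ->.
move=> h; have : (\int[mu]_(z in `]0%R, +oo[) ((z ^+ 2)%:E * g z) = 0)%E.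
  apply/eqP; move/eqP: h; rewrite eq_sym mule_eq0 => /orP[|//].
  by rewrite eqe gt_eqF// kappa_gt0.
apply/eqP; rewrite gt_eqF//.
have : (0 < ((r / 2) ^+ 2 * e)%:E)%E by rewrite lte_fin mulr_gt0// exprn_gt0// divr_gt0.
move=> /lt_le_trans; apply.
have re : r - e <= r by lra.
have := integral_itv_cst ((r / 2) ^+ 2) re; rewrite (_ : r - (r - e) = e) => [<-|]; last by ring.
rewrite integral_if [leRHS]integral_if; apply: ge0_le_integral_nomeas => z.
  by case: ifP => // _; rewrite lee_fin sqr_ge0.
rewrite !mem_setE !in_itv/= andbT; case: ifP => [hz|_]; last first.
  by case: ifP => // _; rewrite mule_ge0// lee_fin sqr_ge0.
have /andP[z1 z2] := hz; rewrite ifT; last by lra.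
rewrite /g (near z hz) -EFinM mulr1 lee_fin ler_pXn2r ?nnegrE//; lra.
Qed.

(** [reverse_hardy] with J = A^2 / kappa, the value of the integral of (k0 - quot k0)^2 found in
    [outgoing_slope]. *)
Lemma outgoing_energy r : 0 <= r -> prim (fun r => k0 r ^+ 2) r <= 2 / kappa R * A ^+ 2.
Proof.
have lk := locint_outgoing_profile; have lk2 := locint_sqr_outgoing_profile.
have [C C0 hC] := outgoing_sqr_bound.
move=> r0; rewrite -mulrA [_ * A ^+ 2]mulrC.
apply: (reverse_hardy lk lk2 outgoing_sup hC) => // x y x0 xy.
rewrite -lee_fin -outgoing_slope /Rintegral fineK; last first.
  apply: integrable_fin_num => //.
  rewrite (_ : (fun r => _) = EFin \o (fun r => (k0 r ^+ 2 + quot k0 r ^+ 2) - 2 * (k0 r * quot k0 r))).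
    apply: locint_itv; apply: locint_sub; first by apply: locint_add => //; exact: locint_quot2 outgoing_sup.
    by apply: locint_mulr; exact: locint_kquot outgoing_sup.
  by apply/funext => z /=; congr EFin; ring.
apply: ge0_subset_integral => //.
- apply: measurable_funS (measurableT) _ _ => //; apply/measurable_EFinP; apply: measurable_funX.
  by apply: measurable_funB; [exact: lk.1|apply: measurable_quot].
- by move=> z _; rewrite lee_fin sqr_ge0.
- by move=> z; rewrite /= !in_itv/= andbT => /andP[h _]; exact: lt_le_trans h.
Qed.

End initial_data.

(** * The solution of the integral equation *)


Section prim_shift.
Variable R : realType.
Local Notation mu := (@lebesgue_measure R).

(** Carries a function of y = r - t to the radius r, with value 0 for r < t, the region that an
    outgoing wave has left by time t. *)
Definition delay (l : R -> R) (t r : R) : R := if 0 <= r - t then l (r - t) else 0.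

Lemma measurable_delay (l : R -> R) (t : R) : measurable_fun setT l -> measurable_fun setT (delay l t).
Proof. by move=> ml; apply: measurable_fun_ifT; mfun; apply: (mcomp ml); mfun. Qed.

Lemma prim_delay (l : R -> R) (X t : R) : measurable_fun setT l -> 0 <= t ->
  prim (delay l t) X = prim l (X - t).
Proof.
move=> ml t0; have md := measurable_delay t ml.
rewrite /prim Rintegral_if [RHS]Rintegral_if (Rintegral_shift t); last first.
  have -> : (fun x : R => if x \in `[0, X]%classic then delay l t x else 0) =
      (fun x : R => if (0 <= x) && (x <= X) then delay l t x else 0).
    by apply/funext => x; rewrite mem_setE in_itv.
  by apply: measurable_fun_ifT; mfun.
apply: eq_Rintegral => r _; rewrite !mem_setE !in_itv/= /delay addrK.
case: (leP 0 r) => [r0|r0]; last by rewrite if_same.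
by rewrite (addr_ge0 r0 t0)/= lerBrDr.
Qed.

Lemma locint_delay (l : R -> R) t : locint l -> locint (delay l t).
Proof.
move=> ll; have l2 := locint_shift (- t) ll; have m := measurable_delay t ll.1.
split => // M; apply: (@le_integrable_real _ _ _ mu `[- M, M]%classic _ (fun r : R => `|l (r - t)|)) => //.
- exact: measurable_funS m.
- by move=> r _; rewrite /delay; case: ifP => // _; rewrite normr0.
- by have [_] := locint_norm l2.
Qed.

Lemma sqr_delay (l : R -> R) t : (fun r => delay l t r ^+ 2) = delay (fun y => l y ^+ 2) t.
Proof. by apply/funext => r; rewrite /delay; case: ifP => // _; rewrite expr0n. Qed.

End prim_shift.

Section radial_solution.
Variable R : realType.
Local Notation R3 := (R3 R).
Local Notation mu := (@lebesgue_measure R).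
Local Notation mu3 := (mu3 R).
Variables (N a K : R) (k0 : R -> R) (V W f : R -> R -> R).
Hypotheses (N2 : 2 <= N) (a0 : 0 <= a) (lk0 : locint k0) (k00 : forall r, r <= 0 -> k0 r = 0).
Hypothesis gs : goursat_solution N a K k0 V W f.

(** Times t < 0 lie outside the interval of the equation and get the value 0. *)
Definition radial_solution (t : R) (x : R3) : R :=
  if 0 <= t then (enorm x)^-1 * V (enorm x - t) t else 0.
Local Notation u := radial_solution.

Lemma V_lt0 y t : y < 0 -> V y t = 0.
Proof. by move=> y0; rewrite (gs_VE gs) prim_lt0. Qed.

Lemma V0 t : V 0 t = 0.
Proof. by rewrite (gs_VE gs) prim0. Qed.

Lemma f0 s : 0 <= s -> f 0 s = 0.
Proof. by move=> s0; rewrite (gs_fE gs)// V0 mulr0 mul0r. Qed.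

Lemma radial_solution_radial t : radial (u t).
Proof. by exists (fun r => if 0 <= t then r^-1 * V (r - t) t else 0). Qed.

Lemma measurable_radial_solution :
  measurable_fun setT (fun p : measurableTypeR R * R3 => u p.1 p.2).
Proof.
have me : measurable_fun setT (fun p : R * R3 => enorm p.2).
  by apply: measurable_enorm_fun; mfun.
apply: measurable_fun_ifT; mfun.
  exact: measurable_funV.
apply: (mcomp (gs_mV gs) (g := fun p : R * R3 => (enorm p.2 - p.1, p.1))).
by apply: measurable_fun_pair; mfun.
Qed.

Definition profile_at t : R -> R := delay (W ^~ t) t.

Lemma prim_profile_at t X : 0 <= t -> prim (profile_at t) X = V (X - t) t.
Proof. by move=> t0; rewrite prim_delay ?(gs_VE gs)//; exact: (gs_lW gs t).1. Qed.

Lemma radial_solutionE t : 0 <= t ->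
  u t = (fun x : R3 => (enorm x)^-1 * prim (profile_at t) (enorm x)).
Proof. by move=> t0; apply/funext => x; rewrite /u t0 prim_profile_at. Qed.

Lemma locint_profile_at t : locint (profile_at t).
Proof. exact: locint_delay (gs_lW gs t). Qed.

Lemma V_sup t X : 0 <= t -> 0 <= X -> `|V (X - t) t| <= K * X.
Proof.
move=> t0 X0; have [h|h] := leP 0 (X - t).
  by have := gs_sup gs t0 h; rewrite subrK.
rewrite V_lt0// normr0 mulr_ge0//.
have := gs_sup gs ler01 (lexx 0); rewrite add0r mulr1; exact: le_trans.
Qed.

Lemma dotH1_radial_solution t : 0 <= t -> in_dotH1 (u t) /\
  (dotH1_norm (u t) <= (Num.sqrt (2 * kappa R) * a)%:E)%E.
Proof.
move=> t0; rewrite (radial_solutionE t0).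
have lk := locint_profile_at t.
have lk2 : locint (fun r => profile_at t r ^+ 2).
  by rewrite sqr_delay; apply: locint_delay; exact: (gs_lW2 gs t0).
have kB r : 0 <= r -> `|prim (profile_at t) r| <= K * r.
  by move=> r0; rewrite prim_profile_at// V_sup.
have k2 r : 0 <= r -> prim (fun r => profile_at t r ^+ 2) r <= a ^+ 2.
  move=> r0; rewrite sqr_delay prim_delay//; last exact: (gs_lW2 gs t0).1.
  have [h|h] := leP 0 (r - t); first exact: (gs_energy gs).
  by rewrite prim_lt0// sqr_ge0.
by split; [exact: (dotH1_radial lk a0 lk2 kB k2)|exact: (dotH1_norm_radial_le lk a0 lk2 kB k2)].
Qed.

Lemma radial_solution_sup t x : 0 <= t -> `|u t x| <= K.
Proof.
move=> t0; rewrite /u t0; have e0 := enorm_ge0 x.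
have [e1|e1] := eqVneq (enorm x) 0.
  rewrite e1 invr0 mul0r normr0; have := gs_sup gs ler01 (lexx 0); rewrite add0r mulr1; exact: le_trans.
have e2 : 0 < enorm x by rewrite lt_def e1.
by rewrite normrM normfV (gtr0_norm e2) mulrC ler_pdivrMr// V_sup.
Qed.

Lemma radial_solution_decay t x : 0 < t -> `|u t x| <= a * t `^ (- 2^-1).
Proof.
move=> t0; rewrite /u (ltW t0); have e0 := enorm_ge0 x.
have p0 : 0 <= t `^ (- 2^-1) by exact: powR_ge0.
have [h|h] := leP 0 (enorm x - t); last by rewrite V_lt0// mulr0 normr0 mulr_ge0.
have e2 : 0 < enorm x by lra.
rewrite -(@ler_pXn2r _ 2)// ?nnegrE ?mulr_ge0// real_normK ?num_real// !exprMn.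
have -> : (t `^ (- 2^-1)) ^+ 2 = t^-1.
  rewrite -powR_mulrn// -powRrM mulNr mulVf ?pnatr_eq0// powR_inv1// ltW//.
have := gs_sqrt gs (ltW t0) h => h1.
rewrite exprVn mulrC ler_pdivrMr ?exprn_gt0//; apply: le_trans h1 _.
rewrite [leLHS]mulrC -[leRHS]mulrA ler_wpM2l ?sqr_ge0// ler_pdivlMl//.
have := sqr_ge0 (enorm x - t); nra.
Qed.

(** The profile, in the sense of d'Alembert's formula, of the projected nonlinearity at time s: r
    |u|^N u is f(r - s, s), and the outgoing projection contributes the factor - 1/2. *)
Definition source s : R -> R := delay (fun y => - 2^-1 * f y s) s.

Lemma measurable_f s : measurable_fun setT (f ^~ s).
Proof.
by apply: (mcomp (gs_mf gs) (g := fun y : R => (y, s))); apply: measurable_fun_pair; mfun.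
Qed.

Lemma locint_f s : locint (f ^~ s).
Proof.
apply: bounded_locint; first exact: measurable_f.
move=> M; have [C hC] := gs_f_bound gs M `|s|; exists C => r hr; exact: hC.
Qed.

Lemma locint_source s : locint (source s).
Proof. by apply: locint_delay; apply: locint_mulr; exact: locint_f. Qed.

Lemma source_neg s r : 0 <= s -> 0 <= r -> source s (- r) = 0.
Proof.
move=> s0 r0; rewrite /source /delay; case: ifP => // h.
have -> : - r - s = 0 by lra.
by rewrite f0 ?mulr0//.
Qed.

(** Emission at time s and free propagation during t - s keep the source a function of y = r - t;
    the incoming half could only meet y = 0, where f vanishes. *)
Lemma wave_source s t x : 0 <= s <= t ->
  wave (source s) (t - s) x = (enorm x)^-1 * (- 2^-1 * prim (f ^~ s) (enorm x - t)).
Proof.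
move=> /andP[s0 st]; have t0 := le_trans s0 st.
rewrite /wave -[_ * prim (f ^~ s) _]primZ; last exact: locint_f.
rewrite -prim_delay//; last by apply: measurable_funM; [mfun|exact: measurable_f].
congr (_ * _); apply: eq_prim => r /andP[r0 rX]; rewrite /source /delay.
rewrite [X in _ + X](_ : _ = 0) ?addr0.
  by rewrite (_ : r - (t - s) - s = r - t)//; ring.
case: ifP => // h; rewrite (_ : - r - (t - s) - s = 0) ?f0 ?mulr0//; lra.
Qed.

Lemma nonlinearity_profile s r : 0 <= s -> 0 < r ->
  r * profile (nonlinearity N (u s)) r = -2 * source s r.
Proof.
move=> s0 r0; rewrite /profile /nonlinearity /u s0.
have -> : enorm ((r, 0, 0) : R3) = r.
  by rewrite enormE/= expr0n/= !addr0 sqrtr_sqr gtr0_norm.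
rewrite /source /delay; case: ifPn => h; last by rewrite V_lt0 ?ltNge// !mulr0.
have rN : r `^ N != 0 by rewrite gt_eqF// powR_gt0.
have e : (r^-1) `^ N = (r `^ N)^-1.
  by rewrite -[r^-1]powR_inv1 ?(ltW r0)// -powRrM mulN1r powRN.
rewrite (gs_fE gs)// subrK normrM powRM// normfV (gtr0_norm r0) powRN e.
by field; rewrite rN gt_eqF.
Qed.

(** [radial_deriv] is computed from a chosen weak gradient, so even for the zero function its value
    is known only almost everywhere. *)
Lemma radial_deriv0 : \forall x \ae mu3, radial_deriv (fun=> 0 : R) x = 0.
Proof.
have l0 : locint (fun _ : R => 0 : R) by apply: bounded_locint => // M; exists 0 => r _; rewrite normr0.
have e : (fun x : R3 => (enorm x)^-1 * prim (fun=> 0) (enorm x)) = (fun=> 0).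
  by apply/funext => x; rewrite /prim /Rintegral integral0 mulr0.
have := radial_derivE l0; rewrite e; apply: ae_imp => x ->.
by rewrite /radial_slope /quot /prim /Rintegral integral0 mulr0 subrr mulr0.
Qed.

Lemma linear_wave_source s : 0 <= s ->
  linear_wave (P_plus (fun=> 0, nonlinearity N (u s))) (wave (source s)) (wave_t (source s)).
Proof.
move=> s0; apply: linear_wave_wave; first exact: locint_source.
- apply: aeW => x; rewrite /P_plus /wave/= sub0r.
  have -> : \int[mu]_(r in `[0, enorm x]) (r * profile (nonlinearity N (u s)) r) = -2 * prim (source s) (enorm x).
    rewrite -primZ; last exact: locint_source.
    apply: eq_prim => r /andP[r0 _]; have [r1|r1] := ltP 0 r; first exact: nonlinearity_profile.
    have -> : r = 0 by apply/eqP; rewrite eq_le r0 r1.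
    by have := source_neg s0 (lexx 0); rewrite oppr0 mul0r => ->; rewrite mulr0.
  have -> : prim (fun r => source s (r - 0) + source s (- r - 0)) (enorm x) = prim (source s) (enorm x).
    by apply: eq_prim => r /andP[r0 _]; rewrite !subr0 source_neg ?addr0.
  by move: (_^-1) (prim _ _) => p q; field.
- apply: ae_imp2 (mu3_neq0 R) radial_deriv0 => x x0 hx; have e0 : 0 < enorm x by rewrite enorm_gt0.
  rewrite /P_plus /wave_t/= hx mul0r oppr0 !add0r !addr0 source_neg ?(ltW e0)// sub0r.
  have := nonlinearity_profile s0 e0; rewrite -radialE//; last first.
    by have [g ug] := radial_solution_radial s; exists (fun r => `|g r| `^ N * g r) => y; rewrite /nonlinearity ug.
  move=> h; have -> : - source s (enorm x) = 2^-1 * (enorm x * nonlinearity N (u s) x) by rewrite h; field.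
  by field; rewrite gt_eqF.
Qed.

(** Duhamel's formula: the equation for W is integrated in y from 0 to r - t and the integrations in
    y and s are exchanged. *)
Lemma radial_solution_equation t x : 0 <= t ->
  mu.-integrable `[0, t] (fun s => ((enorm x)^-1 * (- 2^-1 * prim (f ^~ s) (enorm x - t)))%:E) /\
  u t x = wave k0 t x +
    \int[mu]_(s in `[0, t]) ((enorm x)^-1 * (- 2^-1 * prim (f ^~ s) (enorm x - t))).
Proof.
move=> t0; set X := enorm x; have X0 : 0 <= X := enorm_ge0 x.
have wE : wave k0 t x = X^-1 * prim k0 (X - t).
  rewrite /wave -prim_delay//; last exact: lk0.1.
  congr (_ * _); apply: eq_prim => r /andP[r0 _]; rewrite [X in _ + X]k00 ?addr0 /delay; last by lra.
  by case: leP => // h; rewrite k00// ltW.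
set Y := X - t; have [Y0|Y0] := ltP Y 0.
  have e : (fun s => X^-1 * (- 2^-1 * prim (f ^~ s) Y)) = (fun=> 0).
    by apply/funext => s; rewrite prim_lt0// !mulr0.
  rewrite wE /u t0 -/X -/Y V_lt0// prim_lt0// !mulr0.
  split; last by rewrite (_ : (fun s => _) = fun=> 0) /Rintegral ?integral0 ?addr0.
  rewrite (_ : (fun s => _) = EFin \o (fun=> 0)); first exact: integrable0.
  by apply/funext => s /=; rewrite prim_lt0// !mulr0.
have [C hC] := gs_f_bound gs Y t.
have hf y s : 0 <= y <= Y -> 0 <= s <= t -> `|f y s| <= C.
  by move=> /andP[y0 yY] /andP[s0 st]; apply: hC; rewrite ger0_norm.
have lS : locint (fun s => prim (f ^~ s) Y).
  apply: bounded_locint.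
    apply: (@measurable_prim_param R _ R (fun q : R * R => f q.2 q.1) (fun=> Y)); last mfun.
    by apply: (mcomp (gs_mf gs) (g := fun q : R * R => (q.2, q.1))); apply: measurable_fun_pair; mfun.
  move=> M; have [D hD] := gs_f_bound gs Y M; exists (D * Y) => s sM.
  by apply: norm_prim_cst => //; [exact: locint_f|move=> y /andP[y0 yY]; apply: hD; rewrite ?(ger0_norm y0)].
have lT : locint (fun y => prim (f y) t).
  apply: bounded_locint.
    by apply: (@measurable_prim_param R _ R (fun q : R * R => f q.1 q.2) (fun=> t)); [exact: (gs_mf gs)|mfun].
  move=> M; have [D hD] := gs_f_bound gs M t; exists (D * t) => y yM.
  by apply: norm_prim_cst => //; [exact: (gs_lf gs)|move=> s /andP[s0 st]; apply: hD; rewrite ?(ger0_norm s0)].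
have lS2 := locint_mulr X^-1 (locint_mulr (- 2^-1) lS).
split; first exact: locint_itv lS2.
have -> : \int[mu]_(s in `[0, t]) (X^-1 * (- 2^-1 * prim (f ^~ s) Y)) = X^-1 * (- 2^-1 * prim (fun s => prim (f ^~ s) Y) t).
  rewrite -primZ// -primZ//; exact: locint_mulr.
have lC : locint (fun _ : R => C) by apply: locint_continuous; exact: cst_continuous.
rewrite -(prim_swap Y0 t0 (gs_mf gs) lC hf) wE -mulrDr /u t0; congr (_ * _).
rewrite (gs_VE gs) (@eq_prim _ _ (fun y => k0 y - 2^-1 * prim (f y) t)).
  by rewrite primB ?primZ//; [ring|exact: locint_mulr].
by move=> y _; exact: (gs_WE gs).
Qed.

Lemma radial_solutionP (U : state R) : (\forall x \ae mu3, wave k0 0 x = U.1 x) ->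
  (\forall x \ae mu3, wave_t k0 0 x = U.2 x) ->
  is_solution N `[0, +oo[ U u.
Proof.
move=> h1 h2; split.
- by move=> t _; exact: radial_solution_radial.
- by apply: measurable_funS measurable_radial_solution => //; apply: measurableX => //; exact: measurable_itv.
- move=> t; rewrite /= in_itv/= andbT => t0.
  exists (wave k0 t), (fun s x => (enorm x)^-1 * (- 2^-1 * prim (f ^~ s) (enorm x - t))).
  split.
  + exists (wave_t k0 t), (wave k0), (wave_t k0); split; [exact: linear_wave_wave|exact: aeW|exact: aeW].
  + apply: measurable_funS (measurableT) _ _ => //.
    have me : measurable_fun setT (fun p : R * R3 => enorm p.2) by apply: measurable_enorm_fun; mfun.
    apply: measurable_funM; first exact: measurable_funV.
    apply: measurable_funM; first mfun.
    apply: (@measurable_prim_param R _ (R * R3)%type (fun q : (R * R3) * R => f q.2 q.1.1) (fun p => enorm p.2 - t)); last mfun.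
    apply: (mcomp (gs_mf gs) (g := fun q : (R * R3) * R => (q.2, q.1.1))).
    by apply: measurable_fun_pair; mfun.
  + move=> s; rewrite in_itv/= => st; have /andP[s0 _] := st.
    exists (wave_t (source s) (t - s)), (wave (source s)), (wave_t (source s)).
    split; [exact: linear_wave_source| |exact: aeW].
    by apply: aeW => x /=; rewrite wave_source.
  + by apply: aeW => x; exact: radial_solution_equation.
Qed.

End radial_solution.

(** * Mixed norms *)


Section powers.
Variable R : realType.
Local Notation mu := (@lebesgue_measure R).

Lemma continuous_powR_max (c a r : R) : 0 < c + a -> continuous (fun s : R => (c + Num.max s a) `^ r).
Proof.
move=> ca s; have m0 : 0 < c + Num.max s a by rewrite (lt_le_trans ca)// lerD2l le_max lexx orbT.
apply: (@continuous_comp _ _ _ (fun s : R => c + Num.max s a) (fun z => z `^ r)).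
  apply: cvgD; first exact: cvg_cst.
  by apply: (@continuous_max _ _ (fun s : R => s) (cst a)); [exact: cvg_id|exact: cvg_cst].
exact: is_derive_continuous (is_derive1_powR r m0).
Qed.

Lemma integral_powR (c a b r : R) : 0 < c + a -> a <= b -> r != 0 ->
  \int[mu]_(s in `[a, b]) (c + Num.max s a) `^ (r - 1) = r^-1 * ((c + b) `^ r - (c + a) `^ r).
Proof.
move=> ca ab r0.
have cq := continuous_powR_max (r := r - 1) ca.
have dF (s : R) : a <= s <= b ->
    is_derive s (1 : R) (fun s => r^-1 * (c + s) `^ r) ((c + Num.max s a) `^ (r - 1)).
  move=> /andP[as_ _]; rewrite max_l//.
  have cs : 0 < c + s by lra.
  have d1 : is_derive s (1 : R) (fun s : R => c + s) 1.
    by have := is_deriveD (is_derive_cst c s (1 : R)) (is_derive_id s (1 : R)); rewrite add0r.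
  have d2 := @is_derive1_comp _ (fun z : R => z `^ r) (fun s : R => c + s) s _ _ (is_derive1_powR r cs) d1.
  have := is_deriveZ r^-1 d2; rewrite /GRing.scale/= mulr1 mulrA mulVf// mul1r; exact.
by rewrite /Rintegral (FTC2_derive ab cq dF)/= mulrBr.
Qed.

Lemma prim_powR_le (c p T : R) : 0 < c -> 1 < p -> 0 <= T ->
  prim (fun s => (c + Num.max s 0) `^ (- p)) T <= c `^ (1 - p) / (p - 1).
Proof.
move=> c0 p1 T0; have c00 : 0 < c + 0 by rewrite addr0.
have r0 : 1 - p != 0 by rewrite subr_eq0 lt_eqF.
have := integral_powR c00 T0 r0; rewrite (_ : 1 - p - 1 = - p); last by ring.
rewrite /prim => ->; rewrite addr0.
have -> : (1 - p)^-1 * ((c + T) `^ (1 - p) - c `^ (1 - p)) = (c `^ (1 - p) - (c + T) `^ (1 - p)) / (p - 1).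
  by field; rewrite r0 subr_eq0 gt_eqF.
by apply: ler_wpM2r; rewrite ?invr_ge0 ?subr_ge0 ?(ltW p1)// gerBl powR_ge0.
Qed.

Lemma half_line_powR_le (c p : R) : 0 < c -> 1 < p ->
  (\int[mu]_(s in `]0%R, +oo[) ((c + s) `^ (- p))%:E <= (c `^ (1 - p) / (p - 1))%:E)%E.
Proof.
move=> c0 p1; have c00 : 0 < c + 0 by rewrite addr0.
have cq := continuous_powR_max (r := - p) c00.
have lq : locint (fun s => (c + Num.max s 0) `^ (- p)) := locint_continuous cq.
have -> : (\int[mu]_(s in `]0%R, +oo[) ((c + s) `^ (- p))%:E = \int[mu]_(s in `]0%R, +oo[) ((c + Num.max s 0) `^ (- p))%:E)%E.
  by apply: eq_integral => s; rewrite inE/= in_itv/= andbT => s0; rewrite max_l// ltW.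
apply: half_line_le => //; first exact: lq.1.
  by move=> s; exact: powR_ge0.
move=> a b a0 ab; apply: le_trans (prim_powR_le c0 p1 (le_trans (ltW a0) ab)).
rewrite Rintegral_prim//; [|exact: ltW|exact: lq.1].
apply: le_prim => //; last by move=> z _; case: ifP => // _; exact: powR_ge0.
have := locint_delay a (locint_shift a lq); congr locint; apply/funext => z.
by rewrite /delay subr_ge0 subrK.
Qed.

(** Cauchy-Schwarz with weight z^(1/2), since the integral of z^(-1/2) over [Y, y] is at most 2
    y^(1/2). *)
Lemma weighted_sqr_le (W : R -> R) (Y y : R) : 0 < Y -> Y <= y -> locint W -> locint (fun z => W z ^+ 2) ->
  (\int[mu]_(z in `[Y, y]) W z) ^+ 2 <=
  2 * y `^ 2^-1 * \int[mu]_(z in `[Y, y]) (W z ^+ 2 * (Num.max z Y) `^ 2^-1).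
Proof.
move=> Y0; rewrite le_eqVlt => /predU1P[<- _ _|Yy lW lW2].
  rewrite set_itv1 /Rintegral !integral_set1 expr0n/= mulr0//.
have y0 := lt_trans Y0 Yy; have Y00 : 0 < 0 + Y by rewrite add0r.
have cq r : continuous (fun z : R => (Num.max z Y) `^ r).
  by have := continuous_powR_max (r := r) Y00; rewrite (_ : (fun s : R => _) = (fun z : R => (Num.max z Y) `^ r))//; apply/funext => s; rewrite add0r.
set q := fun z : R => (Num.max z Y) `^ 2^-1; set q' := fun z : R => (Num.max z Y) `^ (- 2^-1).
have m0 z : 0 < Num.max z Y by rewrite lt_max Y0 orbT.
have qq z : q z * q' z = 1 by rewrite /q /q' powRN mulfV// gt_eqF// powR_gt0.
have qp z : 0 < q z by rewrite powR_gt0.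
have lq' : locint q' := locint_continuous (cq _).
have lWq : locint (fun z => W z ^+ 2 * q z).
  apply: locint_bounded_mul => //; first exact: continuous_measurable_fun (cq _).
  move=> M; exists ((Num.max M Y) `^ 2^-1) => z /ler_normlP[_ zM]; rewrite (ger0_norm (ltW (qp z))).
  have m1 : 0 <= Num.max M Y by rewrite le_max (ltW Y0) orbT.
  by apply: ge0_ler_powR; rewrite ?nnegrE ?(ltW (m0 _))// ge_max !le_max zM lexx orbT.
have mI := measurable_itv `[Y, y].
set S := \int[mu]_(z in _) W z; set P := \int[mu]_(z in _) (_ * _).
pose Q := \int[mu]_(z in `[Y, y]) q' z.
have QE : Q = 2 * (y `^ 2^-1 - Y `^ 2^-1).
  have h : (2^-1 : R) != 0 by rewrite invr_eq0.
  have := integral_powR Y00 (ltW Yy) h; rewrite !add0r invrK => <-.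
  by apply: eq_Rintegral => z _; rewrite add0r /q'; congr (_ `^ _); field.
have Q0 : 0 < Q.
  by rewrite QE mulr_gt0// subr_gt0 gt0_ltr_powR ?nnegrE ?ltW// invr_gt0.
have Q2 : Q <= 2 * y `^ 2^-1 by rewrite QE mulrBr gerBl mulr_ge0// powR_ge0.
have P0 : 0 <= P by apply: Rintegral_ge0 => z _; apply: mulr_ge0; [exact: sqr_ge0|exact: ltW (qp z)].
pose c := S / Q.
have i1 : mu.-integrable `[Y, y] (EFin \o (fun z => W z ^+ 2 * q z)) := locint_itv _ _ lWq.
have i2 : mu.-integrable `[Y, y] (EFin \o (fun z => 2 * c * W z)) by apply: integrable_mulr => //; exact: locint_itv.
have i3 : mu.-integrable `[Y, y] (EFin \o (fun z => c ^+ 2 * q' z)) by apply: integrable_mulr => //; exact: locint_itv.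
have : 0 <= \int[mu]_(z in `[Y, y]) (W z ^+ 2 * q z - 2 * c * W z + c ^+ 2 * q' z).
  apply: Rintegral_ge0 => z _; rewrite (_ : _ + _ = q z * (W z - c * q' z) ^+ 2); last first.
    by have := qq z; move: (q z) (q' z) => s s' ss'; ring: ss'.
  by apply: mulr_ge0; [exact: ltW (qp z)|exact: sqr_ge0].
rewrite RintegralD//; last exact: integrable_subr.
rewrite RintegralB// !RintegralZl//; [|exact: locint_itv|exact: locint_itv].
rewrite -/S -/P -/Q => h.
have Sc : S = c * Q by rewrite /c mulfVK// gt_eqF.
have h2 : S ^+ 2 <= Q * P.
  have : Q * (P - 2 * c * S + c ^+ 2 * Q) >= 0 by rewrite mulr_ge0// ltW.
  by rewrite Sc; nra.
by apply: le_trans h2 _; rewrite ler_wpM2r.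
Qed.

End powers.

Section norm_bounds.
Variable R : realType.
Local Notation mu := (@lebesgue_measure R).
Local Notation R3 := (R3 R).

Lemma mu_time_ge0 : \forall t \ae mu_time R, 0 <= t.
Proof.
exists `]-oo, 0[%classic; split; first exact: measurable_itv.
  rewrite /mu_time/= /mrestr (_ : _ `&` _ = set0) ?measure0//.
  by apply/seteqP; split => x //=; rewrite !in_itv/= andbT => -[]; lra.
by move=> x /=; rewrite in_itv/= ltNge => /negP.
Qed.

Lemma mu_time_sup_le (n : R -> \bar R) (C : R) : 0 <= C -> (forall t : R, 0 <= t -> (0 <= n t <= C%:E)%E) ->
  ('N[mu_time R]_(+oo)[n] <= C%:E)%E.
Proof.
move=> C0 h; rewrite Lnorm.unlock; case: ifP => // _; apply/ess_supP.
by apply: ae_imp mu_time_ge0 => t /h /andP[n0 nC] /=; rewrite gee0_abs.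
Qed.

Lemma le_integral_mu_time (f : R -> \bar R) : measurable_fun setT f -> (forall t, 0 <= f t)%E ->
  (\int[mu_time R]_t f t <= \int[mu]_t f t)%E.
Proof.
move=> mf f0; apply: ge0_le_measure_integral => //.
move=> A mA; apply: le_measure; rewrite ?inE//.
by apply: measurableI => //; exact: measurable_itv.
Qed.

Lemma Linfty_norm_le (f : R3 -> R) (C : R) : 0 <= C -> (forall x, `|f x| <= C) ->
  (Linfty_norm f <= C%:E)%E.
Proof.
move=> C0 h; rewrite /Linfty_norm Lnorm.unlock; case: ifP => // _; apply/ess_supP.
by apply: aeW => x /=; rewrite lee_fin.
Qed.

(** The bound takes extended values because it will contain an integral of [tail_kernel] in z, whose
    finiteness is not known at each individual time. *)
Lemma Linfty_norm_sqr_le (f : R3 -> R) (Q : \bar R) : (0 <= Q)%E ->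
  (forall x, (f x ^+ 2)%:E <= Q)%E -> (`|Linfty_norm f| `^ 2 <= Q)%E.
Proof.
have N0 : (0 <= Linfty_norm f)%E by exact: Lnorm_ge0.
case: Q => [q| |]// q0 h; last by rewrite leey.
have s0 : 0 <= Num.sqrt q by exact: sqrtr_ge0.
have : (Linfty_norm f <= (Num.sqrt q)%:E)%E.
  apply: Linfty_norm_le => // x; rewrite -(@ler_pXn2r _ 2)// ?nnegrE// real_normK ?num_real//.
  by rewrite sqr_sqrtr -?lee_fin.
rewrite gee0_abs//; move: N0; case: (Linfty_norm f) => [r| |]// r0 rq.
rewrite poweR_EFin powR_mulrn// lee_fin -[leRHS]sqr_sqrtr -?lee_fin//.
by rewrite lee_fin ler_pXn2r ?nnegrE.
Qed.

End norm_bounds.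

(** * Estimates for large times *)

Section tail.
Variable R : realType.
Local Notation R3 := (R3 R).
Local Notation mu := (@lebesgue_measure R).

Lemma measurable_fun_powR d (T : measurableType d) (g : T -> R) (r : R) :
  measurable_fun setT g -> measurable_fun setT (fun t => g t `^ r).
Proof. exact: measurableT_comp (measurable_powR _). Qed.

Lemma tail_powR_le (c p : R) : 0 < c -> 1 < p ->
  (\int[mu]_t (if (c <= t)%R then t `^ (- p) else 0%R)%:E <= (c `^ (1 - p) / (p - 1))%:E)%E.
Proof.
move=> c0 p1.
have mf : measurable_fun setT (fun t : R => if c <= t then t `^ (- p) else 0).
  by apply: measurable_fun_ifT; [mfun|exact: measurable_powR|mfun].
rewrite (ge0_integral_shift c); [|by apply/measurable_EFinP|]; last first.
  by move=> t; rewrite lee_fin; case: ifP => // _; exact: powR_ge0.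
apply: le_trans (half_line_powR_le c0 p1).
have -> : (\int[mu]_x (if (c <= x + c)%R then (x + c) `^ (- p) else 0%R)%:E =
    \int[mu]_(x in `[0%R, +oo[) ((c + x) `^ (- p))%:E)%E.
  rewrite [RHS]integral_if; apply: eq_integral => t _.
  by rewrite mem_setE in_itv/= andbT addrC lerDl; case: ifP.
rewrite integral_itv_obnd_cbnd//.
apply: measurable_funS (measurableT) _ _ => //; apply/measurable_EFinP.
by apply: measurable_fun_powR; mfun.
Qed.

Variables (N a K : R) (k0 : R -> R) (V W f : R -> R -> R).
Hypotheses (N2 : 2 <= N) (a0 : 0 <= a).
Hypothesis gs : goursat_solution N a K k0 V W f.
Local Notation A2 := ((a ^+ 2) `^ (N + 1)).

Lemma W_at0 : (fun y => W y 0) = k0.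
Proof. by apply/funext => y; rewrite (gs_WE gs) prim0 mulr0 subr0. Qed.

Lemma locint_k0_sqr : locint (fun y => k0 y ^+ 2).
Proof. by have := gs_lW2 gs (lexx 0); rewrite -W_at0. Qed.

Lemma norm_f_le z s : 0 < z -> 0 <= s ->
  `|f z s| <= (z * a ^+ 2) `^ ((N + 1) / 2) * (z + Num.max s 0) `^ (- N).
Proof.
move=> z0 s0; rewrite max_l// (gs_fE gs (ltW z0) s0) !normrM.
rewrite !(ger0_norm (powR_ge0 _ _)) ler_wpM2r ?powR_ge0//.
have -> : `|V z s| `^ N * `|V z s| = (V z s ^+ 2) `^ ((N + 1) / 2).
  rewrite -(real_normK (num_real (V z s))) -powR_mulrn// -powRrM.
  rewrite (_ : 2%:R * ((N + 1) / 2) = N + 1); last by field.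
  rewrite powRD ?powRr1//; apply/implyP => /eqP e; have := lt_le_trans (ltr0n R 2) N2; lra.
apply: ge0_ler_powR; first by rewrite divr_ge0// addr_ge0// (le_trans _ N2).
- by rewrite nnegrE sqr_ge0.
- by rewrite nnegrE mulr_ge0 ?sqr_ge0// ltW.
- exact: (gs_sqrt gs s0 (ltW z0)).
Qed.

(** Integrating the bound on f in s gives at most (a^2 z)^((N+1)/2) z^(1-N), whose square is
    a^(2(N+1)) z^(3-N). *)
Lemma W_sqr_le z t : 0 < z -> 0 <= t -> W z t ^+ 2 <= 2 * k0 z ^+ 2 + A2 * z `^ (3 - N).
Proof.
move=> z0 t0; have N1 : 1 < N by apply: lt_le_trans N2; rewrite ltr1n.
have N11 : 1 <= N - 1 by rewrite lerBrDr.
set D := (z * a ^+ 2) `^ ((N + 1) / 2).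
have D0 : 0 <= D by exact: powR_ge0.
have cq : continuous (fun s : R => (z + Num.max s 0) `^ (- N)).
  by apply: continuous_powR_max; rewrite addr0.
have lq := locint_continuous cq.
have h : `|prim (f z) t| <= D * z `^ (1 - N).
  apply: le_trans (norm_prim _ (gs_lf gs z)) _.
  apply: (@le_trans _ _ (prim (fun s => D * (z + Num.max s 0) `^ (- N)) t)).
    apply: le_prim; [exact: locint_norm (gs_lf gs z)|exact: locint_mulr|].
    by move=> s /andP[s0 _]; exact: norm_f_le.
  rewrite primZ// ler_wpM2l//; apply: le_trans (prim_powR_le z0 N1 t0) _.
  by rewrite ler_piMr ?powR_ge0// invf_le1// (lt_le_trans ltr01).
have h2 : prim (f z) t ^+ 2 <= A2 * z `^ (3 - N).
  rewrite -(real_normK (num_real (prim (f z) t))).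
  apply: (@le_trans _ _ ((D * z `^ (1 - N)) ^+ 2)); first by rewrite ler_pXn2r ?nnegrE// mulr_ge0 ?powR_ge0.
  have sq (x p : R) : (x `^ p) ^+ 2 = x `^ (p * 2) by rewrite -powR_mulrn ?powR_ge0// -powRrM.
  rewrite exprMn /D !sq.
  rewrite (_ : (N + 1) / 2 * 2 = N + 1); last by field.
  rewrite powRM ?sqr_ge0 ?(ltW z0)// mulrAC -powRD; last by rewrite (gt_eqF z0) implybT.
  by rewrite mulrC (_ : N + 1 + (1 - N) * 2 = 3 - N)//; ring.
rewrite (gs_WE gs); move: h2; set X := prim _ _ => h2.
have := sqr_ge0 (k0 z + 2^-1 * X); have := sqr_ge0 X; lra.
Qed.

Variable Y : R.
Hypothesis (Y0 : 0 < Y).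

Definition tail_weight (z : R) : R := 2 * k0 z ^+ 2 + A2 * z `^ (3 - N).
Local Notation m := tail_weight.

Lemma tail_weight_ge0 z : 0 <= m z.
Proof. by apply: addr_ge0; apply: mulr_ge0 => //; rewrite ?sqr_ge0 ?powR_ge0. Qed.

Lemma measurable_tail_weight : measurable_fun setT m.
Proof.
have mk := locint_k0_sqr.1; apply: measurable_funD; apply: measurable_funM => //.
Qed.

(* The kernel z^(1/2) (z + t)^(-3/2) comes from the Cauchy-Schwarz inequality with weight z^(1/2);
   its integral over t > 0 does not depend on z. *)
Definition tail_kernel (t z : R) : R :=
  if (0 < t) && (Y <= z) then 4 * m z * z `^ 2^-1 * (z + t) `^ (- (3 / 2)) else 0.
Local Notation G := tail_kernel.

Lemma tail_kernel_ge0 t z : 0 <= G t z.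
Proof.
rewrite /G; case: ifP => // _; rewrite !mulr_ge0 ?powR_ge0//; exact: tail_weight_ge0.
Qed.

Lemma measurable_tail_kernel : measurable_fun setT (fun p : R * R => G p.1 p.2).
Proof.
apply: measurable_fun_ifT; [mfun| |mfun].
apply: measurable_funM; last by apply: measurable_fun_powR; mfun.
apply: measurable_funM; last by apply: measurable_fun_powR; mfun.
by apply: measurable_funM => //; apply: (mcomp measurable_tail_weight); mfun.
Qed.

(** The right side does not depend on y, so it bounds the sup norm in x. The value at Y gives the
    term in t^(-2); in the remaining increment y^(1/2) (y + t)^(-2) <= (z + t)^(-3/2) for z <= y
    removes y. *)
Lemma V_tail y t : 0 < t -> 0 <= y ->
  (((V y t / (y + t)) ^+ 2)%:E <= (2 * a ^+ 2 * Y * t `^ (- 2))%:E + \int[mu]_z (G t z)%:E)%E.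
Proof.
move=> t0 y0; set X := y + t; have X0 : 0 < X by rewrite ltr_wpDl.
have t2 : t `^ (- 2) = (t ^+ 2)^-1 by rewrite powRN -powR_mulrn// ltW.
have IG0 : (0 <= \int[mu]_z (G t z)%:E)%E by apply: integral_ge0 => z _; rewrite lee_fin tail_kernel_ge0.
have a20 : 0 <= a ^+ 2 := sqr_ge0 a.
have XX : (X ^+ 2)^-1 <= (t ^+ 2)^-1.
  rewrite lef_pV2 ?posrE ?exprn_gt0// ler_pXn2r ?nnegrE ?(ltW X0) ?(ltW t0)//.
  by rewrite lerDr.
have small (v : R) : v ^+ 2 <= Y * a ^+ 2 -> (v / X) ^+ 2 * 2 <= 2 * a ^+ 2 * Y * t `^ (- 2).
  move=> hv; rewrite expr_div_n t2 (_ : 2 * a ^+ 2 * Y * (t ^+ 2)^-1 = (Y * a ^+ 2) * (t ^+ 2)^-1 * 2); last by ring.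
  rewrite ler_wpM2r//; apply: ler_pM => //; first exact: sqr_ge0.
  by rewrite invr_ge0 exprn_ge0// ltW.
have [yY|Yy] := leP y Y.
  have h : (V y t / X) ^+ 2 <= 2 * a ^+ 2 * Y * t `^ (- 2).
    have := small (V y t) (le_trans (gs_sqrt gs (ltW t0) y0) (ler_wpM2r a20 yY)).
    by have := sqr_ge0 (V y t / X); lra.
  by apply: (@le_trans _ _ ((2 * a ^+ 2 * Y * t `^ (- 2))%:E)); rewrite ?lee_fin// leeDl.
have YY := ltW Yy.
have lW := gs_lW gs t; have lW2 := gs_lW2 gs (ltW t0).
pose S := \int[mu]_(z in `[Y, y]) W z t.
have VS : V y t = V Y t + S by rewrite !(gs_VE gs) /S -prim_sub ?(ltW Y0)// addrC subrK.
have hS := weighted_sqr_le Y0 YY lW lW2; rewrite -/S in hS.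
pose q z := (Num.max z Y) `^ 2^-1.
have m0 z : 0 < Num.max z Y by rewrite lt_max Y0 orbT.
have cq : continuous q.
  have Y00 : 0 < 0 + Y by rewrite add0r.
  by have := continuous_powR_max (r := 2^-1) Y00; rewrite (_ : (fun s : R => _) = q)//; apply/funext => s; rewrite add0r.
have lWq : locint (fun z => W z t ^+ 2 * q z).
  apply: locint_bounded_mul => //; first exact: continuous_measurable_fun cq.
  move=> M; exists ((Num.max M Y) `^ 2^-1) => z /ler_normlP[_ zM]; rewrite ger0_norm ?powR_ge0//.
  have m1 : 0 <= Num.max M Y by rewrite le_max (ltW Y0) orbT.
  by apply: ge0_ler_powR; rewrite ?nnegrE ?(ltW (m0 _))// ge_max !le_max zM lexx orbT.
have i1 := locint_itv Y y (locint_mulr (4 * y `^ 2^-1 / X ^+ 2) lWq).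
have hSX : 2 * (S / X) ^+ 2 <= \int[mu]_(z in `[Y, y]) (4 * y `^ 2^-1 / X ^+ 2 * (W z t ^+ 2 * q z)).
  rewrite RintegralZl//; last exact: locint_itv.
  rewrite expr_div_n mulrA ler_pdivrMr ?exprn_gt0//.
  rewrite (_ : _ * X ^+ 2 = 2 * (2 * y `^ 2^-1 * \int[mu]_(z in `[Y, y]) (W z t ^+ 2 * q z))).
    by rewrite ler_wpM2l.
  by move: (Rintegral _ _ _) => I; field; rewrite gt_eqF.
have hG : ((2 * (S / X) ^+ 2)%:E <= \int[mu]_z (G t z)%:E)%E.
  apply: (@le_trans _ _ (\int[mu]_(z in `[Y, y]) (4 * y `^ 2^-1 / X ^+ 2 * (W z t ^+ 2 * q z))%:E)%E).
    rewrite -(fineK (integrable_fin_num _ i1)) ?lee_fin//.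
  rewrite integral_if; apply: ge0_le_integral_nomeas => z; rewrite mem_setE in_itv/=.
    case: ifP => // _; rewrite lee_fin; apply: mulr_ge0.
      by apply: divr_ge0; [rewrite mulr_ge0 ?powR_ge0|rewrite exprn_ge0// ltW].
    by rewrite mulr_ge0 ?powR_ge0 ?sqr_ge0.
  case: ifP => [/andP[Yz zy]|_]; last by rewrite lee_fin tail_kernel_ge0.
  have z0 := lt_le_trans Y0 Yz.
  rewrite lee_fin /G t0 Yz/= /q max_l//.
  have e1 : y `^ 2^-1 / X ^+ 2 <= (z + t) `^ (- (3 / 2)).
    have zt0 : 0 < z + t by lra.
    apply: (@le_trans _ _ (X `^ (- (3 / 2)))).
      have -> : X `^ (- (3 / 2)) = X `^ 2^-1 / X ^+ 2.
        rewrite -powR_mulrn ?(ltW X0)// -powRB; last by rewrite (gt_eqF X0) implybT.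
        by congr (_ `^ _); field.
      rewrite ler_wpM2r ?invr_ge0 ?exprn_ge0 ?(ltW X0)//.
      by apply: ge0_ler_powR; rewrite ?nnegrE ?(ltW X0)// /X lerDl ltW.
    rewrite !powRN lef_pV2 ?posrE ?powR_gt0//.
    apply: ge0_ler_powR; rewrite ?nnegrE ?(ltW X0) ?(ltW zt0)//.
    by rewrite /X lerD2r.
  have w := W_sqr_le z0 (ltW t0); rewrite -/(m z) in w.
  rewrite (_ : 4 * y `^ 2^-1 / X ^+ 2 * (W z t ^+ 2 * z `^ 2^-1) =
    4 * W z t ^+ 2 * z `^ 2^-1 * (y `^ 2^-1 / X ^+ 2)); last by ring.
  apply: ler_pM => //.
  - by rewrite mulr_ge0 ?powR_ge0// mulr_ge0// sqr_ge0.
  - by rewrite divr_ge0 ?powR_ge0 ?exprn_ge0// ltW.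
  - by rewrite ler_wpM2r ?powR_ge0// ler_wpM2l.
apply: (@le_trans _ _ (((V Y t / X) ^+ 2 * 2)%:E + (2 * (S / X) ^+ 2)%:E)%E).
  rewrite -EFinD lee_fin VS mulrDl; have := sqr_ge0 (V Y t / X - S / X); lra.
apply: leeD => //; rewrite lee_fin; apply: small; exact: (gs_sqrt gs (ltW t0) (ltW Y0)).
Qed.

(** By Tonelli t is integrated first: (z + t)^(-3/2) yields 2 z^(-1/2), leaving 8 times
    [tail_weight]. The power z^(3-N) is integrable at infinity because N > 4. *)
Lemma tail_kernel_integral_le : 4 < N ->
  (\int[mu]_t \int[mu]_z (G t z)%:E <= (16 * a ^+ 2 + 8 * (A2 * (Y `^ (4 - N) / (N - 4))))%:E)%E.
Proof.
move=> N4.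
have mG : measurable_fun setT (fun p : R * R => (G p.1 p.2)%:E).
  by apply/measurable_EFinP; exact: measurable_tail_kernel.
have G0 (p : R * R) : (0 <= (G p.1 p.2)%:E)%E by rewrite lee_fin tail_kernel_ge0.
have /= -> := @fubini_tonelli _ _ _ _ _ mu mu (fun p : R * R => (G p.1 p.2)%:E) mG G0.
have inner z : (\int[mu]_t (G t z)%:E <= (if (Y <= z)%R then 8 * m z else 0%R)%:E)%E.
  rewrite /G; have [Yz|zY] := leP Y z; last by rewrite integral0_eq// => t _; rewrite andbF.
  have z0 := lt_le_trans Y0 Yz; have mz := tail_weight_ge0 z.
  have c0 : 0 <= 4 * m z * z `^ 2^-1 by rewrite !mulr_ge0 ?powR_ge0.
  have -> : (\int[mu]_t (if (0 < t) && true then 4 * m z * z `^ 2^-1 * (z + t) `^ (- (3 / 2)) else 0)%:E =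
      (4 * m z * z `^ 2^-1)%:E * \int[mu]_(t in `]0%R, +oo[) ((z + t) `^ (- (3 / 2)))%:E)%E.
    rewrite -ge0_integralZl//; last first.
    - by move=> t _; rewrite lee_fin powR_ge0.
    - apply: measurable_funS (measurableT) _ _ => //; apply/measurable_EFinP.
      by apply: measurable_fun_powR; mfun.
    rewrite [RHS]integral_if; apply: eq_integral => t _.
    by rewrite mem_setE in_itv/= !andbT; case: ifP.
  have p1 : (1 : R) < 3 / 2 by lra.
  apply: (@le_trans _ _ ((4 * m z * z `^ 2^-1)%:E * (z `^ (1 - 3 / 2) / (3 / 2 - 1))%:E)%E).
    by apply: lee_wpmul2l => //; exact: half_line_powR_le.
  rewrite -EFinM lee_fin (_ : 1 - 3 / 2 = - 2^-1 :> R); last by field.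
  have s0 : 0 < z `^ 2^-1 by exact: powR_gt0.
  rewrite powRN; move: (z `^ 2^-1) s0 (m z) => s s0 M.
  rewrite (_ : 4 * M * s * (s^-1 / (3 / 2 - 1)) = 8 * M)//.
  rewrite (_ : 3 / 2 - 1 = 2^-1 :> R); last by field.
  by rewrite invrK; field; rewrite gt_eqF.
apply: (@le_trans _ _ (\int[mu]_z (if (Y <= z)%R then 8 * m z else 0%R)%:E)%E).
  by apply: ge0_le_integral_nomeas => // z; apply: integral_ge0 => t _; rewrite lee_fin tail_kernel_ge0.
have e z : ((if (Y <= z)%R then 8 * m z else 0%R)%:E =
    (if (Y <= z)%R then 16 * k0 z ^+ 2 else 0%R)%:E + (8 * A2)%:E * (if (Y <= z)%R then z `^ (- (N - 3)) else 0%R)%:E)%E.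
  rewrite -EFinM -EFinD; congr EFin; case: ifP => _; last by rewrite mulr0 addr0.
  by rewrite /m opprB; ring.
under eq_integral do rewrite e.
have mk := locint_k0_sqr.1.
have m1 : measurable_fun setT (fun z : R => if Y <= z then 16 * k0 z ^+ 2 else 0).
  by apply: measurable_fun_ifT; mfun.
have m2 : measurable_fun setT (fun z : R => if Y <= z then z `^ (- (N - 3)) else 0).
  by apply: measurable_fun_ifT; [mfun|exact: measurable_powR|mfun].
have g1 z : 0 <= (if Y <= z then 16 * k0 z ^+ 2 else 0) by case: ifP => // _; rewrite mulr_ge0// sqr_ge0.
have g2 z : 0 <= (if Y <= z then z `^ (- (N - 3)) else 0) by case: ifP => // _; exact: powR_ge0.
have c8 : 0 <= 8 * A2 by rewrite mulr_ge0// powR_ge0.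
rewrite ge0_integralD//; first last.
- by apply: emeasurable_funM => //; apply/measurable_EFinP.
- by move=> z _; rewrite mule_ge0// lee_fin.
- by apply/measurable_EFinP.
- by move=> z _; rewrite lee_fin.
rewrite ge0_integralZl//; [|by apply/measurable_EFinP|by move=> z _; rewrite lee_fin].
rewrite EFinD; apply: leeD; last first.
  rewrite [8 * (_ * _)]mulrA [leRHS]EFinM; apply: lee_wpmul2l => //.
  have p1 : 1 < N - 3 by lra.
  have := tail_powR_le Y0 p1.
  by rewrite (_ : 1 - (N - 3) = 4 - N) 1?(_ : N - 3 - 1 = N - 4)//; ring.
have l16 := locint_mulr 16 locint_k0_sqr.
apply: (@le_trans _ _ (\int[mu]_(z in `]0%R, +oo[) (16 * k0 z ^+ 2)%:E)%E).
  rewrite [leRHS]integral_if; apply: ge0_le_integral_nomeas => // z.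
  rewrite mem_setE in_itv/= andbT; case: ifP => [Yz|_]; first by rewrite (lt_le_trans Y0 Yz).
  by case: ifP => // _; rewrite lee_fin mulr_ge0// sqr_ge0.
apply: half_line_le => //; first exact: l16.1.
  by move=> z; rewrite mulr_ge0// sqr_ge0.
move=> b c b0 bc; have c00 := le_trans (ltW b0) bc; rewrite RintegralZl//; last by apply: locint_itv; exact: locint_k0_sqr.
rewrite ler_wpM2l// -prim_sub ?(ltW b0)//; last exact: locint_k0_sqr.
have := gs_energy gs (lexx 0) c00; rewrite (_ : (fun y => W y 0 ^+ 2) = (fun y => k0 y ^+ 2)); last by rewrite -W_at0.
have : 0 <= prim (fun y => k0 y ^+ 2) b by apply: prim_ge0 => z _; exact: sqr_ge0.
lra.
Qed.

End tail.

(** * The square integral in time *)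

Section square_integral.
Variable R : realType.
Local Notation R3 := (R3 R).
Local Notation mu := (@lebesgue_measure R).

Lemma integral_inv (a b : R) : 0 < a -> a <= b ->
  (\int[mu]_(t in `[a, b]) ((Num.max t a)^-1)%:E = (ln b - ln a)%:E)%E.
Proof.
move=> a0 ab; apply: FTC2_derive => //.
  have a00 : 0 < 0 + a by rewrite add0r.
  have := continuous_powR_max (r := -1) a00; rewrite (_ : (fun s : R => _) = (fun t : R => (Num.max t a)^-1))//.
  by apply/funext => s; rewrite add0r powR_inv1// le_max (ltW a0) orbT.
move=> t /andP[at_ _]; rewrite max_l//; exact: is_derive1_ln (lt_le_trans a0 at_).
Qed.

Variables (N a K : R) (k0 : R -> R) (V W f : R -> R -> R).
Hypotheses (N2 : 2 <= N) (a0 : 0 <= a).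
Hypothesis gs : goursat_solution N a K k0 V W f.
Local Notation A2 := ((a ^+ 2) `^ (N + 1)).
Local Notation u := (radial_solution V).

(** The sup bound on [0, T] costs K^2 T and the decay on [T, Y] costs a^2 ln (Y / T). Of the
    constant 18, 2 comes from the t^(-2) term beyond Y and 16 from k0 in the kernel. *)
Lemma L2_Linfty_le (T Y C : R) : 4 < N -> 0 < T -> T <= Y -> 0 <= C ->
  K ^+ 2 * T + a ^+ 2 * (ln Y - ln T) + 18 * a ^+ 2 + 8 * (A2 * (Y `^ (4 - N) / (N - 4))) <= C ^+ 2 ->
  ('N[mu_time R]_(2%:E)[(fun t => Linfty_norm (u t))] <= C%:E)%E.
Proof.
move=> N4 T0 TY C0 hC; apply: (@Lnorm_le _ _ _ _ 2) => //.
have Y0 := lt_le_trans T0 TY.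
pose q1 (t : R) := if (0 <= t) && (t <= T) then K ^+ 2 else 0.
pose q2 (t : R) := if (T <= t) && (t <= Y) then a ^+ 2 * (Num.max t T)^-1 else 0.
pose q3 (t : R) := if Y <= t then t `^ (- 2) else 0.
pose q4 (t : R) := (\int[mu]_z (tail_kernel N a k0 Y t z)%:E)%E.
have m1 : measurable_fun setT q1 by apply: measurable_fun_ifT; mfun.
have m2 : measurable_fun setT q2.
  by apply: measurable_fun_ifT; mfun; apply: measurable_funV; apply: measurable_maxr; mfun.
have m3 : measurable_fun setT q3 by apply: measurable_fun_ifT; [mfun|exact: measurable_powR|mfun].
have m4 : measurable_fun setT q4.
  apply: (@measurable_fun_fubini_tonelli_F _ _ _ _ _ mu (fun p : R * R => (tail_kernel N a k0 Y p.1 p.2)%:E)) => //.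
    by apply/measurable_EFinP; exact: (measurable_tail_kernel gs).
  by move=> p; rewrite lee_fin tail_kernel_ge0.
have p1 t : 0 <= q1 t by rewrite /q1; case: ifP => // _; exact: sqr_ge0.
have p2 t : 0 <= q2 t.
  rewrite /q2; case: ifP => // _; rewrite mulr_ge0 ?sqr_ge0// invr_ge0 le_max (ltW T0) orbT//.
have p3 t : 0 <= q3 t by rewrite /q3; case: ifP => // _; exact: powR_ge0.
have p4 t : (0 <= q4 t)%E by apply: integral_ge0 => z _; rewrite lee_fin tail_kernel_ge0.
have c3 : 0 <= 2 * a ^+ 2 * Y by rewrite !mulr_ge0 ?sqr_ge0// ltW.
(* A sum of nonnegative pieces, each of which suffices on its own range of times; the sum is
   measurable even though the norm itself is not shown to be. *)
pose Q t := ((q1 t)%:E + ((q2 t)%:E + ((2 * a ^+ 2 * Y)%:E * (q3 t)%:E + q4 t)))%E.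
have e3 t : (0 <= (2 * a ^+ 2 * Y)%:E * (q3 t)%:E)%E by apply: mule_ge0; rewrite lee_fin.
have e34 t : (0 <= (2 * a ^+ 2 * Y)%:E * (q3 t)%:E + q4 t)%E by exact: adde_ge0.
have e234 t : (0 <= (q2 t)%:E + ((2 * a ^+ 2 * Y)%:E * (q3 t)%:E + q4 t))%E.
  by apply: adde_ge0 => //; rewrite lee_fin.
have Q0 t : (0 <= Q t)%E by apply: adde_ge0 => //; rewrite lee_fin.
have mQ : measurable_fun setT Q.
  apply: emeasurable_funD; first exact/measurable_EFinP.
  apply: emeasurable_funD; first exact/measurable_EFinP.
  apply: emeasurable_funD => //; apply: emeasurable_funM => //; exact/measurable_EFinP.
apply: (@le_trans _ _ (\int[mu_time R]_t Q t)%E).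
  apply: ge0_le_integral_nomeas => t; first exact: poweR_ge0.
  apply: Linfty_norm_sqr_le => // x.
  have usq : (`|u t x| ^+ 2 = u t x ^+ 2)%R by rewrite real_normK ?num_real.
  have [t0|t0] := ltP t 0.
    by move: t0; rewrite /radial_solution ltNge => /negbTE ->; rewrite expr0n Q0.
  have K0 := le_trans (normr_ge0 _) (radial_solution_sup gs x t0).
  have [tT|Tt] := leP t T.
    apply: (@le_trans _ _ (q1 t)%:E); last by rewrite leeDl.
    rewrite lee_fin /q1 t0 tT/= -usq ler_pXn2r ?nnegrE//; exact: (radial_solution_sup gs).
  have t0' : 0 < t := lt_trans T0 Tt.
  have [tY|Yt] := leP t Y.
    apply: (@le_trans _ _ (q2 t)%:E); last first.
      apply: (@le_trans _ _ ((q2 t)%:E + ((2 * a ^+ 2 * Y)%:E * (q3 t)%:E + q4 t))%E).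
        by rewrite leeDl.
      by rewrite leeDr ?lee_fin.
    rewrite lee_fin /q2 (ltW Tt) tY/= max_l ?(ltW Tt)// -usq.
    have -> : a ^+ 2 * t^-1 = (a * t `^ (- 2^-1)) ^+ 2.
      rewrite exprMn -[(t `^ _) ^+ 2]powR_mulrn ?powR_ge0// -powRrM mulNr mulVf ?pnatr_eq0// powR_inv1// ltW//.
    by rewrite ler_pXn2r ?nnegrE ?mulr_ge0 ?powR_ge0//; exact: (radial_solution_decay a0 gs).
  apply: (@le_trans _ _ ((2 * a ^+ 2 * Y)%:E * (q3 t)%:E + q4 t)%E); last first.
    apply: (@le_trans _ _ ((q2 t)%:E + ((2 * a ^+ 2 * Y)%:E * (q3 t)%:E + q4 t))%E).
      by rewrite leeDr ?lee_fin.
    by rewrite leeDr ?lee_fin.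
  have [xt|tx] := ltP (enorm x - t) 0.
    rewrite /radial_solution t0 (V_lt0 gs)// mulr0 expr0n.
    exact: e34.
  have := V_tail N2 gs Y0 t0' tx; rewrite /q3 (ltW Yt) -EFinM subrK.
  by rewrite /radial_solution t0 mulrC.
apply: (le_trans (le_integral_mu_time mQ Q0)).
have i1 : (\int[mu]_t (q1 t)%:E = (K ^+ 2 * T)%:E)%E.
  have := integral_itv_cst (K ^+ 2) (ltW T0); rewrite subr0 => <-; rewrite [RHS]integral_if.
  by apply: eq_integral => t _; rewrite mem_setE in_itv/= /q1; case: ifP.
have i2 : (\int[mu]_t (q2 t)%:E = (a ^+ 2 * (ln Y - ln T))%:E)%E.
  rewrite EFinM -(integral_inv T0 TY) -ge0_integralZl//; first last.
  - by rewrite lee_fin sqr_ge0.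
  - by move=> t _; rewrite lee_fin invr_ge0 le_max (ltW T0) orbT.
  - apply: measurable_funS (measurableT) _ _ => //; apply/measurable_EFinP.
    by apply: measurable_funV; apply: measurable_maxr; mfun.
  by rewrite [RHS]integral_if; apply: eq_integral => t _; rewrite mem_setE in_itv/= /q2; case: ifP.
have i3 : ((2 * a ^+ 2 * Y)%:E * \int[mu]_t (q3 t)%:E <= (2 * a ^+ 2)%:E)%E.
  have p21 : (1 : R) < 2 by rewrite ltr1n.
  apply: le_trans (lee_wpmul2l _ (tail_powR_le Y0 p21)) _; first by rewrite lee_fin.
  rewrite -EFinM lee_fin (_ : 1 - 2 = -1 :> R); last by ring.
  rewrite powR_inv1 ?(ltW Y0)// (_ : 2 - 1 = 1 :> R); last by ring.
  by rewrite divr1 mulfK ?gt_eqF.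
have i4 := tail_kernel_integral_le gs Y0 N4.
rewrite ge0_integralD//; first last.
- apply: emeasurable_funD; first exact/measurable_EFinP.
  apply: emeasurable_funD => //; apply: emeasurable_funM => //; exact/measurable_EFinP.
- exact/measurable_EFinP.
- by move=> t _; rewrite lee_fin.
rewrite ge0_integralD//; first last.
- by apply: emeasurable_funD => //; apply: emeasurable_funM => //; exact/measurable_EFinP.
- exact/measurable_EFinP.
- by move=> t _; rewrite lee_fin.
rewrite ge0_integralD//; first last.
- by apply: emeasurable_funM => //; exact/measurable_EFinP.
rewrite ge0_integralZl//; first last.
- by move=> t _; rewrite lee_fin.
- exact/measurable_EFinP.
rewrite i1 i2.
apply: (@le_trans _ _ ((K ^+ 2 * T)%:E + ((a ^+ 2 * (ln Y - ln T))%:E + ((2 * a ^+ 2)%:E + (16 * a ^+ 2 + 8 * (A2 * (Y `^ (4 - N) / (N - 4))))%:E)))%E).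
  by rewrite leeD2l// leeD2l//; apply: leeD.
rewrite -!EFinD lee_fin; apply: le_trans hC; lra.
Qed.

End square_integral.

(** * Arithmetic of the constants *)

Section constants.
Variable R : realType.

Lemma ln_plusE (x : R) : ln_plus x = ln (Num.max x 1).
Proof.
rewrite /ln_plus; have [x1|x1] : x <= 1 \/ 1 < x by case: (ltP 1 x); [right|left].
- by rewrite (max_r x1) ln1 max_r// ln_le0.
- by rewrite (max_l (ltW x1)) max_l// ln_ge0// ltW.
Qed.

Lemma ln_plus_ge0 (x : R) : 0 <= ln_plus x.
Proof. by rewrite /ln_plus le_max lexx orbT. Qed.

Lemma ln_plusM (x y : R) : 0 <= x -> 0 <= y -> ln_plus (x * y) <= ln_plus x + ln_plus y.
Proof.
move=> x0 y0; have m1 (z : R) : 1 <= Num.max z 1 by rewrite le_max lexx orbT.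
have m0 (z : R) : 0 < Num.max z 1 by exact: lt_le_trans (m1 z).
have le_m (z : R) : z <= Num.max z 1 by rewrite le_max lexx.
rewrite !ln_plusE -lnM ?posrE// ler_ln ?posrE ?mulr_gt0// ge_max; apply/andP; split.
  by apply: ler_pM.
by rewrite -[leLHS]mulr1; apply: ler_pM.
Qed.

Lemma sup_constant (N A B c : R) : 2 <= N -> 0 <= A -> 0 <= B -> 0 <= c ->
  2 * B + c * A * (2 * B) `^ (N / 4) <=
  (2 + c * 2 `^ (N / 4)) * (B + A ^+ 2 * B `^ ((N - 2) / 2) + A * B `^ (N / 2)).
Proof.
move=> N2 A0 B0 c0.
have t0 : 0 <= A * B `^ (N / 2) by rewrite mulr_ge0 ?powR_ge0.
have s0 : 0 <= A ^+ 2 * B `^ ((N - 2) / 2) by rewrite mulr_ge0 ?powR_ge0 ?sqr_ge0.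
(* A B^(N/4) is the product of B^(1/2) and A B^((N-2)/4), and a product is at most the sum of the
   squares. *)
have key : A * B `^ (N / 4) <= B + A ^+ 2 * B `^ ((N - 2) / 2).
  have [->|Bn0] := eqVneq B 0.
    rewrite powR0 ?mulr0 ?add0r ?mulr_ge0 ?sqr_ge0 ?powR_ge0//.
    by apply: lt0r_neq0; apply: divr_gt0 => //; lra.
  have Bp : 0 < B by rewrite lt_def Bn0.
  pose x := B `^ 2^-1; pose y := A * B `^ ((N - 2) / 4).
  have sq (p : R) : (B `^ p) ^+ 2 = B `^ (p * 2) by rewrite -powR_mulrn ?powR_ge0// -powRrM.
  have -> : B = x ^+ 2 :> R by rewrite /x sq mulVf ?pnatr_eq0// powRr1.
  rewrite -/(x) (_ : x ^+ 2 = B); last by rewrite /x sq mulVf ?pnatr_eq0// powRr1.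
  have -> : A ^+ 2 * B `^ ((N - 2) / 2) = y ^+ 2.
    by rewrite /y exprMn sq; congr (_ * _ `^ _); field.
  have -> : A * B `^ (N / 4) = x * y.
    rewrite /x /y mulrCA -powRD; last by rewrite Bn0 implybT.
    by congr (_ * _ `^ _); field.
  have <- : x ^+ 2 = B by rewrite /x sq mulVf ?pnatr_eq0// powRr1.
  have := sqr_ge0 (x - y); have := sqr_ge0 (x + y); nra.
rewrite powRM//; have p0 : 0 <= 2 `^ (N / 4) :> R by exact: powR_ge0.
have cp : 0 <= c * 2 `^ (N / 4) by rewrite mulr_ge0.
rewrite (_ : c * A * (2 `^ (N / 4) * B `^ (N / 4)) = c * 2 `^ (N / 4) * (A * B `^ (N / 4))); last by ring.
have h := ler_wpM2l cp key; have h2 := mulr_ge0 cp t0.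
by rewrite mulrDr in h; rewrite mulrDl !mulrDr; lra.
Qed.

(** The coefficients of a^2 L in [square_constant], in this order: from K^2 T, from ln Y, from - ln
    T, from the constant 18 and from the tail. *)
Definition log_constant (N c : R) : R :=
  2 * 2 `^ (N / 2) + 2 * N / (N - 4) * (ln_plus c + 1) + N / 2 + 18 + 8 / (N - 4).

(** T is chosen so that B^(N/2) T <= 1, which absorbs the factor B^(N/2) of K^2; Y so that Y^(N-4) =
    max(a, 1)^(2N), which absorbs a^(2N) in the tail. Their logarithms are multiples of
    [ln_plus]. *)
Lemma square_constant (N A B c : R) (a := c * A) (K := 2 * B + a * (2 * B) `^ (N / 4))
    (T := (Num.max B 1) `^ (- (N / 2))) (Y := (Num.max a 1) `^ (2 * N / (N - 4)))
    (L := ln_plus A + ln_plus B + 1) : 4 < N -> 0 <= A -> 0 <= B -> 0 <= c ->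
  [/\ 0 < T, T <= Y & K ^+ 2 * T + a ^+ 2 * (ln Y - ln T) + 18 * a ^+ 2 +
      8 * ((a ^+ 2) `^ (N + 1) * (Y `^ (4 - N) / (N - 4))) <=
      (Num.sqrt (8 + c ^+ 2 * log_constant N c) * (B + L `^ 2^-1 * A)) ^+ 2].
Proof.
move=> N4 A0 B0 c0; have a0 : 0 <= a by rewrite mulr_ge0.
have N40 : 0 < N - 4 by rewrite subr_gt0.
have N0 : 0 < N by lra.
have m1 (z : R) : 1 <= Num.max z 1 by rewrite le_max lexx orbT.
have m0 (z : R) : 0 < Num.max z 1 by exact: lt_le_trans (m1 z).
have le_m (z : R) : z <= Num.max z 1 by rewrite le_max lexx.
have T0 : 0 < T by exact: powR_gt0.
have T1 : T <= 1.
  by rewrite /T powRN invf_le1 ?powR_gt0// -[leLHS](powRr0 (Num.max B 1)) ler_powR// divr_ge0// ltW.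
have p0 : 0 <= 2 * N / (N - 4) by rewrite divr_ge0 ?mulr_ge0// ltW.
have Y1 : 1 <= Y by rewrite /Y -[leLHS](powRr0 (Num.max a 1)) ler_powR.
split => //; first exact: le_trans Y1.
have L1 : 1 <= L by rewrite /L lerDr addr_ge0 ?ln_plus_ge0.
have BT : B `^ (N / 2) * T <= 1.
  rewrite /T powRN ler_pdivrMr ?powR_gt0// mul1r.
  by apply: ge0_ler_powR; rewrite ?nnegrE ?(ltW (m0 _))// divr_ge0// ltW.
have sq (x p : R) : (x `^ p) ^+ 2 = x `^ (p * 2) by rewrite -powR_mulrn ?powR_ge0// -powRrM.
have KT : K ^+ 2 * T <= 8 * B ^+ 2 + 2 * 2 `^ (N / 2) * a ^+ 2.
  have h1 : K ^+ 2 <= 8 * B ^+ 2 + 2 * (a ^+ 2 * (2 `^ (N / 2) * B `^ (N / 2))).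
    have -> : 2 `^ (N / 2) * B `^ (N / 2) = ((2 * B) `^ (N / 4)) ^+ 2.
      by rewrite sq (_ : N / 4 * 2 = N / 2) ?powRM//; field.
    rewrite /K; move: ((2 * B) `^ (N / 4)) => s.
    have := sqr_ge0 (2 * B - a * s); rewrite -exprMn; lra.
  apply: le_trans (ler_wpM2r (ltW T0) h1) _; rewrite mulrDl; apply: lerD.
    by rewrite ler_piMr// mulr_ge0// sqr_ge0.
  rewrite (_ : _ * T = 2 * 2 `^ (N / 2) * a ^+ 2 * (B `^ (N / 2) * T)); last by ring.
  by rewrite ler_piMr// mulr_ge0 ?sqr_ge0// mulr_ge0// powR_ge0.
have lnY : ln Y <= 2 * N / (N - 4) * (ln_plus c + ln_plus A).
  by rewrite /Y ln_powR -ln_plusE ler_wpM2l// ln_plusM.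
have lnT : ln T = - (N / 2 * ln_plus B) by rewrite /T ln_powR -ln_plusE mulNr.
have tail : (a ^+ 2) `^ (N + 1) * (Y `^ (4 - N) / (N - 4)) <= a ^+ 2 / (N - 4).
  rewrite mulrA ler_wpM2r ?invr_ge0 ?(ltW N40)//.
  rewrite powRD; last by apply/implyP => /eqP; lra.
  rewrite powRr1 ?sqr_ge0// mulrAC ler_piMl ?sqr_ge0//.
  rewrite /Y -powRrM (_ : 2 * N / (N - 4) * (4 - N) = - (2 * N)); last by field; rewrite gt_eqF.
  rewrite powRN ler_pdivrMr ?powR_gt0// mul1r -powR_mulrn// -powRrM.
  by apply: ge0_ler_powR; rewrite ?nnegrE ?(ltW (m0 _))// mulr_ge0// ltW.
have lA : ln_plus A <= L by rewrite /L; have := ln_plus_ge0 B; lra.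
have lB : ln_plus B <= L by rewrite /L; have := ln_plus_ge0 A; lra.
have D0 : 0 <= log_constant N c.
  have c1 : 0 <= ln_plus c + 1 by rewrite addr_ge0// ln_plus_ge0.
  rewrite /log_constant; do 4 ?apply: addr_ge0 => //.
  - by rewrite mulr_ge0// powR_ge0.
  - by rewrite divr_ge0// ltW.
  - by rewrite divr_ge0// ltW.
have s0 : 0 <= 8 + c ^+ 2 * log_constant N c by rewrite addr_ge0// mulr_ge0// sqr_ge0.
have LD : 2 * 2 `^ (N / 2) + 2 * N / (N - 4) * (ln_plus c + ln_plus A) + N / 2 * ln_plus B + 18 + 8 / (N - 4) <=
    log_constant N c * L.
  rewrite /log_constant; have e1 : 0 <= 2 `^ (N / 2) :> R by exact: powR_ge0.
  have e2 : 0 <= 8 / (N - 4) by rewrite divr_ge0// ltW.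
  have e3 := ln_plus_ge0 c.
  have N20 : 0 <= N / 2 by rewrite divr_ge0// ltW.
  have aux (x y z p lc la lb l : R) : 0 <= x -> 0 <= y -> 0 <= z -> 0 <= p -> 0 <= lc ->
      la <= l -> lb <= l -> 1 <= l ->
      2 * x + p * (lc + la) + z * lb + 18 + y <= (2 * x + p * (lc + 1) + z + 18 + y) * l.
    move=> x0 y0 z0 q0 lc0 lal lbl l1; have l10 : 0 <= l - 1 by rewrite subr_ge0.
    have := mulr_ge0 x0 l10; have := mulr_ge0 y0 l10; have := mulr_ge0 (mulr_ge0 q0 lc0) l10.
    have := ler_wpM2l q0 lal; have := ler_wpM2l z0 lbl; lra.
  exact: aux.
have main : K ^+ 2 * T + a ^+ 2 * (ln Y - ln T) + 18 * a ^+ 2 +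
    8 * ((a ^+ 2) `^ (N + 1) * (Y `^ (4 - N) / (N - 4))) <= 8 * B ^+ 2 + c ^+ 2 * log_constant N c * (L * A ^+ 2).
  have a20 := sqr_ge0 a.
  have LD' := ler_wpM2l a20 LD.
  rewrite (_ : c ^+ 2 * log_constant N c * (L * A ^+ 2) = a ^+ 2 * (log_constant N c * L)); last by rewrite /a; ring.
  have lnY' := ler_wpM2l a20 lnY; rewrite lnT.
  have aux (a2 x PN PB i DL KT' lY TL b2 : R) : a2 * (2 * x + PN + PB + 18 + 8 * i) <= a2 * DL ->
      KT' <= 8 * b2 + 2 * x * a2 -> a2 * lY <= a2 * PN -> TL <= a2 * i ->
      KT' + a2 * (lY - - PB) + 18 * a2 + 8 * TL <= 8 * b2 + a2 * DL by lra.
  exact: aux LD' KT lnY' tail.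
apply: le_trans main _; rewrite exprMn sqr_sqrtr//.
have Ls : (L `^ 2^-1) ^+ 2 = L by rewrite sq mulVf ?pnatr_eq0// powRr1// (le_trans ler01).
have l0 : 0 <= L `^ 2^-1 by exact: powR_ge0.
rewrite -{1}Ls -exprMn; set X := L `^ 2^-1 * A; have X0 : 0 <= X by rewrite mulr_ge0.
have cD : 0 <= c ^+ 2 * log_constant N c by rewrite mulr_ge0// sqr_ge0.
move: (c ^+ 2 * _) cD => E E0.
have e1 : B ^+ 2 + X ^+ 2 <= (B + X) ^+ 2 by have := mulr_ge0 B0 X0; nra.
have e2 := ler_wpM2l E0 e1; have e3 := mulr_ge0 E0 (sqr_ge0 B); have := sqr_ge0 X; lra.
Qed.

End constants.

Unset Implicit Arguments.
Theorem theorem1p1 (R : realType) (N : R) (hN : 2 <= N) :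
  exists C : R, 0 < C /\
  forall u0 u1 : R3 R -> R,
    radial u0 -> radial u1 ->
    in_dotH1 u0 -> u0 \in Lfun (mu3 R) +oo%E -> u1 \in Lfun (mu3 R) 2%:E ->
    outgoing (u0, u1) ->
    let A : R := fine (dotH1_norm u0) in
    let B : R := fine (Linfty_norm u0) in
    exists u : R -> R3 R -> R,
      is_solution N `[0, +oo[ (u0, u1) u /\
      [/\ ('N[mu_time R]_(+oo) [(fun t => dotH1_norm (u t))] <= (C * A)%:E)%E,
          forall t : R, 0 < t ->
            (Linfty_norm (u t) <= (C * (t `^ (- 2^-1) * A))%:E)%E,
          ('N[mu_time R]_(+oo) [(fun t => Linfty_norm (u t))] <=
             (C * (B + A ^+ 2 * B `^ ((N - 2) / 2) + A * B `^ (N / 2)))%:E)%E &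
          4 < N ->
          ('N[mu_time R]_(2%:E) [(fun t => Linfty_norm (u t))] <=
             (C * (B + (ln_plus A + ln_plus B + 1) `^ 2^-1 * A))%:E)%E].
Proof.
have kappa0 := kappa_gt0 R.
(* The energy of the profile is bounded by (c A)^2 through [outgoing_energy]. The constants S and D
   are those of [sup_constant] and [square_constant], and their sum with c serves all four
   bounds. *)
pose c : R := Num.sqrt (2 / kappa R).
have c2 : c ^+ 2 = 2 / kappa R by rewrite sqr_sqrtr// divr_ge0// ltW.
have c0 : 0 <= c by exact: sqrtr_ge0.
pose S : R := 2 + c * 2 `^ (N / 4).
have S2 : 2 <= S by rewrite lerDl mulr_ge0// powR_ge0.
pose D : R := Num.sqrt (8 + c ^+ 2 * log_constant N c).
have D0 : 0 <= D by exact: sqrtr_ge0.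
exists (c + S + D); split; first by rewrite -addrA ltr_wpDl// ltr_wpDr// (lt_le_trans _ S2).
move=> u0 u1 ru0 ru1 H1 bu0 Lu1 [out _] A B.
have [A0 _] := dotH1_norm_sqr H1; rewrite -/A in A0.
have lk0 := locint_outgoing_profile ru1 Lu1.
have lk02 := locint_sqr_outgoing_profile ru1 Lu1.
have [B0 _] := outgoing_sup_ae bu0 out; rewrite -/B in B0.
have k0B := outgoing_sup ru1 bu0 Lu1 out; rewrite -/B in k0B.
have k02 y : 0 <= y -> prim (fun y => outgoing_profile u1 y ^+ 2) y <= (c * A) ^+ 2.
  by move=> y0; rewrite exprMn c2; exact: outgoing_energy.
have a0 : 0 <= c * A by rewrite mulr_ge0.
have [V [W [f gs]]] := goursat_solution_exists hN a0 B0 lk0 lk02 k0B k02.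
have k00 r : r <= 0 -> outgoing_profile u1 r = 0 by rewrite leNgt /outgoing_profile => /negbTE ->.
exists (radial_solution V); split.
  apply: (radial_solutionP lk0 k00 gs); last exact: outgoing_u1.
  by apply: ae_imp (outgoing_u0 out) => x h; rewrite wave_outgoing_profile0 h.
split.
- apply: mu_time_sup_le; first by rewrite mulr_ge0// addr_ge0// addr_ge0// (le_trans _ S2).
  move=> t t0; have [h1 h2] := dotH1_radial_solution a0 gs t0.
  apply/andP; split; first by rewrite /dotH1_norm asboolT// Lnorm_ge0.
  apply: le_trans h2 _; rewrite lee_fin mulrA ler_wpM2r//.
  (* The constant of [dotH1_norm_radial_le] times c is exactly 2, and S >= 2. *)
  rewrite -sqrtrM ?mulr_ge0 ?(ltW kappa0)//.
  rewrite (_ : 2 * kappa R * (2 / kappa R) = 2 ^+ 2); last by field; rewrite gt_eqF.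
  by rewrite sqrtr_sqr ger0_norm//; lra.
- move=> t t0; apply: Linfty_norm_le.
    by rewrite !mulr_ge0 ?powR_ge0// addr_ge0// addr_ge0// (le_trans _ S2).
  move=> x; apply: le_trans (radial_solution_decay a0 gs x t0) _.
  rewrite -mulrA [A * _]mulrC ler_wpM2r ?mulr_ge0 ?powR_ge0//; lra.
- apply: mu_time_sup_le.
    by rewrite !mulr_ge0 ?addr_ge0 ?mulr_ge0 ?powR_ge0 ?sqr_ge0// (le_trans _ S2).
  move=> t t0; rewrite Lnorm_ge0/=.
  have K0 := le_trans (normr_ge0 _) (radial_solution_sup gs (0, 0, 0) t0).
  apply: (@le_trans _ _ (2 * B + c * A * (2 * B) `^ (N / 4))%:E).
    by apply: Linfty_norm_le => // x; exact: (radial_solution_sup gs).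
  rewrite lee_fin; apply: le_trans (sup_constant hN A0 B0 c0) _.
  rewrite ler_wpM2r ?addr_ge0 ?mulr_ge0 ?powR_ge0 ?sqr_ge0//; rewrite -/S; lra.
- move=> N4; have [T0 TY h] := square_constant N4 A0 B0 c0.
  have L0 : 0 <= B + (ln_plus A + ln_plus B + 1) `^ 2^-1 * A.
    by rewrite addr_ge0// mulr_ge0// powR_ge0.
  have C0 : 0 <= D * (B + (ln_plus A + ln_plus B + 1) `^ 2^-1 * A) by rewrite mulr_ge0.
  apply: le_trans (L2_Linfty_le hN a0 gs N4 T0 TY C0 h) _.
  rewrite lee_fin ler_wpM2r//; lra.
Qed.
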